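(* Let the assumptions (A1)--(A7) listed in the context hold. Then $$\|(T-T^\delta)w\|_{L^2(0,1)}\le C\,\delta\,\|w\|_{H^2(I)}\qquad\text{and}\qquad \|y-y^\delta\|_{L^2(0,1)}\le C\,\delta$$ (the first estimate for $w\in H^2(I)$), with some constant $C$ independent of the noise level $\delta$.
   Context: Assumptions: (A1) $\Omega\subset\mathbb{R}^3$ is a bounded domain with $C^{1,1}$ boundary. (A2) $j\in W^{1-1/p,p}(\partial\Omega)$ for some $p>3$ and $\int_{\partial\Omega}j\,ds=0$. (A3) $a\in H^1(\mathbb{R})$ and $0<c_a\le a(u)\le c_a^{-1}$ for all $u\in\mathbb{R}$, for some constant $c_a$. (A4) $\gamma:[0,1]\to\partial\Omega$ is a $C^1$ curve, i.e. $0<c_\gamma\le|\gamma'(s)|\le c_\gamma^{-1}$. (A5) $0<c_g\le|g'(\gamma(s))|\le c_g^{-1}$ for all $s\in[0,1]$. (A6) $\|j-j^\delta\|_{L^2(\partial\Omega)}\le\delta$. (A7) $\|g-g^\delta\|_{L^2(\gamma)}\le\delta$ and $g^\delta(\gamma)\subset[g_{min},g_{max}]$. Here $g=u|_\gamma$ is the exact Dirichlet data along the curve $\gamma$ of the solution $u$ of $-\mathrm{div}(a(u)\nabla u)=0$ in $\Omega$, $a(u)\partial_n u=j$ on $\partial\Omega$, and $g'$ denotes its derivative along $\gamma$; $I=\{g(x):x\in\gamma\}=[g_{min},g_{max}]$ is the interval of states attained on $\gamma$; and $j^\delta$, $g^\delta$ are the measured (perturbed) Neumann and Dirichlet data with noise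 level $\delta$. Operators: $(Tw)(s)=w(g(\gamma(s)))$ and $(T^\delta w)(s)=w(g^\delta(\gamma(s)))$ for $s\in[0,1]$. Data: $y(s)=v(\gamma(s))$ and $y^\delta(s)=v^\delta(\gamma(s))$ for $s\in[0,1]$, where $v$ is the zero-average solution of $-\Delta v=0$ in $\Omega$, $\partial_n v=j$ on $\partial\Omega$, and $v^\delta$ is the zero-average solution of the same problem with $j$ replaced by $j^\delta$. $W^{s,p}$ are the usual Sobolev spaces, $H^k=W^{k,2}$, and $\partial_n$ is the normal derivative.
   Formalization: In (A3), a ∈ H^1(R) is replaced by a ∈ H^1_loc(R), since no function with a ≥ c_a > 0 is square-integrable on R; y and y^δ are understood as traces of v and v^δ along γ, since j^δ is only in L^2. *)

(* Defs.v *)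
From HB Require Import structures.
From mathcomp Require Export all_boot all_order all_algebra.
From mathcomp Require Export all_classical all_reals all_analysis.

Set Implicit Arguments.
Unset Strict Implicit.
Unset Printing Implicit Defensive.

Import Order.TTheory GRing.Theory Num.Theory.
Export numFieldNormedType.Exports.

Local Open Scope classical_set_scope.
Local Open Scope ring_scope.

(* R^3 is the product R * R * R. Its library topology and product sigma-algebra
   are the usual ones, but its library norm is the sup norm: the Euclidean norm
   is [norm3] below. [mE3 R] is the same type carrying the Borel sigma-algebra
   on which the library defines the Lebesgue measure. *)
Notation E3 R := (R * R * R)%type.
Notation mE3 R :=
  (measurableTypeR R * measurableTypeR R * measurableTypeR R)%type.

Section Definitions.
Context {R : realType}.

Definition leb1 : {measure set (measurableTypeR R) -> \bar R} :=
  @lebesgue_measure R.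
Definition leb3 : {measure set (mE3 R) -> \bar R} :=
  ((@lebesgue_measure R \x @lebesgue_measure R) \x @lebesgue_measure R)%E.

Definition dot3 (x y : E3 R) : R := x.1.1 * y.1.1 + x.1.2 * y.1.2 + x.2 * y.2.
Definition norm3 (x : E3 R) : R := Num.sqrt (dot3 x x).
Definition ball3 (x : E3 R) (r : R) : set (E3 R) := [set z | norm3 (z - x) < r].

Definition grad2 (f : R * R -> R) (y : R * R) : R * R :=
  ('D_(1, 0) f y, 'D_(0, 1) f y).
Definition grad3 (f : E3 R -> R) (x : E3 R) : E3 R :=
  ('D_(1, 0, 0) f x, 'D_(0, 1, 0) f x, 'D_(0, 0, 1) f x).

(* C^infinity: all iterated directional derivatives exist and are continuous. *)
Definition smooth (V : normedModType R) (f : V -> R) : Prop :=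
  forall l : seq V,
    let Dlf := foldr (fun v h => 'D_v h) f l in
    continuous Dlf /\ forall v x, derivable Dlf x v.

Definition test_function (V : normedModType R) (D : set V) (phi : V -> R) :
    Prop :=
  [/\ smooth phi, compact (closure [set x | phi x != 0]) &
      closure [set x | phi x != 0] `<=` D].

Definition L2norm d (T : measurableType d) (mu : {measure set T -> \bar R})
    (D : set T) (f : T -> R) : \bar R :=
  'N[mu]_(2%:E)[EFin \o (f \_ D)]%E.

Definition inLp d (T : measurableType d) (mu : {measure set T -> \bar R})
    (p : R) (D : set T) (f : T -> R) : Prop :=
  measurable_fun D f /\ ('N[mu]_(p%:E)[EFin \o (f \_ D)] < +oo)%E.

Definition weak_derivative (D : set R) (f f' : R -> R) : Prop :=
  forall phi : R -> R, test_function D phi ->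
    \int[leb1]_(x in D) (f x * 'D_1 phi x) =
    - \int[leb1]_(x in D) (f' x * phi x).

(* An element of H^k is given together with its weak derivatives: [Df n] is the
   n-th weak derivative of [Df 0]. *)
Definition inHk (D : set R) (k : nat) (Df : nat -> R -> R) : Prop :=
  (forall n, (n <= k)%N -> inLp leb1 2 D (Df n)) /\
  (forall n, (n < k)%N -> weak_derivative D (Df n) (Df n.+1)).

Definition Hknorm (D : set R) (k : nat) (Df : nat -> R -> R) : \bar R :=
  ((\sum_(n < k.+1) L2norm leb1 D (Df n) ^+ 2) `^ 2^-1)%E.

(* The square-integrability of [a] is only local: no function bounded below by
   a positive constant is square-integrable on the whole line. *)
Definition inH1loc (a : R -> R) : Prop :=
  exists Da : nat -> R -> R,
    Da 0%N = a /\ forall M : R, 0 < M -> inHk `](- M), M[ 1 Da.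

Definition weak_gradient (D : set (E3 R)) (f : E3 R -> R) (Df : E3 R -> E3 R) :
    Prop :=
  forall (phi : E3 R -> R) (v : E3 R), test_function D phi ->
    \int[leb3]_(x in D) (f x * 'D_v phi x) =
    - \int[leb3]_(x in D) (dot3 (Df x) v * phi x).

Definition inH1 (D : set (E3 R)) (f : E3 R -> R) (Df : E3 R -> E3 R) : Prop :=
  [/\ inLp leb3 2 D f, measurable_fun (D : set (mE3 R)) (Df : mE3 R -> mE3 R),
      inLp leb3 2 D (norm3 \o Df) & weak_gradient D f Df].

(* p-th power of the Sobolev-Slobodeckij seminorm of order s of a function on
   an N-dimensional set D, given the pairwise distances F x y of its values. *)
Definition slobodeckij (mu : {measure set (mE3 R) -> \bar R}) (D : set (E3 R))
    (N s p : R) (F : E3 R -> E3 R -> R) : \bar R :=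
  (\int[mu]_(x in D) \int[mu]_(y in D)
     (F x y `^ p / norm3 (x - y) `^ (N + s * p))%:E)%E.

Definition bdry (Omega : set (E3 R)) : set (E3 R) :=
  closure Omega `\` interior Omega.

Definition C11 (psi : R * R -> R) : Prop :=
  (forall y, differentiable psi y) /\
  exists L : R, forall y z, `|grad2 psi y - grad2 psi z| <= L * `|y - z|.

Definition orthonormal3 (e1 e2 e3 : E3 R) : Prop :=
  [/\ dot3 e1 e1 = 1, dot3 e2 e2 = 1 & dot3 e3 e3 = 1] /\
  [/\ dot3 e1 e2 = 0, dot3 e1 e3 = 0 & dot3 e2 e3 = 0].

(* In B(x0, r), Omega is the part lying above the graph of psi, in the
   Cartesian coordinates with axes e1, e2, e3. *)
Definition graph_chart (Omega : set (E3 R)) (x0 : E3 R) (r : R)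
    (e1 e2 e3 : E3 R) (psi : R * R -> R) : Prop :=
  [/\ 0 < r, orthonormal3 e1 e2 e3, C11 psi &
      forall x, ball3 x0 r x ->
        (Omega x <-> psi (dot3 x e1, dot3 x e2) < dot3 x e3)].

Definition graph_point (e1 e2 e3 : E3 R) (psi : R * R -> R) (y : R * R) :
    E3 R :=
  y.1 *: e1 + y.2 *: e2 + psi y *: e3.

Definition bounded_C11_domain (Omega : set (E3 R)) : Prop :=
  [/\ Omega !=set0, open Omega, connected Omega, bounded_set Omega &
      forall x0, bdry Omega x0 -> exists r e1 e2 e3 psi,
        graph_chart Omega x0 r e1 e2 e3 psi].

(* The surface measure ds of the boundary, as a Borel measure on R^3: these
   conditions determine it uniquely for a bounded C^{1,1} domain. *)
Definition surface_measure (Omega : set (E3 R))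
    (sigma : {measure set (mE3 R) -> \bar R}) : Prop :=
  sigma (~` bdry Omega) = 0%E /\
  forall x0 r e1 e2 e3 psi, bdry Omega x0 ->
    graph_chart Omega x0 r e1 e2 e3 psi ->
    forall A : set (mE3 R), measurable A -> A `<=` bdry Omega `&` ball3 x0 r ->
      sigma A = (\int[@lebesgue_measure R \x @lebesgue_measure R]_(
          y in [set y | A (graph_point e1 e2 e3 psi y)])
        (Num.sqrt (1 + (grad2 psi y).1 ^+ 2 + (grad2 psi y).2 ^+ 2))%:E)%E.

(* W^{s,p} on the (two-dimensional) boundary. *)
Definition inWsp_bdry (Omega : set (E3 R))
    (sigma : {measure set (mE3 R) -> \bar R}) (s p : R) (j : E3 R -> R) :
    Prop :=
  inLp sigma p (bdry Omega) j /\
  (slobodeckij sigma (bdry Omega) 2 s p (fun x y => `|j x - j y|)%R < +oo)%E.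

(* Weak form of - div (kappa grad u) = 0 in Omega, kappa d_n u = j on the
   boundary. The restrictions to Omega of the functions phi smooth on R^3 are
   dense in H^1(Omega). *)
Definition neumann_solution (Omega : set (E3 R))
    (sigma : {measure set (mE3 R) -> \bar R}) (kappa j : E3 R -> R)
    (u : E3 R -> R) (Du : E3 R -> E3 R) : Prop :=
  inH1 Omega u Du /\
  forall phi : E3 R -> R, smooth phi ->
    \int[leb3]_(x in Omega) (kappa x * dot3 (Du x) (grad3 phi x)) =
    \int[sigma]_(x in bdry Omega) (j x * phi x).

Definition zero_average_solution (Omega : set (E3 R))
    (sigma : {measure set (mE3 R) -> \bar R}) (j : E3 R -> R)
    (v : E3 R -> R) (Dv : E3 R -> E3 R) : Prop :=
  neumann_solution Omega sigma (cst 1) j v Dv /\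
  \int[leb3]_(x in Omega) v x = 0.

(* C^1 on the closed interval [0, 1], with derivative f'. *)
Definition C1_on01 (V : normedModType R) (f f' : R -> V) : Prop :=
  [/\ {within `[0, 1], continuous f}, {within `[0, 1], continuous f'} &
      forall s : R, 0 < s < 1 -> is_derive s (1 : R) f (f' s)].

Definition C1_curve_in (S : set (E3 R)) (gamma dgamma : R -> E3 R) : Prop :=
  C1_on01 gamma dgamma /\ forall s : R, 0 <= s <= 1 -> S (gamma s).

(* L^2 norm along the curve, with respect to arc length. *)
Definition L2norm_curve (gamma dgamma : R -> E3 R) (f : E3 R -> R) : \bar R :=
  ((\int[leb1]_(s in `[0%R, 1%R])
      (f (gamma s) ^+ 2 * norm3 (dgamma s))%:E) `^ 2^-1)%E.

Definition H32norm (Omega : set (E3 R)) (f : E3 R -> R) (Df : E3 R -> E3 R) :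
    \bar R :=
  ((L2norm leb3 Omega f ^+ 2 + L2norm leb3 Omega (norm3 \o Df) ^+ 2 +
    slobodeckij leb3 Omega 3 2^-1 2
      (fun x y => norm3 (Df x - Df y))%R) `^ 2^-1)%E.

(* y(s) = f(gamma(s)) in the sense of traces: y is the value at f of the
   continuous extension of phi |-> phi \o gamma from smooth functions to a map
   from H^{3/2}(Omega) to L^2(0, 1). Solutions of the Neumann problem with
   boundary data that are merely in L^2 belong to H^{3/2} but need not be
   continuous up to the boundary. *)
Definition curve_trace (Omega : set (E3 R)) (gamma : R -> E3 R)
    (f : E3 R -> R) (Df : E3 R -> E3 R) (y : R -> R) : Prop :=
  measurable_fun (`[0, 1] : set (measurableTypeR R)) y /\
  exists phi : nat -> E3 R -> R,
    [/\ forall n, smooth (phi n),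
        H32norm Omega (fun x => f x - phi n x)
          (fun x => Df x - grad3 (phi n) x) @[n --> \oo] --> 0%E &
        L2norm leb1 `[0, 1] (fun s => phi n (gamma s) - y s) @[n --> \oo]
          --> 0%E].

Definition opT (g : E3 R -> R) (gamma : R -> E3 R) (w : R -> R) : R -> R :=
  fun s => w (g (gamma s)).

End Definitions.

(* Main.v *)
(* The operator part: testing the weak derivatives of [w] against twice
   integrated differences of mollified Dirac masses shows that a function of
   H^2 on an interval is Lipschitz, with a constant controlled by its norm; the
   estimate follows since the speed of the curve is bounded below.

   The data part: [z = y - y_delta] is the trace along the curve of a harmonic
   function V whose Neumann data [h = j - j_delta] is only square-integrable, so
   that the trace theorem on the surface does not suffice. Let f be smooth and
   close to V in H^{3/2}, and let [r = (|x' - x|^2 + eps^2)^(-1/2)] be the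
   fundamental solution with regularised pole x on the boundary. The divergence
   theorem in a boundary chart, where [x' - x] is almost tangential, bounds
   [|f x|] by the pairing of the gradients of f and r plus terms of lower order
   that involve the gradient of f on the domain and f on the boundary, weighted
   by r. The weak formulation turns the pairing into the integral of [h r] over
   the boundary, up to the pairing of [E = grad f - grad V] with the gradient of
   r, which is at most [r^2]. These kernels are square-integrated along the
   curve by Schur's test: [r^(3/4)] is bounded along a curve, [r^(5/4)] on a
   surface and [r^(11/4)] in the domain, uniformly in eps, and [1 = (3/4 +
   5/4)/2]. For the error term the splitting [2 = (5/4 + 11/4)/2] leaves the
   weight given by the integral of [r^(5/4)] along the curve, which a fractional
   Hardy inequality bounds by the Gagliardo seminorm of E. The energy of f is
   controlled by h through the trace and Poincare inequalities, and the mean of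
   f tends to that of V, which is zero. Letting eps tend to 0 and then f to V
   gives the estimate. *)
Require Import Defs.
From HB Require Import structures.
From mathcomp Require Import all_boot all_order all_algebra.
From mathcomp Require Import all_classical all_reals all_analysis.
From mathcomp Require Import measurable_realfun.
From mathcomp Require Import ring lra.
Set Implicit Arguments.
Unset Strict Implicit.
Unset Printing Implicit Defensive.
Import Order.TTheory GRing.Theory Num.Theory.
Import numFieldNormedType.Exports.
Local Open Scope classical_set_scope.
Local Open Scope ring_scope.

(** The classical route bounds the H^{3/2} norm of V by that of h, through elliptic regularity. It
    is bypassed: only the distance of f to V in H^{3/2} enters, and it vanishes in the limit, so
    that the surviving constants depend on the domain and the curve alone. The pole is regularised
    to make r an admissible test function; its Laplacian is then [- 3 eps^2 r^5], an approximate
    Dirac mass, which recovers f x because a small ball around a boundary point meets the domain in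
    a comparable volume. Freezing f at the pole costs [M eps^2] times the integral of r^4, with M a
    Lipschitz constant of f; hence eps is chosen after f. The exponents 3/4, 5/4, 11/4 lie below the
    dimensions 1, 2, 3 of curve, surface and domain, and equal shares per coordinate reduce the
    bounds to one-dimensional integrals. For r^2 between domain and curve the case is critical:
    admissible exponents would have to be below 1 and 3, with mean below 2. One exponent must exceed
    its dimension, which is why half a derivative of E is spent. *)

(** * Borel sets, Tonelli's theorem and translations in R^3 *)

Lemma rat_itvoo_subball {R : realType} (x e : R) : 0 < e ->
  exists q : rat * rat, `]ratr q.1, ratr q.2[%classic x /\
    `]ratr q.1, ratr q.2[%classic `<=` ball x e.
Proof.
move=> e0.
have [|a] := @rat_in_itvoo R (x - e) x; first by rewrite ltrBlDr ltrDl.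
rewrite in_itv/= => /andP[a1 a2].
have [|b] := @rat_in_itvoo R x (x + e); first by rewrite ltrDl.
rewrite in_itv/= => /andP[b1 b2].
exists (a, b) => /=; split; first by rewrite /= in_itv/= a2.
move=> y /=; rewrite in_itv/= => /andP[ay yb]; rewrite /ball/= ltr_norml; lra.
Qed.

(** The product sigma-algebra is generated by rectangles, not by open sets. Second countability
    bridges the gap: an open set is the union of the countably many boxes with rational endpoints
    that it contains. *)
Lemma open3_measurable {R : realType} (U : set (E3 R)) :
  open U -> measurable (U : set (mE3 R)).
Proof.
move=> oU.
pose box (q : (rat * rat) * (rat * rat) * (rat * rat)) : set (mE3 R) :=
  (`]ratr q.1.1.1, ratr q.1.1.2[%classic `*` `]ratr q.1.2.1, ratr q.1.2.2[%classic)
  `*` `]ratr q.2.1, ratr q.2.2[%classic.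
have -> : U = \bigcup_q (if pselect (box q `<=` U) then box q else set0).
  apply/seteqP; split => [x Ux|x [q _]]; last by case: pselect => // + /=; apply.
  have /nbhs_ballP[e /= e0 xeU] := open_nbhs_nbhs (conj oU Ux).
  have [q1 [xq1 q1e]] := rat_itvoo_subball x.1.1 e0.
  have [q2 [xq2 q2e]] := rat_itvoo_subball x.1.2 e0.
  have [q3 [xq3 q3e]] := rat_itvoo_subball x.2 e0.
  exists (q1, q2, q3) => //; case: pselect => // -[].
  move=> y [[/= y1 y2] y3]; apply: xeU.
  by split; [split; [exact: q1e|exact: q2e]|exact: q3e].
apply: countable_bigcupT_measurable => [|q]; first exact: countableP.
case: pselect => [?|?]; last exact: measurable0.
by apply: measurableX; [apply: measurableX|]; exact: measurable_itv.
Qed.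

Lemma open2_measurable {R : realType} (U : set (R * R)) :
  open U -> measurable (U : set (measurableTypeR R * measurableTypeR R)).
Proof.
move=> oU.
pose box (q : (rat * rat) * (rat * rat)) :
    set (measurableTypeR R * measurableTypeR R) :=
  `]ratr q.1.1, ratr q.1.2[%classic `*` `]ratr q.2.1, ratr q.2.2[%classic.
have -> : U = \bigcup_q (if pselect (box q `<=` U) then box q else set0).
  apply/seteqP; split => [x Ux|x [q _]]; last by case: pselect => // + /=; apply.
  have /nbhs_ballP[e /= e0 xeU] := open_nbhs_nbhs (conj oU Ux).
  have [q1 [xq1 q1e]] := rat_itvoo_subball x.1 e0.
  have [q2 [xq2 q2e]] := rat_itvoo_subball x.2 e0.
  exists (q1, q2) => //; case: pselect => // -[].
  by move=> y [/= y1 y2]; apply: xeU; split; [exact: q1e|exact: q2e].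
apply: countable_bigcupT_measurable => [|q]; first exact: countableP.
case: pselect => [?|?]; last exact: measurable0.
by apply: measurableX; exact: measurable_itv.
Qed.

Lemma continuous3_measurable {R : realType} (f : E3 R -> R) :
  continuous f -> measurable_fun [set: mE3 R] (f : mE3 R -> measurableTypeR R).
Proof.
move=> /continuousP cf; apply: (measurability _ (RGenOpens.measurableE R)).
move=> _ [_ [a [b ->]] <-].
rewrite setTI; apply: open3_measurable; apply: cf; exact: interval_open.
Qed.

Lemma continuous2_measurable {R : realType} (f : R * R -> R) :
  continuous f -> measurable_fun [set: measurableTypeR R * measurableTypeR R]
    (f : measurableTypeR R * measurableTypeR R -> measurableTypeR R).
Proof.
move=> /continuousP cf; apply: (measurability _ (RGenOpens.measurableE R)).
move=> _ [_ [a [b ->]] <-].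
rewrite setTI; apply: open2_measurable; apply: cf; exact: interval_open.
Qed.

Section sigma_finite_product.
Local Open Scope ereal_scope.
Context d1 d2 (T1 : measurableType d1) (T2 : measurableType d2) (R : realType).
Variable m1 : {sigma_finite_measure set T1 -> \bar R}.
Variable m2 : {sigma_finite_measure set T2 -> \bar R}.

(* The library instance making [m1 \x m2] sigma-finite is hidden by the one
   for subprobabilities, which is keyed on the same constant. *)
Definition sfprod : set (T1 * T2) -> \bar R := m1 \x m2.

HB.instance Definition _ := Measure.on sfprod.

Let sfprod_sigma_finite : sigma_finite setT sfprod.
Proof.
have /sigma_finiteP[F [TF ndF Foo]] := sigma_finiteT m1.
have /sigma_finiteP[G [TG ndG Goo]] := sigma_finiteT m2.
exists (fun n => F n `*` G n).
  rewrite -setXTT TF TG predeqE => -[x y]; split => [[/= [n _ Fnx] [k _ Gky]]|].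
    exists (maxn n k) => //; split.
    - by move: x Fnx; exact/subsetPset/ndF/leq_maxl.
    - by move: y Gky; exact/subsetPset/ndG/leq_maxr.
  by move=> [n _ []/= ? ?]; split; exists n.
move=> k; have [? ?] := Foo k; have [? ?] := Goo k.
split; first exact: measurableX.
by rewrite /sfprod product_measure1E// lte_mul_pinfty// ge0_fin_numE.
Qed.

HB.instance Definition _ :=
  Measure_isSigmaFinite.Build _ _ _ sfprod sfprod_sigma_finite.

End sigma_finite_product.

Section Tonelli3.
Local Open Scope ereal_scope.
Context {R : realType}.
Local Notation M1 := (measurableTypeR R).
Local Notation L2 := (@lebesgue_measure R \x @lebesgue_measure R)%E.
Implicit Types F : mE3 R -> \bar R.

(** The iterated products with their sigma-finite structure, which Tonelli's theorem asks of its
    factors. They are convertible to the measures inside [leb3], so results transfer without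
    rewriting. *)
Definition leb2 : {sigma_finite_measure set (M1 * M1)%type -> \bar R} :=
  sfprod (@lebesgue_measure R) (@lebesgue_measure R).
Definition sleb3 : {sigma_finite_measure set (mE3 R) -> \bar R} :=
  sfprod leb2 (@lebesgue_measure R).

Lemma leb3_tonelli F : measurable_fun setT F -> (forall x, 0 <= F x) ->
  \int[leb3]_x F x = \int[leb2]_y \int[leb1]_t F (y, t).
Proof.
move=> mF F0.
exact: (@fubini_tonelli1 _ _ _ _ R leb2 (@lebesgue_measure R) F mF F0).
Qed.

Lemma leb3_tonelli' F : measurable_fun setT F -> (forall x, 0 <= F x) ->
  \int[leb3]_x F x = \int[leb1]_t \int[leb2]_y F (y, t).
Proof.
move=> mF F0.
exact: (@fubini_tonelli2 _ _ _ _ R leb2 (@lebesgue_measure R) F mF F0).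
Qed.

Lemma leb3_tonelli3 F : measurable_fun setT F -> (forall x, 0 <= F x) ->
  \int[leb3]_x F x =
  \int[leb1]_x \int[leb1]_y \int[leb1]_z F (x, y, z).
Proof.
move=> mF F0; rewrite leb3_tonelli//.
apply: (@fubini_tonelli1 _ _ _ _ R (@lebesgue_measure R) (@lebesgue_measure R)
  (fun y => \int[leb1]_z F (y, z))).
  exact: (@measurable_fun_fubini_tonelli_F _ _ _ _ R (@lebesgue_measure R) F).
by move=> x; apply: integral_ge0.
Qed.

(** The image of Lebesgue measure under a translation has the right value on intervals, hence equals
    Lebesgue measure by uniqueness. *)
Lemma leb1_shift (f : R -> \bar R) a : measurable_fun [set: M1] f ->
  (forall x, 0 <= f x) -> \int[leb1]_x f (x + a)%R = \int[leb1]_x f x.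
Proof.
move=> mf f0.
have ma : measurable_fun [set: M1] (fun x : M1 => (x + a)%R : M1).
  by apply: measurable_funD.
pose m := measure_function_pushforward__canonical__measure_function_Measure
  (@lebesgue_measure R) ma.
rewrite /leb1 [RHS](_ : _ = \int[m]_x f x); last first.
  apply: eq_measure_integral => A mA _; apply: lebesgue_measure_unique => //.
  move=> _ [[b c]] _ <-; rewrite /m/= /pushforward.
  rewrite [X in _ = _ X](_ : _ = `](b - a)%R, (c - a)%R]%classic); last first.
    by apply/seteqP; split => x/=; rewrite !in_itv/= ltrBlDr lerBrDr.
  rewrite !lebesgue_measure_itv/= !lte_fin ltrD2r -!EFinD.
  by case: ifPn => // _; congr _%:E; ring.
by rewrite ge0_integral_pushforward.
Qed.

Lemma leb1_opp (f : R -> \bar R) : measurable_fun [set: M1] f ->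
  (forall x, 0 <= f x) -> \int[leb1]_x f (- x)%R = \int[leb1]_x f x.
Proof.
move=> mf f0.
have mN : measurable_fun [set: M1] (fun x : M1 => (- x)%R : M1).
  exact: oppr_measurable.
pose m := measure_function_pushforward__canonical__measure_function_Measure
  (@lebesgue_measure R) mN.
rewrite /leb1 [RHS](_ : _ = \int[m]_x f x).
  by rewrite ge0_integral_pushforward.
by apply: eq_measure_integral => A mA _; rewrite /m/= lebesgue_measureN.
Qed.

Lemma measurable_mE3 d (T : measurableType d) (f : T -> mE3 R) :
  measurable_fun setT (fun x => (f x).1.1) ->
  measurable_fun setT (fun x => (f x).1.2) ->
  measurable_fun setT (fun x => (f x).2) -> measurable_fun setT f.
Proof.
move=> f1 f2 f3.
rewrite [X in measurable_fun _ X](_ : _ =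
  fun x => ((f x).1.1 , (f x).1.2, (f x).2)); last first.
  by apply/funext => x; case: (f x) => -[].
by apply: measurable_fun_pair => //; apply: measurable_fun_pair.
Qed.

Lemma measurable_mE311 : measurable_fun setT (fun x : mE3 R => x.1.1 : M1).
Proof. exact: (measurableT_comp measurable_fst measurable_fst). Qed.

Lemma measurable_mE312 : measurable_fun setT (fun x : mE3 R => x.1.2 : M1).
Proof. exact: (measurableT_comp measurable_snd measurable_fst). Qed.

Lemma measurable_mE32 : measurable_fun setT (fun x : mE3 R => x.2 : M1).
Proof. exact: measurable_snd. Qed.

Section comp.
Context d (T : measurableType d).
Implicit Types f g : T -> mE3 R.

Lemma measurable_mE3_11 f : measurable_fun setT f ->
  measurable_fun setT (fun x => (f x).1.1 : M1).
Proof. exact: (measurableT_comp measurable_mE311). Qed.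
Lemma measurable_mE3_12 f : measurable_fun setT f ->
  measurable_fun setT (fun x => (f x).1.2 : M1).
Proof. exact: (measurableT_comp measurable_mE312). Qed.
Lemma measurable_mE3_2 f : measurable_fun setT f ->
  measurable_fun setT (fun x => (f x).2 : M1).
Proof. exact: (measurableT_comp measurable_mE32). Qed.

Lemma measurable_mE3D f g : measurable_fun setT f -> measurable_fun setT g ->
  measurable_fun setT (fun x => ((f x : E3 R) + (g x : E3 R))%R : mE3 R).
Proof.
move=> mf mg; apply: measurable_mE3; apply: measurable_funD;
  by [exact: measurable_mE3_11|exact: measurable_mE3_12|exact: measurable_mE3_2].
Qed.

Lemma measurable_mE3N f : measurable_fun setT f ->
  measurable_fun setT (fun x => (- (f x : E3 R))%R : mE3 R).
Proof.
move=> mf; apply: measurable_mE3; apply: measurable_funN;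
  by [exact: measurable_mE3_11|exact: measurable_mE3_12|exact: measurable_mE3_2].
Qed.

Lemma measurable_mE3B f g : measurable_fun setT f -> measurable_fun setT g ->
  measurable_fun setT (fun x => ((f x : E3 R) - (g x : E3 R))%R : mE3 R).
Proof.
by move=> mf mg; apply: measurable_mE3D => //; exact: measurable_mE3N.
Qed.

End comp.

Lemma leb3_shift F (a : E3 R) : measurable_fun setT F -> (forall x, 0 <= F x) ->
  \int[leb3]_x F ((x : E3 R) + a)%R = \int[leb3]_x F x.
Proof.
move=> mF F0.
have mG : measurable_fun setT (fun x : mE3 R => F ((x : E3 R) + a)%R).
  apply: (measurableT_comp mF).
  by apply: measurable_mE3D => //; exact: measurable_cst.
apply: (etrans (leb3_tonelli3 mG _)) => //.
apply: (etrans _ (esym (leb3_tonelli3 mF F0))).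
transitivity (\int[leb1]_x \int[leb1]_y \int[leb1]_z
    F ((x + a.1.1)%R, (y + a.1.2)%R, z)).
  apply: eq_integral => x _; apply: eq_integral => y _.
  apply: (@leb1_shift (fun z => F ((x + a.1.1)%R, (y + a.1.2)%R, z)) a.2) => //.
  exact: measurable_fun_pair2.
have mF1 := @measurable_fun_fubini_tonelli_F _ _ _ _ R (@lebesgue_measure R) F
  mF F0.
transitivity (\int[leb1]_x \int[leb1]_y \int[leb1]_z F ((x + a.1.1)%R, y, z)).
  apply: eq_integral => x _.
  apply: (@leb1_shift (fun y => \int[leb1]_z F ((x + a.1.1)%R, y, z)) a.1.2).
  - by apply: (measurable_fun_pair2 _ mF1).
  - by move=> y; apply: integral_ge0.
apply: (@leb1_shift (fun x => \int[leb1]_y \int[leb1]_z F (x, y, z)) a.1.1).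
- apply: (@measurable_fun_fubini_tonelli_F _ _ _ _ R (@lebesgue_measure R) _
    mF1) => x.
  exact: integral_ge0.
- by move=> x; apply: integral_ge0 => y _; apply: integral_ge0.
Qed.

Lemma leb3_opp F : measurable_fun setT F -> (forall x, 0 <= F x) ->
  \int[leb3]_x F (- (x : E3 R))%R = \int[leb3]_x F x.
Proof.
move=> mF F0.
have mG : measurable_fun setT (fun x : mE3 R => F (- (x : E3 R))%R).
  by apply: (measurableT_comp mF); exact: measurable_mE3N.
apply: (etrans (leb3_tonelli3 mG _)) => //.
apply: (etrans _ (esym (leb3_tonelli3 mF F0))).
transitivity (\int[leb1]_x \int[leb1]_y \int[leb1]_z F ((- x)%R, (- y)%R, z)).
  apply: eq_integral => x _; apply: eq_integral => y _.
  apply: (@leb1_opp (fun z => F ((- x)%R, (- y)%R, z))) => //.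
  exact: measurable_fun_pair2.
have mF1 := @measurable_fun_fubini_tonelli_F _ _ _ _ R (@lebesgue_measure R) F
  mF F0.
transitivity (\int[leb1]_x \int[leb1]_y \int[leb1]_z F ((- x)%R, y, z)).
  apply: eq_integral => x _.
  apply: (@leb1_opp (fun y => \int[leb1]_z F ((- x)%R, y, z))).
  - by apply: (measurable_fun_pair2 _ mF1).
  - by move=> y; apply: integral_ge0.
apply: (@leb1_opp (fun x => \int[leb1]_y \int[leb1]_z F (x, y, z))).
- apply: (@measurable_fun_fubini_tonelli_F _ _ _ _ R (@lebesgue_measure R) _
    mF1) => x.
  exact: integral_ge0.
- by move=> x; apply: integral_ge0 => y _; apply: integral_ge0.
Qed.

End Tonelli3.

(** * Euclidean geometry of R^3 *)

Section dot3_theory.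
Context {R : realType}.
Implicit Types (x y z e : E3 R) (a b : R).

Lemma scaleRE a b : a *: (b : R) = a * b. Proof. by []. Qed.

Lemma dot3C x y : dot3 x y = dot3 y x.
Proof. by rewrite /dot3; ring. Qed.

Lemma dot3Dl x y z : dot3 (x + y) z = dot3 x z + dot3 y z.
Proof. by rewrite /dot3/=; ring. Qed.

Lemma dot3Nl x z : dot3 (- x) z = - dot3 x z.
Proof. by rewrite /dot3/=; ring. Qed.

Lemma dot3Bl x y z : dot3 (x - y) z = dot3 x z - dot3 y z.
Proof. by rewrite dot3Dl dot3Nl. Qed.

Lemma dot3Zl a x z : dot3 (a *: x) z = a * dot3 x z.
Proof. by rewrite /dot3/= !scaleRE; ring. Qed.

Lemma dot3Dr x y z : dot3 z (x + y) = dot3 z x + dot3 z y.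
Proof. by rewrite dot3C dot3Dl 2!(dot3C z). Qed.

Lemma dot3Zr a x z : dot3 z (a *: x) = a * dot3 z x.
Proof. by rewrite dot3C dot3Zl dot3C. Qed.

Lemma dot3_ge0 x : 0 <= dot3 x x.
Proof. by rewrite /dot3 -!expr2 !addr_ge0// sqr_ge0. Qed.

Lemma norm3_ge0 x : 0 <= norm3 x. Proof. exact: sqrtr_ge0. Qed.

Lemma norm3_sqr x : norm3 x ^+ 2 = dot3 x x.
Proof. by rewrite sqr_sqrtr// dot3_ge0. Qed.

Lemma norm3N x : norm3 (- x) = norm3 x.
Proof. by rewrite /norm3 dot3Nl dot3C dot3Nl opprK. Qed.

Lemma norm3B x y : norm3 (x - y) = norm3 (y - x).
Proof. by rewrite -norm3N opprB. Qed.

Lemma norm30 : norm3 (0 : E3 R) = 0.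
Proof. by rewrite /norm3 /dot3/= !mul0r !addr0 sqrtr0. Qed.

(** Lagrange's identity: the difference of the two sides is the squared norm of the cross
    product. *)
Lemma dot3_CS_sqr x y : dot3 x y ^+ 2 <= dot3 x x * dot3 y y.
Proof.
rewrite -subr_ge0 (_ : _ - _ =
  (x.1.1 * y.1.2 - x.1.2 * y.1.1) ^+ 2 + (x.1.1 * y.2 - x.2 * y.1.1) ^+ 2
  + (x.1.2 * y.2 - x.2 * y.1.2) ^+ 2); last by rewrite /dot3; ring.
by rewrite !addr_ge0// sqr_ge0.
Qed.

Lemma dot3_CS x y : `|dot3 x y| <= norm3 x * norm3 y.
Proof.
rewrite -ler_sqr ?nnegrE ?mulr_ge0 ?norm3_ge0//.
by rewrite exprMn !norm3_sqr real_normK ?num_real// dot3_CS_sqr.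
Qed.

Lemma norm3_triangle x y : norm3 (x + y) <= norm3 x + norm3 y.
Proof.
rewrite -ler_sqr ?nnegrE ?addr_ge0 ?norm3_ge0//.
rewrite sqrrD !norm3_sqr dot3Dl !dot3Dr (dot3C y x).
have := le_trans (ler_norm _) (dot3_CS x y); lra.
Qed.

Lemma norm3_triangleB x y z : norm3 (x - z) <= norm3 (x - y) + norm3 (y - z).
Proof. by rewrite (le_trans _ (norm3_triangle _ _))// subrKA. Qed.

Lemma norm3Z a x : norm3 (a *: x) = `|a| * norm3 x.
Proof.
by rewrite /norm3 dot3Zl dot3Zr mulrA -expr2 sqrtrM ?sqr_ge0// sqrtr_sqr.
Qed.

Lemma coord11_le_norm3 x : `|x.1.1| <= norm3 x.
Proof.
rewrite -ler_sqr ?nnegrE ?norm3_ge0// norm3_sqr real_normK ?num_real// /dot3.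
by rewrite -!expr2 -addrA lerDl addr_ge0 ?sqr_ge0.
Qed.

Lemma coord12_le_norm3 x : `|x.1.2| <= norm3 x.
Proof.
rewrite -ler_sqr ?nnegrE ?norm3_ge0// norm3_sqr real_normK ?num_real// /dot3.
by rewrite -!expr2 addrAC lerDr addr_ge0 ?sqr_ge0.
Qed.

Lemma coord2_le_norm3 x : `|x.2| <= norm3 x.
Proof.
rewrite -ler_sqr ?nnegrE ?norm3_ge0// norm3_sqr real_normK ?num_real// /dot3.
by rewrite -!expr2 lerDr addr_ge0 ?sqr_ge0.
Qed.

(** The sharp constant is the square root of 3; the value 2 keeps later arithmetic rational. *)
Lemma norm3_le_coord x b : `|x.1.1| <= b -> `|x.1.2| <= b -> `|x.2| <= b ->
  norm3 x <= 2 * b.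
Proof.
move=> h1 h2 h3; have b0 : 0 <= b by exact: le_trans h1.
rewrite -ler_sqr ?nnegrE ?norm3_ge0 ?mulr_ge0// norm3_sqr /dot3 -!expr2.
have sq (t : R) : `|t| <= b -> t ^+ 2 <= b ^+ 2.
  by move=> tb; rewrite -(real_normK (num_real t)) ler_sqr ?nnegrE.
rewrite (_ : (2 * b) ^+ 2 = 4 * b ^+ 2); last by ring.
by have := sq _ h1; have := sq _ h2; have := sq _ h3; have := sqr_ge0 b; lra.
Qed.

Lemma norm3_eq0 x : norm3 x = 0 -> x = 0.
Proof.
move=> x0; have := coord11_le_norm3 x; have := coord12_le_norm3 x.
have := coord2_le_norm3 x; rewrite x0 !normr_le0.
by move: x {x0} => [[x1 x2] x3]/= /eqP -> /eqP -> /eqP ->.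
Qed.

(** The matrix with rows [e1], [e2], [e3] has its transpose as a right inverse, hence also as a left
    inverse: its columns are orthonormal too. *)
Lemma onb_dual e1 e2 e3 : orthonormal3 e1 e2 e3 ->
  [/\ e1.1.1 ^+ 2 + e2.1.1 ^+ 2 + e3.1.1 ^+ 2 = 1,
      e1.1.2 ^+ 2 + e2.1.2 ^+ 2 + e3.1.2 ^+ 2 = 1 &
      e1.2 ^+ 2 + e2.2 ^+ 2 + e3.2 ^+ 2 = 1] /\
  [/\ e1.1.1 * e1.1.2 + e2.1.1 * e2.1.2 + e3.1.1 * e3.1.2 = 0,
      e1.1.1 * e1.2 + e2.1.1 * e2.2 + e3.1.1 * e3.2 = 0 &
      e1.1.2 * e1.2 + e2.1.2 * e2.2 + e3.1.2 * e3.2 = 0].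
Proof.
move=> [[n1 n2 n3] [d12 d13 d23]].
pose E (i : 'I_3) : E3 R := nth 0 [:: e1; e2; e3] i.
pose c (x : E3 R) (j : 'I_3) : R := nth 0 [:: x.1.1; x.1.2; x.2] j.
pose M : 'M[R]_3 := \matrix_(i, j) c (E i) j.
have MM : M *m M^T = 1%:M.
  have [d21 d31 d32] : [/\ dot3 e2 e1 = 0, dot3 e3 e1 = 0 & dot3 e3 e2 = 0].
    by rewrite (dot3C e2 e1) !(dot3C e3).
  apply/matrixP => i j; rewrite !mxE !big_ord_recr big_ord0/= !mxE add0r.
  case: i => [[|[|[|?]]] // ?]; case: j => [[|[|[|?]]] // ?]; rewrite /c /E/=;
    by [exact: n1|exact: n2|exact: n3|exact: d12|exact: d13|exact: d23|
        exact: d21|exact: d31|exact: d32].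
have := mulmx1C MM => /matrixP MTM.
have := MTM 0 0; have := MTM 1 1; have := MTM 2%:R 2%:R.
have := MTM 0 1; have := MTM 0 2%:R; have := MTM 1 2%:R.
rewrite !mxE !big_ord_recr !big_ord0/= !mxE /c /E/= !add0r !expr2.
by move=> -> -> -> -> -> ->.
Qed.
End dot3_theory.

Section ge0_integralZ.
Local Open Scope ereal_scope.
Context d (T : measurableType d) (R : realType).
Variables (mu : {measure set T -> \bar R}) (f : T -> \bar R).
Hypotheses (mf : measurable_fun setT f) (f0 : forall x, 0 <= f x).

Lemma ge0_integralTZl k : 0 <= k ->
  \int[mu]_x (k * f x) = k * \int[mu]_x f x.
Proof. by move=> k0; apply: ge0_integralZl. Qed.

Lemma ge0_integralTZr k : 0 <= k ->
  \int[mu]_x (f x * k) = \int[mu]_x f x * k.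
Proof. by move=> k0; apply: ge0_integralZr. Qed.

End ge0_integralZ.

(** * Orthonormal frames and graph coordinates preserve Lebesgue measure *)

Section frame.
Context {R : realType}.
Implicit Types (x y : E3 R).

Definition frame (e1 e2 e3 y : E3 R) : E3 R :=
  y.1.1 *: e1 + y.1.2 *: e2 + y.2 *: e3.

Definition coframe (e1 e2 e3 x : E3 R) : E3 R :=
  (dot3 x e1, dot3 x e2, dot3 x e3).

(** Straightens the boundary: [y.2] is the height over the graph, measured along [e3]. As a vertical
    shear followed by a rotation, the map has unit Jacobian whatever the slope of [psi]. *)
Definition graph_coord (e1 e2 e3 : E3 R) (psi : R * R -> R) (y : E3 R) : E3 R :=
  frame e1 e2 e3 (y.1, psi y.1 + y.2).

Definition graph_cocoord (e1 e2 e3 : E3 R) (psi : R * R -> R) (x : E3 R) :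
    E3 R :=
  ((coframe e1 e2 e3 x).1, dot3 x e3 - psi (coframe e1 e2 e3 x).1).

Lemma measurable_fun_dot3 d (T : measurableType d) (f g : T -> mE3 R) :
  measurable_fun setT f -> measurable_fun setT g ->
  measurable_fun setT (fun t => dot3 (f t) (g t) : measurableTypeR R).
Proof.
move=> mf mg; rewrite /dot3.
have := measurable_funM (measurable_mE3_11 mf) (measurable_mE3_11 mg).
have := measurable_funM (measurable_mE3_12 mf) (measurable_mE3_12 mg).
have := measurable_funM (measurable_mE3_2 mf) (measurable_mE3_2 mg).
by move=> h3 h2 h1; apply: measurable_funD h3; exact: measurable_funD h2.
Qed.

Lemma continuous_E3_11 : continuous (fun x : E3 R => x.1.1).
Proof. by move=> x; apply: (continuous_comp (g := fst)); exact: cvg_fst. Qed.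

Lemma continuous_E3_12 : continuous (fun x : E3 R => x.1.2).
Proof.
by move=> x; apply: (continuous_comp (g := snd)); [exact: cvg_fst|exact: cvg_snd].
Qed.

Lemma continuous_E3_2 : continuous (fun x : E3 R => x.2).
Proof. by move=> x; exact: cvg_snd. Qed.

Lemma continuous_fun_dot3 (T : topologicalType) (f g : T -> E3 R) :
  continuous f -> continuous g -> continuous (fun t => dot3 (f t) (g t)).
Proof.
move=> cf cg t; have cvgM' (p : E3 R -> R) : continuous p ->
    p (f s) * p (g s) @[s --> t] --> p (f t) * p (g t).
  move=> cp; apply: cvgM; first exact: (continuous_comp (cf t) (cp _)).
  exact: (continuous_comp (cg t) (cp _)).
apply: cvgD; last exact: (cvgM' snd continuous_E3_2).
by apply: cvgD; [exact: (cvgM' (fun x => x.1.1) continuous_E3_11)|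
                 exact: (cvgM' (fun x => x.1.2) continuous_E3_12)].
Qed.

Lemma continuous_norm3 : continuous (@norm3 R).
Proof.
move=> x; apply: continuous_comp; last exact: sqrt_continuous.
by apply: continuous_fun_dot3 => y; exact: cvg_id.
Qed.

Lemma continuous_E3 (T : topologicalType) (f : T -> E3 R) :
  continuous (fun t => (f t).1.1) -> continuous (fun t => (f t).1.2) ->
  continuous (fun t => (f t).2) -> continuous f.
Proof.
move=> c1 c2 c3 t; rewrite (_ : f = fun t => ((f t).1.1, (f t).1.2, (f t).2)).
  exact: (cvg_pair (cvg_pair (c1 t) (c2 t)) (c3 t)).
by apply/funext => s; case: (f s) => [[]].
Qed.

Lemma measurable_fun_norm3 d (T : measurableType d) (f : T -> mE3 R) :
  measurable_fun setT f ->
  measurable_fun setT (fun t => norm3 (f t) : measurableTypeR R).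
Proof.
exact: (measurableT_comp (continuous3_measurable continuous_norm3)).
Qed.

Lemma E3_eq x y : x.1.1 = y.1.1 -> x.1.2 = y.1.2 -> x.2 = y.2 -> x = y.
Proof. by move: x y => [[? ?] ?] [[? ?] ?]/= -> -> ->. Qed.

Lemma leb3_box (A B C : set (measurableTypeR R)) :
  measurable A -> measurable B -> measurable C ->
  leb3 (A `*` B `*` C : set (mE3 R)) = (leb1 A * leb1 B * leb1 C)%E.
Proof.
move=> mA mB mC.
apply: (etrans (@product_measure1E _ _ _ _ R leb2 (@lebesgue_measure R) _ _
  (measurableX mA mB) mC)).
congr (_ * _)%E.
exact: (@product_measure1E _ _ _ _ R (@lebesgue_measure R)).
Qed.

Lemma leb1_oo (a b : R) : a <= b -> leb1 `]a, b[%classic = (b - a)%:E.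
Proof.
move=> ab; apply: (etrans (lebesgue_measure_itv _)) => /=; rewrite lte_fin.
by move: ab; rewrite le_eqVlt => /predU1P[->|->]; rewrite ?ltxx ?subrr// -EFinD.
Qed.

Section orthonormal_frame.
Variables e1 e2 e3 : E3 R.
Hypothesis onb : orthonormal3 e1 e2 e3.
Local Notation P := (frame e1 e2 e3).
Local Notation Q := (coframe e1 e2 e3).

Lemma frameK : cancel P Q.
Proof.
move: onb => [[n1 n2 n3] [d12 d13 d23]] [[a b] c].
rewrite /coframe /frame /= !(dot3Dl, dot3Zl) (dot3C e2 e1) !(dot3C e3).
by rewrite n1 n2 n3 d12 d13 d23 !(mulr0, mulr1, addr0, add0r).
Qed.

Lemma coframeK : cancel Q P.
Proof.
move: (onb_dual onb) => [[c1 c2 c3] [c12 c13 c23]] [[x1 x2] x3].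
rewrite /coframe /frame /dot3/=; congr (_, _, _); rewrite /= !scaleRE.
- move/(congr1 (fun t => x1 * t)): c1; move/(congr1 (fun t => x2 * t)): c12.
  by move/(congr1 (fun t => x3 * t)): c13; rewrite /=; lra.
- move/(congr1 (fun t => x2 * t)): c2; move/(congr1 (fun t => x1 * t)): c12.
  by move/(congr1 (fun t => x3 * t)): c23; rewrite /=; lra.
- move/(congr1 (fun t => x3 * t)): c3; move/(congr1 (fun t => x1 * t)): c13.
  by move/(congr1 (fun t => x2 * t)): c23; rewrite /=; lra.
Qed.

Lemma dot3_frame x y : dot3 (P x) (P y) = dot3 x y.
Proof.
move: onb => [[n1 n2 n3] [d12 d13 d23]].
rewrite /frame !(dot3Dl, dot3Dr, dot3Zl, dot3Zr) (dot3C e2 e1) !(dot3C e3).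
by rewrite n1 n2 n3 d12 d13 d23 /dot3; ring.
Qed.

Lemma dot3_coframe x y : dot3 (Q x) (Q y) = dot3 x y.
Proof. by rewrite -dot3_frame !coframeK. Qed.

Lemma norm3_frame y : norm3 (P y) = norm3 y.
Proof. by rewrite /norm3 dot3_frame. Qed.

Lemma frameD x y : P (x + y) = P x + P y.
Proof. by apply: E3_eq; rewrite /frame/= ?scaleRE; ring. Qed.

Lemma frameN x : P (- x) = - P x.
Proof. by apply: E3_eq; rewrite /frame/= ?scaleRE; ring. Qed.

Lemma frameB x y : P (x - y) = P x - P y.
Proof. by rewrite frameD frameN. Qed.

Lemma measurable_frame : measurable_fun setT (P : mE3 R -> mE3 R).
Proof.
have m1 := measurable_mE311 (R := R); have m2 := measurable_mE312 (R := R).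
have m3 := measurable_mE32 (R := R).
by apply: measurable_mE3; rewrite /frame/=; apply: measurable_funD;
  [apply: measurable_funD| |apply: measurable_funD| |apply: measurable_funD|];
  apply: measurable_funM.
Qed.

(** Rotation invariance comes from translation invariance and a rotation invariant reference
    function, here the indicator [b] of the unit ball. The double integral of [F x * b (x + P y)] is
    computed in both orders; each order yields one side of the claim times the volume [I] of the
    ball, which is positive and finite and cancels. *)
Lemma leb3_frame (F : mE3 R -> \bar R) : measurable_fun setT F ->
  (forall x, (0 <= F x)%E) ->
  (\int[leb3]_y F (P y) = \int[leb3]_x F x)%E.
Proof.
move=> mF F0.
pose B : set (mE3 R) := ball3 0 1.
pose b (x : mE3 R) : \bar R := (\1_B x)%:E.
have mB : measurable B.
  apply: open3_measurable; rewrite /B /ball3.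
  rewrite (_ : mkset _ = @norm3 R @^-1` `]-oo, 1[%classic).
    by move/continuousP: continuous_norm3; apply; exact: interval_open.
  by apply/seteqP; split => x /=; rewrite subr0 in_itv.
have mb : measurable_fun setT b.
  by apply/measurable_EFinP; exact: measurable_indic.
have b0 x : (0 <= b x)%E by rewrite lee_fin.
have bP y : b (P y) = b y.
  rewrite /b !indicE (_ : (P y \in B) = (y \in B))//.
  by apply/idP/idP; rewrite !inE /B /ball3/= !subr0 norm3_frame.
have mP := measurable_frame.
pose I := (\int[leb3]_x b x)%E.
have I0 : (0 <= I)%E by exact: integral_ge0.
have IE : I = leb3 B.
  by rewrite -[B in RHS]setIT; exact: integral_indic.
have Ipos : (0 < I)%E.
  pose c : set (mE3 R) := (`](- 2^-1)%R, (2^-1)%R[ `*` `](- 2^-1)%R, (2^-1)%R[) `*` `](- 2^-1)%R, (2^-1)%R[.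
  have cB : c `<=` B.
    move=> x [[/=]]; rewrite !in_itv/= => /andP[x1 x2] /andP[x3 x4] /andP[x5 x6].
    rewrite /B /ball3/= subr0 /norm3 -sqrtr1 ltr_sqrt// /dot3 -!expr2.
    by nra.
  rewrite IE (@lt_le_trans _ _ (leb3 c))//; last first.
    by apply: le_measure => //; rewrite inE//; do ?apply: measurableX.
  by rewrite /c leb3_box// leb1_oo; [rewrite -!EFinM lte_fin; lra|lra].
have Ify : (I < +oo)%E.
  pose c : set (mE3 R) := (`](- 1)%R, 1%R[ `*` `](- 1)%R, 1%R[) `*` `](- 1)%R, 1%R[.
  have Bc : B `<=` c.
    move=> x; rewrite /B /ball3/= subr0 => x1.
    have := coord11_le_norm3 x; have := coord12_le_norm3 x.
    have := coord2_le_norm3 x.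
    rewrite !ler_norml => /andP[? ?] /andP[? ?] /andP[? ?].
    by split; [split|]; rewrite /= in_itv/=; apply/andP; split; lra.
  rewrite IE (@le_lt_trans _ _ (leb3 c))//.
    by apply: le_measure => //; rewrite inE//; do ?apply: measurableX.
  by rewrite /c leb3_box// leb1_oo -?EFinM ?ltry//; lra.
pose J := (\int[leb3]_x \int[leb3]_y (F x * b ((x : E3 R) + P y)%R))%E.
have mid : measurable_fun setT (@id (mE3 R)) by exact: measurable_id.
have mbxP (x : E3 R) : measurable_fun setT (fun y => b (x + P y)%R).
  by apply: (measurableT_comp mb (measurable_mE3D (measurable_cst x) mP)).
have mFP : measurable_fun setT (fun y => F (P y)) := measurableT_comp mF mP.
have mFPx (x : E3 R) : measurable_fun setT (fun y => F (x - P y)%R).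
  by apply: (measurableT_comp mF (measurable_mE3B (measurable_cst x) mP)).
(* Writing [x = P (Q x)] turns [b (x + P y)] into [b (Q x + y)], so the inner integral over [y] is
   [I] for every [x]. *)
have J1 : J = (\int[leb3]_x F x * I)%E.
  apply: (etrans _ (ge0_integralTZr _ mF F0 I0)).
  apply: eq_integral => x _.
  apply: (etrans (ge0_integralTZl leb3 (mbxP x) (fun=> b0 _) (F0 x))).
  congr (_ * _)%E; apply: (etrans _ (leb3_shift (Q x) mb b0)).
  by apply: eq_integral => y _; rewrite -[RHS]bP frameD coframeK addrC.
(* In the other order [x] is translated by [- P y]; the inner integral of [F (x - P y)] over [y]
   becomes that of [F \o P] after a reflection and a translation by [Q x]. *)
have J2 : J = (\int[leb3]_y F (P y) * I)%E.
  have mJ : measurable_fun setT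
      (fun u : mE3 R * mE3 R => F u.1 * b ((u.1 : E3 R) + P u.2)%R)%E.
    apply: emeasurable_funM; first exact: (measurableT_comp mF measurable_fst).
    apply: (measurableT_comp mb (measurable_mE3D _ _)); first exact: measurable_fst.
    exact: (measurableT_comp mP measurable_snd).
  have mJ' : measurable_fun setT
      (fun u : mE3 R * mE3 R => F ((u.2 : E3 R) - P u.1)%R * b u.2)%E.
    apply: emeasurable_funM; last exact: (measurableT_comp mb measurable_snd).
    apply: (measurableT_comp mF (measurable_mE3B _ _)); first exact: measurable_snd.
    exact: (measurableT_comp mP measurable_fst).
  apply: (etrans (@fubini_tonelli _ _ _ _ R sleb3 sleb3 _ mJ _)).
    by move=> u; apply: mule_ge0.
  transitivity (\int[leb3]_y \int[leb3]_x (F ((x : E3 R) - P y)%R * b x))%E.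
    apply: eq_integral => y _.
    apply: (etrans _ (@leb3_shift _ (fun x => F ((x : E3 R) - P y)%R * b x)%E (P y)
       _ _)).
    - by apply: eq_integral => x _; rewrite addrK.
    - apply: emeasurable_funM => //; apply: (measurableT_comp mF).
      exact: (measurable_mE3D mid (measurable_cst (- P y))).
    - by move=> x; apply: mule_ge0.
  apply: (etrans (@fubini_tonelli _ _ _ _ R sleb3 sleb3 _ mJ' _)).
    by move=> u; apply: mule_ge0.
  apply: (etrans _ (ge0_integralTZl leb3 mb b0 _)); last exact: integral_ge0.
  apply: eq_integral => x _.
  apply: (etrans (ge0_integralTZr leb3 (mFPx x) (fun=> F0 _) (b0 x))).
  congr (_ * _)%E.
  apply: (etrans _ (leb3_shift (Q x) mFP (fun=> F0 _))).
  apply: (etrans _ (@leb3_opp _ (fun y => F (P ((y : E3 R) + Q x)%R)) _ _)) => //.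
    by apply: eq_integral => y _; rewrite frameD coframeK frameN addrC.
  apply: (measurableT_comp mFP).
  exact: (measurable_mE3D mid (measurable_cst (Q x))).
have : I \is a fin_num by rewrite ge0_fin_numE.
move=> /fineK IfE.
have I' : fine I != 0 by rewrite gt_eqF// fine_gt0// Ipos Ify.
have := J1; rewrite J2 -IfE => /(congr1 (fun t => t * (fine I)^-1%:E)%E).
by rewrite -!muleA -EFinM mulfV// !mule1.
Qed.

End orthonormal_frame.
End frame.

Section graph_coordinates.
Context {R : realType}.
Variables (e1 e2 e3 : E3 R) (psi : R * R -> R).
Hypothesis onb : orthonormal3 e1 e2 e3.
Local Notation M1 := (measurableTypeR R).
Local Notation Psi := (graph_coord e1 e2 e3 psi).
Local Notation Phi := (graph_cocoord e1 e2 e3 psi).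

Lemma graph_coordK : cancel Psi Phi.
Proof.
move=> [y t]; rewrite /graph_cocoord /graph_coord frameK//=.
have -> : dot3 (frame e1 e2 e3 (y, psi y + t)) e3 =
    (coframe e1 e2 e3 (frame e1 e2 e3 (y, psi y + t))).2 by [].
by rewrite frameK//= addrAC subrr add0r.
Qed.

Lemma graph_cocoordK : cancel Phi Psi.
Proof. by move=> x; rewrite /graph_coord /graph_cocoord/= addrC subrK coframeK. Qed.

Lemma graph_coordB (y z : E3 R) : norm3 (Psi y - Psi z) =
  norm3 (y.1.1 - z.1.1, y.1.2 - z.1.2, psi y.1 + y.2 - (psi z.1 + z.2)).
Proof. by rewrite /graph_coord -frameB// norm3_frame. Qed.

Hypothesis mpsi : measurable_fun [set: M1 * M1] (psi : M1 * M1 -> M1).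

Lemma measurable_graph_coord : measurable_fun setT (Psi : mE3 R -> mE3 R).
Proof.
apply: (measurableT_comp (measurable_frame e1 e2 e3)).
apply: measurable_fun_pair; first exact: measurable_fst.
apply: measurable_funD; last exact: measurable_mE32.
exact: (measurableT_comp mpsi measurable_fst).
Qed.

(** On each vertical line the shear is a translation by [psi y], so Tonelli and translation
    invariance reduce the claim to [leb3_frame]. *)
Lemma leb3_graph_coord (F : mE3 R -> \bar R) : measurable_fun setT F ->
  (forall x, (0 <= F x)%E) ->
  (\int[leb3]_y F (Psi y) = \int[leb3]_x F x)%E.
Proof.
move=> mF F0; rewrite -(leb3_frame onb mF F0).
have mG : measurable_fun setT (fun y => F (frame e1 e2 e3 y)).
  exact: (measurableT_comp mF (measurable_frame e1 e2 e3)).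
apply: (etrans (leb3_tonelli (measurableT_comp mF measurable_graph_coord) _)).
  by move=> x; exact: F0.
apply: (etrans _ (esym (leb3_tonelli mG (fun=> F0 _)))).
apply: eq_integral => y _.
apply: (etrans _ (leb1_shift (psi y) (measurable_fun_pair2 y mG) (fun=> F0 _))).
by apply: eq_integral => t _; rewrite /graph_coord/= addrC.
Qed.

Lemma leb3_set_graph_coord (F : mE3 R -> \bar R) (D : set (mE3 R)) :
  measurable D -> measurable_fun setT F -> (forall x, (0 <= F x)%E) ->
  (\int[leb3]_(x in D) F x = \int[leb3]_(y in Psi @^-1` D) F (Psi y))%E.
Proof.
move=> mD mF F0; rewrite integral_mkcond [RHS]integral_mkcond.
rewrite -leb3_graph_coord.
- apply: eq_integral => y _; rewrite /patch.
  rewrite (_ : (Psi y \in D) = (y \in Psi @^-1` D))//.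
- by apply/(measurable_restrictT _ mD); exact: measurable_funTS.
- by move=> x; rewrite /patch; case: ifP.
Qed.

End graph_coordinates.

(** * C^1 functions, their gradients and the chain rule *)

Section C1_functions.
Context {R : realType}.
Implicit Types (f g : E3 R -> R) (df dg : E3 R -> E3 R) (x y : E3 R).

Definition is_derive_curve (c : R -> E3 R) (s : R) (dc : E3 R) :=
  [/\ is_derive s (1 : R) (fun t => (c t).1.1) dc.1.1,
      is_derive s (1 : R) (fun t => (c t).1.2) dc.1.2 &
      is_derive s (1 : R) (fun t => (c t).2) dc.2].

(* [df] is the gradient of the C^1 function [f], expressed by the chain rule
   along differentiable curves. *)
Definition C1grad f df := [/\ continuous f, continuous df &
  forall c s dc, is_derive_curve c s dc ->
    is_derive s (1 : R) (f \o c) (dot3 (df (c s)) dc)].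

Lemma is_derive_line x v (s : R) : is_derive_curve (fun t => x + t *: v) s v.
Proof.
have H (a b : R) : is_derive s (1 : R) (fun t => a + t *: b) b.
  rewrite (_ : (fun _ => _) = cst a + (fun t => b * t)).
    by apply: is_derive_eq; rewrite add0r /GRing.scale/= mulr1.
  by apply/funext => t; rewrite /= scaleRE mulrC.
by split; exact: H.
Qed.

Lemma cvg_is_derive (F : R -> R) (s l : R) :
  h^-1 *: (F (h + s) - F s) @[h --> 0^'] --> l -> is_derive s (1 : R) F l.
Proof.
move=> H.
have H' : h^-1 *: ((F \o shift s) (h *: (1 : R)) - F s) @[h --> 0^'] --> l.
  by apply: cvg_trans H; apply: near_eq_cvg; near=> h; rewrite /= /GRing.scale/= mulr1.
by split; [apply/cvg_ex; exists l | apply/cvg_lim].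
Unshelve. all: by end_near. Qed.

Lemma MVT_between (f df : R -> R) (a b : R) :
  (forall t, is_derive t (1 : R) f (df t)) ->
  exists2 c, `|c - a| <= `|b - a| & f b - f a = df c * (b - a).
Proof.
move=> fdf; have cf : continuous f.
  by move=> t; apply/differentiable_continuous/derivable1_diffP; case: (fdf t).
have [ab|ba|->] := ltgtP a b; last first.
- by exists b; rewrite // !subrr mulr0.
- have [|c] := MVT ba (fun t _ => fdf t); first exact/continuous_subspaceT.
  rewrite in_itv/= => /andP[bc ca] E; exists c.
    by rewrite !ltr0_norm ?subr_lt0//; lra.
  by lra.
- have [|c] := MVT ab (fun t _ => fdf t); first exact/continuous_subspaceT.
  rewrite in_itv/= => /andP[bc ca] E; exists c => //.
  by rewrite !gtr0_norm ?subr_gt0//; lra.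
Qed.

(** The classical argument for differentiability from continuous partial derivatives: the increment
    along the curve is split over three axis-parallel segments from [c s] to [c (h + s)], with a
    mean value point [th] on each. These points are squeezed to [c s], and continuity of the
    partials gives the limit of the quotient. *)
Lemma continuous_partials_C1grad f : continuous f ->
  (forall v x, derivable f x v) ->
  (forall v, continuous ('D_v f)) -> C1grad f (grad3 f).
Proof.
move=> cf df cDf; split=> //.
  by apply: continuous_E3; exact: cDf.
move=> c s dc [c1 c2 c3].
have ax (v x : E3 R) t : is_derive t (1 : R) (fun t => f (x + t *: v)) ('D_v f (x + t *: v)).
  apply: cvg_is_derive.
  have := df v (x + t *: v); rewrite /derivable => /cvg_ex[l fl].
  have -> : 'D_v f (x + t *: v) = l by apply/cvg_lim.
  apply: cvg_trans fl; apply: near_eq_cvg; near=> h => /=.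
  by rewrite scalerDl addrCA.
pose D1 := 'D_(1, 0, 0) f; pose D2 := 'D_(0, 1, 0) f; pose D3 := 'D_(0, 0, 1) f.
have step h : exists th : R * R * R,
  [/\ `|th.1.1 - (c s).1.1| <= `|(c (h + s)).1.1 - (c s).1.1|,
      `|th.1.2 - (c s).1.2| <= `|(c (h + s)).1.2 - (c s).1.2|,
      `|th.2 - (c s).2| <= `|(c (h + s)).2 - (c s).2| &
  f (c (h + s)) - f (c s) =
    D1 (th.1.1, (c s).1.2, (c s).2) * ((c (h + s)).1.1 - (c s).1.1) +
    D2 ((c (h + s)).1.1, th.1.2, (c s).2) * ((c (h + s)).1.2 - (c s).1.2) +
    D3 ((c (h + s)).1.1, (c (h + s)).1.2, th.2) * ((c (h + s)).2 - (c s).2)].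
  move: (c (h + s)) (c s) => [[b1 b2] b3] [[a1 a2] a3]/=.
  have [t1 ht1 E1] := MVT_between a1 b1 (ax (1, 0, 0) (0, a2, a3)).
  have [t2 ht2 E2] := MVT_between a2 b2 (ax (0, 1, 0) (b1, 0, a3)).
  have [t3 ht3 E3] := MVT_between a3 b3 (ax (0, 0, 1) (b1, b2, 0)).
  exists (t1, t2, t3); split => //=; move: E1 E2 E3.
  have s1 t : (0, a2, a3) + t *: (1, 0, 0) = (t, a2, a3) :> E3 R.
    by apply: E3_eq; rewrite /= !scaleRE; ring.
  have s2 t : (b1, 0, a3) + t *: (0, 1, 0) = (b1, t, a3) :> E3 R.
    by apply: E3_eq; rewrite /= !scaleRE; ring.
  have s3 t : (b1, b2, 0) + t *: (0, 0, 1) = (b1, b2, t) :> E3 R.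
    by apply: E3_eq; rewrite /= !scaleRE; ring.
  by rewrite !s1 !s2 !s3 => <- <- <-; ring.
have [th Hth] := choice step.
have cvc (p : E3 R -> R) d : is_derive s (1 : R) (fun t => p (c t)) d ->
    (p (c (h + s)) @[h --> 0^'] --> p (c s)) /\
    (h^-1 *: (p (c (h + s)) - p (c s)) @[h --> 0^'] --> d).
  move=> Hd; split.
    have cp : p (c t) @[t --> s] --> p (c s).
      by apply/differentiable_continuous/derivable1_diffP; case: Hd.
    apply: (cvg_comp _ _ _ cp); apply: cvg_trans (_ : h + s @[h --> 0] --> s).
      by apply: cvg_app; exact: nbhs_dnbhs.
    by rewrite -[X in _ --> X]add0r; apply: cvgD; [exact: cvg_id|exact: cvg_cst].
  case: Hd => /cvg_ex[l Hl] E; have El : l = d by rewrite -E; apply/esym/cvg_lim.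
  rewrite -El; apply: cvg_trans Hl; apply: near_eq_cvg; near=> h => /=.
  by rewrite /GRing.scale/= mulr1.
have [cc1 q1] := cvc (fun x => x.1.1) _ c1.
have [cc2 q2] := cvc (fun x => x.1.2) _ c2.
have [cc3 q3] := cvc (fun x => x.2) _ c3.
have sq (a b : R -> R) (l : R) : (forall h, `|a h - l| <= `|b h - l|) ->
    b h @[h --> 0^'] --> l -> a h @[h --> 0^'] --> l.
  move=> ab /cvgrPdist_lt bl; apply/cvgrPdist_lt => e /bl; apply: filterS => h.
  by apply: le_lt_trans; rewrite distrC (distrC l).
have t1 := sq (fun h => (th h).1.1) _ _ (fun h => let: And4 H _ _ _ := Hth h in H) cc1.
have t2 := sq (fun h => (th h).1.2) _ _ (fun h => let: And4 _ H _ _ := Hth h in H) cc2.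
have t3 := sq (fun h => (th h).2) _ _ (fun h => let: And4 _ _ H _ := Hth h in H) cc3.
apply: cvg_is_derive => /=.
have cs : c s = ((c s).1.1, (c s).1.2, (c s).2) by case: (c s) => [[]].
have k1 : D1 ((th h).1.1, (c s).1.2, (c s).2) @[h --> 0^'] --> D1 (c s).
  rewrite [X in _ --> D1 X]cs; apply: continuous_cvg; first exact: cDf.
  exact: (cvg_pair (cvg_pair t1 (cvg_cst _)) (cvg_cst _)).
have k2 : D2 ((c (h + s)).1.1, (th h).1.2, (c s).2) @[h --> 0^'] --> D2 (c s).
  rewrite [X in _ --> D2 X]cs; apply: continuous_cvg; first exact: cDf.
  exact: (cvg_pair (cvg_pair cc1 t2) (cvg_cst _)).
have k3 : D3 ((c (h + s)).1.1, (c (h + s)).1.2, (th h).2) @[h --> 0^'] --> D3 (c s).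
  rewrite [X in _ --> D3 X]cs; apply: continuous_cvg; first exact: cDf.
  exact: (cvg_pair (cvg_pair cc1 cc2) t3).
apply: cvg_trans (cvgD (cvgD (cvgM k1 q1) (cvgM k2 q2)) (cvgM k3 q3)).
apply: near_eq_cvg; near=> h => /=.
have [_ _ _ ->] := Hth h; rewrite [LHS](_ : _ =
  D1 ((th h).1.1, (c s).1.2, (c s).2) * (h^-1 * ((c (h + s)).1.1 - (c s).1.1)) +
  D2 ((c (h + s)).1.1, (th h).1.2, (c s).2) *
    (h^-1 * ((c (h + s)).1.2 - (c s).1.2)) +
  D3 ((c (h + s)).1.1, (c (h + s)).1.2, (th h).2) *
    (h^-1 * ((c (h + s)).2 - (c s).2)))// scaleRE.
by ring.
Unshelve. all: by end_near. Qed.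

End C1_functions.

(** * Calculus of gradients and the regularised kernel *)

Section C1grad_theory.
Context {R : realType}.
Implicit Types (f g : E3 R -> R) (df dg : E3 R -> E3 R) (x y a e v : E3 R).

Lemma smooth_C1grad f : smooth f -> C1grad f (grad3 f).
Proof.
move=> sf; apply: continuous_partials_C1grad.
- by have [] := sf [::].
- by have [_] := sf [::].
- by move=> v; have [] := sf [:: v].
Qed.

Let line_quotient f x v :
  (fun h : R => h^-1 *: ((f \o shift x) (h *: v) - f x)) =
  (fun h : R => h^-1 *: (((f \o (fun t => x + t *: v)) \o shift 0) (h *: (1 : R))
     - (f \o (fun t => x + t *: v)) 0)).
Proof.
apply/funext => h/=.
by rewrite addr0 scale0r addr0 [h%:A]mulr1 (addrC x).
Qed.

Lemma C1grad_derive f df x v : C1grad f df -> 'D_v f x = dot3 (df x) v.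
Proof.
move=> [_ _ /(_ _ _ _ (is_derive_line x v 0))]; rewrite scale0r addr0 => -[_ <-].
by rewrite /derive line_quotient.
Qed.

Lemma C1grad_derivable f df x v : C1grad f df -> derivable f x v.
Proof.
move=> [_ _ /(_ _ _ _ (is_derive_line x v 0)) [+ _]].
by rewrite /derivable line_quotient.
Qed.

Lemma C1grad_grad3 f df : C1grad f df -> grad3 f = df.
Proof.
move=> fdf; apply/funext => x; rewrite /grad3 !(C1grad_derive _ _ fdf).
by case: (df x) => [[a b] c]; rewrite /dot3/= !(mulr0, mulr1, addr0, add0r).
Qed.

Lemma C1grad_cst (k : R) : C1grad (cst k) (cst 0).
Proof.
split=> [x|x|c s dc _]; [exact: cst_continuous|exact: cst_continuous|].
rewrite (_ : dot3 _ _ = 0); last by rewrite /dot3/= !mul0r !addr0.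
exact: is_derive_cst.
Qed.

Lemma C1gradM f df g dg : C1grad f df -> C1grad g dg ->
  C1grad (fun x => f x * g x) (fun x => f x *: dg x + g x *: df x).
Proof.
move=> [cf cdf Hf] [cg cdg Hg]; split=> [x|x|c s dc Hc].
- by apply: cvgM; [exact: cf|exact: cg].
- by apply: cvgD; apply: cvgZ; [exact: cf|exact: cdg|exact: cg|exact: cdf].
- rewrite dot3Dl !dot3Zl; have Hfc := Hf _ _ _ Hc; have Hgc := Hg _ _ _ Hc.
  exact: (is_deriveM Hfc Hgc).
Qed.

Lemma C1gradD f df g dg : C1grad f df -> C1grad g dg ->
  C1grad (fun x => f x + g x) (fun x => df x + dg x).
Proof.
move=> [cf cdf Hf] [cg cdg Hg]; split=> [x|x|c s dc Hc].
- by apply: cvgD; [exact: cf|exact: cg].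
- by apply: cvgD; [exact: cdf|exact: cdg].
- rewrite dot3Dl; have Hfc := Hf _ _ _ Hc; have Hgc := Hg _ _ _ Hc.
  exact: (is_deriveD Hfc Hgc).
Qed.

Lemma C1gradZ (k : R) f df : C1grad f df ->
  C1grad (fun x => k * f x) (fun x => k *: df x).
Proof.
move=> fdf; have := C1gradM (C1grad_cst k) fdf.
by under [X in C1grad _ X -> _]eq_fun do rewrite /= scaler0 addr0.
Qed.

Lemma C1gradB f df g dg : C1grad f df -> C1grad g dg ->
  C1grad (fun x => f x - g x) (fun x => df x - dg x).
Proof.
move=> fdf /(C1gradZ (-1)) gdg; have := C1gradD fdf gdg.
under [X in C1grad X _ -> _]eq_fun do rewrite /= mulN1r.
by under [X in C1grad _ X -> _]eq_fun do rewrite /= scaleN1r.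
Qed.

Lemma C1grad_comp (b db : R -> R) f df : C1grad f df ->
  (forall x, is_derive (f x) (1 : R) b (db (f x))) ->
  continuous (fun x => db (f x)) ->
  C1grad (fun x => b (f x)) (fun x => db (f x) *: df x).
Proof.
move=> [cf cdf Hf] Hb cdb; split=> [x|x|c s dc Hc].
- apply: (continuous_comp (cf x)).
  by apply/differentiable_continuous/derivable1_diffP; case: (Hb x).
- by apply: cvgZ; [exact: cdb|exact: cdf].
- rewrite dot3Zl; have Hfc := Hf _ _ _ Hc.
  exact: (is_derive1_comp (Hb (c s)) Hfc).
Qed.

Lemma C1grad_dot3 a e : C1grad (fun x => dot3 (x - a) e) (cst e).
Proof.
split=> [x||c s dc [c1 c2 c3]]; last 2 first.
- exact: cst_continuous.
- rewrite (_ : _ \o _ = (fun t => e.1.1 *: (c t).1.1) + (fun t => e.1.2 *: (c t).1.2)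
    + (fun t => e.2 *: (c t).2) + cst (- dot3 a e)); last first.
    by apply/funext => t; rewrite fctE/= !fctE /dot3/= !scaleRE; ring.
  have -> : dot3 (cst e (c s)) dc = e.1.1 *: dc.1.1 + e.1.2 *: dc.1.2 + e.2 *: dc.2 + 0.
    by rewrite addr0.
  have h1 : is_derive s (1 : R) (fun t => e.1.1 *: (c t).1.1) (e.1.1 *: dc.1.1).
    exact: is_deriveZ.
  have h2 : is_derive s (1 : R) (fun t => e.1.2 *: (c t).1.2) (e.1.2 *: dc.1.2).
    exact: is_deriveZ.
  have h3 : is_derive s (1 : R) (fun t => e.2 *: (c t).2) (e.2 *: dc.2).
    exact: is_deriveZ.
  exact: (is_deriveD (is_deriveD (is_deriveD h1 h2) h3) (is_derive_cst _ _ _)).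
- apply: continuous_fun_dot3; last exact: cst_continuous.
  by move=> y; apply: cvgB; [exact: cvg_id|exact: cvg_cst].
Qed.

Lemma C1grad_sqdist a : C1grad (fun x => dot3 (x - a) (x - a)) (fun x => 2 *: (x - a)).
Proof.
have i e := C1gradM (C1grad_dot3 a e) (C1grad_dot3 a e).
have := C1gradD (C1gradD (i (1, 0, 0)) (i (0, 1, 0))) (i (0, 0, 1)).
set F := (X in C1grad X _); set G := (X in C1grad _ X).
rewrite (_ : F = (fun x => dot3 (x - a) (x - a))); last first.
  by apply/funext => x; rewrite /F /dot3/=; ring.
rewrite (_ : G = (fun x => 2 *: (x - a)))//.
by apply/funext => x; apply: E3_eq; rewrite /G /dot3/= ?scaleRE; ring.
Qed.

(** The kernel [r] of the overview, with pole [a]. For [eps > 0] it is smooth on the whole space, so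
    that it may be used as a test function even with the pole on the boundary. *)
Definition rdist (eps : R) a x : R :=
  (Num.sqrt (dot3 (x - a) (x - a) + eps ^+ 2))^-1.

Section rdist.
Variables (eps : R) (a : E3 R).
Hypothesis eps0 : 0 < eps.
Local Notation r := (rdist eps a).

Lemma rdist_gt0 x : 0 < r x.
Proof.
rewrite invr_gt0 sqrtr_gt0; apply: ltr_wpDl; first exact: dot3_ge0.
by rewrite exprn_gt0.
Qed.

Lemma rdist_sqr x : (r x) ^- 2 = dot3 (x - a) (x - a) + eps ^+ 2.
Proof.
rewrite exprVn invrK sqr_sqrtr// addr_ge0 ?sqr_ge0//; exact: dot3_ge0.
Qed.

Lemma C1grad_rdist : C1grad r (fun x => - (r x ^+ 3) *: (x - a)).
Proof.
pose b (t : R) := (Num.sqrt (t + eps ^+ 2))^-1.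
pose db (t : R) := - 2^-1 * (b t * (b t * b t)).
have Hb x : is_derive (dot3 (x - a) (x - a)) (1 : R) b (db (dot3 (x - a) (x - a))).
  set t := dot3 _ _.
  have t0 : 0 < t + eps ^+ 2.
    by apply: ltr_wpDl; [exact: dot3_ge0|rewrite exprn_gt0].
  have Hs : is_derive t (1 : R) (fun t => Num.sqrt (t + eps ^+ 2))
      ((2 * Num.sqrt (t + eps ^+ 2))^-1 * (1 + 0)).
    have Ha : is_derive t (1 : R) (fun u => u + eps ^+ 2) (1 + 0).
      exact: (is_deriveD (is_derive_id t (1 : R)) (is_derive_cst (eps ^+ 2) _ _)).
    exact: (@is_derive1_comp R Num.sqrt (fun u => u + eps ^+ 2) t _ _
      (is_derive1_sqrt t0) Ha).
  have s0 : Num.sqrt (t + eps ^+ 2) != 0 by rewrite gt_eqF// sqrtr_gt0.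
  have := Hs; case=> Ds Es; split; first exact: derivableV.
  rewrite deriveV// Es /db /b scaleRE addr0 mulr1.
  move: s0; set s := Num.sqrt _ => s0; field; exact: s0.
have cr : continuous r.
  move=> x; rewrite /rdist; have [cq _ _] := C1grad_sqdist a.
  have s0 : Num.sqrt (dot3 (x - a) (x - a) + eps ^+ 2) != 0.
    by have := rdist_gt0 x; rewrite invr_gt0 => /gt_eqF ->.
  apply: (cvgV s0).
  apply: (continuous_cvg _ (@sqrt_continuous _ _)).
  by apply: cvgD; [exact: cq|exact: cvg_cst].
have cdb : continuous (fun x => db (dot3 (x - a) (x - a))).
  move=> x; rewrite /db; apply: cvgM; first exact: cvg_cst.
  by apply: cvgM; [exact: cr|apply: cvgM; exact: cr].
have := C1grad_comp (C1grad_sqdist a) Hb cdb.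
rewrite (_ : (fun x => db _ *: _) = (fun x => - (r x ^+ 3) *: (x - a)))//.
apply/funext => x; rewrite /db -[b _]/(r x) scalerA; congr (_ *: _).
by field.
Qed.

End rdist.
End C1grad_theory.

Lemma foldr_deriveB {R : realType} (V : normedModType R) (f g : V -> R)
    (l : seq V) : smooth f -> smooth g ->
  foldr (fun v h => 'D_v h) (fun x => f x - g x) l =
  (fun x => foldr (fun v h => 'D_v h) f l x - foldr (fun v h => 'D_v h) g l x).
Proof.
move=> sf sg; elim: l => [//|v l IH] /=; rewrite IH; apply/funext => x.
have [_ df] := sf l; have [_ dg] := sg l.
exact: (deriveB (df v x) (dg v x)).
Qed.

Lemma smoothB {R : realType} (V : normedModType R) (f g : V -> R) :
  smooth f -> smooth g -> smooth (fun x => f x - g x).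
Proof.
move=> sf sg l; rewrite (foldr_deriveB l sf sg).
have [cf df] := sf l; have [cg dg] := sg l; split.
  by move=> x; apply: cvgB; [exact: cf|exact: cg].
by move=> v x; exact: (derivableB (df v x) (dg v x)).
Qed.

Section smooth_rdist.
Context {R : realType}.
Variables (eps : R) (a : E3 R).
Hypothesis eps0 : 0 < eps.
Local Notation r := (rdist eps a).

(* A class of functions containing [rdist eps a] and closed under directional
   derivatives. *)
Inductive rdist_expr : (E3 R -> R) -> Prop :=
| rdist_expr_cst k : rdist_expr (cst k)
| rdist_expr_lin e : rdist_expr (fun x => dot3 (x - a) e)
| rdist_expr_rdist : rdist_expr r
| rdist_exprD f g : rdist_expr f -> rdist_expr g ->
    rdist_expr (fun x => f x + g x)
| rdist_exprM f g : rdist_expr f -> rdist_expr g ->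
    rdist_expr (fun x => f x * g x).

Lemma rdist_expr_C1 f : rdist_expr f ->
  exists2 df, C1grad f df & forall v, rdist_expr (fun x => dot3 (df x) v).
Proof.
elim=> {f} [k|e||f g ef [df fdf Hf] eg [dg gdg Hg]|f g ef [df fdf Hf] eg [dg gdg Hg]].
- exists (cst 0); first exact: C1grad_cst.
  move=> v; rewrite (_ : (fun _ => _) = cst 0); first exact: rdist_expr_cst.
  by apply/funext => x; rewrite /dot3/= !mul0r !addr0.
- exists (cst e); first exact: C1grad_dot3.
  by move=> v; exact: (rdist_expr_cst (dot3 e v)).
- exists (fun x => - (r x ^+ 3) *: (x - a)); first exact: C1grad_rdist.
  move=> v; rewrite (_ : (fun _ => _) =
      fun x => (r x * (r x * r x)) * ((cst (-1) x) * dot3 (x - a) v)); last first.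
    by apply/funext => x; rewrite dot3Zl/=; ring.
  by do !constructor.
- exists (fun x => df x + dg x); first exact: C1gradD.
  move=> v; rewrite (_ : (fun _ => _) = fun x => dot3 (df x) v + dot3 (dg x) v).
    exact: (rdist_exprD (Hf v) (Hg v)).
  by apply/funext => x; rewrite dot3Dl.
- exists (fun x => f x *: dg x + g x *: df x); first exact: C1gradM.
  move=> v; rewrite (_ : (fun _ => _) =
      fun x => f x * dot3 (dg x) v + g x * dot3 (df x) v).
    exact: (rdist_exprD (rdist_exprM ef (Hg v)) (rdist_exprM eg (Hf v))).
  by apply/funext => x; rewrite dot3Dl !dot3Zl.
Qed.

Lemma smooth_rdist : smooth r.
Proof.
move=> l; suff : rdist_expr (foldr (fun v h => 'D_v h) r l).
  move=> /rdist_expr_C1[df fdf _]; split; first by case: fdf.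
  by move=> v x; exact: (C1grad_derivable fdf).
elim: l => [|v l /rdist_expr_C1[df fdf H]] /=; first exact: rdist_expr_rdist.
rewrite (_ : 'D_v _ = fun x => dot3 (df x) v); first exact: H.
by apply/funext => x; rewrite (C1grad_derive _ _ fdf).
Qed.

End smooth_rdist.

(** * Cutoff functions *)

Section cutoff.
Context {R : realType}.

(** A quadratic bound on the remainder replaces the computation of a limit: it suits functions given
    piecewise, and affine ones with [K = 0]. *)
Lemma quadratic_is_derive (F : R -> R) (s l K : R) :
  (forall h, `|F (h + s) - F s - l * h| <= K * h ^+ 2) -> is_derive s (1 : R) F l.
Proof.
move=> FK; apply: cvg_is_derive; apply/cvgrPdist_lt => e e0.
have K0 : 0 <= K.
  by have := le_trans (normr_ge0 _) (FK 1); rewrite expr1n mulr1.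
near=> h.
have h0 : h != 0 by near: h; exact: nbhs_dnbhs_neq.
have hK : `|h| < e / (K + 1).
  near: h; apply: dnbhs0_lt.
  by rewrite divr_gt0// ltr_wpDl.
rewrite distrC.
have -> : h^-1 *: (F (h + s) - F s) - l = h^-1 * (F (h + s) - F s - l * h).
  by rewrite scaleRE; field.
rewrite normrM normfV mulrC ltr_pdivrMr ?normr_gt0//.
apply: (le_lt_trans (FK h)); rewrite -real_normK ?num_real// expr2 mulrA.
rewrite ltr_pM2r ?normr_gt0//.
apply: le_lt_trans (_ : (K + 1) * `|h| < _); first by rewrite ler_wpM2r// lerDl.
by rewrite mulrC -ltr_pdivlMr// ltr_wpDl.
Unshelve. all: by end_near. Qed.

(** A C^1 function vanishing exactly on a half-line; the cutoffs built from it enter only C^1 vector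
    fields. *)
Definition sqpos (t : R) := (Num.max 0 t) ^+ 2.

Lemma is_derive_sqpos (t : R) : is_derive t (1 : R) sqpos (2 * Num.max 0 t).
Proof.
apply: (@quadratic_is_derive _ _ _ 1) => h; rewrite mul1r /sqpos ler_norml.
have [t0|t0] := leP 0 t; have [ht|ht] := leP 0 (h + t); apply/andP; split; nra.
Qed.

Lemma sqpos_continuous : continuous sqpos.
Proof.
move=> t; apply/differentiable_continuous/derivable1_diffP.
by case: (is_derive_sqpos t).
Qed.

Lemma cutoff_exists (x0 : E3 R) (r : R) : 0 < r -> exists chi dchi (M : R),
  [/\ C1grad chi dchi, forall x, 0 <= chi x <= 1, forall x, norm3 (dchi x) <= M,
      forall x, norm3 (x - x0) <= r / 2 -> chi x = 1 /\ dchi x = 0 &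
      forall x, r <= norm3 (x - x0) -> chi x = 0].
Proof.
(* [k] is [r ^+ 2 - (r / 2) ^+ 2]: the affine function [s] of the squared distance runs from 0 at
   radius [r / 2] to 1 at radius [r]. *)
move=> r0; pose k : R := 3 * r ^+ 2 / 4; have k0 : 0 < k by rewrite /k; nra.
pose s (q : R) := (q - r ^+ 2 / 4) / k.
pose b q := sqpos (1 - sqpos (s q)).
pose db q := 2 * Num.max 0 (1 - sqpos (s q)) * (- (2 * Num.max 0 (s q) * k^-1)).
have Hs q : is_derive q (1 : R) s (k^-1).
  apply: (@quadratic_is_derive _ _ _ 0) => h; rewrite mul0r normr_le0 subr_eq0.
  by apply/eqP; rewrite /s; field; rewrite gt_eqF.
have Hb q : is_derive q (1 : R) b (db q).
  have h1 := @is_derive1_comp R sqpos s q _ _ (is_derive_sqpos (s q)) (Hs q).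
  have h2 : is_derive q (1 : R) (fun q => 1 - sqpos (s q))
      (0 - 2 * Num.max 0 (s q) * k^-1).
    exact: (is_deriveB (is_derive_cst (1 : R) q (1 : R)) h1).
  have := @is_derive1_comp R sqpos (fun q => 1 - sqpos (s q)) q _ _
    (is_derive_sqpos _) h2.
  by rewrite /db sub0r.
have cs : continuous s.
  by move=> q; apply/differentiable_continuous/derivable1_diffP; case: (Hs q).
have cmax (T : topologicalType) (f : T -> R) : continuous f ->
    continuous (fun x => Num.max 0 (f x)).
  by move=> cf x; apply: continuous_max; [exact: cst_continuous|exact: cf].
have cdb : continuous db.
  have c1 : continuous (fun q => 1 - sqpos (s q)).
    move=> q; apply: cvgB; first exact: cvg_cst.
    by apply: (continuous_comp (cs q)); exact: sqpos_continuous.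
  move=> q; apply: cvgM; first by apply: cvgM; [exact: cvg_cst|exact: (cmax _ _ c1)].
  apply: cvgN; apply: cvgM; last exact: cvg_cst.
  by apply: cvgM; [exact: cvg_cst|exact: (cmax _ _ cs)].
pose q (x : E3 R) := dot3 (x - x0) (x - x0).
have [cq _ _] := C1grad_sqdist x0.
have q2 x : q x = norm3 (x - x0) ^+ 2 by rewrite norm3_sqr.
have sle0 x : norm3 (x - x0) <= r / 2 -> s (q x) <= 0.
  move=> xr; rewrite /s pmulr_lle0 ?invr_gt0// q2.
  by have := norm3_ge0 (x - x0); nra.
have sge1 x : r <= norm3 (x - x0) -> 1 <= s (q x).
  move=> xr; rewrite /s ler_pdivlMr// q2 /k.
  by have := norm3_ge0 (x - x0); nra.
(* The gradient vanishes unless [norm3 (x - x0) < r]; there [db] is at most [4 / k] and the gradient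
   of [q] at most [2 * r]. *)
exists (fun x => b (q x)), (fun x => db (q x) *: (2 *: (x - x0))), (8 * r / k).
have max01 (t : R) : 0 <= Num.max 0 t by rewrite le_max lexx.
split.
- apply: (C1grad_comp (C1grad_sqdist x0) (fun x => Hb _)).
  by move=> x; apply: (continuous_comp (cq x)); exact: cdb.
- move=> x; rewrite /b /sqpos sqr_ge0/= -[leRHS](expr1n _ 2).
  by rewrite ler_sqr ?nnegrE// ge_max ler01/= gerBl sqr_ge0.
- move=> x; rewrite !norm3Z; have [s0|s0] := leP (s (q x)) 0.
    rewrite /db; have -> : Num.max 0 (s (q x)) = 0 by apply/max_idPl.
    rewrite mulr0 mul0r oppr0 mulr0 normr0 mul0r divr_ge0 ?ltW//.
    by rewrite mulr_gt0.
  have [s1|s1] := leP r (norm3 (x - x0)).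
    rewrite /db; have -> : Num.max 0 (1 - sqpos (s (q x))) = 0.
      apply/max_idPl; rewrite subr_le0 /sqpos.
      have -> : Num.max 0 (s (q x)) = s (q x) by apply/max_idPr/ltW.
      by have := sge1 _ s1; nra.
    by rewrite mulr0 mul0r normr0 mul0r divr_ge0 ?ltW// mulr_gt0.
  have sl1 : s (q x) < 1.
    rewrite /s ltr_pdivrMr// q2 /k; have := norm3_ge0 (x - x0); nra.
  have dbl : `|db (q x)| <= 4 * k^-1.
    rewrite /db normrM normrN !normrM (ger0_norm (max01 (1 - _)))
      (ger0_norm (max01 (s (q x)))).
    rewrite (gtr0_norm (_ : 0 < 2))// (gtr0_norm (_ : 0 < k^-1)) ?invr_gt0//.
    have m1 : Num.max 0 (1 - sqpos (s (q x))) <= 1.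
      by rewrite ge_max ler01/= gerBl sqr_ge0.
    have m2 : Num.max 0 (s (q x)) <= 1 by rewrite ge_max ler01/= ltW.
    rewrite !mulrA ler_pM2r ?invr_gt0//.
    have := max01 (1 - sqpos (s (q x))); have := max01 (s (q x)).
    by move: (Num.max 0 _) (Num.max 0 _) m1 m2 => A B; nra.
  rewrite (gtr0_norm (_ : 0 < 2))//.
  apply: (@le_trans _ _ (4 * k^-1 * (2 * r))).
    apply: ler_pM => //; first by rewrite mulr_ge0// norm3_ge0.
    by rewrite ler_pM2l// ltW.
  by rewrite le_eqVlt; apply/orP; left; apply/eqP; ring.
- move=> x xr; have := sle0 _ xr => s0.
  have m0 : Num.max 0 (s (q x)) = 0 by apply/max_idPl.
  split; last by rewrite /db m0 mulr0 mul0r oppr0 mulr0 scale0r.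
  rewrite /b /sqpos m0 expr0n/= subr0 (_ : Num.max 0 1 = 1) ?expr1n//.
  by apply/max_idPr.
- move=> x xr; have := sge1 _ xr => s1.
  rewrite /b {1}/sqpos (_ : Num.max 0 _ = 0) ?expr0n//.
  apply/max_idPl; rewrite subr_le0 /sqpos.
  have -> : Num.max 0 (s (q x)) = s (q x) by apply/max_idPr/(le_trans ler01).
  by nra.
Qed.

End cutoff.

(** * Functions with Lipschitz gradient on the plane *)

Section C11_theory.
Context {R : realType}.
Implicit Types (psi : R * R -> R) (y z h : R * R).

Lemma prod_norm_le y (b : R) : (`|y| <= b) = (`|y.1| <= b) && (`|y.2| <= b).
Proof. by rewrite [`|y|]/(Num.max _ _) ge_max. Qed.

Lemma prod_norm1 y : `|y.1| <= `|y|.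
Proof. by have := lexx `|y|; rewrite prod_norm_le => /andP[]. Qed.

Lemma prod_norm2 y : `|y.2| <= `|y|.
Proof. by have := lexx `|y|; rewrite prod_norm_le => /andP[]. Qed.

Lemma C11_continuous psi : C11 psi -> continuous psi.
Proof. by move=> [d _] y; exact: differentiable_continuous. Qed.

Lemma C11_lipschitz psi : C11 psi -> exists2 L : R, 0 <= L &
  forall y z, `|(grad2 psi y).1 - (grad2 psi z).1| <= L * `|y - z| /\
    `|(grad2 psi y).2 - (grad2 psi z).2| <= L * `|y - z|.
Proof.
move=> [_ [L HL]]; exists (Num.max 0 L); first by rewrite le_max lexx.
move=> y z; have : `|grad2 psi y - grad2 psi z| <= Num.max 0 L * `|y - z|.
  by apply: (le_trans (HL y z)); rewrite ler_wpM2r// le_max lexx orbT.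
by rewrite prod_norm_le => /andP[].
Qed.

Lemma C11_grad_continuous psi : C11 psi ->
  continuous (fun y => (grad2 psi y).1) /\ continuous (fun y => (grad2 psi y).2).
Proof.
move=> /C11_lipschitz[L L0 HL].
have H (p : R * R -> R) : (forall y z, `|p y - p z| <= L * `|y - z|) -> continuous p.
  move=> Hp y; apply/cvgrPdist_lt => e e0.
  have L1 : 0 < L + 1 by rewrite ltr_wpDl.
  near=> z; apply: (le_lt_trans (Hp y z)).
  have : `|y - z| < e / (L + 1).
    near: z; have /cvgrPdist_lt : z @[z --> y] --> y by exact: cvg_id.
    by apply; rewrite divr_gt0.
  rewrite ltr_pdivlMr// => Hz; apply: le_lt_trans Hz.
  by rewrite mulrC ler_wpM2l// lerDl.
by split; apply: H => y z; have [] := HL y z.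
Unshelve. all: by end_near. Qed.

Lemma C11_derive psi y h : C11 psi ->
  'D_h psi y = (grad2 psi y).1 * h.1 + (grad2 psi y).2 * h.2.
Proof.
move=> [d _]; rewrite /grad2 !deriveE//=.
rewrite -[in LHS](_ : h.1 *: (1, 0) + h.2 *: (0, 1) = h).
  by rewrite linearD !linearZ/= scaleRE scaleRE; congr (_ + _); rewrite mulrC.
by case: h => a b; congr pair; rewrite /= !scaleRE; ring.
Qed.

Lemma C11_line psi y h (s : R) : C11 psi -> is_derive s (1 : R)
  (fun t => psi (y + t *: h))
  ((grad2 psi (y + s *: h)).1 * h.1 + (grad2 psi (y + s *: h)).2 * h.2).
Proof.
move=> C; rewrite -C11_derive//; apply: cvg_is_derive.
have := diff_derivable (v := h) (proj1 C (y + s *: h)).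
rewrite /derivable => /cvg_ex[l fl].
have -> : 'D_h psi (y + s *: h) = l by apply/cvg_lim.
apply: cvg_trans fl; apply: near_eq_cvg; near=> t => /=.
by rewrite scalerDl addrCA.
Unshelve. all: by end_near. Qed.

Lemma C11_MVT psi y z : C11 psi -> exists2 w, `|w - y| <= `|z - y| &
  psi z - psi y = (grad2 psi w).1 * (z.1 - y.1) + (grad2 psi w).2 * (z.2 - y.2).
Proof.
move=> C; have [c c1] := MVT_between 0 1 (fun s => C11_line y (z - y) s C).
rewrite scale1r scale0r addr0 subrKC !subr0 mulr1 => ->.
exists (y + c *: (z - y)) => //.
rewrite addrAC subrr add0r normrZ; rewrite !subr0 normr1 in c1.
by rewrite -[leRHS]mul1r ler_wpM2r.
Qed.

(** The mean value theorem, followed by the Lipschitz bound of the gradient between [y] and the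
    intermediate point. The second order of this remainder is what the regularity of the boundary
    contributes to the pointwise estimate at a boundary pole. *)
Lemma C11_taylor psi : C11 psi -> exists2 L : R, 0 <= L & forall y z,
  `|psi z - psi y - (grad2 psi y).1 * (z.1 - y.1) - (grad2 psi y).2 * (z.2 - y.2)|
    <= L * `|z - y| ^+ 2.
Proof.
move=> C; have [L L0 HL] := C11_lipschitz C; exists (2 * L); first by rewrite mulr_ge0.
move=> y z; have [w wy ->] := C11_MVT y z C.
rewrite [X in `|X|](_ : _ =
  ((grad2 psi w).1 - (grad2 psi y).1) * (z.1 - y.1) +
  ((grad2 psi w).2 - (grad2 psi y).2) * (z.2 - y.2)); last by ring.
have [H1 H2] := HL w y.
have H (a b : R) : `|a| <= L * `|w - y| -> `|b| <= `|z - y| ->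
    `|a * b| <= L * `|z - y| ^+ 2.
  move=> Ha Hb; rewrite normrM expr2 mulrA ler_pM//.
  by apply: (le_trans Ha); rewrite ler_wpM2l.
apply: le_trans (ler_normD _ _) _.
apply: (le_trans (lerD (H _ _ H1 (prod_norm1 (z - y))) (H _ _ H2 (prod_norm2 (z - y))))).
by rewrite -[leRHS]mulrA [leRHS]mulr_natl mulr2n.
Qed.

Lemma C11_grad_bounded psi (b : R * R) (rho : R) : C11 psi ->
  exists2 M : R, 0 <= M & forall y, `|y - b| <= rho ->
    `|(grad2 psi y).1| <= M /\ `|(grad2 psi y).2| <= M.
Proof.
move=> /C11_lipschitz[L L0 HL].
exists (Num.max `|(grad2 psi b).1| `|(grad2 psi b).2| + L * `|rho|).
  by rewrite addr_ge0 ?le_max ?normr_ge0// mulr_ge0.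
move=> y yb; have [H1 H2] := HL y b.
have yb' : L * `|y - b| <= L * `|rho|.
  by rewrite ler_wpM2l// (le_trans yb)// ler_norm.
split.
- rewrite -[(grad2 psi y).1](subrK (grad2 psi b).1) addrC.
  apply: (le_trans (ler_normD _ _)); apply: lerD; first by rewrite le_max lexx.
  exact: le_trans H1 yb'.
- rewrite -[(grad2 psi y).2](subrK (grad2 psi b).2) addrC.
  apply: (le_trans (ler_normD _ _)); apply: lerD; first by rewrite le_max lexx orbT.
  exact: le_trans H2 yb'.
Qed.

Lemma C11_local_lipschitz psi (b : R * R) (rho : R) : C11 psi ->
  exists2 M : R, 0 <= M & forall y z, `|y - b| <= rho -> `|z - b| <= rho ->
    `|psi z - psi y| <= M * `|z - y|.
Proof.
(* The mean value point is within [2 * rho] of [y], hence within [3 * rho] of [b]. *)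
move=> C; have [M M0 HM] := C11_grad_bounded b (3 * rho) C.
exists (2 * M); first by rewrite mulr_ge0.
move=> y z yb zb; have [w wy ->] := C11_MVT y z C.
have [|H1 H2] := HM w.
  rewrite -(subrKA y); apply: (le_trans (ler_normD _ _)).
  have : `|z - y| <= `|z - b| + `|y - b|.
    by rewrite -(subrKA b) (distrC y); exact: ler_normD.
  by lra.
apply: (le_trans (ler_normD _ _)); rewrite !normrM.
apply: (le_trans (lerD (ler_pM (normr_ge0 _) (normr_ge0 _) H1 (prod_norm1 (z - y)))
  (ler_pM (normr_ge0 _) (normr_ge0 _) H2 (prod_norm2 (z - y))))).
by rewrite -[leRHS]mulrA [leRHS]mulr_natl mulr2n.
Qed.

End C11_theory.

(** * Charts of the boundary *)

Section charts.
Context {R : realType}.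
Variable Omega : set (E3 R).
Hypothesis oOmega : open Omega.
Implicit Types x y : E3 R.

Lemma bdryE x : bdry Omega x <-> closure Omega x /\ ~ Omega x.
Proof. by rewrite /bdry (interior_id Omega).1. Qed.

Lemma open_ball3 (x : E3 R) r : open (ball3 x r).
Proof.
rewrite /ball3 (_ : mkset _ = (fun z => norm3 (z - x)) @^-1` `]-oo, r[%classic).
  have /continuousP : continuous (fun z : E3 R => norm3 (z - x)).
    move=> z; apply: continuous_comp; last exact: continuous_norm3.
    by apply: cvgB; [exact: cvg_id|exact: cvg_cst].
  by apply; exact: interval_open.
by apply/seteqP; split => z /=; rewrite in_itv.
Qed.

Lemma ball3_center x r : 0 < r -> ball3 x r x.
Proof. by move=> r0; rewrite /ball3/= subrr norm30. Qed.

Lemma nbhs_ball3 x r : 0 < r -> nbhs x (ball3 x r).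
Proof.
by move=> r0; apply: open_nbhs_nbhs; split; [exact: open_ball3|exact: ball3_center].
Qed.

Lemma continuous_dot3 (e : E3 R) : continuous (dot3^~ e).
Proof.
apply: (@continuous_fun_dot3 _ _ id (cst e)); last exact: cst_continuous.
by move=> x; exact: cvg_id.
Qed.

Lemma continuous_coframe (e1 e2 e3 : E3 R) : continuous (coframe e1 e2 e3).
Proof. by apply: continuous_E3 => /=; exact: continuous_dot3. Qed.

Lemma continuous_frame (e1 e2 e3 : E3 R) : continuous (frame e1 e2 e3).
Proof.
move=> y; rewrite /frame.
by apply: cvgD; [apply: cvgD|]; apply: cvgZ; try exact: cvg_cst;
  [exact: continuous_E3_11|exact: continuous_E3_12|exact: continuous_E3_2].
Qed.

Lemma continuous_graph_coord e1 e2 e3 (psi : R * R -> R) : continuous psi ->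
  continuous (graph_coord e1 e2 e3 psi).
Proof.
move=> cpsi y; apply: (continuous_comp (f := fun y : E3 R => (y.1, psi y.1 + y.2))).
  have c1 : z.1 @[z --> y] --> y.1 by exact: cvg_fst.
  have c2 : psi z.1 + z.2 @[z --> y] --> psi y.1 + y.2.
    apply: cvgD; last exact: cvg_snd.
    by apply: (continuous_cvg _ (cpsi _)); exact: cvg_fst.
  exact: (cvg_pair c1 c2).
exact: continuous_frame.
Qed.

Lemma continuous_graph_cocoord e1 e2 e3 (psi : R * R -> R) : continuous psi ->
  continuous (graph_cocoord e1 e2 e3 psi).
Proof.
move=> cpsi x.
have c1 : (coframe e1 e2 e3 z).1 @[z --> x] --> (coframe e1 e2 e3 x).1.
  by apply: (continuous_comp (@continuous_coframe e1 e2 e3 x)); exact: cvg_fst.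
have c2 : dot3 z e3 - psi (coframe e1 e2 e3 z).1 @[z --> x] -->
    dot3 x e3 - psi (coframe e1 e2 e3 x).1.
  apply: cvgB; first exact: continuous_dot3.
  by apply: (continuous_cvg _ (cpsi _)).
exact: (cvg_pair c1 c2).
Qed.

Section one_chart.
Variables (x0 : E3 R) (r : R) (e1 e2 e3 : E3 R) (psi : R * R -> R).
Hypothesis chart : graph_chart Omega x0 r e1 e2 e3 psi.
Local Notation Psi := (graph_coord e1 e2 e3 psi).
Local Notation Phi := (graph_cocoord e1 e2 e3 psi).

Lemma chart_Omega x : ball3 x0 r x -> Omega x <-> 0 < (Phi x).2.
Proof.
move: chart => [_ _ _ H] /H; rewrite /graph_cocoord/= subr_gt0.
by rewrite /coframe/=.
Qed.

Lemma chart_closure x : ball3 x0 r x -> closure Omega x -> 0 <= (Phi x).2.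
Proof.
move: (chart) => [r0 onb C H] bx cx; rewrite leNgt; apply/negP => P0.
have cP := @continuous_graph_cocoord e1 e2 e3 psi (C11_continuous C).
have : nbhs x (ball3 x0 r `&` [set z | (Phi z).2 < 0]).
  apply: filterI; first by apply: open_nbhs_nbhs; split => //; exact: open_ball3.
  have : (fun z => (Phi z).2) @ x --> (Phi x).2.
    by apply: (continuous_cvg _ cvg_snd); exact: cP.
  by move=> /cvgr_lt; apply.
move=> /cx[z [/[swap] -[bz /= zn]]] /(chart_Omega bz).1 => zp.
by move: (lt_trans zn zp); rewrite ltxx.
Qed.

Lemma chart_bdry x : ball3 x0 r x -> bdry Omega x -> (Phi x).2 = 0.
Proof.
move=> bx /bdryE[cx nx]; apply/eqP; rewrite eq_le (chart_closure bx cx) andbT.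
by rewrite leNgt; apply/negP => /(chart_Omega bx).2.
Qed.

(** A point of the graph is not strictly above it, hence not in [Omega], but it is the limit of the
    points directly above it, which are. *)
Lemma chart_bdry_graph (y : R * R) : ball3 x0 r (Psi (y, 0)) ->
  bdry Omega (Psi (y, 0)).
Proof.
move: (chart) => [r0 onb C H] bx; apply/bdryE.
have PK := graph_coordK psi onb.
split; last by move=> /(chart_Omega bx).1; rewrite PK ltxx.
have cP := @continuous_graph_coord e1 e2 e3 psi (C11_continuous C).
move=> B nB.
have : nbhs (y, 0 : R) (Psi @^-1` (B `&` ball3 x0 r)).
  apply: cP; apply: filterI => //.
  by apply: open_nbhs_nbhs; split => //; exact: open_ball3.
move=> /nbhs_ballP[e /= e0 He].
have [|Bz bz] := He (y, e / 2).
  split => /=; first exact: ballxx.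
  by rewrite /ball/= sub0r normrN gtr0_norm; lra.
exists (Psi (y, e / 2)); split => //.
by apply/(chart_Omega bz).2; rewrite PK/= divr_gt0.
Qed.

End one_chart.
End charts.

Section windows.
Context {K : realFieldType}.
Implicit Types u v b e rho tau d : K.

Lemma window_half u b rho : - (rho / 2) < u - b -> u - b < rho / 2 -> `|u - b| <= rho.
Proof. by move=> h1 h2; rewrite ler_norml; apply/andP; split; lra. Qed.

Lemma window_mid u v b e rho : - (rho / 2) < u - b -> u - b < rho / 2 ->
  u < v -> v < u + e -> e <= rho / 2 -> `|v - b| < rho.
Proof. by move=> *; rewrite ltr_norml; apply/andP; split; lra. Qed.

Lemma window_height u v e rho tau : 0 <= u -> u < tau -> tau <= 3 / 2 * rho ->
  u < v -> v < u + e -> e <= rho / 2 -> 0 < v < 2 * rho.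
Proof. by move=> *; apply/andP; split; lra. Qed.

Lemma window_up u v e : u < v -> v < u + e -> `|v - u| <= e.
Proof. by move=> *; rewrite ler_norml; apply/andP; split; lra. Qed.

Lemma window_scaled u v e (m : K) : 0 <= m -> u < v -> v < u + e -> `|v - u| <= (m + 1) * e.
Proof.
move=> m0 h1 h2; apply: (le_trans (window_up h1 h2)); rewrite mulrDl mul1r lerDr mulr_ge0//.
by lra.
Qed.

Lemma box_window u v e : 0 < e -> u - e / 2 < v -> v <= u + e / 2 -> `|u - v| < e.
Proof. by move=> *; rewrite ltr_norml; apply/andP; split; lra. Qed.

Lemma window_box u v e : - e < u - v -> u - v < e -> u - e < v <= u + e.
Proof. by move=> *; apply/andP; split; lra. Qed.

Lemma nested_window u v d e : - e < u - (v + d) -> u - (v + - d) < e -> 0 < d ->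
  [/\ u - e <= v - d, v - d < v + d & v + d <= u + e].
Proof. by move=> *; split; lra. Qed.

End windows.

(** * Compactness, and boxes of graph coordinates inside the domain *)

Section compactness.
Context {R : realType}.
Implicit Types (K : set (E3 R)).

Lemma bounded_norm3 K : bounded_set K ->
  exists2 M : R, 0 < M & forall x, K x -> norm3 x <= M.
Proof.
move=> [M0 [_ HM]]; pose M := `|M0| + 1.
have M1 : M0 < M by rewrite /M (le_lt_trans (ler_norm _))// ltrDl.
exists (2 * M); first by rewrite mulr_gt0// /M ltr_wpDl.
move=> x Kx; have /= := HM _ M1 x Kx.
rewrite [`|x|]/(Num.max `|x.1| `|x.2|) ge_max prod_norm_le => /andP[/andP[h1 h2] h3].
exact: norm3_le_coord.
Qed.

Lemma bounded_closure_compact K : bounded_set K -> compact (closure K).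
Proof.
move=> /bounded_norm3[M M0 HM].
pose S := `[- M, M]%classic `*` `[- M, M]%classic `*` `[- M, M]%classic : set (E3 R).
have cS : compact S.
  by apply: compact_setX; [apply: compact_setX|]; exact: segment_compact.
apply: (subclosed_compact _ cS); first exact: closed_closure.
have KS : K `<=` S.
  move=> x /HM xM; have := coord11_le_norm3 x; have := coord12_le_norm3 x.
  have := coord2_le_norm3 x.
  by move=> h3 h2 h1; split; [split|]; rewrite /= in_itv/= -ler_norml (le_trans _ xM).
have clS : closed S.
  apply: compact_closed => //; exact: norm_hausdorff.
by move/closure_subset: KS; rewrite -((closure_id _).1 clS).
Qed.

(** Compactness as an induction principle: a property of sets that holds for neighbourhoods of each
    point and is stable under finite unions holds for a set containing [K]. The good sets, directed
    by inclusion, generate a filter to which the near-covering form of compactness applies. *)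
Lemma compact_union_cover (T : topologicalType) (K : set T)
    (G : set (set T)) : compact K -> G set0 ->
  (forall U V, G U -> G V -> G (U `|` V)) ->
  (forall x, K x -> exists2 U, open U /\ U x & G U) ->
  exists2 U, K `<=` U & G U.
Proof.
move=> /compact_near_coveringP cK G0 GU Kx.
pose F := filter_from G (fun U => [set V | G V /\ U `<=` V]).
have FF : Filter F.
  apply: filter_from_filter; first by exists set0.
  move=> U V GU1 GV; exists (U `|` V); first exact: GU.
  by move=> W [GW UVW]; split; split => // x ?; apply: UVW; [left|right].
have [|U GU1 /(_ U) H] := cK _ F (fun V x => V x) FF.
  move=> x /Kx[U [oU Ux] GUU]; exists (U, [set V | G V /\ U `<=` V]) => /=.
    by split; [exact: open_nbhs_nbhs|exists U].
  by move=> [y V] /= [Uy [_ UV]]; exact: UV.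
by exists U => //; apply: H; split.
Qed.

End compactness.

Section patches.
Context {R : realType}.
Variable Omega : set (E3 R).
Hypothesis oOmega : open Omega.
Implicit Types x y : E3 R.

Lemma leb3_preimage_graph_coord e1 e2 e3 (psi : R * R -> R) (D : set (mE3 R)) :
  orthonormal3 e1 e2 e3 -> C11 psi -> measurable D ->
  leb3 D = leb3 (graph_coord e1 e2 e3 psi @^-1` D).
Proof.
move=> onb C mD.
have mpsi := continuous2_measurable (C11_continuous C).
have m1 := @measurable_cst _ _ (mE3 R) (\bar R) setT 1%E.
have := leb3_set_graph_coord onb mpsi mD m1 (fun=> lee01).
rewrite integral_cst// mul1e integral_cst ?mul1e//.
rewrite -[X in measurable X]setTI.
exact: (measurable_graph_coord e1 e2 e3 mpsi).
Qed.

(* Near [x0], [Omega] contains a box of graph coordinates; [tau] bounds the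
   heights over the graph of the points near [x0]. *)
Definition patch x0 e1 e2 e3 (psi : R * R -> R) (b : R * R) (rho tau : R) :=
  [/\ 0 < rho, orthonormal3 e1 e2 e3, C11 psi,
      forall y, `|y.1.1 - b.1| < rho -> `|y.1.2 - b.2| < rho ->
        0 < y.2 < 2 * rho -> Omega (graph_coord e1 e2 e3 psi y) &
      \forall x \near x0, closure Omega x ->
        let y := graph_cocoord e1 e2 e3 psi x in
        [/\ `|y.1.1 - b.1| < rho / 2, `|y.1.2 - b.2| < rho / 2,
            0 <= y.2 < tau & Omega x -> 0 < y.2]].

Lemma near_coord (T : topologicalType) (F : T -> E3 R) (x0 : T) (e : R) :
  continuous F -> 0 < e -> \forall x \near x0,
  [/\ `|(F x).1.1 - (F x0).1.1| < e, `|(F x).1.2 - (F x0).1.2| < e &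
      `|(F x).2 - (F x0).2| < e].
Proof.
move=> cF e0.
have H (p : E3 R -> R) : continuous p ->
    \forall x \near x0, `|p (F x) - p (F x0)| < e.
  move=> cp; have /cvgrPdist_lt : p (F x) @[x --> x0] --> p (F x0).
    by apply: (continuous_comp (cF x0)); exact: cp.
  by move=> /(_ _ e0); apply: filterS => x; rewrite distrC.
have h1 := H (fun x => x.1.1) (@continuous_E3_11 R).
have h2 := H (fun x => x.1.2) (@continuous_E3_12 R).
have h3 := H (fun x => x.2) (@continuous_E3_2 R).
by near=> x; split; near: x.
Unshelve. all: by end_near. Qed.

Lemma bdry_patch x0 r e1 e2 e3 psi : graph_chart Omega x0 r e1 e2 e3 psi ->
  bdry Omega x0 -> exists rho : R,
  [/\ patch x0 e1 e2 e3 psi (coframe e1 e2 e3 x0).1 rho (rho / 2) &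
      forall y, `|y.1.1 - (coframe e1 e2 e3 x0).1.1| < rho ->
        `|y.1.2 - (coframe e1 e2 e3 x0).1.2| < rho ->
        `|y.2| < 2 * rho -> ball3 x0 r (graph_coord e1 e2 e3 psi y)].
Proof.
move=> ch bx0; move: (ch) => [r0 onb C _].
have cPsi := @continuous_graph_coord _ e1 e2 e3 psi (C11_continuous C).
have cPhi := @continuous_graph_cocoord _ e1 e2 e3 psi (C11_continuous C).
have Phi02 := chart_bdry oOmega ch (ball3_center _ r0) bx0.
have PhiE : graph_cocoord e1 e2 e3 psi x0 = ((coframe e1 e2 e3 x0).1, 0).
  by rewrite -Phi02.
have PsiE : graph_coord e1 e2 e3 psi ((coframe e1 e2 e3 x0).1, 0) = x0.
  by rewrite -PhiE graph_cocoordK.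
have : nbhs ((coframe e1 e2 e3 x0).1, 0 : R)
    (graph_coord e1 e2 e3 psi @^-1` ball3 x0 r).
  by apply: cPsi; rewrite PsiE; exact: nbhs_ball3.
move=> /nbhs_ballP[e /= e0 He].
(* The box of half side [e] in graph coordinates is mapped into the chart ball; halving it makes
   room for heights up to [2 * rho]. *)
exists (e / 2).
have HB y : `|y.1.1 - (coframe e1 e2 e3 x0).1.1| < e / 2 ->
    `|y.1.2 - (coframe e1 e2 e3 x0).1.2| < e / 2 ->
    `|y.2| < 2 * (e / 2) -> ball3 x0 r (graph_coord e1 e2 e3 psi y).
  move=> h1 h2 h3; apply: He; split; [split|]; rewrite /ball/= distrC.
  - by apply: lt_trans h1 _; lra.
  - by apply: lt_trans h2 _; lra.
  - by rewrite subr0; apply: lt_le_trans h3 _; lra.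
split; last exact: HB.
split => //; first by rewrite divr_gt0.
  move=> y h1 h2 /andP[h3 h4].
  apply/(chart_Omega ch (HB _ h1 h2 _)).2; last by rewrite graph_coordK.
  by rewrite gtr0_norm.
have nb : \forall x \near x0, ball3 x0 r x by exact: nbhs_ball3.
have e4 : 0 < e / 2 / 2 by rewrite !divr_gt0.
have := near_coord x0 cPhi e4; rewrite PhiE/= => nc.
near=> x; move=> cx /=; have bx : ball3 x0 r x by near: x.
have [] : [/\ `|(graph_cocoord e1 e2 e3 psi x).1.1 - (coframe e1 e2 e3 x0).1.1| < e / 2 / 2,
  `|(graph_cocoord e1 e2 e3 psi x).1.2 - (coframe e1 e2 e3 x0).1.2| < e / 2 / 2 &
  `|(graph_cocoord e1 e2 e3 psi x).2 - 0| < e / 2 / 2] by near: x.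
move=> h1 h2; rewrite subr0 => h3; split => //.
  by rewrite (chart_closure ch bx cx) (le_lt_trans (ler_norm _)).
by move=> /(chart_Omega ch bx).1.
Unshelve. all: by end_near. Qed.

Let s1 : E3 R := (1, 0, 0).
Let s2 : E3 R := (0, 1, 0).
Let s3 : E3 R := (0, 0, 1).

Lemma orthonormal3_std : orthonormal3 s1 s2 s3.
Proof.
by rewrite /s1 /s2 /s3; split; split; rewrite /dot3/=; ring.
Qed.

Lemma C11_cst (c : R) : C11 (cst c).
Proof.
split; first by move=> y; exact: differentiable_cst.
exists 0 => y z; rewrite mul0r /grad2 !derive_cst.
by rewrite subrr normr0.
Qed.

(** An interior point is placed at height [rho] over a fictitious flat graph, so that interior and
    boundary points are treated alike. Heights near [x0] stay within [rho / 2] of [rho], whence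
    [3 / 2 * rho]. *)
Lemma interior_patch x0 : Omega x0 -> exists (c : R) (b : R * R) (rho : R),
  patch x0 s1 s2 s3 (cst c) b rho (3 / 2 * rho).
Proof.
move=> Ox; have /nbhs_ballP[e /= e0 He] := open_nbhs_nbhs (conj oOmega Ox).
pose rho := e / 2; have rho0 : 0 < rho by rewrite divr_gt0.
exists (x0.2 - rho), x0.1, rho.
have onb := orthonormal3_std.
have PsiE y : graph_coord s1 s2 s3 (cst (x0.2 - rho)) y = (y.1, x0.2 - rho + y.2).
  by case: y => [[a b] d]; apply: E3_eq; rewrite /= ?scaleRE; ring.
have PhiE x : graph_cocoord s1 s2 s3 (cst (x0.2 - rho)) x = (x.1, x.2 - (x0.2 - rho)).
  by case: x => [[a b] d]; apply: E3_eq; rewrite /= /dot3/=; ring.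
split => //; first exact: C11_cst.
  move=> y h1 h2 /andP[h3 h4]; apply: He; rewrite PsiE.
  split; [split|]; rewrite /ball/= distrC.
  - by apply: lt_trans h1 _; rewrite /rho; lra.
  - by apply: lt_trans h2 _; rewrite /rho; lra.
  - by rewrite /rho in h3 h4 *; rewrite ltr_norml; apply/andP; split; lra.
have rho2 : 0 < rho / 2 by rewrite divr_gt0.
have nc := @near_coord _ id x0 (rho / 2) (fun x => cvg_id) rho2.
near=> x; move=> cx; rewrite PhiE /=.
have [h1 h2] : [/\ `|x.1.1 - x0.1.1| < rho / 2,
  `|x.1.2 - x0.1.2| < rho / 2 & `|x.2 - x0.2| < rho / 2] by near: x.
rewrite ltr_norml => /andP[h3 h4]; split => //; last by move=> _; lra.
by apply/andP; split; lra.
Unshelve. all: by end_near. Qed.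

(** The cube of side proportional to [d] with lowest corner at the graph coordinates of [x] points
    away from the boundary, hence stays in [Omega]; the Lipschitz constant of [psi] keeps its image
    in the ball of radius [d], and graph coordinates preserve its volume. *)
Lemma patch_density x0 e1 e2 e3 psi b rho tau :
  patch x0 e1 e2 e3 psi b rho tau -> tau <= 3 / 2 * rho ->
  exists c : R, 0 < c /\
  \forall x \near x0, closure Omega x -> forall d : R, 0 < d <= c ->
    ((c * d ^+ 3)%:E <= leb3 (ball3 x d `&` Omega : set (mE3 R)))%E.
Proof.
move=> [rho0 onb C HO near_x0] taurho.
have [M M0 HM] := C11_local_lipschitz b rho C.
(* With [e = k * d] the image of the cube has points at distance at most [2 * (M + 1) * e < d] from
   [x]; [k <= 1 / 2] gives [e <= rho / 2], the room left above height [tau]. *)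
pose k := (2 * (M + 2))^-1.
have k0 : 0 < k by rewrite invr_gt0 mulr_gt0// ltr_wpDl.
have k1 : k <= 2^-1.
  by rewrite /k lef_pV2 ?posrE//; nra.
exists (Num.min (k ^+ 3) rho); split; first by rewrite lt_min exprn_gt0.
apply: filterS near_x0 => x Hx cx; have := Hx cx; cbv zeta.
have := graph_cocoordK psi onb x.
move: (graph_cocoord e1 e2 e3 psi x) => y yE -[y1 y2 /andP[y3 y4] _] d.
move=> /andP[d0]; rewrite le_min => /andP[_ drho].
pose e := k * d.
have e0 : 0 < e by rewrite mulr_gt0.
have erho : e <= rho / 2 by rewrite /e; nra.
have eM : 2 * (M + 1) * e < d.
  have -> : d = 2 * (M + 2) * e.
    by rewrite /e /k; field; rewrite gt_eqF// ltr_wpDl.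
  by rewrite ltr_pM2r//; lra.
pose B : set (mE3 R) := `]y.1.1, y.1.1 + e[%classic `*` `]y.1.2, y.1.2 + e[%classic
  `*` `]y.2, y.2 + e[%classic.
have mB : measurable B by apply: measurableX => //; exact: measurableX.
have mD : measurable (ball3 x d `&` Omega : set (mE3 R)).
  by apply: measurableI; apply: open3_measurable => //; exact: open_ball3.
rewrite (leb3_preimage_graph_coord onb C mD).
apply: (@le_trans _ _ (leb3 B)).
  rewrite /B leb3_box// !leb1_oo; try by rewrite lerDl ltW.
  rewrite -!EFinM lee_fin ![_ + e]addrC !addrK.
  rewrite /e (_ : k * d * (k * d) * (k * d) = k ^+ 3 * d ^+ 3); last by ring.
  by rewrite ler_wpM2r ?ge_min ?lexx// exprn_ge0// ltW.
apply: le_measure; rewrite ?inE//.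
  rewrite -[X in measurable X]setTI.
  apply: (measurable_graph_coord e1 e2 e3) => //.
  exact: continuous2_measurable (C11_continuous C).
move=> z [[/=]]; rewrite !in_itv/= => /andP[z1 z1'] /andP[z2 z2'] /andP[z3 z3'].
move: y1 y2; rewrite !ltr_norml => /andP[y1 y1'] /andP[y2 y2'].
split; last first.
  apply: HO; [exact: (window_mid y1 y1' z1 z1' erho)|exact: (window_mid y2 y2' z2 z2' erho)|].
  exact: (window_height y3 y4 taurho z3 z3' erho).
rewrite /ball3/= -yE graph_coordB//.
apply: le_lt_trans eM; rewrite -mulrA; apply: norm3_le_coord => /=.
- exact: (window_scaled M0 z1 z1').
- exact: (window_scaled M0 z2 z2').
- rewrite (_ : _ - _ = (psi z.1 - psi y.1) + (z.2 - y.2)); last by ring.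
  apply: (le_trans (ler_normD _ _)); rewrite mulrDl mul1r; apply: lerD; last first.
    exact: (window_up z3 z3').
  apply: (le_trans (HM y.1 z.1 _ _)).
  + by rewrite prod_norm_le /= (window_half y1 y1') (window_half y2 y2').
  + rewrite prod_norm_le /= (ltW (window_mid y1 y1' z1 z1' erho)).
    by rewrite (ltW (window_mid y2 y2' z2 z2' erho)).
  + by rewrite ler_wpM2l// prod_norm_le /= (window_up z1 z1') (window_up z2 z2').
Qed.

End patches.

(** * Square integrals and one-dimensional inequalities *)

Section L2_integrals.
Local Open Scope ereal_scope.
Context d (T : measurableType d) (R : realType).
Variable mu : {measure set T -> \bar R}.
Implicit Types (D : set T) (f g : T -> R).

Lemma L2norm_sqr D f : measurable D ->
  L2norm mu D f ^+ 2 = \int[mu]_(x in D) (f x ^+ 2)%:E.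
Proof.
move=> mD; rewrite /L2norm unlock /Lnorm expe2.
have I0 : 0 <= \int[mu]_x `|(EFin \o (f \_ D)) x| `^ 2.
  by apply: integral_ge0 => x _; exact: poweR_ge0.
have -> (x : \bar R) : 0 <= x -> x `^ 2^-1 * x `^ 2^-1 = x.
  move=> x0; case: x x0 => [r|_|//]; last by rewrite poweRyr ?invr_neq0// mulyy.
  rewrite lee_fin => r0; rewrite -EFinM; congr _%:E.
  have [->|r1] := eqVneq r 0%R; first by rewrite powR0 ?mulr0// invr_neq0.
  by rewrite -powRD ?r1 ?implybT// (_ : 2^-1 + 2^-1 = 1)%R ?powRr1//; lra.
- rewrite [RHS]integral_mkcond; apply: eq_integral => x _ /=.
  rewrite !patchE; have [xD|xD] := boolP (x \in D); last by rewrite normr0 powR0.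
  by rewrite (powR_mulrn 2)// real_normK ?num_real.
- exact: I0.
Qed.

Lemma L2norm_le D f (c : R) : measurable D -> (0 <= c)%R ->
  (L2norm mu D f <= c%:E) = (\int[mu]_(x in D) (f x ^+ 2)%:E <= (c ^+ 2)%:E).
Proof.
move=> mD c0; rewrite -L2norm_sqr// (EFin_expe c 2) lee_sqr//.
exact: Lnorm_ge0.
Qed.

(** Hoelder's inequality with exponents 2 and 2, squared: no roots appear, and the statement makes
    sense for infinite integrals. *)
Lemma cauchy_schwarz D f g : measurable D -> measurable_fun D f ->
  measurable_fun D g -> (forall x, D x -> 0 <= f x)%R ->
  (forall x, D x -> 0 <= g x)%R ->
  (\int[mu]_(x in D) (f x * g x)%:E) ^+ 2 <=
  (\int[mu]_(x in D) (f x ^+ 2)%:E) * (\int[mu]_(x in D) (g x ^+ 2)%:E).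
Proof.
move=> mD mf mg f0 g0; rewrite -!L2norm_sqr//.
have mf' : measurable_fun setT (f \_ D) by apply/(measurable_restrictT _ mD).
have mg' : measurable_fun setT (g \_ D) by apply/(measurable_restrictT _ mD).
have := @hoelder _ _ _ mu _ _ 2 2 mf' mg'; rewrite ltr0n.
have -> : (2^-1 + 2^-1 = 1 :> R)%R by lra.
move=> /(_ isT isT erefl); rewrite Lnorm1.
rewrite [X in X <= _](_ : _ = \int[mu]_(x in D) (f x * g x)%:E); last first.
  rewrite [RHS]integral_mkcond; apply: eq_integral => x _ /=.
  rewrite !patchE; have [xD|xD] := boolP (x \in D); last by rewrite mulr0 normr0.
  by rewrite ger0_norm// mulr_ge0// ?f0 ?g0//; move: xD; rewrite inE.
move=> H; have I0 : 0 <= \int[mu]_(x in D) (f x * g x)%:E.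
  by apply: integral_ge0 => x Dx; rewrite lee_fin mulr_ge0// ?f0 ?g0.
rewrite !expe2 muleACA; apply: lee_pmul => //; rewrite /L2norm; exact: H.
Qed.

Lemma sqrD_le2 (a b : R) : ((a + b) ^+ 2 <= 2 * a ^+ 2 + 2 * b ^+ 2)%R.
Proof. by rewrite -subr_ge0 (_ : _ - _ = (a - b) ^+ 2)%R ?sqr_ge0//; ring. Qed.

End L2_integrals.

Section one_dim.
Context {R : realType}.
Implicit Types (g dg : R -> R).
Local Notation M1 := (measurableTypeR R).

Lemma is_derive_continuous g dg : (forall t, is_derive t (1 : R) g (dg t)) ->
  continuous g.
Proof.
by move=> H t; apply/differentiable_continuous/derivable1_diffP; case: (H t).
Qed.

Lemma FTC_segment g dg (a b : R) : (forall t, is_derive t (1 : R) g (dg t)) ->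
  continuous dg -> a <= b ->
  (\int[leb1]_(t in `[a, b]) (dg t)%:E = (g b - g a)%:E)%E.
Proof.
move=> H cdg; rewrite le_eqVlt => /predU1P[->|ab].
  by rewrite subrr set_itv1 /leb1 integral_set1.
have cg := is_derive_continuous H.
rewrite EFinB; apply: (continuous_FTC2 ab).
- exact: continuous_subspaceT.
- split.
  + by move=> t _; case: (H t).
  + by apply: cvg_at_right_filter; exact: cg.
  + by apply: cvg_at_left_filter; exact: cg.
- by move=> t _; rewrite derive1E; case: (H t).
Qed.

Lemma continuous_integrable_segment g (a b : R) : continuous g ->
  (leb1 : {measure set M1 -> \bar R}).-integrable `[a, b] (EFin \o g).
Proof.
move=> cg; apply: (@continuous_compact_integrable R g `[a, b]%classic).
  exact: segment_compact.
exact: continuous_subspaceT.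
Qed.

Lemma continuous_integral_fin_num g (a b : R) : continuous g ->
  (\int[leb1]_(t in `[a, b]) (g t)%:E)%E \is a fin_num.
Proof.
by move=> cg; apply: integrable_fin_num => //; exact: continuous_integrable_segment.
Qed.

Lemma continuous_measurable1 g (D : set M1) : continuous g -> measurable D ->
  measurable_fun D (g : M1 -> M1).
Proof.
by move=> cg mD; apply: measurable_funTS; exact: continuous_measurable_fun.
Qed.

Lemma leb1_cc (a b : R) : a <= b -> leb1 `[a, b]%classic = (b - a)%:E.
Proof.
move=> ab; apply: (etrans (lebesgue_measure_itv _)) => /=; rewrite lte_fin.
by move: ab; rewrite le_eqVlt => /predU1P[->|->]; rewrite ?ltxx ?subrr// -EFinD.
Qed.

(** The increment is the integral of [dg] between [u] and [v]; Cauchy-Schwarz against the constant 1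
    on the larger segment [[a, b]] gives the bound. *)
Lemma increment_sqr_le g dg (a b u v : R) :
  (forall t, is_derive t (1 : R) g (dg t)) -> continuous dg ->
  a <= u <= b -> a <= v <= b ->
  (((g v - g u) ^+ 2)%:E <=
   (b - a)%:E * \int[leb1]_(t in `[a, b]) (dg t ^+ 2)%:E)%E.
Proof.
move=> H cdg; wlog uv : u v / u <= v.
  move=> W ub vb; have [uv|/ltW vu] := leP u v; first exact: W.
  by rewrite -sqrrN opprB; apply: W.
move=> /andP[au ub] /andP[av vb].
have mdg (D : set M1) : measurable D -> measurable_fun D (dg : M1 -> M1).
  exact: continuous_measurable1.
have H1 : (`|g v - g u|%:E <= \int[leb1]_(t in `[a, b]) (`|dg t| * 1)%:E)%E.
  have -> : (`|g v - g u|%:E = `|\int[leb1]_(t in `[u, v]) (dg t)%:E|)%E.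
    by rewrite (FTC_segment H).
  apply: (le_trans (le_abse_integral _ _ _)) => //.
    by apply/measurable_EFinP; exact: mdg.
  rewrite [leRHS](_ : _ = \int[leb1]_(t in `[a, b]) `|(dg t)%:E|)%E; last first.
    by apply: eq_integral => t _; rewrite mulr1.
  apply: ge0_subset_integral => //.
    by apply: measurableT_comp => //; apply/measurable_EFinP; exact: mdg.
  by apply: subset_itv; rewrite bnd_simp.
have m1 : measurable_fun (`[a, b] : set M1) (fun t => `|dg t|).
  by apply: measurableT_comp => //; exact: mdg.
have := @cauchy_schwarz _ M1 R leb1 `[a, b]%classic _ _ (measurable_itv _) m1
  (@measurable_cst _ _ M1 M1 _ 1) (fun x _ => normr_ge0 _) (fun x _ => ler01).
rewrite [X in (_ <= _ * X)%E -> _](_ : _ = (b - a)%:E); last first.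
  under eq_integral do rewrite expr1n.
  by rewrite integral_cst// mul1e; apply: leb1_cc; exact: le_trans au ub.
under [X in (_ <= X * _)%E -> _]eq_integral do rewrite real_normK ?num_real//.
move=> CS; rewrite muleC; apply: le_trans CS.
rewrite -(real_normK (num_real (g v - g u))) EFin_expe lee_sqr ?lee_fin//.
by apply: integral_ge0 => t _; rewrite lee_fin mulr1.
Qed.

(** One-dimensional Sobolev inequality: [g x ^+ 2] is at most twice [g s ^+ 2] plus twice the
    squared increment, and the result is averaged over [s] in [[c, d]]. The freedom in [[c, d]] lets
    a part of the interval control the whole. *)
Lemma sup_sqr_le g dg (a b c d x : R) :
  (forall t, is_derive t (1 : R) g (dg t)) -> continuous dg ->
  a <= c -> c < d -> d <= b -> a <= x <= b ->
  ((g x ^+ 2)%:E <=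
   (2 / (d - c))%:E * \int[leb1]_(s in `[c, d]) (g s ^+ 2)%:E
   + (2 * (b - a))%:E * \int[leb1]_(t in `[a, b]) (dg t ^+ 2)%:E)%E.
Proof.
move=> H cdg ac cd db xab; have cg := is_derive_continuous H.
have sqc (h : R -> R) : continuous h -> continuous (fun t => h t ^+ 2).
  move=> ch t; rewrite (_ : (fun t => _) = fun t => h t * h t).
    by apply: cvgM; exact: ch.
  by apply/funext => s; rewrite expr2.
pose I := (\int[leb1]_(t in `[a, b]) (dg t ^+ 2)%:E)%E.
have I0 : (0 <= I)%E by apply: integral_ge0 => t _; rewrite lee_fin sqr_ge0.
have If : I \is a fin_num.
  exact: (@continuous_integral_fin_num (fun t => dg t ^+ 2) a b (sqc _ cdg)).
pose J := (\int[leb1]_(s in `[c, d]) (g s ^+ 2)%:E)%E.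
have Jf : J \is a fin_num.
  exact: (@continuous_integral_fin_num (fun t => g t ^+ 2) c d (sqc _ cg)).
pose k := 2 * (b - a) * fine I.
have k0 : 0 <= k.
  by rewrite /k mulr_ge0 ?fine_ge0// mulr_ge0// subr_ge0; lra.
have Hs s : c <= s <= d -> g x ^+ 2 <= 2 * g s ^+ 2 + k.
  move=> /andP[cs sd]; have sab : a <= s <= b by apply/andP; split; lra.
  have := increment_sqr_le H cdg sab xab; rewrite -/I -(fineK If) -EFinM lee_fin => H1.
  rewrite (_ : g x = g s + (g x - g s)); last by ring.
  apply: (le_trans (sqrD_le2 _ _)); rewrite lerD2l /k -mulrA ler_pM2l//.
have dc0 : 0 < d - c by rewrite subr_gt0.
have : (\int[leb1]_(s in `[c, d]) (cst (g x ^+ 2)%:E s) <=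
    \int[leb1]_(s in `[c, d]) (2%:E * (g s ^+ 2)%:E + cst k%:E s))%E.
  apply: ge0_le_integral => //.
  - by move=> s _; rewrite lee_fin sqr_ge0.
  - apply: emeasurable_funD => //; apply: emeasurable_funM => //.
    by apply/measurable_EFinP; exact: continuous_measurable1 (sqc _ cg) _.
have mcd := leb1_cc (ltW cd).
rewrite integral_cst// ge0_integralD//; last 2 first.
- by move=> s _; rewrite -EFinM lee_fin mulr_ge0// sqr_ge0.
- apply: emeasurable_funM => //.
  by apply/measurable_EFinP; exact: continuous_measurable1 (sqc _ cg) _.
rewrite integral_cst// mcd ge0_integralZl//; last 2 first.
- by apply/measurable_EFinP; exact: continuous_measurable1 (sqc _ cg) _.
- by move=> s _; rewrite lee_fin sqr_ge0.
rewrite -/J -/I -(fineK Jf) -(fineK If) -!EFinM -!EFinD !lee_fin.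
rewrite -ler_pdivlMr//; move/le_trans; apply.
rewrite /k le_eqVlt; apply/orP; left; apply/eqP; field.
by rewrite gt_eqF.
Qed.

(** Uniformity in the pole [a] is obtained by projecting it onto the interval of integration, which
    only shortens distances. Each side of a pole inside the interval is then integrated by the
    primitive of the shifted power, whose exponent [1 - q] is positive. *)
Lemma power_kernel_bound (q M : R) : 0 < q < 1 -> 0 < M ->
  exists2 K : R, 0 <= K & forall b a eps : R, 0 < eps <= 1 ->
  (\int[leb1]_(t in `[(b - M)%R, (b + M)%R]) ((`|t - a| + eps) `^ (- q))%:E <= K%:E)%E.
Proof.
move=> /andP[q0 q1] M0; pose p := 1 - q; have p0 : 0 < p by rewrite subr_gt0.
exists (2 * ((2 * M + 1) `^ p / p)); first by rewrite mulr_ge0// divr_ge0 ?powR_ge0// ltW.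
move=> b a eps /andP[eps0 eps1].
have cpow (f : R -> R) : (forall t, 0 < f t) -> continuous f ->
    continuous (fun t => f t `^ (- q)).
  move=> f0 cf t; apply: (@continuous_comp _ _ _ f (fun u => u `^ (- q)) t (cf t)).
  apply/differentiable_continuous/derivable1_diffP.
  by case: (is_derive1_powR (- q) (f0 t)).
have cabs (c : R) : continuous (fun t : R => `|t - c| + eps).
  move=> t; apply: cvgD; last exact: cvg_cst.
  by apply: cvg_norm; apply: cvgB; [exact: cvg_id|exact: cvg_cst].
have ck (c : R) : continuous (fun t : R => (`|t - c| + eps) `^ (- q)).
  by apply: cpow => // t; rewrite ltr_wpDl.
have side (c v : R) : c <= v -> v - c <= 2 * M ->
    (\int[leb1]_(t in `[c, v]) ((`|t - c| + eps) `^ (- q))%:E <=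
     ((2 * M + 1) `^ p / p)%:E)%E.
  move=> av vM; pose m (t : R) := Num.max c t.
  rewrite [X in (X <= _)%E](_ : _ = ((v - c + eps) `^ p / p - (eps `^ p) / p)%:E).
    rewrite lee_fin; apply: (@le_trans _ _ ((v - c + eps) `^ p / p)).
      by rewrite gerBl divr_ge0 ?powR_ge0// ltW.
    rewrite ler_pM2r ?invr_gt0// ge0_ler_powR ?nnegrE//; try exact: ltW; lra.
  move: av; rewrite le_eqVlt => /predU1P[->|av].
    by rewrite set_itv1 /leb1 integral_set1 subrr add0r subrr.
  have Hd (t : R) : c - eps < t ->
      is_derive t (1 : R) (fun t => (t - c + eps) `^ p / p) ((t - c + eps) `^ (- q)).
    move=> ta; have t0 : 0 < t - c + eps by lra.
    have h1 : is_derive t (1 : R) (fun t => t - c + eps) 1.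
      apply: (@quadratic_is_derive _ _ _ _ 0) => h.
      by rewrite mul0r normr_le0; apply/eqP; ring.
    have h2 := @is_derive1_comp R ((@powR R)^~ p) (fun t => t - c + eps) t _ _
      (is_derive1_powR p t0) h1.
    have h3 := @is_deriveZ _ _ _ _ p^-1 t 1 _ h2.
    rewrite (_ : (fun t => _) = p^-1 \*: (((@powR R)^~ p) \o (fun t => t - c + eps))).
      apply: (is_derive_eq h3); rewrite scaleRE mulr1 mulrA mulVf ?gt_eqF// mul1r.
      by congr (_ `^ _); rewrite /p; lra.
    by apply/funext => s /=; rewrite scaleRE mulrC.
  rewrite [in RHS](_ : _ - _ = (v - c + eps) `^ p / p - (c - c + eps) `^ p / p).
    2: by rewrite subrr add0r.
  rewrite EFinB; apply: (@continuous_FTC2 R _ (fun t => (t - c + eps) `^ p / p)) => //.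
  - exact: continuous_subspaceT.
  - have cF (t : R) : c <= t -> {for t, continuous (fun t => (t - c + eps) `^ p / p)}.
      move=> at0; apply/differentiable_continuous/derivable1_diffP.
      by have [] := Hd t _ ; first by lra.
    split.
    + by move=> t; rewrite in_itv/= => /andP[at0 _]; case: (Hd t _) => //; lra.
    + by apply: cvg_at_right_filter; exact: (cF c).
    + by apply: cvg_at_left_filter; apply: (cF v); exact: ltW.
  - move=> t; rewrite in_itv/= => /andP[at0 _]; rewrite derive1E.
    case: (Hd t _); first by lra.
    by move=> _ ->; rewrite gtr0_norm// subr_gt0.
have sideN (c v : R) : v <= c -> c - v <= 2 * M ->
    (\int[leb1]_(t in `[v, c]) ((`|t - c| + eps) `^ (- q))%:E <=
     ((2 * M + 1) `^ p / p)%:E)%E.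
  move=> va aM; have := side (- c) (- v); rewrite lerN2 opprK => /(_ va).
  rewrite addrC => /(_ aM); apply: le_trans.
  rewrite integral_mkcond [leRHS]integral_mkcond -leb1_opp.
  - rewrite le_eqVlt; apply/orP; left; apply/eqP; apply: eq_integral => t _.
    have tE : (- t \in `[v, c]%classic) = (t \in `[(- c), (- v)]%classic).
      by apply/idP/idP; rewrite !inE/= !in_itv/= => /andP[? ?]; apply/andP; split; lra.
    by rewrite !patchE tE -normrN opprD !opprK.
  - apply/(measurable_restrictT _ (measurable_itv _)); apply/measurable_EFinP.
    exact: continuous_measurable1.
  - by move=> t; apply: erestrict_ge0 => s _; rewrite lee_fin powR_ge0.
have mk (c : R) (D : set M1) : measurable D ->
    measurable_fun D (fun t => ((`|t - c| + eps) `^ (- q))%:E).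
  by move=> mD; apply/measurable_EFinP; exact: continuous_measurable1.
(* The projection of the pole onto [[b - M, b + M]]. *)
pose a' := Num.max (b - M) (Num.min (b + M) a).
have a'1 : b - M <= a' by rewrite /a' le_max lexx.
have a'2 : a' <= b + M by rewrite /a' ge_max ge_min lexx/=; lra.
apply: (@le_trans _ _ (\int[leb1]_(t in `[(b - M)%R, (b + M)%R])
   ((`|t - a'| + eps) `^ (- q))%:E)%E).
  apply: ge0_le_integral => //; do ?exact: mk.
  - by move=> t _; rewrite lee_fin powR_ge0.
  - move=> t /=; rewrite in_itv/= => /andP[tb bt]; rewrite lee_fin.
    rewrite !powRN lef_pV2 ?posrE ?powR_gt0 ?ltr_wpDl//.
    rewrite ge0_ler_powR ?nnegrE ?(ltW q0) ?addr_ge0 ?(ltW eps0)// lerD2r.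
    rewrite /a'; have [h1|h1] := leP a (b + M).
      have [h2|h2] := leP (b - M) a; first by [].
      by rewrite !ger0_norm ?subr_ge0//; lra.
    have [h2|h2] := leP (b - M) (b + M); last by lra.
    by rewrite !ler0_norm ?subr_le0//; lra.
have := side a' (b + M) a'2; have := sideN a' (b - M) a'1.
rewrite -(_ : [set` `[b - M, a']] `|` [set` `]a', b + M]] = [set` `[b - M, b + M]]).
  move=> h1 h2; rewrite ge0_integral_setU//.
  - rewrite mulr2n mulrDl !mul1r EFinD; apply: leeD; first by apply: h1; lra.
    apply: le_trans (h2 _); last by lra.
    apply: ge0_subset_integral => //; first exact: mk.
      by move=> t _; rewrite lee_fin powR_ge0.
    by apply: subset_itv; rewrite bnd_simp.
  - by apply: mk; exact: measurableU.
  - by move=> t _; rewrite lee_fin powR_ge0.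
  - rewrite disj_set2E; apply/eqP/seteqP; split => // t [] /=.
    by rewrite !in_itv/= => /andP[_ h] /andP[h' _]; move: (lt_le_trans h' h); rewrite ltxx.
apply/seteqP; split => t /=; rewrite !in_itv/=.
  by case => /andP[h1 h2]; apply/andP; split => //; [exact: le_trans h2 _|exact: le_trans a'1 (ltW h1)].
by move=> /andP[h1 h2]; have [h|h] := leP t a'; [left|right]; apply/andP.
Qed.

End one_dim.

Section integral_misc.
Local Open Scope ereal_scope.
Context d (T : measurableType d) (R : realType).
Implicit Types (mu : {measure set T -> \bar R}) (A B D : set T) (f : T -> \bar R).

Lemma ge0_integral_setU_le mu A B f : measurable A -> measurable B ->
  measurable_fun setT f -> (forall x, 0 <= f x) ->
  \int[mu]_(x in A `|` B) f x <= \int[mu]_(x in A) f x + \int[mu]_(x in B) f x.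
Proof.
move=> mA mB mf f0.
have mf' D : measurable_fun D f by exact: measurable_funTS.
have -> : A `|` B = A `|` (B `\` A).
  apply/seteqP; split => x [?|]; try by [left|case; right].
  by move=> Bx; have [Ax|nA] := pselect (A x); [left|right].
have mBA : measurable (B `\` A) by exact: measurableD.
rewrite ge0_integral_setU//; last first.
  by rewrite disj_set2E; apply/eqP/seteqP; split => // x [Ax [_ nA]].
apply: leeD => //; apply: ge0_subset_integral => //.
Qed.

Import HBNNSimple.

(** A simple function below [f] on [D] and below 0 elsewhere has its positive level sets inside [D],
    where the measures compare; the level 0 contributes nothing and negative levels are empty. *)
Lemma le_measure_integral (m1 m2 : {measure set T -> \bar R}) D f :
  measurable D ->
  (forall A, measurable A -> A `<=` D -> m1 A <= m2 A) ->
  (forall x, 0 <= f x) ->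
  \int[m1]_(x in D) f x <= \int[m2]_(x in D) f x.
Proof.
move=> mD m12 f0; rewrite !ge0_integralE; try by move=> x _; exact: f0.
apply: ge_ereal_sup => _ [h /= hf <-].
have h12 : sintegral m1 h <= sintegral m2 h; last first.
  by apply: (le_trans h12); apply: ereal_sup_ubound; exists h.
rewrite !sintegralE; apply: lee_fsum; first exact: fimfunP.
move=> r _; have [r0|r0] := leP r 0%R; last first.
  apply: lee_pmul => //; first by rewrite lee_fin ltW.
  apply: m12; first exact: measurable_sfunP.
  move=> x /= hx; apply: contrapT => nD; have := hf x.
  by rewrite patchE memNset// hx lee_fin leNgt r0.
have [->|rn0] := eqVneq r 0%R; first by rewrite !mul0e.
have -> : h @^-1` [set r] = set0; last by rewrite !measure0.
apply/seteqP; split => // x /= hx; have hx0 : (0 <= h x)%R by [].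
by move: hx0; rewrite hx leNgt lt_neqAle rn0 r0.
Qed.

End integral_misc.

(** * Slabs over a graph and integration along vertical lines *)

Section slabs.
Context {R : realType}.
Local Notation M1 := (measurableTypeR R).
Implicit Types (f : E3 R -> R) (df : E3 R -> E3 R) (B : set (M1 * M1)).

Lemma measurable_sqr3 f (D : set (mE3 R)) : continuous f ->
  measurable_fun D (fun x : mE3 R => (f x ^+ 2)%:E).
Proof.
move=> cf; apply: measurable_funTS; apply/measurable_EFinP.
by apply: measurable_funX; exact: continuous3_measurable.
Qed.

Lemma measurable_sqrnorm3 df (D : set (mE3 R)) : continuous df ->
  measurable_fun D (fun x : mE3 R => (norm3 (df x) ^+ 2)%:E).
Proof.
move=> cf; apply: (@measurable_sqr3 (@norm3 R \o df)) => x.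
by apply: continuous_comp; [exact: cf|exact: continuous_norm3].
Qed.

(** Heights are half-open so that a slab starting at height 0 leaves out the graph, and may lie in
    the open set [Omega]. *)
Definition slab e1 e2 e3 psi B (a b : R) : set (E3 R) :=
  [set x | B (graph_cocoord e1 e2 e3 psi x).1 /\
    a < (graph_cocoord e1 e2 e3 psi x).2 <= b].

Section one_slab.
Variables (e1 e2 e3 : E3 R) (psi : R * R -> R).
Hypotheses (onb : orthonormal3 e1 e2 e3) (C : C11 psi).
Local Notation Psi := (graph_coord e1 e2 e3 psi).
Let cPsi := @continuous_graph_coord _ e1 e2 e3 psi (C11_continuous C).
Let cPhi := @continuous_graph_cocoord _ e1 e2 e3 psi (C11_continuous C).
Let mpsi := continuous2_measurable (C11_continuous C).

Lemma measurable_graph_cocoord :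
  measurable_fun setT (graph_cocoord e1 e2 e3 psi : mE3 R -> mE3 R).
Proof.
apply: measurable_mE3.
- exact: (measurable_fun_dot3 (@measurable_id _ _ _) (@measurable_cst _ _ _ _ _ e1)).
- exact: (measurable_fun_dot3 (@measurable_id _ _ _) (@measurable_cst _ _ _ _ _ e2)).
- apply: (@continuous3_measurable _ (fun x => (graph_cocoord e1 e2 e3 psi x).2)) => x.
  exact: (@continuous_comp _ _ _ _ (fun y : E3 R => y.2) x (@cPhi x) (@continuous_E3_2 R _)).
Qed.

Lemma measurable_slab B a b : measurable B ->
  measurable (slab e1 e2 e3 psi B a b : set (mE3 R)).
Proof.
move=> mB.
rewrite (_ : slab _ _ _ _ _ _ _ = graph_cocoord e1 e2 e3 psi @^-1` (B `*` `]a, b]%classic)).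
  by rewrite -[X in measurable X]setTI; apply: measurable_graph_cocoord => //; exact: measurableX.
by apply/seteqP; split => x [/= ?]; rewrite ?in_itv /=.
Qed.

Lemma preimage_slab B a b :
  Psi @^-1` slab e1 e2 e3 psi B a b = B `*` `]a, b]%classic.
Proof.
have PK := graph_coordK psi onb.
by apply/seteqP; split => -[y t]; rewrite /preimage /slab /mkset PK /setX /= in_itv.
Qed.

Lemma slab_tonelli (F : mE3 R -> \bar R) B a b : measurable B ->
  measurable_fun setT F -> (forall x, (0 <= F x)%E) ->
  (\int[leb3]_(x in slab e1 e2 e3 psi B a b) F x =
   \int[leb2]_(y in B) \int[leb1]_(t in `]a, b]) F (Psi (y, t)))%E.
Proof.
move=> mB mF F0; rewrite (leb3_set_graph_coord onb mpsi (measurable_slab _ _ mB) mF F0).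
have -> : Psi @^-1` slab e1 e2 e3 psi B a b = B `*` `]a, b]%classic.
  exact: preimage_slab.
have mBJ : measurable (B `*` `]a, b]%classic : set (mE3 R)) by exact: measurableX.
have mG : measurable_fun setT (F \o Psi).
  by apply: measurableT_comp => //; exact: measurable_graph_coord.
rewrite integral_mkcond [RHS]integral_mkcond leb3_tonelli; last 2 first.
- by apply/(measurable_restrictT _ mBJ); exact: measurable_funTS.
- by move=> x; apply: erestrict_ge0 => z _; exact: F0.
apply: eq_integral => y _; rewrite [in RHS]patchE; case: ifPn => [yB|yB].
  rewrite [RHS]integral_mkcond; apply: eq_integral => t _; rewrite !patchE.
  congr (if _ then _ else _); apply/idP/idP; rewrite !inE/=; first by case.
  by move: yB; rewrite inE.
apply: integral0_eq => t _; rewrite patchE memNset// => -[/= /mem_set].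
by move=> h; rewrite h in yB.
Qed.

Lemma is_derive_vertical f df (y : R * R) (t : R) : C1grad f df ->
  is_derive t (1 : R) (fun s => f (Psi (y, s))) (dot3 (df (Psi (y, t))) e3).
Proof.
move=> [_ _ H]; apply: (H (fun s => Psi (y, s))).
rewrite (_ : (fun s : R => _) = fun s => Psi (y, 0) + s *: e3).
  exact: is_derive_line.
apply/funext => s; rewrite /graph_coord /frame /= addr0 scalerDl addrA.
by [].
Qed.

Lemma continuous_vertical f (y : R * R) : continuous f ->
  continuous (fun s : R => f (Psi (y, s))).
Proof.
move=> cf t; apply: (@continuous_comp _ _ _ (fun s => Psi (y, s)) f); last exact: cf.
apply: (@continuous_comp _ _ _ (fun s : R => (y, s)) Psi); last exact: @cPsi.
exact: (cvg_pair (cvg_cst _) (@cvg_id _ (nbhs t))).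
Qed.

(* The vertical lines are straight lines in the direction [e3], so that the
   one-dimensional Sobolev inequality can be integrated over them. *)
Lemma slice_sqr_le f df B (a b c d t : R) : measurable B -> C1grad f df ->
  a <= c -> c < d -> d <= b -> a <= t <= b ->
  (\int[leb2]_(y in B) (f (Psi (y, t)) ^+ 2)%:E <=
   (2 / (d - c))%:E * \int[leb3]_(x in slab e1 e2 e3 psi B c d) (f x ^+ 2)%:E +
   (2 * (b - a))%:E *
     \int[leb3]_(x in slab e1 e2 e3 psi B a b) (norm3 (df x) ^+ 2)%:E)%E.
Proof.
move=> mB Cf ac cd db tab; have [cf cdf _] := Cf.
have mf := measurable_sqr3 (D := setT) cf; have mdf := measurable_sqrnorm3 (D := setT) cdf.
have f0 x : (0 <= (f x ^+ 2)%:E)%E by rewrite lee_fin sqr_ge0.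
have df0 x : (0 <= (norm3 (df x) ^+ 2)%:E)%E by rewrite lee_fin sqr_ge0.
rewrite !slab_tonelli//.
have dc : 0 <= 2 / (d - c) by rewrite divr_ge0// subr_ge0 ltW.
have ba : 0 <= 2 * (b - a) by rewrite mulr_ge0// subr_ge0; lra.
have mI (F : mE3 R -> \bar R) u w : measurable_fun setT F -> (forall x, (0 <= F x)%E) ->
    measurable_fun B (fun y => \int[leb1]_(t in `]u, w]) F (Psi (y, t)))%E.
  move=> mF F0; apply: measurable_funTS.
  have mS : measurable (setT `*` `]u, w]%classic : set (mE3 R)) by exact: measurableX.
  rewrite (_ : (fun y => _) = fun y => (\int[leb1]_t
    ((F \o Psi) \_ (setT `*` `]u, w]%classic)) (y, t))%E); last first.
    apply/funext => y; rewrite integral_mkcond; apply: eq_integral => s _.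
    rewrite !patchE; congr (if _ then _ else _).
    by apply/idP/idP; rewrite !inE; [split|case].
  apply: (@measurable_fun_fubini_tonelli_F _ _ _ _ R (@lebesgue_measure R)).
    apply/(measurable_restrictT _ mS); apply: measurable_funTS.
    by apply: measurableT_comp => //; exact: measurable_graph_coord.
  by move=> x; apply: erestrict_ge0 => z _; exact: F0.
have mI1 := mI _ c d mf f0; have mI2 := mI _ a b mdf df0.
rewrite -ge0_integralZl//; last by move=> y _; exact: integral_ge0.
rewrite -ge0_integralZl//; last by move=> y _; exact: integral_ge0.
rewrite -ge0_integralD//; last 4 first.
- by move=> y _; apply: mule_ge0 => //; exact: integral_ge0.
- exact: measurable_funeM.
- by move=> y _; apply: mule_ge0 => //; exact: integral_ge0.
- exact: measurable_funeM.
apply: ge0_le_integral => //.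
- apply/measurable_EFinP; apply: measurable_funX; apply: measurable_funTS.
  apply: (@continuous2_measurable _ (fun y => f (Psi (y, t)))) => y.
  apply: (@continuous_comp _ _ _ (fun s => Psi (s, t)) f); last exact: cf.
  apply: (@continuous_comp _ _ _ (fun s : R * R => (s, t)) Psi); last exact: @cPsi.
  exact: (cvg_pair (@cvg_id _ (nbhs y)) (cvg_cst _)).
- by apply: emeasurable_funD; exact: measurable_funeM.
move=> y _.
have cg : continuous (fun s => f (Psi (y, s))) by exact: continuous_vertical.
have cdg : continuous (fun s => dot3 (df (Psi (y, s))) e3).
  apply: (@continuous_vertical (fun x => dot3 (df x) e3) y) => x.
  exact: (@continuous_comp _ _ _ df (dot3^~ e3) _ (cdf x) (@continuous_dot3 _ e3 _)).
have := sup_sqr_le (fun s => is_derive_vertical y s Cf) cdg ac cd db tab.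
move=> /le_trans; apply; apply: leeD.
  rewrite lee_pmul2l//; last by rewrite lte_fin divr_gt0// subr_gt0.
  rewrite -integral_itv_obnd_cbnd//.
  by apply/measurable_EFinP; apply: measurable_funX; exact: continuous_measurable1.
apply: lee_wpmul2l => //.
rewrite -integral_itv_obnd_cbnd//; last first.
  by apply/measurable_EFinP; apply: measurable_funX; exact: continuous_measurable1.
apply: ge0_le_integral => //.
- by move=> s _; rewrite lee_fin sqr_ge0.
- by apply/measurable_EFinP; apply: measurable_funX; exact: continuous_measurable1.
- apply/measurable_EFinP; apply: measurable_funX; apply: continuous_measurable1 => //.
  apply: (@continuous_vertical (fun x => norm3 (df x)) y) => x.
  exact: (@continuous_comp _ _ _ df (@norm3 R) _ (cdf x) (@continuous_norm3 _ _)).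
- move=> s _; rewrite lee_fin; have [[_ _ e33] _] := onb.
  by apply: le_trans (dot3_CS_sqr _ _) _; rewrite e33 mulr1 norm3_sqr.
Qed.

(** The bound of a slice does not depend on its height; integrating it over the heights yields the
    factor [b - a]. *)
Lemma slab_sqr_le f df B (a b c d : R) : measurable B -> C1grad f df ->
  a <= c -> c < d -> d <= b ->
  (\int[leb3]_(x in slab e1 e2 e3 psi B a b) (f x ^+ 2)%:E <= (b - a)%:E *
   ((2 / (d - c))%:E * \int[leb3]_(x in slab e1 e2 e3 psi B c d) (f x ^+ 2)%:E +
   (2 * (b - a))%:E *
     \int[leb3]_(x in slab e1 e2 e3 psi B a b) (norm3 (df x) ^+ 2)%:E))%E.
Proof.
move=> mB Cf ac cd db; have [cf cdf _] := Cf.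
have ab : a <= b by lra.
set K := (_ + _)%E.
have f0 x : (0 <= (f x ^+ 2)%:E)%E by rewrite lee_fin sqr_ge0.
have mBJ : measurable (B `*` `]a, b]%classic : set (mE3 R)) by exact: measurableX.
pose G : mE3 R -> \bar R := (fun x => (f (Psi x) ^+ 2)%:E) \_ (B `*` `]a, b]%classic).
have mG : measurable_fun setT G.
  apply/(measurable_restrictT _ mBJ); apply: measurable_sqr3 => x.
  exact: (@continuous_comp _ _ _ _ f x (@cPsi x) (cf _)).
have G0 x : (0 <= G x)%E by apply: erestrict_ge0.
rewrite (leb3_set_graph_coord onb mpsi (measurable_slab _ _ mB) (measurable_sqr3 (D := setT) cf) f0).
have -> : Psi @^-1` slab e1 e2 e3 psi B a b = B `*` `]a, b]%classic.
  exact: preimage_slab.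
rewrite integral_mkcond.
rewrite (leb3_tonelli' mG G0).
rewrite (_ : (b - a)%:E * K = \int[leb1]_(t in `]a, b]) cst K t)%E; last first.
  have -> : (\int[leb1]_(t in `]a, b]) cst K t = \int[leb1]_(t in `[a, b]) cst K t)%E.
    by rewrite -integral_itv_obnd_cbnd//; exact: measurable_cst.
  by rewrite integral_cst// (leb1_cc ab) muleC.
rewrite [leRHS]integral_mkcond.
have K0 : (0 <= K)%E.
  apply: adde_ge0; apply: mule_ge0; try by apply: integral_ge0 => x _; rewrite lee_fin sqr_ge0.
    by rewrite lee_fin divr_ge0// subr_ge0 ltW.
  by rewrite lee_fin mulr_ge0// subr_ge0.
apply: ge0_le_integral => //.
- by move=> t _; exact: integral_ge0.
- exact: (@measurable_fun_fubini_tonelli_G _ _ _ _ R leb2 G mG G0).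
- by apply/(measurable_restrictT _ (measurable_itv _)); exact: measurable_cst.
move=> t _; rewrite patchE; case: ifPn => [|tn]; last first.
  rewrite integral0_eq// => y _; rewrite /G patchE memNset// => -[_ h].
  by move: tn; rewrite notin_setE; apply.
rewrite inE /= in_itv /= => /andP[a_t tb].
apply: (le_trans _ (@slice_sqr_le f df B a b c d t mB Cf ac cd db _)).
  rewrite [leRHS]integral_mkcond le_eqVlt; apply/orP; left; apply/eqP.
  apply: eq_integral => y _; rewrite /G !patchE.
  congr (if _ then _ else _); apply/idP/idP; rewrite !inE/=; first by case.
  by split => //=; rewrite in_itv/= a_t tb.
by rewrite (ltW a_t).
Qed.

End one_slab.
End slabs.

(** * Poincare inequality on a cube *)

Section mean_value_cube.
Context {R : realType}.
Local Notation M1 := (measurableTypeR R).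
Implicit Types (f : E3 R -> R) (df : E3 R -> E3 R).

(** If [g] exceeded [(K + eta) / l] everywhere, its integral would be at least [K + eta]. The slack
    [eta] spares a discussion of strict inequalities between integrals. *)
Lemma exists_le_average (g : R -> \bar R) (a l K eta : R) : 0 < l -> 0 < eta ->
  measurable_fun [set: M1] g -> (forall t, (0 <= g t)%E) ->
  (\int[leb1]_(t in `[a, (a + l)%R]) g t <= K%:E)%E ->
  exists2 t, a <= t <= a + l & (g t <= ((K + eta) / l)%:E)%E.
Proof.
move=> l0 eta0 mg g0 gK; apply: contrapT => H.
have gK' := gK.
suff : ((K + eta)%:E <= K%:E)%E by rewrite lee_fin; apply/negP; rewrite -ltNge; lra.
apply: le_trans gK.
apply: (@le_trans _ _ (\int[leb1]_(t in `[a, (a + l)%R]) cst ((K + eta) / l)%:E t)%E).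
  rewrite integral_cst//= leb1_cc; last by lra.
  by rewrite -EFinM lee_fin [a + l]addrC addrK divfK// gt_eqF.
rewrite integral_mkcond [leRHS]integral_mkcond.
have Kp : 0 <= (K + eta) / l.
  have KK : (0 <= K%:E)%E by apply: le_trans gK'; exact: integral_ge0.
  by rewrite divr_ge0 ?(ltW l0)// addr_ge0 ?(ltW eta0)// -lee_fin.
apply: ge0_le_integral => //.
- by move=> t _; apply: erestrict_ge0 => s _; rewrite lee_fin.
- by apply/(measurable_restrictT _ (measurable_itv _)); exact: measurable_cst.
- by apply/(measurable_restrictT _ (measurable_itv _)); exact: measurable_funTS.
- move=> t _; rewrite !patchE; case: ifPn => //; rewrite inE/= in_itv/= => tab.
  by rewrite leNgt; apply/negP => gt; apply: H; exists t => //; exact: ltW.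
Qed.

Definition cube (a : E3 R) (l : R) : set (E3 R) :=
  `[a.1.1, a.1.1 + l]%classic `*` `[a.1.2, a.1.2 + l]%classic
  `*` `[a.2, a.2 + l]%classic.

Lemma measurable_cube a l : measurable (cube a l : set (mE3 R)).
Proof. by apply: measurableX; first exact: measurableX. Qed.

Lemma continuous_bounded_on (D : set (E3 R)) (g : E3 R -> R) : bounded_set D ->
  continuous g -> exists2 M, 0 <= M & forall x, D x -> `|g x| <= M.
Proof.
move=> bD cg; have kD := bounded_closure_compact bD.
have /compact_bounded[M [_ HM]] : compact (g @` closure D).
  by apply: continuous_compact => //; exact: continuous_subspaceT.
exists (`|M| + 1) => [|x Dx]; first by rewrite addr_ge0.
apply: HM; first by rewrite ltr_pwDr// ler_norm.
by exists x => //; exact: subset_closure.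
Qed.

Lemma leb3_cube a l : 0 <= l -> leb3 (cube a l) = (l ^+ 3)%:E.
Proof.
move=> l0; rewrite leb3_box// !leb1_cc ?lerDl// -!EFinM; congr (_%:E).
by ring.
Qed.

Lemma leb3_bounded_lty (D : set (mE3 R)) : measurable D -> bounded_set (D : set (E3 R)) ->
  (leb3 D < +oo)%E.
Proof.
move=> mD /bounded_norm3[M M0 HM].
apply: (@le_lt_trans _ _ (leb3 (cube (- M, - M, - M) (2 * M)))).
  apply: le_measure; rewrite ?inE//; first exact: measurable_cube.
  move=> x /HM xM; have h1 := le_trans (coord11_le_norm3 x) xM.
  have h2 := le_trans (coord12_le_norm3 x) xM.
  have h3 := le_trans (coord2_le_norm3 x) xM.
  move: h1 h2 h3; rewrite !ler_norml => /andP[? ?] /andP[? ?] /andP[? ?].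
  by split; [split|]; rewrite /= in_itv/=; apply/andP; split; lra.
by rewrite leb3_cube ?ltry// mulr_ge0// ltW.
Qed.

Lemma bounded_integral_fin_num (D : set (mE3 R)) (g : E3 R -> R) : measurable D ->
  bounded_set (D : set (E3 R)) -> continuous g -> (forall x, 0 <= g x) ->
  (\int[leb3]_(x in D) (g x)%:E)%E \is a fin_num.
Proof.
move=> mD bD cg g0; have [M M0 HM] := continuous_bounded_on bD cg.
rewrite ge0_fin_numE; last by apply: integral_ge0 => x _; rewrite lee_fin.
apply: (@le_lt_trans _ _ (\int[leb3]_(x in D) cst M%:E x)%E).
  apply: ge0_le_integral => //.
  - by move=> x _; rewrite lee_fin.
  - by apply: measurable_funTS; apply/measurable_EFinP; exact: continuous3_measurable.
  - by move=> x Dx; rewrite lee_fin (le_trans (ler_norm _))// HM.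
rewrite integral_cst//; apply: lte_mul_pinfty; rewrite ?lee_fin//.
exact: leb3_bounded_lty.
Qed.

Lemma cube_bounded a l : bounded_set (cube a l).
Proof.
apply: compact_bounded.
by apply: compact_setX; [apply: compact_setX|]; exact: segment_compact.
Qed.

Lemma cubeE a l x : cube a l x <->
  [/\ a.1.1 <= x.1.1 <= a.1.1 + l, a.1.2 <= x.1.2 <= a.1.2 + l &
      a.2 <= x.2 <= a.2 + l].
Proof. by rewrite /cube /setX /= !in_itv/=; split => [[[]]|[]]. Qed.

(* A point value approximately controls the mean: the three coordinates of the
   point are chosen one after the other on slices where the energy does not
   exceed its average. *)
Lemma cube_point_poincare a l f df eta : 0 < l -> 0 < eta -> C1grad f df ->
  exists c : R, (\int[leb3]_(x in cube a l) ((f x - c) ^+ 2)%:E <=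
    (9 * l ^+ 2)%:E *
    (\int[leb3]_(x in cube a l) (norm3 (df x) ^+ 2)%:E + eta%:E))%E.
Proof.
move=> l0 eta0 Cf; have [cf cdf _] := Cf.
have mQ := measurable_cube a l.
pose p x := norm3 (df x) ^+ 2.
have p0 x : 0 <= p x by exact: sqr_ge0.
have cp : continuous p.
  have cn : continuous (fun x => norm3 (df x)).
    by move=> x; exact: (@continuous_comp _ _ _ df (@norm3 R) _ (cdf x) (@continuous_norm3 R _)).
  by move=> x; rewrite /p; apply: cvgM; exact: cn.
pose F : mE3 R -> \bar R := (fun x => (p x)%:E) \_ (cube a l).
have F0 x : (0 <= F x)%E by apply: erestrict_ge0 => z _; rewrite lee_fin.
have mF : measurable_fun setT F.
  apply/(measurable_restrictT _ mQ); apply: measurable_funTS.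
  by apply/measurable_EFinP; exact: continuous3_measurable.
have Efin : (\int[leb3]_x F x)%E \is a fin_num.
  by rewrite -integral_mkcond; exact: (bounded_integral_fin_num mQ (@cube_bounded a l)).
pose E := fine (\int[leb3]_x F x)%E.
have EE : (\int[leb3]_x F x = E%:E)%E by rewrite fineK.
have -> : (\int[leb3]_(x in cube a l) (norm3 (df x) ^+ 2)%:E = E%:E)%E.
  by rewrite integral_mkcond.
have E0 : 0 <= E by rewrite -lee_fin -EE; exact: integral_ge0.
pose H (z : R) := (\int[leb2]_y F (y, z))%E.
have mH : measurable_fun [set: M1] H.
  exact: (@measurable_fun_fubini_tonelli_G _ _ _ _ R leb2 F mF F0).
have H0 z : (0 <= H z)%E by exact: integral_ge0.
have [t3 t3a Ht3] : exists2 t, a.2 <= t <= a.2 + l & (H t <= ((E + eta) / l)%:E)%E.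
  apply: exists_le_average => //; rewrite -EE (leb3_tonelli' mF F0).
  exact: ge0_subset_integral.
have mF3 : measurable_fun setT (fun y : M1 * M1 => F (y, t3)) by exact: measurable_fun_pair1.
pose H2 (y : R) := (\int[leb1]_x F (x, y, t3))%E.
have mH2 : measurable_fun [set: M1] H2.
  exact: (@measurable_fun_fubini_tonelli_G _ _ _ _ R (@lebesgue_measure R) (fun y => F (y, t3)) mF3).
have H20 z : (0 <= H2 z)%E by exact: integral_ge0.
have [t2 t2a Ht2] : exists2 t, a.1.2 <= t <= a.1.2 + l &
    (H2 t <= (((E + eta) / l + eta / l) / l)%:E)%E.
  apply: exists_le_average => //; first by rewrite divr_gt0.
  apply: le_trans Ht3; rewrite /H.
  rewrite [leRHS](_ : _ = \int[leb1]_y H2 y)%E; first exact: ge0_subset_integral.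
  exact: (@fubini_tonelli2 _ _ _ _ R (@lebesgue_measure R) (@lebesgue_measure R) (fun y => F (y, t3)) mF3).
pose E2 := ((E + eta) / l + eta / l) / l.
have E20 : 0 <= E2.
  by rewrite /E2 !(divr_ge0, addr_ge0)// ltW.
(* The line through [t2] and [t3] carries energy at most [E2], so any of its points in the cube
   would do; the one on a face is taken. *)
exists (f (a.1.1, t2, t3)); set c := f _.
pose G3 (y : M1 * M1) := (\int[leb1]_s F (y, s))%E.
pose G2 (x : M1) := (\int[leb1]_s F (x, s, t3))%E.
have mG3 : measurable_fun setT G3.
  exact: (@measurable_fun_fubini_tonelli_F _ _ _ _ R (@lebesgue_measure R) F mF F0).
have mG2 : measurable_fun setT G2.
  exact: (@measurable_fun_fubini_tonelli_F _ _ _ _ R (@lebesgue_measure R) (fun y => F (y, t3)) mF3).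
pose J (u : R) : set M1 := `[u, u + l]%classic.
have mJ u : measurable (J u) by exact: measurable_itv.
pose i (u t : R) : \bar R := (\1_(J u) t)%:E.
have mi u : measurable_fun [set: M1] (i u).
  by apply/measurable_EFinP; exact: measurable_indic.
have i0 u t : (0 <= i u t)%E by rewrite lee_fin indicE ler0n.
have ii u : (\int[leb1]_t i u t = l%:E)%E.
  by rewrite integral_indic// setIT leb1_cc ?lerDl ?ltW//; congr (_%:E); ring.
pose k : \bar R := (3 * l)%:E.
have k0 : (0 <= k)%E by rewrite lee_fin mulr_ge0// ltW.
(* The path from [x] to the base point has three axis-parallel segments: vertical down to height
   [t3], then to [t2] inside that plane, then along the selected line. [T1], [T2], [T3] bound their
   contributions to [(f x - c) ^+ 2]; the 3 in [k] is that of the square of a sum of three terms. *)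
pose T1 (x : mE3 R) := (k * (i a.2 x.2 * G3 x.1))%E.
pose T2 (x : mE3 R) := (k * (i a.1.2 x.1.2 * (i a.2 x.2 * G2 x.1.1)))%E.
pose T3 (x : mE3 R) := (k * (E2%:E * (\1_(cube a l) x)%:E))%E.
have G30 y : (0 <= G3 y)%E by exact: integral_ge0.
have G20 y : (0 <= G2 y)%E by exact: integral_ge0.
have T10 x : (0 <= T1 x)%E by rewrite !mule_ge0.
have T20 x : (0 <= T2 x)%E by rewrite !mule_ge0.
have T30 x : (0 <= T3 x)%E by rewrite !mule_ge0// lee_fin indicE ler0n.
have mT1 : measurable_fun setT T1.
  apply: measurable_funeM; apply: emeasurable_funM.
    exact: (measurableT_comp (mi _) measurable_snd).
  exact: (measurableT_comp mG3 measurable_fst).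
have mT2 : measurable_fun setT T2.
  apply: measurable_funeM; apply: emeasurable_funM.
    exact: (measurableT_comp (mi _) (@measurable_mE312 R)).
  apply: emeasurable_funM.
    exact: (measurableT_comp (mi _) measurable_snd).
  exact: (measurableT_comp mG2 (@measurable_mE311 R)).
have mT3 : measurable_fun setT T3.
  apply: measurable_funeM; apply: measurable_funeM.
  by apply/measurable_EFinP; exact: measurable_indic.
have I1 : (\int[leb3]_x T1 x = k * (l * E)%:E)%E.
  rewrite (leb3_tonelli' mT1 T10).
  under eq_integral => z _.
    rewrite /T1/= ge0_integralTZl//; last 2 first.
    - by apply: measurable_funeM.
    - by move=> y; rewrite mule_ge0.
    rewrite ge0_integralTZl//.
    over.
  rewrite ge0_integralTZl//; last 2 first.
  - by apply: emeasurable_funM => //; exact: measurable_cst.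
  - by move=> z; rewrite mule_ge0// integral_ge0.
  congr (_ * _)%E; rewrite ge0_integralTZr//; last exact: integral_ge0.
  by rewrite ii EFinM -EE (leb3_tonelli mF F0).
have I2 : (\int[leb3]_x T2 x <= k * (l ^+ 2 * ((E + eta) / l))%:E)%E.
  rewrite (leb3_tonelli3 mT2 T20).
  under eq_integral => x _.
    under eq_integral => y _.
      rewrite /T2/= ge0_integralTZl//; last 2 first.
      - by apply: measurable_funeM => //; apply: emeasurable_funM => //; exact: measurable_cst.
      - by move=> z; rewrite !mule_ge0.
      rewrite ge0_integralTZl//; last 2 first.
      - by apply: emeasurable_funM => //; exact: measurable_cst.
      - by move=> z; rewrite !mule_ge0.
      rewrite ge0_integralTZr// ii.
      over.
    rewrite ge0_integralTZl//; last 2 first.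
    - by apply: emeasurable_funM => //; exact: measurable_cst.
    - by move=> z; rewrite !mule_ge0// lee_fin ltW.
    rewrite ge0_integralTZr//; last by rewrite mule_ge0// lee_fin ltW.
    rewrite ii.
    over.
  rewrite ge0_integralTZl//; last 2 first.
  - by do 2 apply: measurable_funeM.
  - by move=> z; rewrite !mule_ge0// lee_fin ltW.
  apply: lee_wpmul2l => //.
  rewrite ge0_integralTZl//; last 3 first.
  - by apply: measurable_funeM.
  - by move=> z; rewrite !mule_ge0// lee_fin ltW.
  - by rewrite lee_fin ltW.
  rewrite ge0_integralTZl//; last by rewrite lee_fin ltW.
  rewrite muleA -EFinM -expr2 [leRHS]EFinM; apply: lee_wpmul2l; first by rewrite lee_fin sqr_ge0.
  apply: le_trans Ht3; rewrite le_eqVlt; apply/orP; left; apply/eqP.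
  by apply/esym; exact: (@fubini_tonelli1 _ _ _ _ R (@lebesgue_measure R) (@lebesgue_measure R) (fun y => F (y, t3)) mF3).
have I3 : (\int[leb3]_x T3 x = k * (E2 * l ^+ 3)%:E)%E.
  rewrite ge0_integralTZl//; last 2 first.
  - by apply: measurable_funeM; apply/measurable_EFinP; exact: measurable_indic.
  - by move=> z; rewrite !mule_ge0// lee_fin indicE ler0n.
  rewrite ge0_integralTZl.
  - by rewrite integral_indic// setIT leb3_cube ?ltW// -EFinM.
  - by apply/measurable_EFinP; exact: measurable_indic.
  - by move=> z; rewrite lee_fin indicE ler0n.
  - by rewrite lee_fin.
apply: (@le_trans _ _ (\int[leb3]_x (T1 x + (T2 x + T3 x)))%E); last first.
  rewrite ge0_integralD//; last 2 first.
  - by move=> x _; rewrite adde_ge0.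
  - exact: emeasurable_funD.
  rewrite ge0_integralD// I1 I3; apply: (le_trans (leeD2l _ (leeD2r _ I2))).
  (* The three contributions are [l * E], [l * (E + eta)] and [l * (E + 2 * eta)], times [3 * l]:
     their sum is exactly [9 * l ^+ 2 * (E + eta)]. *)
  rewrite -!EFinM -!EFinD lee_fin le_eqVlt; apply/orP; left; apply/eqP.
  by rewrite /E2; field; rewrite gt_eqF.
rewrite integral_mkcond; apply: ge0_le_integral => //.
- by move=> x _; apply: erestrict_ge0 => z _; rewrite lee_fin sqr_ge0.
- apply/(measurable_restrictT _ mQ); apply: measurable_sqr3 => x.
  by apply: cvgB; [exact: cf|exact: cvg_cst].
- by apply: emeasurable_funD => //; exact: emeasurable_funD.
move=> x _; rewrite patchE; case: ifPn; last by rewrite !adde_ge0.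
rewrite inE => Qx; have /cubeE[x1 x2 x3] := Qx.
have line (b : R -> E3 R) e s0 s1 u : dot3 e e = 1 ->
    (forall s, b s = b 0 + s *: e) -> u <= s0 <= u + l -> u <= s1 <= u + l ->
    (forall s, u <= s <= u + l -> cube a l (b s)) ->
    (((f (b s1) - f (b s0)) ^+ 2)%:E <= l%:E * \int[leb1]_s F (b s))%E.
  move=> e1 bE s0u s1u bQ.
  have bd s : is_derive s (1 : R) (fun s => f (b s)) (dot3 (df (b s)) e).
    have [_ _ Hc] := Cf; apply: (Hc b); rewrite (funext bE).
    exact: is_derive_line.
  have cb : continuous b.
    move=> s; rewrite (funext bE); apply: cvgD; first exact: cvg_cst.
    exact: cvgZr_tmp.
  have cdb : continuous (fun s => dot3 (df (b s)) e).
    apply: continuous_fun_dot3 => s; last exact: cvg_cst.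
    exact: (@continuous_comp _ _ _ b df _ (cb s) (cdf _)).
  have := increment_sqr_le bd cdb s0u s1u => /le_trans; apply.
  rewrite [u + l]addrC addrK; apply: lee_wpmul2l; first by rewrite lee_fin ltW.
  rewrite integral_mkcond; apply: ge0_le_integral => //.
  - by move=> s _; apply: erestrict_ge0 => z _; rewrite lee_fin sqr_ge0.
  - apply/(measurable_restrictT _ (measurable_itv _)).
    by apply/measurable_EFinP; apply: measurable_funX; exact: continuous_measurable1.
  - apply: measurableT_comp => //; apply: measurable_mE3.
    + by apply: continuous_measurable1 => // s; exact: (@continuous_comp _ _ _ b (fun x => x.1.1) _ (cb s) (@continuous_E3_11 R _)).
    + by apply: continuous_measurable1 => // s; exact: (@continuous_comp _ _ _ b (fun x => x.1.2) _ (cb s) (@continuous_E3_12 R _)).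
    + by apply: continuous_measurable1 => // s; exact: (@continuous_comp _ _ _ b (fun x => x.2) _ (cb s) (@continuous_E3_2 R _)).
  - move=> s _; rewrite patchE; case: ifPn => // su; rewrite /F patchE mem_set.
      rewrite lee_fin; apply: le_trans (dot3_CS_sqr _ _) _.
      by rewrite e1 mulr1 -norm3_sqr.
    by apply: bQ; move: su; rewrite inE/= in_itv/= [l + u]addrC.
have xE : x = (x.1.1, x.1.2, x.2) by case: (x) => [[]].
have h1 : (((f x - f (x.1.1, x.1.2, t3)) ^+ 2)%:E <= l%:E * G3 x.1)%E.
  have := line (fun s => (x.1.1, x.1.2, s)) (0, 0, 1) t3 x.2 a.2.
  rewrite -xE (_ : G3 x.1 = \int[leb1]_s F (x.1.1, x.1.2, s))%E; last by case: (x) => [[]].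
  apply => //; first by rewrite /dot3/=; ring.
  by move=> s; apply: E3_eq; rewrite /= ?scaleRE; ring.
have h2 : (((f (x.1.1, x.1.2, t3) - f (x.1.1, t2, t3)) ^+ 2)%:E <= l%:E * G2 x.1.1)%E.
  apply: (line (fun s => (x.1.1, s, t3)) (0, 1, 0) t2 x.1.2 a.1.2) => //.
  - by rewrite /dot3/=; ring.
  - by move=> s; apply: E3_eq; rewrite /= ?scaleRE; ring.
have h3 : (((f (x.1.1, t2, t3) - c) ^+ 2)%:E <= l%:E * E2%:E)%E.
  apply: (@le_trans _ _ (l%:E * H2 t2)%E).
    apply: (line (fun s => (s, t2, t3)) (1, 0, 0) a.1.1 x.1.1 a.1.1) => //.
    - by rewrite /dot3/=; ring.
    - by move=> s; apply: E3_eq; rewrite /= ?scaleRE; ring.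
    - by rewrite lexx lerDl ltW.
    by apply: lee_wpmul2l => //; rewrite lee_fin ltW.
have iE u t : u <= t <= u + l -> i u t = 1%E.
  by move=> ut; rewrite /i indicE mem_set//= in_itv.
rewrite /T1 /T2 /T3 !iE// !mul1e indicE mem_set// mule1 /k.
move: (G30 x.1) (G20 x.1.1) h1 h2; move: (G3 x.1) (G2 x.1.1) => g3 g2 g30 g20 h1 h2.
have l0' : (0 <= l%:E)%E by rewrite lee_fin ltW.
have E20' : (0 <= E2%:E)%E by rewrite lee_fin.
move: (E2) E20' h3 => E2' E20' h3.
rewrite (_ : (_ + _)%E = 3%:E * (l%:E * g3 + (l%:E * g2 + l%:E * E2'%:E)))%E; last first.
  rewrite ge0_muleDr ?adde_ge0 ?mule_ge0// ge0_muleDr ?mule_ge0//.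
  by rewrite !muleA -!EFinM.
have h123 := leeD h1 (leeD h2 h3).
apply: (le_trans _ (lee_wpmul2l _ h123)); last by rewrite lee_fin.
rewrite -!EFinD -EFinM lee_fin.
move: (f x) (f (x.1.1, x.1.2, t3)) (f (x.1.1, t2, t3)) => u v w.
have : 0 <= (u - v - (v - w)) ^+ 2 + (v - w - (w - c)) ^+ 2 + (u - v - (w - c)) ^+ 2.
  by rewrite !addr_ge0 ?sqr_ge0.
move=> h; rewrite -subr_ge0; apply: (le_trans h); rewrite le_eqVlt; apply/orP; left.
by apply/eqP; ring.
Qed.

End mean_value_cube.

Lemma near_open (T : topologicalType) (x0 : T) (P : set T) :
  (\forall x \near x0, P x) -> exists2 U, open U /\ U x0 & forall z, U z -> P z.
Proof.
rewrite -nbhs_nearE nbhsE => -[U oU UP].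
by exists U => //; case: oU.
Qed.

(** * Poincare inequality on the domain by propagation of control *)

Section poincare.
Context {R : realType}.
Local Notation M1 := (measurableTypeR R).
Variable Omega : set (E3 R).
Hypotheses (oOmega : open Omega) (cOmega : connected Omega).
Hypothesis bOmega : bounded_set Omega.
Implicit Types (f : E3 R -> R) (df : E3 R -> E3 R) (A B D : set (mE3 R)).

Let mOmega : measurable (Omega : set (mE3 R)) := open3_measurable oOmega.

Definition energy df := (\int[leb3]_(x in Omega) (norm3 (df x) ^+ 2)%:E)%E.

Lemma energy_ge0 df : (0 <= energy df)%E.
Proof. by apply: integral_ge0 => x _; rewrite lee_fin sqr_ge0. Qed.

(** Poincare's inequality is propagated from a small cube to the domain by this relation: it is
    transitive, stable under finite unions on the right, and always measures the gradient on all of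
    [Omega]. *)
Definition controls A B := exists2 C : R, 0 <= C & forall f df, C1grad f df ->
  (\int[leb3]_(x in B) (f x ^+ 2)%:E <=
   C%:E * (\int[leb3]_(x in A) (f x ^+ 2)%:E + energy df))%E.

Let I0 A f : (0 <= \int[leb3]_(x in A) (f x ^+ 2)%:E)%E.
Proof. by apply: integral_ge0 => x _; rewrite lee_fin sqr_ge0. Qed.

Lemma controls_trans A B D : controls A B -> controls B D -> controls A D.
Proof.
move=> [C1 C10 H1] [C2 C20 H2]; exists (C2 * (C1 + 1)).
  by rewrite mulr_ge0// addr_ge0.
move=> f df Cf; apply: (le_trans (H2 _ _ Cf)).
rewrite EFinM -muleA; apply: lee_wpmul2l; first by rewrite lee_fin.
rewrite EFinD ge0_muleDl ?lee_fin// mul1e; apply: leeD; first exact: H1.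
by rewrite leeDr.
Qed.

Lemma controls_sub A B : measurable A -> measurable B -> A `<=` B -> controls B A.
Proof.
move=> mA mB AB; exists 1 => // f df [cf _ _].
rewrite mul1e; apply: le_trans (leeDl _ (energy_ge0 _)).
apply: ge0_subset_integral => //; first exact: measurable_sqr3.
by move=> x _; rewrite lee_fin sqr_ge0.
Qed.

Lemma controlsU A B D : measurable B -> measurable D ->
  controls A B -> controls A D -> controls A (B `|` D).
Proof.
move=> mB mD [C1 C10 H1] [C2 C20 H2]; exists (C1 + C2); first by rewrite addr_ge0.
move=> f df Cf; have [cf _ _] := Cf.
apply: le_trans (ge0_integral_setU_le _ mB mD (measurable_sqr3 (D := setT) cf) _) _.
  by move=> x; rewrite lee_fin sqr_ge0.
by rewrite EFinD ge0_muleDl ?lee_fin//; apply: leeD; [exact: H1|exact: H2].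
Qed.

Lemma controls_set0 A : controls A set0.
Proof. by exists 0 => // f df _; rewrite integral_set0 mul0e. Qed.

(** Part of a slab, of positive thickness, controls the whole slab; this reaches down to the
    boundary without any extension operator. *)
Lemma slab_controls e1 e2 e3 psi (B : set (M1 * M1)) (a b c d : R) :
  orthonormal3 e1 e2 e3 -> C11 psi -> measurable B -> a <= c -> c < d -> d <= b ->
  slab e1 e2 e3 psi B a b `<=` Omega ->
  controls (slab e1 e2 e3 psi B c d) (slab e1 e2 e3 psi B a b).
Proof.
move=> onb C mB ac cd db sO.
have ab : 0 <= b - a by rewrite subr_ge0; lra.
have dc : 0 <= 2 / (d - c) by rewrite divr_ge0// subr_ge0 ltW.
exists ((b - a) * (2 / (d - c) + 2 * (b - a))).
  by rewrite mulr_ge0// addr_ge0// mulr_ge0.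
move=> f df Cf; have [_ cdf _] := Cf.
apply: (le_trans (slab_sqr_le onb C mB Cf ac cd db)).
rewrite [in leRHS]EFinM -muleA; apply: lee_wpmul2l; first by rewrite lee_fin.
have E1 : (0 <= (2 / (d - c))%:E)%E by rewrite lee_fin.
have E2 : (0 <= (2 * (b - a))%:E)%E by rewrite lee_fin mulr_ge0.
rewrite [in leRHS]EFinD [leRHS](ge0_muleDl _ E1 E2).
apply: leeD; apply: lee_pmul => //.
- by rewrite leeDl// energy_ge0.
- apply: le_trans (leeDr _ (I0 _ _)); apply: ge0_subset_integral => //.
  + exact: measurable_slab.
  + exact: measurable_sqrnorm3.
  + by move=> x _; rewrite lee_fin sqr_ge0.
Qed.

Definition box (a b : E3 R) : set (mE3 R) :=
  `]a.1.1, b.1.1]%classic `*` `]a.1.2, b.1.2]%classic `*` `]a.2, b.2]%classic.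

Lemma boxE a b x : box a b x <->
  [/\ a.1.1 < x.1.1 <= b.1.1, a.1.2 < x.1.2 <= b.1.2 & a.2 < x.2 <= b.2].
Proof. by rewrite /box /setX /= !in_itv/=; split => [[[]]|[]]. Qed.

Lemma measurable_box a b : measurable (box a b).
Proof. by apply: measurableX; first exact: measurableX. Qed.

(** The small box is enlarged in one direction at a time; in each direction a box is a slab over a
    flat graph, for a cyclically permuted standard frame. *)
Lemma box_controls (a b a' b' : E3 R) :
  [/\ a'.1.1 <= a.1.1, a.1.1 < b.1.1 & b.1.1 <= b'.1.1] ->
  [/\ a'.1.2 <= a.1.2, a.1.2 < b.1.2 & b.1.2 <= b'.1.2] ->
  [/\ a'.2 <= a.2, a.2 < b.2 & b.2 <= b'.2] ->
  box a' b' `<=` Omega -> controls (box a b) (box a' b').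
Proof.
move=> [h1 h2 h3] [h4 h5 h6] [h7 h8 h9] sO.
pose s1 : E3 R := (1, 0, 0); pose s2 : E3 R := (0, 1, 0); pose s3 : E3 R := (0, 0, 1).
have on123 : orthonormal3 s1 s2 s3 by exact: orthonormal3_std.
have on231 : orthonormal3 s2 s3 s1.
  by rewrite /s1 /s2 /s3; split; split; rewrite /dot3/=; ring.
have on312 : orthonormal3 s3 s1 s2.
  by rewrite /s1 /s2 /s3; split; split; rewrite /dot3/=; ring.
have d1 x : dot3 x s1 = x.1.1 by rewrite /dot3/=; ring.
have d2 x : dot3 x s2 = x.1.2 by rewrite /dot3/=; ring.
have d3 x : dot3 x s3 = x.2 by rewrite /dot3/=; ring.
have bE1 (u v : E3 R) : box u v = slab s2 s3 s1 (cst 0)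
    (`]u.1.2, v.1.2]%classic `*` `]u.2, v.2]%classic) u.1.1 v.1.1.
  apply/seteqP; split => x; rewrite /slab /mkset /graph_cocoord /coframe /setX /= !d1 !d2 !d3 subr0 !in_itv/= => H.
    by have /boxE[] := H.
  by case: H => -[? ?] ?; apply/boxE.
have bE2 (u v : E3 R) : box u v = slab s3 s1 s2 (cst 0)
    (`]u.2, v.2]%classic `*` `]u.1.1, v.1.1]%classic) u.1.2 v.1.2.
  apply/seteqP; split => x; rewrite /slab /mkset /graph_cocoord /coframe /setX /= !d1 !d2 !d3 subr0 !in_itv/= => H.
    by have /boxE[] := H.
  by case: H => -[? ?] ?; apply/boxE.
have bE3 (u v : E3 R) : box u v = slab s1 s2 s3 (cst 0)
    (`]u.1.1, v.1.1]%classic `*` `]u.1.2, v.1.2]%classic) u.2 v.2.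
  apply/seteqP; split => x; rewrite /slab /mkset /graph_cocoord /coframe /setX /= !d1 !d2 !d3 subr0 !in_itv/= => H.
    by have /boxE[] := H.
  by case: H => -[? ?] ?; apply/boxE.
have c0 := @C11_cst R 0.
have sub (u v : E3 R) : a'.1.1 <= u.1.1 -> v.1.1 <= b'.1.1 -> a'.1.2 <= u.1.2 ->
    v.1.2 <= b'.1.2 -> a'.2 <= u.2 -> v.2 <= b'.2 -> box u v `<=` Omega.
  move=> k1 k2 k3 k4 k5 k6 x /boxE[/andP[w1 w2] /andP[w3 w4] /andP[w5 w6]].
  apply: sO; apply/boxE; rewrite (le_lt_trans k1 w1) (le_trans w2 k2).
  by rewrite (le_lt_trans k3 w3) (le_trans w4 k4) (le_lt_trans k5 w5) (le_trans w6 k6).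
apply: (@controls_trans _ (box (a'.1.1, a.1.2, a.2) (b'.1.1, b.1.2, b.2))).
  rewrite !bE1; apply: slab_controls => //; first exact: measurableX.
  by rewrite -(bE1 (a'.1.1, a.1.2, a.2) (b'.1.1, b.1.2, b.2)); apply: sub => //=; lra.
apply: (@controls_trans _ (box (a'.1.1, a'.1.2, a.2) (b'.1.1, b'.1.2, b.2))).
  rewrite !bE2; apply: slab_controls => //; first exact: measurableX.
  by rewrite -(bE2 (a'.1.1, a'.1.2, a.2) (b'.1.1, b'.1.2, b.2)); apply: sub => //=; lra.
rewrite !bE3; apply: slab_controls => //; first exact: measurableX.
by rewrite -(bE3 a' b').
Qed.

Let vec (t : R) : E3 R := (t, t, t).

Lemma ball_boxP (x : E3 R) (e : R) z : ball x e z <->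
  [/\ `|x.1.1 - z.1.1| < e, `|x.1.2 - z.1.2| < e & `|x.2 - z.2| < e].
Proof. by split => [[[]]|[? ? ?]]; [split|split; [split|]]. Qed.

Lemma box_sub_ball (x : E3 R) (e : R) : 0 < e -> box (x - vec (e / 2)) (x + vec (e / 2)) `<=` ball x e.
Proof.
move=> e0 z /boxE[] /=.
move=> /andP[h1 h1'] /andP[h2 h2'] /andP[h3 h3']; apply/ball_boxP.
by split; [exact: (box_window e0 h1 h1')|exact: (box_window e0 h2 h2')|exact: (box_window e0 h3 h3')].
Qed.

Lemma ball_sub_box (x : E3 R) (e : R) : ball x e `<=` box (x - vec e) (x + vec e).
Proof.
move=> z /ball_boxP[]; rewrite !ltr_norml => /andP[h1 h1'] /andP[h2 h2'] /andP[h3 h3'].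
by apply/boxE; split; [exact: (window_box h1 h1')|exact: (window_box h2 h2')|exact: (window_box h3 h3')].
Qed.

Lemma open_ball_E3 (x : E3 R) (e : R) : open (ball x e).
Proof. exact: ball_open. Qed.

(** The points having a neighbourhood controlled by the initial box form a nonempty set that is open
    and relatively closed in [Omega]; connectedness concludes. *)
Lemma interior_controls (x0 : E3 R) (e0 : R) : 0 < e0 -> ball x0 e0 `<=` Omega ->
  forall x, Omega x -> exists2 U : set (E3 R), open U /\ U x &
    controls (box (x0 - vec (e0 / 2)) (x0 + vec (e0 / 2))) U.
Proof.
move=> e00 He0; set A := box _ _.
have mA : measurable A by exact: measurable_box.
pose good := [set x : E3 R | exists2 U : set (E3 R), open U /\ U x & controls A U].
suff <- : Omega `&` good = Omega by move=> x [].
have Ox0 : Omega x0 by apply: He0; exact: ballxx.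
apply: cOmega.
- exists x0; split => //; exists (ball x0 (e0 / 2)).
    by split; [exact: open_ball_E3|apply: ballxx; rewrite divr_gt0].
  apply: controls_sub => //; last exact: ball_sub_box.
  by apply: open3_measurable; exact: open_ball_E3.
- exists good => //; rewrite openE => x [U [oU Ux] cU].
  rewrite /interior; apply: filterS (open_nbhs_nbhs (conj oU Ux)) => z Uz.
  by exists U.
exists (closure (Omega `&` good)); first exact: closed_closure.
apply/seteqP; split => [x gx|x [Ox cx]].
  by split; [case: gx|exact: subset_closure].
split => //; have /nbhs_ballP[e /= e_0 He] := open_nbhs_nbhs (conj oOmega Ox).
have e20 : 0 < e / 2 by rewrite divr_gt0.
(* Relative closedness: near a limit point [x] there is a good point [s]; a small box around [s]
   inside its controlled neighbourhood is enlarged to a box around [x] inside [Omega]. *)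
have [s [[Os [U [oU Us] cU]] bs]] := cx _ (nbhsx_ballx x _ e20).
have oV : open (U `&` ball x (e / 2)) by apply: openI => //; exact: open_ball_E3.
have /nbhs_ballP[d /= d0 Hd] := open_nbhs_nbhs (conj oV (conj Us bs)).
have d2 : 0 < d / 2 by rewrite divr_gt0.
exists (ball x (e / 2)); first by split; [exact: open_ball_E3|exact: ballxx].
have sd (t : R) : `|t| < d -> ball x (e / 2) (s + vec t).
  move=> td; have [] := Hd (s + vec t) _ => //; apply/ball_boxP.
  by split; rewrite /= opprD addrA subrr sub0r normrN.
have td1 : `|d / 2| < d by rewrite gtr0_norm//; lra.
have td2 : `|- (d / 2)| < d by rewrite normrN.
have /ball_boxP[/=] := sd _ td1.
rewrite !ltr_norml => /andP[p1 _] /andP[p2 _] /andP[p3 _].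
have /ball_boxP[/=] := sd _ td2.
rewrite !ltr_norml => /andP[_ q1] /andP[_ q2] /andP[_ q3].
apply: (controls_trans cU).
apply: (@controls_trans _ (box (s - vec (d / 2)) (s + vec (d / 2)))).
  apply: controls_sub; [exact: measurable_box|exact: open3_measurable|].
  by move=> z /(box_sub_ball d0) /Hd[].
apply: (@controls_trans _ (box (x - vec (e / 2)) (x + vec (e / 2)))).
  apply: box_controls => /=.
  - exact: (nested_window p1 q1 d2).
  - exact: (nested_window p2 q2 d2).
  - exact: (nested_window p3 q3 d2).
  - by move=> z /(box_sub_ball e_0) /He.
apply: controls_sub; last exact: ball_sub_box.
  by apply: open3_measurable; exact: open_ball_E3.
exact: measurable_box.
Qed.

Definition cc_rect (b : R * R) (rho : R) : set (M1 * M1) :=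
  `[b.1 - rho, b.1 + rho]%classic `*` `[b.2 - rho, b.2 + rho]%classic.

Lemma cc_rectE b rho y : cc_rect b rho y <-> `|y.1 - b.1| <= rho /\ `|y.2 - b.2| <= rho.
Proof.
rewrite /cc_rect /setX /= !in_itv/= !ler_distlC.
by split => -[/andP[? ?] /andP[? ?]]; split; apply/andP; split; lra.
Qed.

(** The heights from [rho / 2] to [rho] form a compact subset of [Omega], covered by finitely many
    controlled neighbourhoods. *)
Lemma slab_controlled A e1 e2 e3 psi b (rho : R) : 0 < rho ->
  orthonormal3 e1 e2 e3 -> C11 psi ->
  (forall x, Omega x -> exists2 U : set (E3 R), open U /\ U x & controls A U) ->
  (forall y, `|y.1.1 - b.1| < rho -> `|y.1.2 - b.2| < rho -> 0 < y.2 < 2 * rho ->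
    Omega (graph_coord e1 e2 e3 psi y)) ->
  controls A (slab e1 e2 e3 psi (cc_rect b (rho / 2)) (rho / 2) rho).
Proof.
move=> rho0 onb C Hint HO; have rho2 : 0 < rho / 2 by rewrite divr_gt0.
have mB : measurable (cc_rect b (rho / 2)) by exact: measurableX.
pose L : set (E3 R) := cc_rect b (rho / 2) `*` `[rho / 2, rho]%classic.
have cL : compact L.
  by apply: compact_setX; [apply: compact_setX|]; exact: segment_compact.
pose K := graph_coord e1 e2 e3 psi @` L.
have cK : compact K.
  apply: continuous_compact => //; apply: continuous_subspaceT.
  exact: (continuous_graph_coord (C11_continuous C)).
have KO : K `<=` Omega.
  move=> _ [[y t] [/cc_rectE[h1 h2] h3] <-]; move: h3; rewrite /= in_itv/= => /andP[h3 h4].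
  apply: HO => /=; last by apply/andP; split; lra.
    by apply: le_lt_trans h1 _; lra.
  by apply: le_lt_trans h2 _; lra.
have [||x /KO Ox|U KU [mU cU]] := @compact_union_cover _ K
    [set U : set (E3 R) | measurable (U : set (mE3 R)) /\ controls A U] cK.
- by split => //; exact: controls_set0.
- by move=> U V [mU cU] [mV cV]; split; [exact: measurableU|exact: controlsU].
- have [U [oU Ux] cU] := Hint x Ox; exists U => //; split => //.
  exact: open3_measurable.
apply: (controls_trans cU); apply: controls_sub => //; first exact: measurable_slab.
apply: subset_trans KU => x [h1 /andP[h2 h3]].
exists (graph_cocoord e1 e2 e3 psi x); last exact: graph_cocoordK.
by split => //; rewrite /= in_itv/= h3 (ltW h2).
Qed.

Hypothesis charts : forall x0, bdry Omega x0 -> exists r e1 e2 e3 psi,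
  graph_chart Omega x0 r e1 e2 e3 psi.

Lemma slab_rho_sub e1 e2 e3 psi b (rho : R) : 0 < rho -> orthonormal3 e1 e2 e3 ->
  (forall y, `|y.1.1 - b.1| < rho -> `|y.1.2 - b.2| < rho -> 0 < y.2 < 2 * rho ->
    Omega (graph_coord e1 e2 e3 psi y)) ->
  slab e1 e2 e3 psi (cc_rect b (rho / 2)) 0 rho `<=` Omega.
Proof.
move=> rho0 onb HO x [/cc_rectE[h1 h2] /andP[h3 h4]].
rewrite -(graph_cocoordK psi onb x); apply: HO; last by apply/andP; split; lra.
- by apply: le_lt_trans h1 _; lra.
- by apply: le_lt_trans h2 _; lra.
Qed.

(** Compactness of the closure: interior points have controlled neighbourhoods by assumption, and
    near a boundary point the upper half of a slab controls the slab down to height 0. *)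
Lemma domain_controlled A :
  (forall x, Omega x -> exists2 U : set (E3 R), open U /\ U x & controls A U) ->
  controls A Omega.
Proof.
move=> Hint; have [||x cx|U OU [mU cU]] := @compact_union_cover _ (closure Omega)
    [set U : set (E3 R) | measurable (U `&` Omega : set (mE3 R)) /\ controls A (U `&` Omega)]
    (bounded_closure_compact bOmega).
- by rewrite /= set0I; split => //; exact: controls_set0.
- move=> U V [mU cU] [mV cV]; rewrite /= setIUl; split; first exact: measurableU.
  exact: controlsU.
- have [Ox|nOx] := pselect (Omega x).
    have [U [oU Ux] cU] := Hint x Ox; exists U => //.
    have mU : measurable (U `&` Omega : set (mE3 R)).
      by apply: open3_measurable; exact: openI.
    split => //; apply: (controls_trans cU); apply: controls_sub => //.
    exact: open3_measurable.
  have bx : bdry Omega x by apply/bdryE.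
  have [r [e1 [e2 [e3 [psi ch]]]]] := charts bx.
  have [rho [[rho0 onb C HO near_x] _]] := bdry_patch oOmega ch bx.
  have [U [oU Ux] sU] := near_open near_x.
  exists U => //.
  have mU : measurable (U `&` Omega : set (mE3 R)).
    by apply: open3_measurable; exact: openI.
  have mB : measurable (cc_rect (coframe e1 e2 e3 x).1 (rho / 2)) by exact: measurableX.
  split => //; apply: (controls_trans (slab_controlled rho0 onb C Hint HO)).
  apply: (@controls_trans _ (slab e1 e2 e3 psi (cc_rect (coframe e1 e2 e3 x).1 (rho / 2)) 0 rho)).
    apply: slab_controls => //; try lra.
    exact: slab_rho_sub.
  apply: controls_sub => //; first exact: measurable_slab.
  move=> z [Uz Oz]; have [h1 h2 /andP[h3 h4] h5] := sU z Uz (subset_closure Oz).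
  split; first by apply/cc_rectE; rewrite !ltW.
  by apply/andP; split; [exact: h5|lra].
apply: (controls_trans cU); apply: controls_sub => //.
by move=> x Ox; split => //; apply: OU; exact: subset_closure.
Qed.

End poincare.

Lemma window_lt (K : realFieldType) (u z e : K) :
  0 < e -> u - e / 2 <= z -> z <= u - e / 2 + e -> `|u - z| < e.
Proof. by move=> e0 h1 h2; rewrite ltr_norml; apply/andP; split; lra. Qed.

Lemma window_le (K : realFieldType) (u z e : K) :
  u - e / 2 < z -> z <= u + e / 2 -> u - e / 2 <= z <= u - e / 2 + e.
Proof. by move=> h1 h2; apply/andP; split; lra. Qed.

(** * Surface measure and trace inequality on the boundary *)

Section surface.
Context {R : realType}.
Local Notation M1 := (measurableTypeR R).
Variables (Omega : set (E3 R)) (sigma : {measure set (mE3 R) -> \bar R}).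
Hypotheses (oOmega : open Omega) (cOmega : connected Omega).
Hypotheses (bOmega : bounded_set Omega) (nOmega : Omega !=set0).
Hypothesis charts : forall x0, bdry Omega x0 -> exists r e1 e2 e3 psi,
  graph_chart Omega x0 r e1 e2 e3 psi.
Hypothesis surf : surface_measure Omega sigma.
Implicit Types (f : E3 R -> R) (df : E3 R -> E3 R) (F : mE3 R -> \bar R).

Lemma closed3_measurable (A : set (E3 R)) : closed A -> measurable (A : set (mE3 R)).
Proof.
move=> cA; rewrite -[X in measurable X](setCK (A : set (mE3 R))).
by apply: measurableC; apply: open3_measurable; exact: closed_openC.
Qed.

Lemma measurable_bdry : measurable (bdry Omega : set (mE3 R)).
Proof.
apply: measurableD; first by apply: closed3_measurable; exact: closed_closure.
by apply: open3_measurable; exact: open_interior.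
Qed.

Lemma compact_bdry : compact (bdry Omega).
Proof.
apply: (@subclosed_compact _ _ (closure Omega)).
- by apply: closedI; [exact: closed_closure|apply: open_closedC; exact: open_interior].
- exact: bounded_closure_compact.
- by move=> x [].
Qed.

Lemma cc_rect_measurable b (rho : R) : measurable (cc_rect b rho).
Proof. exact: measurableX. Qed.

Lemma measurable_area psi : C11 psi -> measurable_fun [set: M1 * M1]
  (fun y : M1 * M1 => Num.sqrt (1 + (grad2 psi y).1 ^+ 2 + (grad2 psi y).2 ^+ 2) : M1).
Proof.
move=> /C11_grad_continuous[c1 c2].
apply: (@continuous2_measurable _
  (fun y => Num.sqrt (1 + (grad2 psi y).1 ^+ 2 + (grad2 psi y).2 ^+ 2))) => y.
apply: (@continuous_comp _ _ _ (fun y => 1 + (grad2 psi y).1 ^+ 2 + (grad2 psi y).2 ^+ 2)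
  (@Num.sqrt R)); last exact: sqrt_continuous.
have sq (g : R * R -> R) : continuous g -> (g z ^+ 2) @[z --> y] --> g y ^+ 2.
  by move=> cg; rewrite expr2; under eq_fun do rewrite expr2; apply: cvgM; exact: cg.
by apply: cvgD; [apply: cvgD; [exact: cvg_cst|exact: sq]|exact: sq].
Qed.

Section chart_measure.
Variables (x0 : E3 R) (r : R) (e1 e2 e3 : E3 R) (psi : R * R -> R).
Hypothesis chart : graph_chart Omega x0 r e1 e2 e3 psi.
Hypothesis bx0 : bdry Omega x0.
Let gp (y : M1 * M1) : mE3 R := graph_coord e1 e2 e3 psi (y, 0).

Let gpE y : gp y = graph_point e1 e2 e3 psi y.
Proof. by rewrite /gp /graph_coord /graph_point /frame /= addr0. Qed.

Lemma measurable_graph_point0 : measurable_fun setT gp.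
Proof.
have [_ _ C _] := chart.
apply: (measurableT_comp (measurable_graph_coord e1 e2 e3 (continuous2_measurable (C11_continuous C)))).
by apply/measurable_fun_pairP; split; [exact: measurable_id|exact: measurable_cst].
Qed.

(** Lebesgue measure of the parameter plane carried to the graph; [sigma] differs from it by the
    area factor, which is at least 1 and locally bounded. *)
Let m := measure_function_pushforward__canonical__measure_function_Measure
  leb2 measurable_graph_point0.

Lemma chart_bdry_ball (y : M1 * M1) : ball3 x0 r (gp y) -> bdry Omega (gp y).
Proof. exact: chart_bdry_graph. Qed.

Lemma chart_coordK (x : E3 R) : ball3 x0 r x -> bdry Omega x ->
  gp (graph_cocoord e1 e2 e3 psi x).1 = x.
Proof.
move=> bx dx; have [_ onb _ _] := chart.
rewrite -[RHS](graph_cocoordK psi onb); congr (graph_coord _ _ _ _ _).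
by rewrite -(chart_bdry oOmega chart bx dx) -surjective_pairing.
Qed.

Lemma cocoord_gp y : (graph_cocoord e1 e2 e3 psi (gp y)).1 = y.
Proof. by have [_ onb _ _] := chart; rewrite /gp graph_coordK. Qed.

(** The area factor is at least 1. *)
Lemma ge_chart_integral b (rho : R) F : measurable_fun setT F ->
  (forall x, (0 <= F x)%E) ->
  (forall y, cc_rect b rho y -> ball3 x0 r (gp y)) ->
  (\int[leb2]_(y in cc_rect b rho) F (gp y) <= \int[sigma]_(x in bdry Omega) F x)%E.
Proof.
move=> mF F0 Hb; have [_ onb C _] := chart.
pose A' : set (mE3 R) := bdry Omega `&` ball3 x0 r `&`
  (fun x => (graph_cocoord e1 e2 e3 psi x).1) @^-1` cc_rect b rho.
have mA' : measurable A'.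
  apply: measurableI.
    by apply: measurableI; [exact: measurable_bdry|apply: open3_measurable; exact: open_ball3].
  rewrite -[X in measurable X]setTI.
  by apply: (measurableT_comp measurable_fst (measurable_graph_cocoord e1 e2 e3 C)) => //; exact: cc_rect_measurable.
have AE : gp @^-1` A' = cc_rect b rho.
  apply/seteqP; split => y; rewrite /A' /preimage /setI /mkset cocoord_gp.
    by case.
  by move=> yr; split => //; split; [apply: chart_bdry_ball; exact: Hb|exact: Hb].
have -> : (\int[leb2]_(y in cc_rect b rho) F (gp y) = \int[m]_(x in A') F x)%E.
  by rewrite ge0_integral_pushforward ?AE//; [exact: measurable_graph_point0|exact: measurable_funTS].
apply: (@le_trans _ _ (\int[sigma]_(x in A') F x)%E); last first.
  apply: ge0_subset_integral => //; first exact: measurable_bdry.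
    exact: measurable_funTS.
  by move=> x [[]].
apply: le_measure_integral => // A mA AA'; case: surf => _ /(_ _ _ _ _ _ _ bx0 chart A mA) ->.
  have mgA : measurable [set y : M1 * M1 | A (graph_point e1 e2 e3 psi y)].
    rewrite (_ : [set y | _] = gp @^-1` A); last by apply/seteqP; split => y /=; rewrite gpE.
    by rewrite -[X in measurable X]setTI; exact: measurable_graph_point0.
  apply: (@le_trans _ _ (\int[leb2]_(y in [set y | A (graph_point e1 e2 e3 psi y)]) cst 1%E y)%E).
    rewrite integral_cst// mul1e le_eqVlt; apply/orP; left; apply/eqP.
    by rewrite /m /pushforward; congr (leb2 _); apply/seteqP; split => y /=; rewrite gpE.
  apply: ge0_le_integral => //.
  - by apply/measurable_EFinP; apply: measurable_funTS; exact: measurable_area.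
  - move=> y _; rewrite lee_fin -[leLHS]sqrtr1 ler_sqrt; last first.
      by rewrite !addr_ge0 ?sqr_ge0.
    by rewrite -addrA lerDl addr_ge0 ?sqr_ge0.
by move=> x /AA' [[]].
Qed.

(** The area factor is bounded on the square because the gradient of [psi] is; [M] depends neither
    on [U] nor on [F]. *)
Lemma le_chart_integral b (rho : R) : exists2 M : R, 0 <= M &
  forall (U : set (mE3 R)) F, measurable U -> measurable_fun setT F ->
  (forall x, (0 <= F x)%E) ->
  (forall x, U x -> bdry Omega x -> ball3 x0 r x /\
     cc_rect b rho (graph_cocoord e1 e2 e3 psi x).1) ->
  (\int[sigma]_(x in bdry Omega `&` U) F x <=
   M%:E * \int[leb2]_(y in cc_rect b rho) F (gp y))%E.
Proof.
have [_ onb C _] := chart.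
have [M0 M00 HM] := C11_grad_bounded b rho C.
pose M := Num.sqrt (1 + M0 ^+ 2 + M0 ^+ 2).
have M_ge0 : 0 <= M by exact: sqrtr_ge0.
exists M => // U F mU mF F0 HU.
pose Mn : {nonneg R} := NngNum M_ge0.
have mbU : measurable (bdry Omega `&` U) by apply: measurableI => //; exact: measurable_bdry.
apply: (@le_trans _ _ (\int[mscale Mn m]_(x in bdry Omega `&` U) F x)%E); last first.
  rewrite ge0_integral_mscale//; last exact: measurable_funTS.
  apply: lee_wpmul2l => //.
  rewrite ge0_integral_pushforward//; last 2 first.
  - exact: measurable_graph_point0.
  - exact: measurable_funTS.
  apply: ge0_subset_integral => //.
  - rewrite -[X in measurable X]setTI; exact: measurable_graph_point0.
  - exact: cc_rect_measurable.
  - by apply: measurable_funTS; apply: measurableT_comp => //; exact: measurable_graph_point0.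
  - by move=> y _; exact: F0.
  - by move=> y [by_ Uy]; have [_] := HU _ Uy by_; rewrite cocoord_gp.
apply: le_measure_integral => // A mA AA'; case: surf => _ /(_ _ _ _ _ _ _ bx0 chart A mA) ->.
  have gE : [set y | A (graph_point e1 e2 e3 psi y)] = gp @^-1` A.
    by apply/seteqP; split => y /=; rewrite gpE.
  have mgA : measurable [set y : M1 * M1 | A (graph_point e1 e2 e3 psi y)].
    by rewrite gE -[X in measurable X]setTI; exact: measurable_graph_point0.
  apply: (@le_trans _ _ (\int[leb2]_(y in [set y | A (graph_point e1 e2 e3 psi y)]) cst M%:E y)%E).
      apply: ge0_le_integral => //.
    - by apply/measurable_EFinP; apply: measurable_funTS; exact: measurable_area.
    - move=> y Ay; rewrite lee_fin /M ler_sqrt; last by rewrite !addr_ge0 ?sqr_ge0.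
      have [yb Uy] := AA' _ Ay; have := HU _ Uy yb; rewrite -gpE cocoord_gp => -[_ /cc_rectE[r1 r2]].
      have [|g1 g2] := HM y; first by rewrite prod_norm_le r1 r2.
      have sq (t : R) : `|t| <= M0 -> t ^+ 2 <= M0 ^+ 2.
        by move=> tL; rewrite -(real_normK (num_real t)) lerXn2r// nnegrE (le_trans _ tL).
      by apply: lerD; [apply: lerD => //|]; exact: sq.
  apply: (@le_trans _ _ (M%:E * leb2 (gp @^-1` A))%E); last exact: lexx.
  rewrite integral_cst; last exact: mgA.
  by rewrite gE; exact: lexx.
by move=> x /AA' [bx Ux]; have [] := HU _ Ux bx.
Qed.

End chart_measure.

(* Bounds uniform in a parameter are proved on the boundary chart by chart. *)
Lemma bdry_integral_bound (T : Type) (P : T -> Prop) (F : T -> mE3 R -> \bar R)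
    (K : T -> \bar R) :
  (forall i, P i -> measurable_fun setT (F i)) -> (forall i x, (0 <= F i x)%E) ->
  (forall i, (0 <= K i)%E) ->
  (forall e1 e2 e3 psi b (rho : R), 0 < rho -> orthonormal3 e1 e2 e3 -> C11 psi ->
    slab e1 e2 e3 psi (cc_rect b (rho / 2)) 0 rho `<=` Omega ->
    exists2 C : R, 0 <= C & forall i, P i ->
      (\int[leb2]_(y in cc_rect b (rho / 2)) F i (graph_coord e1 e2 e3 psi (y, 0)%R) <=
       C%:E * K i)%E) ->
  exists2 C : R, 0 <= C & forall i, P i ->
    (\int[sigma]_(x in bdry Omega) F i x <= C%:E * K i)%E.
Proof.
move=> mF F0 K0 H.
pose G := [set U : set (E3 R) | measurable (U : set (mE3 R)) /\ exists2 C : R, 0 <= C &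
  forall i, P i -> (\int[sigma]_(x in bdry Omega `&` U) F i x <= C%:E * K i)%E].
have mb := measurable_bdry.
have [||x0 bx0|U bU [mU [C C0 HC]]] := @compact_union_cover _ (bdry Omega) G compact_bdry.
- split => //; exists 0 => // i Pi.
  by rewrite setI0 integral_set0 mul0e.
- move=> U V [mU [C1 C10 H1]] [mV [C2 C20 H2]]; split; first exact: measurableU.
  exists (C1 + C2); first by rewrite addr_ge0.
  move=> i Pi; rewrite setIUr.
  have mUb : measurable (bdry Omega `&` U : set (mE3 R)) by exact: measurableI.
  have mVb : measurable (bdry Omega `&` V : set (mE3 R)) by exact: measurableI.
  apply: (le_trans (ge0_integral_setU_le sigma mUb mVb (mF i Pi) (F0 i))).
  by rewrite EFinD ge0_muleDl ?lee_fin//; apply: leeD; [exact: H1|exact: H2].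
- have [r [e1 [e2 [e3 [psi ch]]]]] := charts bx0.
  have [rho [[rho0 onb C HO near_x] _]] := bdry_patch oOmega ch bx0.
  have [r0 _ _ _] := ch.
  have near2 : \forall x \near x0, ball3 x0 r x /\ (closure Omega x ->
        let y := graph_cocoord e1 e2 e3 psi x in
        [/\ `|y.1.1 - (coframe e1 e2 e3 x0).1.1| < rho / 2,
            `|y.1.2 - (coframe e1 e2 e3 x0).1.2| < rho / 2,
            0 <= y.2 < rho / 2
          & Omega x -> 0 < y.2]).
    by apply: filterI => //; exact: nbhs_ball3.
  have [U [oU Ux] sU] := near_open near2; exists U => //.
  have mU : measurable (U : set (mE3 R)) by exact: open3_measurable.
  split => //; set b := (coframe e1 e2 e3 x0).1 in sU HO near_x near2 *.
  have [M M0 HM] := le_chart_integral ch bx0 b (rho / 2).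
  have [C' C'0 HC'] := H e1 e2 e3 psi b rho rho0 onb C (slab_rho_sub rho0 onb HO).
  exists (M * C'); first by rewrite mulr_ge0.
  move=> i Pi; apply: (le_trans (HM _ _ mU (mF i Pi) (F0 i) _)).
    move=> x /sU[bx Hx] [cx _]; split => //; have [h1 h2 _ _] := Hx cx.
    by apply/cc_rectE; rewrite !ltW.
  by rewrite EFinM -muleA; apply: lee_wpmul2l; [rewrite lee_fin|exact: HC'].
exists C => // i Pi; rewrite -(setIidl bU); exact: HC.
Qed.

(** In each chart the boundary is the slice at height 0, which the slice estimate bounds by the slab
    above it. *)
Lemma bdry_trace : exists2 C : R, 0 <= C & forall f df, C1grad f df ->
  (\int[sigma]_(x in bdry Omega) (f x ^+ 2)%:E <=
   C%:E * (\int[leb3]_(x in Omega) (f x ^+ 2)%:E + energy Omega df))%E.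
Proof.
have [||||C C0 HC] := @bdry_integral_bound ((E3 R -> R) * (E3 R -> E3 R))
  (fun i => C1grad i.1 i.2) (fun i x => (i.1 x ^+ 2)%:E)
  (fun i => \int[leb3]_(x in Omega) (i.1 x ^+ 2)%:E + energy Omega i.2)%E.
- by move=> -[f df] /= [cf _ _]; exact: measurable_sqr3.
- by move=> i x; rewrite lee_fin sqr_ge0.
- move=> i; apply: adde_ge0; last exact: energy_ge0.
  by apply: integral_ge0 => x _; rewrite lee_fin sqr_ge0.
- move=> e1 e2 e3 psi b rho rho0 onb C sO.
  exists (2 / (rho / 2) + 2 * rho); first by rewrite addr_ge0 ?divr_ge0 ?mulr_ge0 ?ltW.
  move=> -[f df] /= Cf; have [cf cdf _] := Cf.
  have mB := cc_rect_measurable b (rho / 2).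
  have r2 : 0 <= rho / 2 by rewrite ltW// divr_gt0.
  have r3 : rho / 2 < rho by lra.
  have r4 : (0 : R) <= 0 <= rho by apply/andP; split; [exact: lexx|exact: ltW].
  apply: (le_trans (slice_sqr_le onb C mB Cf r2 r3 (lexx rho) r4)).
  have -> : rho - rho / 2 = rho / 2 by lra.
  rewrite subr0 [in leRHS]EFinD [leRHS]ge0_muleDl; last 2 first.
  - by rewrite lee_fin divr_ge0.
  - by rewrite lee_fin mulr_ge0// ltW.
  have mO : measurable (Omega : set (mE3 R)) by exact: open3_measurable.
  apply: leeD; apply: lee_wpmul2l; try by rewrite lee_fin ?divr_ge0 ?mulr_ge0 ?ltW.
    apply: le_trans (leeDl _ (energy_ge0 _ _)); apply: ge0_subset_integral => //.
    + exact: measurable_slab.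
    + exact: measurable_sqr3.
    + by move=> x _; rewrite lee_fin sqr_ge0.
    + move=> x [h1 /andP[h2 h3]]; apply: sO; split => //.
      by rewrite h3 andbT (le_lt_trans r2).
  apply: le_trans (leeDr _ _); last first.
    by apply: integral_ge0 => x _; rewrite lee_fin sqr_ge0.
  apply: ge0_subset_integral => //.
  + exact: measurable_slab.
  + exact: measurable_sqrnorm3.
  + by move=> x _; rewrite lee_fin sqr_ge0.
by exists C => // f df Cf; exact: (HC (f, df)).
Qed.

(** The constant [c] comes from a cube inside the domain; the control of [Omega] by a box of that
    cube and the trace inequality, applied to [f - c], carry the bound to the domain and to its
    boundary. The slack [eta] is that of the cube. *)
Lemma poincare_trace : exists2 C : R, 0 <= C & forall f df (eta : R), C1grad f df ->
  0 < eta -> exists c : R,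
  (\int[leb3]_(x in Omega) ((f x - c) ^+ 2)%:E +
   \int[sigma]_(x in bdry Omega) ((f x - c) ^+ 2)%:E <=
   C%:E * (energy Omega df + eta%:E))%E.
Proof.
have [x0 Ox0] := nOmega.
have /nbhs_ballP[e0 /= e00 He0] := open_nbhs_nbhs (conj oOmega Ox0).
have cO := domain_controlled oOmega bOmega charts (interior_controls oOmega cOmega e00 He0).
set A := box _ _ in cO; have [C1 C10 H1] := cO.
have [C2 C20 H2] := bdry_trace.
pose a : E3 R := x0 - (e0 / 2, e0 / 2, e0 / 2).
have AQ : A `<=` cube a e0.
  move=> x /boxE[/andP[h1 h2] /andP[h3 h4] /andP[h5 h6]]; apply/cubeE.
  move: h1 h2 h3 h4 h5 h6; rewrite /a /= => h1 h2 h3 h4 h5 h6.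
  by split; [exact: (window_le h1 h2)|exact: (window_le h3 h4)|exact: (window_le h5 h6)].
set k := C1 * (9 * e0 ^+ 2 + 1).
have k0 : 0 <= k by rewrite mulr_ge0// addr_ge0// mulr_ge0// sqr_ge0.
have k1 : 0 <= C2 * (k + 1) by rewrite mulr_ge0// addr_ge0.
exists (k + C2 * (k + 1)); first exact: addr_ge0.
move=> f df eta Cf eta0.
have [c Hc] := cube_point_poincare a e00 eta0 Cf; exists c.
have [_ cdf _] := Cf.
have Cg : C1grad (fun x => f x - c) df.
  rewrite (_ : df = fun x => df x - cst 0 x).
    exact: C1gradB Cf (C1grad_cst c).
  by apply/funext => x; rewrite subr0.
have [cg _ _] := Cg.
have QO : cube a e0 `<=` Omega.
  move=> x /cubeE[/andP[h1 h2] /andP[h3 h4] /andP[h5 h6]]; apply: He0; apply/ball_boxP.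
  move: h1 h2 h3 h4 h5 h6; rewrite /a /= => h1 h2 h3 h4 h5 h6.
  by split; [exact: (window_lt e00 h1 h2)|exact: (window_lt e00 h3 h4)|exact: (window_lt e00 h5 h6)].
have mO : measurable (Omega : set (mE3 R)) by exact: open3_measurable.
set Y := (energy Omega df + eta%:E)%E.
have eta0' : (0 <= eta%:E)%E by rewrite lee_fin ltW.
have en0 := energy_ge0 Omega df.
have Y0 : (0 <= Y)%E by rewrite adde_ge0.
have enY : (energy Omega df <= Y)%E by rewrite leeDl.
have XA : (\int[leb3]_(x in A) ((f x - c) ^+ 2)%:E <= (9 * e0 ^+ 2)%:E * Y)%E.
  apply: (@le_trans _ _ (\int[leb3]_(x in cube a e0) ((f x - c) ^+ 2)%:E)%E).
    apply: ge0_subset_integral => //; first exact: measurable_box.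
    - exact: measurable_cube.
    - exact: (measurable_sqr3 (f := fun x => f x - c)).
    - by move=> x _; rewrite lee_fin sqr_ge0.
  apply: (le_trans Hc); apply: lee_wpmul2l; first by rewrite lee_fin mulr_ge0// sqr_ge0.
  apply: leeD2r; apply: ge0_subset_integral => //; first exact: measurable_cube.
  - exact: measurable_sqrnorm3.
  - by move=> x _; rewrite lee_fin sqr_ge0.
have XO : (\int[leb3]_(x in Omega) ((f x - c) ^+ 2)%:E <= k%:E * Y)%E.
  apply: (le_trans (H1 _ _ Cg)); rewrite EFinM -muleA.
  apply: lee_wpmul2l; first by rewrite lee_fin.
  have e9 : (0 <= (9 * e0 ^+ 2)%:E)%E by rewrite lee_fin mulr_ge0// sqr_ge0.
  have e1 : (0 <= 1%:E :> \bar R)%E by rewrite lee_fin.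
  rewrite [in leRHS]EFinD [leRHS](ge0_muleDl _ e9 e1) mul1e.
  exact: leeD.
rewrite EFinD ge0_muleDl ?lee_fin//; apply: leeD => //.
apply: (le_trans (H2 _ _ Cg)); rewrite EFinM -muleA.
apply: lee_wpmul2l; first by rewrite lee_fin.
rewrite EFinD ge0_muleDl ?lee_fin// mul1e.
exact: leeD.
Qed.

End surface.

(** * Divergence theorem in graph coordinates *)

Section box_integrals.
Context {R : realType}.
Local Notation M1 := (measurableTypeR R).
Implicit Types (p q : E3 R -> R) (b : R * R) (rho T : R).

Lemma bounded_integrable3 (D : set (mE3 R)) p : measurable D ->
  bounded_set (D : set (E3 R)) -> continuous p ->
  (leb3 : {measure set (mE3 R) -> \bar R}).-integrable D (EFin \o p).
Proof.
move=> mD bD cp; apply: measurable_bounded_integrable => //.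
- exact: leb3_bounded_lty.
- by apply: measurable_funTS; exact: continuous3_measurable.
- have [M M0 HM] := continuous_bounded_on bD cp.
  by exists M; split; [exact: num_real|move=> N MN x Dx; exact: le_trans (HM x Dx) (ltW MN)].
Qed.

Lemma leb2_cc_rect b rho : 0 <= rho -> leb2 (cc_rect b rho) = ((2 * rho) ^+ 2)%:E.
Proof.
move=> r0; rewrite /cc_rect.
apply: (etrans (@product_measure1E _ _ _ _ R (@lebesgue_measure R)
  (@lebesgue_measure R) _ _ (measurable_itv _) (measurable_itv _))).
have E (u : R) : @lebesgue_measure R `[u - rho, u + rho]%classic = (2 * rho)%:E.
  apply: (etrans (@leb1_cc R (u - rho) (u + rho) _)); first by lra.
  by congr (_%:E); ring.
rewrite expr2 EFinM; congr (_ * _)%E; exact: E.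
Qed.

Lemma rect_integrable2 b rho (h : R * R -> R) : 0 <= rho -> continuous h ->
  (leb2 : {measure set (M1 * M1)%type -> \bar R}).-integrable (cc_rect b rho) (EFin \o h).
Proof.
move=> r0 ch; apply: measurable_bounded_integrable => //.
- exact: cc_rect_measurable.
- apply: (@le_lt_trans _ _ ((2 * rho) ^+ 2)%:E); last exact: ltry.
  by rewrite le_eqVlt; apply/orP; left; apply/eqP; exact: leb2_cc_rect.
- by apply: measurable_funTS; exact: continuous2_measurable.
- have /compact_bounded[M [Mr HM]] : compact (h @` cc_rect b rho).
    apply: continuous_compact; first exact: continuous_subspaceT.
    by apply: compact_setX; exact: segment_compact.
  by exists M; split => // N MN x Dx; apply: HM => //; exists x.
Qed.

Section one_box.
Variables (b : R * R) (rho T : R).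
Hypotheses (rho0 : 0 <= rho) (T0 : 0 <= T).
Let Q : set (mE3 R) := cc_rect b rho `*` `]0, T]%classic.

Let mQ : measurable Q.
Proof. by apply: measurableX => //; exact: cc_rect_measurable. Qed.

Let bQ : bounded_set (Q : set (E3 R)).
Proof.
have kQ : compact (cc_rect b rho `*` `[0, T]%classic : set (E3 R)).
  by apply: compact_setX; [apply: compact_setX|]; exact: segment_compact.
have [M [Mr HM]] := compact_bounded kQ; exists M; split => // N MN x [x1 x2].
apply: (HM N MN); split => //; move: x2; rewrite /= !in_itv/= => /andP[? ?].
by apply/andP; split => //; exact: ltW.
Qed.

Let gQ p : mE3 R -> \bar R := (EFin \o p) \_ Q.

Let igQ p : continuous p -> (leb3 : {measure set (mE3 R) -> \bar R}).-integrable setT (gQ p).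
Proof.
move=> cp; apply/(integrable_restrict leb3 mQ (@measurableT _ _)).
by rewrite setTI; exact: bounded_integrable3.
Qed.

Let gQ_slice p (t : R) y : 0 < t <= T ->
  gQ p (y, t) = ((fun y => (p (y, t))%:E) \_ (cc_rect b rho)) y.
Proof.
move=> t0; rewrite /gQ !patchE /=; congr (if _ then _ else _).
by apply/idP/idP; rewrite !inE; [case|split => //=; rewrite in_itv].
Qed.

Let gQ_out p (t : R) y : ~ (0 < t <= T) -> gQ p (y, t) = 0%E.
Proof. by move=> t0; rewrite /gQ patchE memNset// => -[_] /=; rewrite in_itv. Qed.

Lemma box_integral_slices p : continuous p ->
  (forall t : R, 0 < t <= T -> (\int[leb2]_(y in cc_rect b rho) (p (y, t))%:E = 0)%E) ->
  (\int[leb3]_(x in Q) (p x)%:E = 0)%E.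
Proof.
move=> cp H; rewrite integral_mkcond.
apply: (etrans (esym (@integral21_prod_meas1 _ _ _ _ R leb2 (@lebesgue_measure R) _ (igQ cp)))).
apply: integral0_eq => t _; rewrite /fubini_G.
have [t0|t0] := pselect (0 < t <= T); last first.
  by apply: integral0_eq => y _; exact: gQ_out.
rewrite -[RHS](H t t0) [RHS]integral_mkcond; apply: eq_integral => y _.
exact: gQ_slice.
Qed.

Lemma continuous_slice3 p (t : R) : continuous p -> continuous (fun y : R * R => p (y, t)).
Proof.
move=> cp y; apply: (@continuous_comp _ _ _ (fun y : R * R => (y, t)) p); last exact: cp.
exact: (cvg_pair (@cvg_id _ (nbhs y)) (cvg_cst _)).
Qed.

Lemma continuous_line1 (h : R * R -> R) (v : R) : continuous h -> continuous (fun u : R => h (u, v)).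
Proof.
move=> cp y; apply: (@continuous_comp _ _ _ (fun y : R => (y, v)) h); last exact: cp.
exact: (cvg_pair (@cvg_id _ (nbhs y)) (cvg_cst _)).
Qed.

Lemma continuous_line2 (h : R * R -> R) (u : R) : continuous h -> continuous (fun v : R => h (u, v)).
Proof.
move=> cp y; apply: (@continuous_comp _ _ _ (fun y : R => (u, y)) h); last exact: cp.
exact: (cvg_pair (cvg_cst _) (@cvg_id _ (nbhs y))).
Qed.

Lemma continuous_line3 p (y : R * R) : continuous p -> continuous (fun t : R => p (y, t)).
Proof.
move=> cp t; apply: (@continuous_comp _ _ _ (fun t : R => (y, t)) p); last exact: cp.
exact: (cvg_pair (cvg_cst _) (@cvg_id _ (nbhs t))).
Qed.

Let irect (h : R * R -> R) : continuous h ->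
  (leb2 : {measure set (M1 * M1)%type -> \bar R}).-integrable setT
    ((EFin \o h) \_ (cc_rect b rho)).
Proof.
move=> ch; apply/(integrable_restrict leb2 (cc_rect_measurable b rho) (@measurableT _ _)).
by rewrite setTI; exact: rect_integrable2.
Qed.

Let itvE (u v : R) : (`|v - u| <= rho) = (v \in `[u - rho, u + rho]).
Proof. by rewrite in_itv/= ler_distlC; apply/idP/idP => /andP[? ?]; apply/andP; split; lra. Qed.

Lemma box_integral_derive1 p q : continuous p ->
  (forall u v t : R, is_derive u (1 : R) (fun s => q (s, v, t)) (p (u, v, t))) ->
  (forall v t : R, `|v - b.2| <= rho -> 0 < t <= T ->
    q (b.1 - rho, v, t) = 0 /\ q (b.1 + rho, v, t) = 0) ->
  (\int[leb3]_(x in Q) (p x)%:E = 0)%E.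
Proof.
move=> cp dq q0; apply: box_integral_slices => // t t0; rewrite integral_mkcond.
have cpt := continuous_slice3 (t := t) cp.
apply: (etrans (esym (@integral21_prod_meas1 _ _ _ _ R (@lebesgue_measure R) (@lebesgue_measure R) _ (irect cpt)))).
apply: integral0_eq => v _; rewrite /fubini_G.
have [vb|vb] := boolP (`|v - b.2| <= rho); last first.
  apply: integral0_eq => u _; rewrite patchE memNset// => /cc_rectE[_] /=.
  by apply/negP.
have [qa qb] := q0 v t vb t0.
have <- : (\int[leb1]_(u in `[(b.1 - rho)%R, (b.1 + rho)%R]) (p (u, v, t))%:E = 0)%E.
  have cl := @continuous_line1 (fun y => p (y, t)) v cpt.
  have ab : b.1 - rho <= b.1 + rho by rewrite lerBlDr -addrA lerDl addr_ge0.
  by rewrite (FTC_segment (fun u => dq u v t) cl ab) qa qb subrr.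
rewrite [RHS]integral_mkcond; apply: eq_integral => u _; rewrite !patchE /=.
congr (if _ then _ else _); apply/idP/idP; rewrite !inE.
  by move=> /cc_rectE[/= h _]; rewrite -itvE.
by move=> /= h; apply/cc_rectE; rewrite /= itvE.
Qed.

Lemma box_integral_derive2 p q : continuous p ->
  (forall u v t : R, is_derive v (1 : R) (fun s => q (u, s, t)) (p (u, v, t))) ->
  (forall u t : R, `|u - b.1| <= rho -> 0 < t <= T ->
    q (u, b.2 - rho, t) = 0 /\ q (u, b.2 + rho, t) = 0) ->
  (\int[leb3]_(x in Q) (p x)%:E = 0)%E.
Proof.
move=> cp dq q0; apply: box_integral_slices => // t t0; rewrite integral_mkcond.
have cpt := continuous_slice3 (t := t) cp.
apply: (etrans (esym (@integral12_prod_meas1 _ _ _ _ R (@lebesgue_measure R) (@lebesgue_measure R) _ (irect cpt)))).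
apply: integral0_eq => u _; rewrite /fubini_F.
have [ub|ub] := boolP (`|u - b.1| <= rho); last first.
  apply: integral0_eq => v _; rewrite patchE memNset// => /cc_rectE[/= h _].
  by move: h; apply/negP.
have [qa qb] := q0 u t ub t0.
have <- : (\int[leb1]_(v in `[(b.2 - rho)%R, (b.2 + rho)%R]) (p (u, v, t))%:E = 0)%E.
  have cl := @continuous_line2 (fun y => p (y, t)) u cpt.
  have ab : b.2 - rho <= b.2 + rho by rewrite lerBlDr -addrA lerDl addr_ge0.
  by rewrite (FTC_segment (fun v => dq u v t) cl ab) qa qb subrr.
rewrite [RHS]integral_mkcond; apply: eq_integral => v _; rewrite !patchE /=.
congr (if _ then _ else _); apply/idP/idP; rewrite !inE.
  by move=> /cc_rectE[/= _ h]; rewrite -itvE.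
by move=> /= h; apply/cc_rectE; rewrite /= ub itvE.
Qed.

(** The fundamental theorem of calculus on vertical segments; vanishing at the top leaves the bottom
    face, with a minus sign. *)
Lemma box_integral_derive3 p q : continuous p ->
  (forall y (t : R), is_derive t (1 : R) (fun s => q (y, s)) (p (y, t))) ->
  (forall y, cc_rect b rho y -> q (y, T) = 0) ->
  (\int[leb3]_(x in Q) (p x)%:E = \int[leb2]_(y in cc_rect b rho) (- q (y, 0%R))%:E)%E.
Proof.
move=> cp dq q0; rewrite integral_mkcond.
apply: (etrans (esym (@integral12_prod_meas1 _ _ _ _ R leb2 (@lebesgue_measure R) _ (igQ cp)))).
rewrite [RHS]integral_mkcond; apply: eq_integral => y _; rewrite /fubini_F [RHS]patchE.
case: ifPn => yb; last first.
  apply: integral0_eq => t _; rewrite /gQ patchE memNset// => -[/= /mem_set].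
  by move=> h; rewrite h in yb.
rewrite inE in yb.
have <- : (\int[leb1]_(t in `[0%R, T]) (p (y, t))%:E = (- q (y, 0))%:E)%E.
  by rewrite (FTC_segment (dq y) (continuous_line3 (y := y) cp) T0) q0// sub0r.
have cl := continuous_line3 (y := y) cp.
rewrite -integral_itv_obnd_cbnd; last first.
  by apply/measurable_EFinP; exact: continuous_measurable1.
rewrite [RHS]integral_mkcond; apply: eq_integral => t _; rewrite /gQ !patchE /=.
congr (if _ then _ else _); apply/idP/idP; rewrite !inE; first by case.
by split.
Qed.

End one_box.
End box_integrals.

Section divergence.
Context {R : realType}.
Local Notation M1 := (measurableTypeR R).
Implicit Types (b : R * R) (rho T : R).

Lemma is_derive_affine (g : R -> R) (dg u v k s : R) : is_derive s (1 : R) g dg ->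
  is_derive s (1 : R) (fun t => t * u + g t * v + k) (u + dg * v).
Proof.
move=> hg; have h1 := @is_deriveZ _ _ _ _ u s 1 _ (is_derive_id s (1 : R)).
have h2 := @is_deriveZ _ _ _ _ v s 1 _ hg.
have h3 := is_deriveD (is_deriveD h1 h2) (is_derive_cst k s (1 : R)).
rewrite (_ : (fun t => _) = (u \*: id) + (v \*: g) + cst k).
  by apply: (is_derive_eq h3); rewrite !scaleRE addr0 mulr1 [v * _]mulrC.
by apply/funext => t; rewrite !fctE /= !scaleRE [u * _]mulrC [v * _]mulrC.
Qed.

Section one_graph.
Variables (e1 e2 e3 : E3 R) (psi : R * R -> R).
Hypotheses (onb : orthonormal3 e1 e2 e3) (C : C11 psi).
Local Notation Psi := (graph_coord e1 e2 e3 psi).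
Local Notation g1 := (fun y => (grad2 psi y).1).
Local Notation g2 := (fun y => (grad2 psi y).2).
Let cPsi := @continuous_graph_coord _ e1 e2 e3 psi (C11_continuous C).

Lemma graph_curve1 (u v t : R) :
  is_derive_curve (fun s => Psi (s, v, t)) u (e1 + g1 (u, v) *: e3).
Proof.
have hp : is_derive u (1 : R) (fun s : R => psi (s, v) + t) (g1 (u, v)).
  have := @C11_line _ psi (0, v) (1, 0) u C.
  rewrite (_ : (fun s : R => psi _) = fun s : R => psi (s, v)); last first.
    apply/funext => s; congr psi; apply/pair_equal_spec; split => /=.
      by rewrite scaleRE; ring.
    by rewrite scaleRE; ring.
  rewrite (_ : (0, v) + u *: (1, 0) = (u, v)); last first.
    by apply/pair_equal_spec; split; rewrite /= scaleRE; ring.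
  move=> /= h; have h' := is_deriveD h (is_derive_cst t u (1 : R)).
  by apply: (is_derive_eq h'); ring.
split.
- have h := is_derive_affine e1.1.1 e3.1.1 (v * e2.1.1) hp.
  rewrite (_ : (fun s => _) = fun s => s * e1.1.1 + (psi (s, v) + t) * e3.1.1 + v * e2.1.1).
    by apply: (is_derive_eq h); rewrite /= scaleRE.
  by apply/funext => s; rewrite /graph_coord /frame /= !scaleRE; ring.
- have h := is_derive_affine e1.1.2 e3.1.2 (v * e2.1.2) hp.
  rewrite (_ : (fun s => _) = fun s => s * e1.1.2 + (psi (s, v) + t) * e3.1.2 + v * e2.1.2).
    by apply: (is_derive_eq h); rewrite /= scaleRE.
  by apply/funext => s; rewrite /graph_coord /frame /= !scaleRE; ring.
- have h := is_derive_affine e1.2 e3.2 (v * e2.2) hp.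
  rewrite (_ : (fun s => _) = fun s => s * e1.2 + (psi (s, v) + t) * e3.2 + v * e2.2).
    by apply: (is_derive_eq h); rewrite /= scaleRE.
  by apply/funext => s; rewrite /graph_coord /frame /= !scaleRE; ring.
Qed.

Lemma graph_curve2 (u v t : R) :
  is_derive_curve (fun s => Psi (u, s, t)) v (e2 + g2 (u, v) *: e3).
Proof.
have hp : is_derive v (1 : R) (fun s : R => psi (u, s) + t) (g2 (u, v)).
  have := @C11_line _ psi (u, 0) (0, 1) v C.
  rewrite (_ : (fun s : R => psi _) = fun s : R => psi (u, s)); last first.
    apply/funext => s; congr psi; apply/pair_equal_spec; split => /=.
      by rewrite scaleRE; ring.
    by rewrite scaleRE; ring.
  rewrite (_ : (u, 0) + v *: (0, 1) = (u, v)); last first.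
    by apply/pair_equal_spec; split; rewrite /= scaleRE; ring.
  move=> /= h; have h' := is_deriveD h (is_derive_cst t v (1 : R)).
  by apply: (is_derive_eq h'); ring.
split.
- have h := is_derive_affine e2.1.1 e3.1.1 (u * e1.1.1) hp.
  rewrite (_ : (fun s => _) = fun s => s * e2.1.1 + (psi (u, s) + t) * e3.1.1 + u * e1.1.1).
    by apply: (is_derive_eq h); rewrite /= scaleRE.
  by apply/funext => s; rewrite /graph_coord /frame /= !scaleRE; ring.
- have h := is_derive_affine e2.1.2 e3.1.2 (u * e1.1.2) hp.
  rewrite (_ : (fun s => _) = fun s => s * e2.1.2 + (psi (u, s) + t) * e3.1.2 + u * e1.1.2).
    by apply: (is_derive_eq h); rewrite /= scaleRE.
  by apply/funext => s; rewrite /graph_coord /frame /= !scaleRE; ring.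
- have h := is_derive_affine e2.2 e3.2 (u * e1.2) hp.
  rewrite (_ : (fun s => _) = fun s => s * e2.2 + (psi (u, s) + t) * e3.2 + u * e1.2).
    by apply: (is_derive_eq h); rewrite /= scaleRE.
  by apply/funext => s; rewrite /graph_coord /frame /= !scaleRE; ring.
Qed.

Variables (b : R * R) (rho T : R) (D : set (mE3 R)).
Hypotheses (rho0 : 0 <= rho) (T0 : 0 <= T) (mD : measurable D).
Let Q : set (mE3 R) := cc_rect b rho `*` `]0, T]%classic.
Hypothesis QD : forall y, Q y -> D (Psi y).

(** The signed form of the change of variables. On the preimage of [D], [F \o Psi] lives on the
    bounded box [Q], which supplies the integrability that the pushforward formula demands. *)
Lemma graph_box_integral (F : E3 R -> R) : continuous F ->
  (forall y, D (Psi y) -> ~ Q y -> F (Psi y) = 0) ->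
  (\int[leb3]_(x in D) (F x)%:E = \int[leb3]_(y in Q) (F (Psi y))%:E)%E.
Proof.
move=> cF F0.
have mPsi := measurable_graph_coord e1 e2 e3 (continuous2_measurable (C11_continuous C)).
have cFP : continuous (fun y => F (Psi y)).
  by move=> y; apply: (@continuous_comp _ _ _ Psi F); [exact: cPsi|exact: cF].
have mQ : measurable Q by apply: measurableX => //; exact: cc_rect_measurable.
have mPD : measurable (Psi @^-1` D : set (mE3 R)).
  by rewrite -[X in measurable X]setTI; exact: mPsi.
have rE : ((fun y => (F (Psi y))%:E) \_ (Psi @^-1` D) = (fun y => (F (Psi y))%:E) \_ Q).
  apply/funext => y; rewrite !patchE; case: ifPn => yD; case: ifPn => yQ //.
    rewrite inE in yD; rewrite notin_setE in yQ.
    by rewrite F0.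
  rewrite inE in yQ; rewrite notin_setE in yD.
  by exfalso; apply: yD; exact: QD.
have iQ := @bounded_integrable3 R Q _ mQ.
have bQ : bounded_set (Q : set (E3 R)).
  have kQ : compact (cc_rect b rho `*` `[0, T]%classic : set (E3 R)).
    by apply: compact_setX; [apply: compact_setX|]; exact: segment_compact.
  have [M [Mr HM]] := compact_bounded kQ; exists M; split => // N MN x [x1 x2].
  apply: (HM N MN); split => //; move: x2; rewrite /= !in_itv/= => /andP[? ?].
  by apply/andP; split => //; exact: ltW.
have iFQ := iQ _ bQ cFP.
have iD : (leb3 : {measure set (mE3 R) -> \bar R}).-integrable (Psi @^-1` D)
    ((fun x => (F x)%:E) \o Psi).
  rewrite -[Psi @^-1` D]setTI; apply/(integrable_restrict leb3 mPD (@measurableT _ _)).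
  rewrite [X in integrable _ _ X]rE.
  by apply/(integrable_restrict leb3 mQ (@measurableT _ _)); rewrite setTI.
pose m := measure_function_pushforward__canonical__measure_function_Measure leb3 mPsi.
transitivity (\int[m]_(x in D) (F x)%:E)%E.
  by apply: eq_measure_integral => A mA _; exact: leb3_preimage_graph_coord.
rewrite (integral_pushforward mPsi _ iD mD); last first.
  by apply/measurable_EFinP; exact: continuous3_measurable.
by rewrite integral_mkcond [RHS]integral_mkcond; congr integral.
Qed.

Variables (H1 H2 H3 : E3 R -> R) (dH1 dH2 dH3 : E3 R -> E3 R).
Hypotheses (CH1 : C1grad H1 dH1) (CH2 : C1grad H2 dH2) (CH3 : C1grad H3 dH3).
Hypothesis lateral : forall y, cc_rect b rho y.1 -> 0 <= y.2 <= T ->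
  `|y.1.1 - b.1| = rho \/ `|y.1.2 - b.2| = rho \/ y.2 = T ->
  [/\ H1 (Psi y) = 0, H2 (Psi y) = 0 & H3 (Psi y) = 0].

Let F x := dot3 (dH1 x) e1 + dot3 (dH2 x) e2 + dot3 (dH3 x) e3.

(* Divergence theorem for a vector field supported in one chart. *)
Lemma graph_divergence :
  (forall y, D (Psi y) -> ~ Q y -> F (Psi y) = 0) ->
  (\int[leb3]_(x in D) (F x)%:E =
   \int[leb2]_(y in cc_rect b rho) (- (H3 (Psi (y, 0%R)) -
      g1 y * H1 (Psi (y, 0%R)) - g2 y * H2 (Psi (y, 0%R))))%:E)%E.
Proof.
move=> F0; have [c1 d1 K1] := CH1; have [c2 d2 K2] := CH2; have [c3 d3 K3] := CH3.
have cdot (d : E3 R -> E3 R) e : continuous d -> continuous (fun x => dot3 (d x) e).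
  by move=> cd; apply: continuous_fun_dot3 => // x; exact: cvg_cst.
have cF : continuous F.
  by move=> x; apply: cvgD; [apply: cvgD|]; exact: cdot.
rewrite graph_box_integral//.
have [cg1 cg2] := C11_grad_continuous C.
have cfst : continuous (fun y : E3 R => y.1) by move=> y; exact: cvg_fst.
have cG1 : continuous (fun y : E3 R => g1 y.1).
  by move=> y; apply: (@continuous_comp _ _ _ (fun y : E3 R => y.1) g1); [exact: cfst|exact: cg1].
have cG2 : continuous (fun y : E3 R => g2 y.1).
  by move=> y; apply: (@continuous_comp _ _ _ (fun y : E3 R => y.1) g2); [exact: cfst|exact: cg2].
have cP (h : E3 R -> R) : continuous h -> continuous (fun y => h (Psi y)).
  by move=> ch y; apply: (@continuous_comp _ _ _ Psi h); [exact: cPsi|exact: ch].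
pose D1 y := dot3 (dH1 (Psi y)); pose D2 y := dot3 (dH2 (Psi y)).
pose D3 y := dot3 (dH3 (Psi y)).
have cD1 e : continuous (D1^~ e) by exact: (cP (fun x => dot3 (dH1 x) e) (cdot _ _ d1)).
have cD2 e : continuous (D2^~ e) by exact: (cP (fun x => dot3 (dH2 x) e) (cdot _ _ d2)).
have cD3 e : continuous (D3^~ e) by exact: (cP (fun x => dot3 (dH3 x) e) (cdot _ _ d3)).
(* The divergence is regrouped as the derivative of [H1] in the first parameter, of [H2] in the
   second, and of [H3 - g1 * H1 - g2 * H2] in the height. The slopes do not depend on the height, so
   no second derivative of [psi] occurs. *)
pose p1 y := D1 y e1 + g1 y.1 * D1 y e3.
pose p2 y := D2 y e2 + g2 y.1 * D2 y e3.
pose p3 y := D3 y e3 - g1 y.1 * D1 y e3 - g2 y.1 * D2 y e3.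
have cp1 : continuous p1.
  by move=> y; apply: cvgD; [exact: cD1|apply: cvgM; [exact: cG1|exact: cD1]].
have cp2 : continuous p2.
  by move=> y; apply: cvgD; [exact: cD2|apply: cvgM; [exact: cG2|exact: cD2]].
have cp3 : continuous p3.
  move=> y; apply: cvgB; last by apply: cvgM; [exact: cG2|exact: cD2].
  by apply: cvgB; [exact: cD3|apply: cvgM; [exact: cG1|exact: cD1]].
have FE y : F (Psi y) = p1 y + (p2 y + p3 y).
  by rewrite /F /p1 /p2 /p3 /D1 /D2 /D3; ring.
have mQ : measurable Q by apply: measurableX => //; exact: cc_rect_measurable.
have bQ : bounded_set (Q : set (E3 R)).
  have kQ : compact (cc_rect b rho `*` `[0, T]%classic : set (E3 R)).
    by apply: compact_setX; [apply: compact_setX|]; exact: segment_compact.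
  have [M [Mr HM]] := compact_bounded kQ; exists M; split => // N MN x [x1 x2].
  apply: (HM N MN); split => //; move: x2; rewrite /= !in_itv/= => /andP[? ?].
  by apply/andP; split => //; exact: ltW.
have i1 := bounded_integrable3 mQ bQ cp1.
have i2 := bounded_integrable3 mQ bQ cp2.
have i3 := bounded_integrable3 mQ bQ cp3.
under eq_integral do rewrite FE EFinD EFinD.
rewrite (integralD mQ i1 (integrableD mQ i2 i3)) (integralD mQ i2 i3).
have rE (t : R) : `|t - rho - t| = rho by rewrite addrAC subrr sub0r normrN ger0_norm.
have rE' (t : R) : `|t + rho - t| = rho by rewrite addrAC subrr add0r ger0_norm.
have Z1 : (\int[leb3]_(x in Q) (p1 x)%:E = 0)%E.
  apply: (box_integral_derive1 rho0 (q := fun y => H1 (Psi y)) cp1).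
    move=> u v t; have := K1 _ _ _ (graph_curve1 u v t).
    by rewrite dot3Dr dot3Zr.
  move=> v t vb /andP[t0 tT]; split.
    have [] // := @lateral (b.1 - rho, v, t).
    - by apply/cc_rectE; rewrite /= rE.
    - by rewrite /= (ltW t0).
    - by left; exact: rE.
  have [] // := @lateral (b.1 + rho, v, t).
  - by apply/cc_rectE; rewrite /= rE'.
  - by rewrite /= (ltW t0).
  - by left; exact: rE'.
have Z2 : (\int[leb3]_(x in Q) (p2 x)%:E = 0)%E.
  apply: (box_integral_derive2 rho0 (q := fun y => H2 (Psi y)) cp2).
    move=> u v t; have := K2 _ _ _ (graph_curve2 u v t).
    by rewrite dot3Dr dot3Zr.
  move=> u t ub /andP[t0 tT]; split.
    have [] // := @lateral (u, b.2 - rho, t).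
    - by apply/cc_rectE; rewrite /= rE.
    - by rewrite /= (ltW t0).
    - by right; left; exact: rE.
  have [] // := @lateral (u, b.2 + rho, t).
  - by apply/cc_rectE; rewrite /= rE'.
  - by rewrite /= (ltW t0).
  - by right; left; exact: rE'.
apply: (etrans (congr2 (fun u v => u + v)%E Z1 (congr2 (fun u v => u + v)%E Z2 erefl))).
rewrite !add0e.
apply: (box_integral_derive3 T0 (q := fun y => H3 (Psi y) -
      g1 y.1 * H1 (Psi y) - g2 y.1 * H2 (Psi y)) cp3).
  move=> y t.
  have h3 := @is_derive_vertical R e1 e2 e3 psi _ _ y t CH3.
  have h1 := @is_derive_vertical R e1 e2 e3 psi _ _ y t CH1.
  have h2 := @is_derive_vertical R e1 e2 e3 psi _ _ y t CH2.
  have k1 := @is_deriveZ _ _ _ _ (g1 y) t 1 _ h1.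
  have k2 := @is_deriveZ _ _ _ _ (g2 y) t 1 _ h2.
  exact: (is_deriveB (is_deriveB h3 k1) k2).
move=> y yb; have [-> -> ->] := @lateral (y, T) yb (introT andP (conj T0 (lexx T))) (or_intror (or_intror erefl)).
by rewrite !mulr0 !subr0.
Qed.

End one_graph.
End divergence.

(** * The kernel field and the pointwise estimate at a boundary pole *)

Section kernel_field.
Context {R : realType}.
Local Notation M1 := (measurableTypeR R).
Implicit Types (f : E3 R -> R) (df : E3 R -> E3 R) (x y e : E3 R) (eps : R).

Lemma C1grad_rdist3 eps x : 0 < eps ->
  C1grad (fun y => rdist eps x y ^+ 3) (fun y => - (3 * rdist eps x y ^+ 5) *: (y - x)).
Proof.
move=> eps0; have Cr := C1grad_rdist x eps0.
have := C1gradM Cr (C1gradM Cr Cr).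
rewrite (_ : (fun y => rdist eps x y * (_ * _)) = fun y => rdist eps x y ^+ 3); last first.
  by apply/funext => y; rewrite !exprS expr0 mulr1.
rewrite (_ : (fun y => _ *: _ + _) = fun y => - (3 * rdist eps x y ^+ 5) *: (y - x)) //.
apply/funext => y; rewrite !scalerA -!scalerDl scalerA -scalerDl.
by rewrite scaleRE; congr (_ *: _); ring.
Qed.

Lemma frame_dot3 (e1 e2 e3 a c : E3 R) : orthonormal3 e1 e2 e3 ->
  dot3 a e1 * dot3 c e1 + dot3 a e2 * dot3 c e2 + dot3 a e3 * dot3 c e3 = dot3 a c.
Proof. by move=> onb; rewrite -(dot3_coframe onb a c). Qed.

(** The functions are the components, in arbitrary directions [e], of the field [f] times the
    gradient of [rdist]. Its divergence is [f] times the Laplacian [- 3 eps^2 r^5] of the kernel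
    plus the product of the gradients; the Laplacian is simplified by
    [(|y - x|^2 + eps^2) r^2 = 1]. *)
Lemma kernel_field_div eps x f df : 0 < eps -> C1grad f df ->
  exists dH : E3 R -> E3 R -> E3 R,
  (forall e, C1grad (fun y => f y * (- 1 * (rdist eps x y ^+ 3 * dot3 (y - x) e))) (dH e)) /\
  forall e1 e2 e3, orthonormal3 e1 e2 e3 -> forall y,
    dot3 (dH e1 y) e1 + dot3 (dH e2 y) e2 + dot3 (dH e3 y) e3 =
    - (3 * eps ^+ 2 * rdist eps x y ^+ 5 * f y) - rdist eps x y ^+ 3 * dot3 (y - x) (df y).
Proof.
move=> eps0 Cf.
exists (fun e y => f y *: (- 1 *: (rdist eps x y ^+ 3 *: e +
   dot3 (y - x) e *: (- (3 * rdist eps x y ^+ 5) *: (y - x)))) +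
   (- 1 * (rdist eps x y ^+ 3 * dot3 (y - x) e)) *: df y).
split=> [e|e1 e2 e3 onb y].
  exact: (C1gradM Cf (C1gradZ _ (C1gradM (C1grad_rdist3 x eps0) (C1grad_dot3 x e)))).
cbv beta; have [[n1 n2 n3] _] := onb.
have F1 := frame_dot3 (y - x) (y - x) onb.
have F2 := frame_dot3 (y - x) (df y) onb.
have r2 : (dot3 (y - x) (y - x) + eps ^+ 2) * rdist eps x y ^+ 2 = 1.
  by rewrite -rdist_sqr// mulVf// expf_neq0// gt_eqF// rdist_gt0.
move: F1 F2 r2; move: (rdist eps x y) (y - x) (df y) => r z d F1 F2 r2.
rewrite !dot3Dl !dot3Zl !dot3Dl !dot3Zl n1 n2 n3.
move: F1 F2 r2.
move: (dot3 z e1) (dot3 z e2) (dot3 z e3) => z1 z2 z3.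
move: (dot3 d e1) (dot3 d e2) (dot3 d e3) => d1 d2 d3 <- <- r2.
have r3 : r ^+ 3 = r ^+ 5 * (z1 * z1 + z2 * z2 + z3 * z3 + eps ^+ 2).
  by rewrite -[LHS]mulr1 -r2; ring.
rewrite (_ : _ + _ + _ = - f y * (3 * r ^+ 3 - 3 * r ^+ 5 * (z1 * z1 + z2 * z2 + z3 * z3))
  - r ^+ 3 * (z1 * d1 + z2 * d2 + z3 * d3)); last by ring.
by rewrite {1}r3; ring.
Qed.

(** Squaring the cutoff forces its gradient to vanish wherever the cutoff does. *)
Lemma cutoff_exists_flat (x0 : E3 R) (r : R) : 0 < r -> exists chi dchi (M : R),
  [/\ C1grad chi dchi, forall x, 0 <= chi x <= 1, forall x, norm3 (dchi x) <= M,
      forall x, norm3 (x - x0) <= r / 2 -> chi x = 1 /\ dchi x = 0 &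
      forall x, r <= norm3 (x - x0) -> chi x = 0 /\ dchi x = 0].
Proof.
move=> r0; have [chi [dchi [M [C c01 dM inn out]]]] := cutoff_exists x0 r0.
exists (fun x => chi x * chi x), (fun x => chi x *: dchi x + chi x *: dchi x), (2 * M).
split; first exact: C1gradM.
- by move=> x; have /andP[? ?] := c01 x; rewrite mulr_ge0//= mulr_ile1.
- move=> x; have /andP[c0 c1] := c01 x.
  apply: (le_trans (norm3_triangle _ _)); rewrite !norm3Z ger0_norm// mulr2n mulrDl mul1r.
  by apply: lerD; (apply: le_trans (dM x); rewrite ler_piMl// norm3_ge0).
- by move=> x /inn[-> ->]; rewrite mulr1 scaler0 addr0.
- by move=> x /out ->; rewrite mulr0 !scale0r addr0.
Qed.

Lemma rdist_le eps x y : 0 < eps -> rdist eps x y <= eps^-1.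
Proof.
move=> eps0; rewrite /rdist lef_pV2 ?posrE//; last first.
  by rewrite sqrtr_gt0 ltr_wpDl ?dot3_ge0// exprn_gt0.
rewrite -[leLHS]gtr0_norm// -sqrtr_sqr ler_sqrt ?lerDr ?dot3_ge0//.
by rewrite addr_ge0 ?dot3_ge0 ?sqr_ge0.
Qed.

Lemma rdist_norm_le1 eps x y : 0 < eps -> rdist eps x y * norm3 (y - x) <= 1.
Proof.
move=> eps0; rewrite /rdist mulrC ler_pdivrMr; last first.
  by rewrite sqrtr_gt0 ltr_wpDl ?dot3_ge0// exprn_gt0.
by rewrite mul1r /norm3 ler_sqrt ?lerDl ?sqr_ge0// addr_ge0 ?dot3_ge0 ?sqr_ge0.
Qed.

Lemma rdist_continuous eps x : 0 < eps -> continuous (rdist eps x).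
Proof. by move=> eps0; have [] := C1grad_rdist x eps0. Qed.

End kernel_field.

Section local_estimate.
Context {R : realType}.
Local Notation M1 := (measurableTypeR R).
Variables (Omega : set (E3 R)) (sigma : {measure set (mE3 R) -> \bar R}).
Hypotheses (oOmega : open Omega) (bOmega : bounded_set Omega).
Hypothesis charts : forall x0, bdry Omega x0 -> exists r e1 e2 e3 psi,
  graph_chart Omega x0 r e1 e2 e3 psi.
Hypothesis surf : surface_measure Omega sigma.
Implicit Types (f : E3 R -> R) (df : E3 R -> E3 R) (x y : E3 R) (M eps : R).

(** The pairing of [df] with the gradient of [rdist eps x], written out. *)
Definition pole_integral df x eps : R :=
  \int[leb3]_(y in Omega) (- (rdist eps x y ^+ 3) * dot3 (y - x) (df y)).

(** The last term is the cost of replacing [f y] by [f x] under the kernel of mass bounded below,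
    with [M] a Lipschitz constant of [f] at [x]: it uses [3 eps^2 r^5 |y - x| <= 3 eps^2 r^4]. *)
Definition point_bound f df x M eps : \bar R :=
  (`|pole_integral df x eps|%:E + \int[leb3]_(y in Omega) (norm3 (df y))%:E +
   \int[leb3]_(y in Omega) `|f y|%:E +
   \int[sigma]_(y in bdry Omega) (`|f y| * rdist eps x y)%:E +
   (M * eps ^+ 2)%:E * \int[leb3]_(y in Omega) (rdist eps x y ^+ 4)%:E)%E.

Let mO : measurable (Omega : set (mE3 R)) := open3_measurable oOmega.

Let iO (g : E3 R -> R) : continuous g ->
  (leb3 : {measure set (mE3 R) -> \bar R}).-integrable Omega (EFin \o g).
Proof. by move=> cg; exact: bounded_integrable3. Qed.

Let I (g : E3 R -> R) : R := \int[leb3]_(y in Omega) g y.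

Let IE (g : E3 R -> R) : continuous g -> (I g)%:E = (\int[leb3]_(y in Omega) (g y)%:E)%E.
Proof.
move=> cg; rewrite /I /Rintegral fineK//.
exact: (integrable_fin_num mO (iO cg)).
Qed.

(* The pole is at a boundary point [x]; the kernel [3 eps^2 r^5], of mass
   bounded below, is minus the divergence of [- r^3 (y - x)]. The boundary term
   is harmless because [y - x] is almost tangential. *)
Lemma point_bound_local x0 : bdry Omega x0 -> exists2 U : set (E3 R), open U /\ U x0 &
  exists C e0 : R, [/\ 0 <= C, 0 < e0 & forall f df x M eps, C1grad f df ->
    bdry Omega x -> U x -> 0 <= M -> 0 < eps <= e0 ->
    (forall y, Omega y -> `|f y - f x| <= M * norm3 (y - x)) ->
    (`|f x|%:E <= C%:E * point_bound f df x M eps)%E].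
Proof.
move=> bx0; have [r [e1 [e2 [e3 [psi ch]]]]] := charts bx0.
have [r0 onb C11psi _] := ch.
have [rho [pat HB]] := bdry_patch oOmega ch bx0.
have [rho0 _ _ HO near_x] := pat.
have rho2 : 0 < rho / 2 by rewrite divr_gt0.
have rhalf : rho / 2 < rho by lra.
have rhalf2 : rho / 2 < 2 * rho by lra.
have [|cd [cd0 near_d]] := patch_density oOmega pat; first by lra.
set b := (coframe e1 e2 e3 x0).1 in HB HO near_x pat.
have [V [oV Vx] sV] := near_open near_x.
have [W [oW Wx] sW] := near_open near_d.
have [RR RR0 sR] : exists2 RR, 0 < RR & ball3 x0 (2 * RR) `<=` V `&` ball3 x0 r.
  have oVb : open (V `&` ball3 x0 r) by apply: openI => //; exact: open_ball3.
  have /nbhs_ballP[e /= e_0 He] := open_nbhs_nbhs (conj oVb (conj Vx (ball3_center x0 r0))).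
  exists (e / 4); first by rewrite divr_gt0.
  move=> z; rewrite /ball3/= => zz; apply: He; apply/ball_boxP.
  have h1 := coord11_le_norm3 (z - x0); have h2 := coord12_le_norm3 (z - x0).
  have h3 := coord2_le_norm3 (z - x0); rewrite /= in h1 h2 h3.
  by split; rewrite distrC; [apply: (le_lt_trans h1)|apply: (le_lt_trans h2)|apply: (le_lt_trans h3)]; clear -zz e_0 oOmega bOmega charts surf mO iO IE; lra.
have [chi [dchi [Mc [Cc c01 dcM inn out]]]] := cutoff_exists_flat x0 RR0.
have [L L0 HL] := C11_taylor C11psi.
have Mc0 : 0 <= Mc by apply: le_trans (dcM 0); exact: norm3_ge0.
(* Bound of [r ^+ 2] at distance at least [RR / 4] from the pole, where the cutoff may differ from
   1. *)
pose K := 16 / RR ^+ 2.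
have K0 : 0 <= K by rewrite divr_ge0// sqr_ge0.
(* Lower bound of the mass: within distance [eps] of the pole [r >= 1 / (2 * eps)], so [3 eps^2 r^5]
   is at least [3 / (32 eps^3)], on a set of volume at least [cd * eps ^+ 3]. *)
pose c0 := 3 / 32 * cd.
have c00 : 0 < c0 by rewrite mulr_gt0// divr_gt0.
pose C := (1 + K + K * Mc + L + 3) / c0.
exists (W `&` ball3 x0 (RR / 4)).
  split; first by apply: openI => //; exact: open_ball3.
  by split => //; apply: ball3_center; rewrite divr_gt0.
(* [eps <= cd] gives the density of the domain at radius [eps]; [eps <= RR / 8], with the pole
   within [RR / 4] of [x0], keeps that ball where [chi] is 1. *)
exists C, (Num.min cd (RR / 8)); split.
- apply: divr_ge0; last exact: ltW.
  by have := mulr_ge0 K0 Mc0; move: K0; generalize (K * Mc) K => w1 w2 ? ?; lra.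
- by rewrite lt_min cd0 divr_gt0.
move=> f df x M eps Cf bx [Wxx xx0] M0 /andP[eps0]; rewrite le_min => /andP[epscd epsR] lip.
rewrite /ball3/= in xx0.
have [cf cdf _] := Cf; have [cchi cdchi _] := Cc.
(* The localised function makes the field vanish on the sides and the top of the box, as the
   divergence theorem requires. *)
pose u y := chi y * f y; pose du y := chi y *: df y + f y *: dchi y.
have Cu : C1grad u du := C1gradM Cc Cf.
have [dH [CH divH]] := kernel_field_div x eps0 Cu.
pose H e y := u y * (- 1 * (rdist eps x y ^+ 3 * dot3 (y - x) e)).
have xr : ball3 x0 r x.
  by have [] // := sR x _; rewrite /ball3/=; lra.
have far y : closure Omega y -> ~ (`|(graph_cocoord e1 e2 e3 psi y).1.1 - b.1| < rho / 2 /\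
    `|(graph_cocoord e1 e2 e3 psi y).1.2 - b.2| < rho / 2 /\
    (graph_cocoord e1 e2 e3 psi y).2 < rho / 2 /\
    (Omega y -> 0 < (graph_cocoord e1 e2 e3 psi y).2)) -> chi y = 0 /\ dchi y = 0.
  move=> cy far; apply: out; rewrite leNgt; apply/negP => yR; apply: far.
  have [|Vy _] := sR y; first by rewrite /ball3/=; lra.
  by have [? ? /andP[_ ?] ?] := sV y Vy cy.
have PK := graph_coordK psi onb.
have QO y : (cc_rect b (rho / 2) `*` `]0, rho / 2]%classic) y -> Omega (graph_coord e1 e2 e3 psi y).
  move=> [/cc_rectE[h1 h2]]; rewrite /= in_itv/= => /andP[h3 h4].
  apply: HO; last by rewrite h3 (le_lt_trans h4).
    exact: le_lt_trans h1 rhalf.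
  exact: le_lt_trans h2 rhalf.
have cl y : cc_rect b (rho / 2) y.1 -> 0 <= y.2 <= rho / 2 -> closure Omega (graph_coord e1 e2 e3 psi y).
  move=> yb /andP[y0 yT]; have [y2|y2] := ltP 0 y.2.
    by apply: subset_closure; apply: QO; split => //=; rewrite in_itv/= y2.
  have -> : y = (y.1, 0) by rewrite [LHS]surjective_pairing; congr pair; apply/eqP; rewrite eq_le y2.
  suff [] : bdry Omega (graph_coord e1 e2 e3 psi (y.1, 0)) by [].
  apply: (chart_bdry_graph oOmega ch); move/cc_rectE : yb => [h1 h2]; apply: HB => /=.
  - exact: le_lt_trans h1 rhalf.
  - exact: le_lt_trans h2 rhalf.
  - by rewrite normr0 mulr_gt0.
have lat y : cc_rect b (rho / 2) y.1 -> 0 <= y.2 <= rho / 2 ->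
    `|y.1.1 - b.1| = rho / 2 \/ `|y.1.2 - b.2| = rho / 2 \/ y.2 = rho / 2 ->
    [/\ H e1 (graph_coord e1 e2 e3 psi y) = 0, H e2 (graph_coord e1 e2 e3 psi y) = 0 &
        H e3 (graph_coord e1 e2 e3 psi y) = 0].
  move=> yb y2 yE; have [|chi0 _] := far _ (cl y yb y2).
    rewrite PK => -[h1 [h2 [h3 _]]].
    by case: yE => [E|[E|E]]; [move: h1|move: h2|move: h3]; rewrite E ltxx.
  by rewrite /H /u chi0 !mul0r.
have out0 y : Omega (graph_coord e1 e2 e3 psi y) ->
    ~ (cc_rect b (rho / 2) `*` `]0, rho / 2]%classic) y ->
    dot3 (dH e1 (graph_coord e1 e2 e3 psi y)) e1 + dot3 (dH e2 (graph_coord e1 e2 e3 psi y)) e2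
    + dot3 (dH e3 (graph_coord e1 e2 e3 psi y)) e3 = 0.
  move=> Oy nQ; have [|chi0 dchi0] := far _ (subset_closure Oy).
    rewrite PK => -[h1 [h2 [h3 h4]]]; apply: nQ; split.
      by apply/cc_rectE; rewrite !ltW.
    by rewrite /= in_itv/= h4//= ltW.
  rewrite (divH _ _ _ onb) /u /du chi0 dchi0 !mul0r scale0r scaler0 addr0.
  by rewrite (_ : dot3 _ 0 = 0); [ring|rewrite /dot3 /=; ring].
have DT := graph_divergence onb C11psi (ltW rho2) (ltW rho2) mO QO (CH e1) (CH e2) (CH e3) lat out0.
pose F y := - (3 * eps ^+ 2 * rdist eps x y ^+ 5 * u y) - rdist eps x y ^+ 3 * dot3 (y - x) (du y).
have cr : continuous (rdist eps x) by exact: rdist_continuous.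
have crn n : continuous (fun y => rdist eps x y ^+ n).
  elim: n => [|n IHn] y; first exact: cvg_cst.
  rewrite (_ : (fun y => _) = fun y => rdist eps x y * rdist eps x y ^+ n).
    by apply: cvgM; [exact: cr|exact: IHn].
  by apply/funext => z; rewrite exprS.
have cz : continuous (fun y => y - x).
  by move=> y; apply: cvgB; [exact: cvg_id|exact: cvg_cst].
have cdz (d : E3 R -> E3 R) : continuous d -> continuous (fun y => dot3 (y - x) (d y)).
  by move=> cd'; exact: continuous_fun_dot3.
have [cu cdu _] := Cu.
have cmul (g h : E3 R -> R) : continuous g -> continuous h -> continuous (fun y => g y * h y).
  by move=> cg ch' y; apply: cvgM; [exact: cg|exact: ch'].
have ccst (k : R) : continuous (fun _ : E3 R => k) by move=> y; exact: cvg_cst.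
pose k y := 3 * eps ^+ 2 * rdist eps x y ^+ 5.
have ck : continuous k by exact: cmul.
have r_ge0 n y : 0 <= rdist eps x y ^+ n by apply: exprn_ge0; apply: ltW; exact: rdist_gt0.
have k0 y : 0 <= k y.
  by apply: mulr_ge0 => //; apply: mulr_ge0 => //; exact: sqr_ge0.
pose G (d : E3 R -> E3 R) y := - (rdist eps x y ^+ 3) * dot3 (y - x) (d y).
have cG d : continuous d -> continuous (G d).
  move=> cd'; apply: cmul; last exact: cdz.
  by move=> y; apply: cvgN; exact: crn.
have FE y : F y = - (k y * u y) + G du y by rewrite /F /k /G; ring.
have cF : continuous F.
  rewrite (funext FE) => y; apply: cvgD; last exact: cG.
  by apply: cvgN; exact: (cmul _ _ ck cu).
have cabsf : continuous (fun y => `|f y|).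
  by move=> y; apply: cvg_norm; exact: cf.
have csf : continuous (fun y => `|f y| * rdist eps x y) by exact: cmul.
have bd_ge0 y : 0 <= `|f y| * rdist eps x y by rewrite mulr_ge0// ltW// rdist_gt0.
pose S := (\int[sigma]_(y in bdry Omega) (`|f y| * rdist eps x y)%:E)%E.
have S0 : (0 <= S)%E by apply: integral_ge0 => y _; rewrite lee_fin.
have IF : (`|I F|%:E <= L%:E * S)%E.
  have -> : (`|I F|%:E = `| \int[leb2]_(y in cc_rect b (rho / 2)) (- (H e3 (graph_coord e1 e2 e3 psi (y, 0%R)) -
      (grad2 psi y).1 * H e1 (graph_coord e1 e2 e3 psi (y, 0%R)) -
      (grad2 psi y).2 * H e2 (graph_coord e1 e2 e3 psi (y, 0%R))))%:E |)%E.
    rewrite -DT -abse_EFin IE//; congr (`| _ |)%E; apply: eq_integral => y _.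
    by rewrite /F -(divH _ _ _ onb).
  pose J (y : R * R) := `|f (graph_coord e1 e2 e3 psi (y, 0))| * rdist eps x (graph_coord e1 e2 e3 psi (y, 0)).
  have mrect := cc_rect_measurable b (rho / 2).
  have cP0 : continuous (fun y : R * R => graph_coord e1 e2 e3 psi (y, 0)).
    move=> y; apply: (@continuous_comp _ _ _ (fun s : R * R => (s, 0 : R)) (graph_coord e1 e2 e3 psi)).
      exact: (cvg_pair (@cvg_id _ (nbhs y)) (cvg_cst _)).
    exact: continuous_graph_coord (C11_continuous C11psi) _.
  have cPh (h : E3 R -> R) : continuous h -> continuous (fun y : R * R => h (graph_coord e1 e2 e3 psi (y, 0))).
    by move=> ch' y; apply: (@continuous_comp _ _ _ (fun y : R * R => graph_coord e1 e2 e3 psi (y, 0)) h); [exact: cP0|exact: ch'].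
  have [cg1 cg2] := C11_grad_continuous C11psi.
  have cH e : continuous (H e) by have [] := CH e.
  have cbd : continuous (fun y : R * R => - (H e3 (graph_coord e1 e2 e3 psi (y, 0%R)) -
      (grad2 psi y).1 * H e1 (graph_coord e1 e2 e3 psi (y, 0%R)) -
      (grad2 psi y).2 * H e2 (graph_coord e1 e2 e3 psi (y, 0%R)))).
    move=> y; apply: cvgN; apply: cvgB; last by apply: cvgM; [exact: cg2|exact: (cPh _ (cH e2))].
    by apply: cvgB; [exact: (cPh _ (cH e3))|apply: cvgM; [exact: cg1|exact: (cPh _ (cH e1))]].
  have mbd := continuous2_measurable cbd.
  apply: (le_trans (le_abse_integral _ mrect _)).
    by apply: measurable_funTS; apply/measurable_EFinP; exact: mbd.
  apply: (@le_trans _ _ (\int[leb2]_(y in cc_rect b (rho / 2)) (L%:E * (J y)%:E))%E).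
    apply: ge0_le_integral => //.
    - by apply: measurableT_comp => //; apply: measurable_funTS; apply/measurable_EFinP; exact: mbd.
    - apply: measurable_funTS; apply: measurable_funeM; apply/measurable_EFinP.
      exact: (continuous2_measurable (cPh _ csf)).
    move=> y _; rewrite -EFinM lee_fin normrN.
    set yb := (graph_cocoord e1 e2 e3 psi x).1.
    have xE := chart_coordK oOmega ch xr bx; cbv beta in xE; rewrite -/yb in xE.
    clearbody yb.
    have dd1 z : dot3 (graph_coord e1 e2 e3 psi (z, 0)) e1 = z.1.
      exact: (congr1 (fun z : E3 R => z.1.1) (frameK onb (z, psi z + 0))).
    have dd2 z : dot3 (graph_coord e1 e2 e3 psi (z, 0)) e2 = z.2.
      exact: (congr1 (fun z : E3 R => z.1.2) (frameK onb (z, psi z + 0))).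
    have d1 : dot3 (graph_coord e1 e2 e3 psi (y, 0) - x) e1 = y.1 - yb.1.
      by rewrite dot3Bl dd1 -xE dd1.
    have d2 : dot3 (graph_coord e1 e2 e3 psi (y, 0) - x) e2 = y.2 - yb.2.
      by rewrite dot3Bl dd2 -xE dd2.
    have dd z : dot3 (graph_coord e1 e2 e3 psi (z, 0)) e3 = psi z.
      exact: (etrans (congr1 (fun z : E3 R => z.2) (frameK onb (z, psi z + 0))) (addr0 _)).
    have d3 : dot3 (graph_coord e1 e2 e3 psi (y, 0) - x) e3 = psi y - psi yb.
      by rewrite dot3Bl dd -xE dd.
    rewrite /H d1 d2 d3 /J; move: (graph_coord e1 e2 e3 psi (y, 0)) d1 d2 d3 => Y d1 d2 d3.
    (* The flux through the boundary is the first order Taylor remainder of [psi] between the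
       running point and the pole. Being quadratic in the distance it absorbs two powers of the
       kernel, and [r ^+ 3] drops to [r]. *)
    rewrite (_ : _ - _ = u Y * rdist eps x Y ^+ 3 * (psi yb - psi y -
      (grad2 psi y).1 * (yb.1 - y.1) - (grad2 psi y).2 * (yb.2 - y.2))); last by ring.
    have uf : `|u Y| <= `|f Y|.
      by have /andP[h0 h1] := c01 Y; rewrite normrM (ger0_norm h0) ler_piMl.
    have r_0 : 0 < rdist eps x Y := rdist_gt0 x eps0 Y.
    have nz : `|yb - y| <= norm3 (Y - x).
      have E : dot3 (Y - x) (Y - x) = (yb.1 - y.1) ^+ 2 + (yb.2 - y.2) ^+ 2 + (psi y - psi yb) ^+ 2.
        by rewrite -(frame_dot3 _ _ onb) d1 d2 d3; ring.
      rewrite prod_norm_le /= /norm3 E -!sqrtr_sqr !ler_sqrt ?addr_ge0 ?sqr_ge0//.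
      apply/andP; split; first by rewrite -addrA lerDl addr_ge0 ?sqr_ge0.
      by rewrite addrAC lerDr addr_ge0 ?sqr_ge0.
    have rz := @rdist_norm_le1 R eps x Y eps0.
    have h1 : rdist eps x Y ^+ 2 * `|yb - y| ^+ 2 <= 1.
      rewrite -exprMn expr_le1 ?mulr_ge0 ?(ltW r_0)//.
      by apply: le_trans rz; rewrite ler_pM2l.
    rewrite normrM normrM (ger0_norm (exprn_ge0 3 (ltW r_0))).
    apply: (le_trans (ler_wpM2l _ (HL y yb))); first by rewrite mulr_ge0// exprn_ge0// ltW.
    rewrite [leLHS](_ : _ = `|u Y| * (L * rdist eps x Y) * (rdist eps x Y ^+ 2 * `|yb - y| ^+ 2)); last by ring.
    apply: (@le_trans _ _ (`|u Y| * (L * rdist eps x Y))).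
      by rewrite ler_piMr// mulr_ge0// mulr_ge0// ltW.
    rewrite [leRHS](_ : _ = `|f Y| * (L * rdist eps x Y)); last by ring.
    by rewrite ler_wpM2r// mulr_ge0// ltW.
  rewrite ge0_integralZl//; last 2 first.
  - by apply: measurable_funTS; apply/measurable_EFinP; exact: (continuous2_measurable (cPh _ csf)).
  - by move=> y _; rewrite lee_fin; exact: bd_ge0.
  apply: lee_wpmul2l; first by rewrite lee_fin.
  apply: (ge_chart_integral oOmega surf ch bx0 (F := fun y => (`|f y| * rdist eps x y)%:E)).
  - by apply/measurable_EFinP; exact: continuous3_measurable.
  - by move=> y; rewrite lee_fin.
  - move=> y /cc_rectE[h1 h2]; apply: HB => /=.
    + exact: le_lt_trans h1 rhalf.
    + exact: le_lt_trans h2 rhalf.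
    + by rewrite normr0 mulr_gt0.
(* Only the part of the domain within [eps] of the pole is kept. *)
have Ick : c0 <= I (fun y => k y * chi y).
  rewrite -lee_fin IE; last exact: cmul.
  have mB : measurable (ball3 x eps `&` Omega : set (mE3 R)).
    by apply: measurableI => //; apply: open3_measurable; exact: open_ball3.
  apply: (@le_trans _ _ (\int[leb3]_(y in ball3 x eps `&` Omega) (k y * chi y)%:E)%E); last first.
    apply: ge0_subset_integral => //.
    - by apply: measurable_funTS; apply/measurable_EFinP; apply: continuous3_measurable; exact: cmul.
    - by move=> y _; rewrite lee_fin mulr_ge0//; case/andP: (c01 y).
  apply: (@le_trans _ _ (\int[leb3]_(y in ball3 x eps `&` Omega) cst (3 / (32 * eps ^+ 3))%:E y)%E).
    rewrite integral_cst//.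
    have [cbx _] : closure Omega x /\ ~ Omega x by exact/bdryE.
    have dens := sW x Wxx cbx eps (introT andP (conj eps0 epscd)).
    apply: (le_trans _ (lee_wpmul2l _ dens)); last by rewrite lee_fin divr_ge0// mulr_ge0// exprn_ge0// ltW.
    rewrite -EFinM lee_fin /c0 le_eqVlt; apply/orP; left; apply/eqP; field.
    by rewrite gt_eqF.
  apply: ge0_le_integral => //.
  - by move=> y _; rewrite lee_fin divr_ge0// mulr_ge0// exprn_ge0// ltW.
  - by apply: measurable_funTS; apply/measurable_EFinP; apply: continuous3_measurable; exact: cmul.
  move=> y [yx Oy]; rewrite /ball3/= in yx; rewrite lee_fin.
  have [-> _] : chi y = 1 /\ dchi y = 0.
    by apply: inn; have := norm3_triangleB y x x0; clear -yx xx0 epsR RR0 oOmega bOmega charts surf mO iO IE; lra.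
  rewrite mulr1 /k.
  have h2 : (2 * eps)^-1 <= rdist eps x y.
    rewrite /rdist lef_pV2 ?posrE ?mulr_gt0//; last first.
      by rewrite sqrtr_gt0 ltr_wpDl ?dot3_ge0// exprn_gt0.
    rewrite -[leRHS]ger0_norm ?mulr_ge0 ?(ltW eps0)// -sqrtr_sqr ler_sqrt ?sqr_ge0//.
    rewrite -norm3_sqr exprMn; have := norm3_ge0 (y - x); clear -yx eps0 oOmega bOmega charts surf mO iO IE; nra.
  have e_2 : 0 <= (2 * eps)^-1 by rewrite invr_ge0 mulr_ge0// ltW.
  have := lerXn2r 5 _ _ h2; rewrite !nnegrE => /(_ e_2 (ltW (rdist_gt0 x eps0 y))) h5.
  apply: (le_trans _ (ler_wpM2l _ h5)); last by rewrite mulr_ge0// sqr_ge0.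
  rewrite le_eqVlt; apply/orP; left; apply/eqP; field.
  by rewrite gt_eqF.
have cnd : continuous (fun y => norm3 (df y)).
  by move=> y; exact: (@continuous_comp _ _ _ df (@norm3 R) _ (cdf y) (@continuous_norm3 R _)).
have cchi1 : continuous (fun y => (chi y - 1) * G df y).
  by apply: cmul; [move=> y; apply: cvgB; [exact: cchi|exact: cvg_cst]|exact: cG].
have cfdc : continuous (fun y => f y * G dchi y) by apply: cmul => //; exact: cG.
have cfx : continuous (fun y => k y * chi y * (f y - f x)).
  apply: (cmul (fun y => k y * chi y) _); first exact: cmul.
  by move=> y; apply: cvgB; [exact: cf|exact: cvg_cst].
(* Away from the pole the gradient of the kernel is bounded uniformly in [eps], so the terms created
   by the cutoff are of lower order. *)
have Gbound d y : RR / 4 <= norm3 (y - x) -> `|G d y| <= K * norm3 (d y).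
  move=> yx; have yx0 : 0 < norm3 (y - x) by apply: lt_le_trans yx; rewrite divr_gt0.
  have r_0 : 0 < rdist eps x y := rdist_gt0 x eps0 y.
  have rz := @rdist_norm_le1 R eps x y eps0.
  have rK : rdist eps x y <= 4 / RR.
    rewrite ler_pdivlMr//; apply: le_trans (_ : rdist eps x y * (4 * norm3 (y - x)) <= _).
      by rewrite ler_pM2l//; clear -yx oOmega bOmega charts surf mO iO IE; lra.
    by clear -rz oOmega bOmega charts surf mO iO IE; lra.
  rewrite /G normrM normrN (ger0_norm (exprn_ge0 3 (ltW r_0))).
  apply: (le_trans (ler_wpM2l (exprn_ge0 3 (ltW r_0)) (dot3_CS _ _))).
  rewrite [leLHS](_ : _ = rdist eps x y ^+ 2 * norm3 (d y) * (rdist eps x y * norm3 (y - x))); last by ring.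
  have nd := norm3_ge0 (d y).
  apply: (@le_trans _ _ (rdist eps x y ^+ 2 * norm3 (d y))).
    by rewrite ler_piMr// mulr_ge0// sqr_ge0.
  rewrite ler_wpM2r// /K (_ : 16 / _ = (4 / RR) ^+ 2); last by field; rewrite gt_eqF.
  by rewrite lerXn2r// nnegrE ?(ltW r_0)// divr_ge0// ltW.
have farx y : ~ (norm3 (y - x0) <= RR / 2) -> RR / 4 <= norm3 (y - x).
  by move=> /negP; rewrite -ltNge => h; have := norm3_triangleB y x x0; clear -h xx0 oOmega bOmega charts surf mO iO IE; lra.
have absI (g h : E3 R -> R) : continuous g -> continuous h ->
    (forall y, Omega y -> `|g y| <= h y) -> `|I g| <= I h.
  move=> cg ch' gh; apply: le_trans (le_normr_Rintegral mO (iO cg)) _.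
  apply: le_Rintegral => //; last exact: iO.
  by apply: iO => y; apply: cvg_norm; exact: cg.
have B1 : `|I (fun y => (chi y - 1) * G df y)| <= K * I (fun y => norm3 (df y)).
  rewrite -(RintegralZl _ mO (iO cnd)); apply: absI => //; first exact: cmul.
  move=> y _; have [/inn[-> _]|/farx/(Gbound df) h] := pselect (norm3 (y - x0) <= RR / 2).
    by rewrite subrr mul0r normr0 mulr_ge0// norm3_ge0.
  rewrite normrM; apply: le_trans h; rewrite ler_piMl//.
  by have /andP[q1 q2] := c01 y; rewrite ler_norml; apply/andP; split; clear -q1 q2 oOmega bOmega charts surf mO iO IE; lra.
have B2 : `|I (fun y => f y * G dchi y)| <= K * Mc * I (fun y => `|f y|).
  rewrite -(RintegralZl _ mO (iO cabsf)); apply: absI => //; first exact: cmul.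
  move=> y _; rewrite normrM mulrC.
  have [/inn[_ d0]|/farx/(Gbound dchi) h] := pselect (norm3 (y - x0) <= RR / 2).
    rewrite /G d0 (_ : dot3 _ _ = 0); last by rewrite /dot3/=; ring.
    by rewrite mulr0 normr0 mul0r; apply: mulr_ge0 => //; exact: mulr_ge0.
  apply: ler_wpM2r => //; apply: (le_trans h); rewrite ler_wpM2l//.
have cr4 : continuous (fun y => rdist eps x y ^+ 4) by exact: crn.
have B3 : `|I (fun y => k y * chi y * (f y - f x))| <= 3 * (M * eps ^+ 2) * I (fun y => rdist eps x y ^+ 4).
  rewrite -(RintegralZl _ mO (iO cr4)); apply: absI => //; first exact: cmul.
  move=> y Oy; have r_0 : 0 < rdist eps x y := rdist_gt0 x eps0 y.
  have rz := @rdist_norm_le1 R eps x y eps0; have /andP[h0 h1] := c01 y.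
  rewrite normrM (ger0_norm (mulr_ge0 (k0 y) h0)).
  apply: (@le_trans _ _ (k y * `|f y - f x|)).
    by rewrite ler_wpM2r// ler_piMr.
  apply: (le_trans (ler_wpM2l (k0 y) (lip y Oy))); rewrite /k.
  rewrite [leLHS](_ : _ = 3 * (M * eps ^+ 2) * rdist eps x y ^+ 4 * (rdist eps x y * norm3 (y - x))); last by ring.
  rewrite ler_piMr//; apply: mulr_ge0 => //; apply: mulr_ge0 => //.
  by apply: mulr_ge0 => //; exact: sqr_ge0.
(* Pointwise [G du - F] is [k * chi * f]; splitting [f y] into [f x] and [f y - f x], and [G du]
   into the uncut pairing plus cutoff errors, gives the identity. *)
have Iid : f x * I (fun y => k y * chi y) = pole_integral df x eps +
    I (fun y => (chi y - 1) * G df y) + I (fun y => f y * G dchi y) - I F -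
    I (fun y => k y * chi y * (f y - f x)).
  rewrite /I /pole_integral -(RintegralZl _ mO (iO (cmul _ _ ck cchi))).
  rewrite -RintegralD//; [|exact: (iO (cG _ cdf))|exact: iO].
  rewrite -RintegralD//; [|apply: iO|exact: iO]; last first.
    by move=> y; apply: cvgD; [exact: (cG _ cdf)|exact: cchi1].
  rewrite -RintegralB//; [|apply: iO|exact: iO]; last first.
    by move=> y; apply: cvgD; [apply: cvgD; [exact: (cG _ cdf)|exact: cchi1]|exact: cfdc].
  rewrite -RintegralB//; [|apply: iO|exact: iO]; last first.
    move=> y; apply: cvgB; last exact: cF.
    by apply: cvgD; [apply: cvgD; [exact: (cG _ cdf)|exact: cchi1]|exact: cfdc].
  apply: eq_Rintegral => y _; rewrite FE /G /u /du dot3Dr !dot3Zr.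
  by ring.
have fin : ((c0 * `|f x|)%:E <= (1 + K + K * Mc + L + 3)%:E * point_bound f df x M eps)%E.
  have A0 : 0 <= I (fun y => norm3 (df y)) by apply: Rintegral_ge0 => y _; exact: norm3_ge0.
  have A1 : 0 <= I (fun y => `|f y|) by apply: Rintegral_ge0.
  have A2 : 0 <= I (fun y => rdist eps x y ^+ 4).
    by apply: Rintegral_ge0 => y _.
  (* An infinite surface integral makes the bound trivial; otherwise all terms are real numbers. *)
  have [Soo|Sfin] := eqVneq S +oo%E.
    rewrite /point_bound -/S Soo; set X := (_ + _)%E.
    have -> : X = +oo%E.
      by rewrite /X -!IE// addey// ?addye// -EFinM ?ltNye.
    rewrite gt0_muley ?leey// lte_fin.
    by have KM := mulr_ge0 K0 Mc0; clear -KM K0 L0 oOmega bOmega charts surf mO iO IE; lra.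
  have SR : S \is a fin_num by rewrite ge0_fin_numE// lt_neqAle Sfin leey.
  move: IF; rewrite /point_bound -/S -(IE cnd) -(IE cabsf) -(IE cr4) -(fineK SR).
  rewrite -!EFinM !lee_fin => IF.
  have s0 : 0 <= fine S by rewrite fine_ge0.
  apply: (@le_trans _ _ (`|f x * I (fun y => k y * chi y)|)).
    rewrite normrM mulrC ler_wpM2l// ger0_norm//.
    by apply: le_trans Ick; exact: ltW.
  rewrite Iid.
  have T4 (a1 a2 a3 a4 a5 : R) : `|a1 + a2 + a3 - a4 - a5| <= `|a1| + `|a2| + `|a3| + `|a4| + `|a5|.
    apply: (le_trans (ler_normB _ _)); rewrite lerD2r.
    apply: (le_trans (ler_normB _ _)); rewrite lerD2r.
    by apply: (le_trans (ler_normD _ _)); rewrite lerD2r ler_normD.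
  apply: (le_trans (T4 _ _ _ _ _)).
  have P0 := normr_ge0 (pole_integral df x eps).
  have ME : 0 <= M * eps ^+ 2 by rewrite mulr_ge0// sqr_ge0.
  move: B1 B2 B3 IF A0 A1 A2 P0 ME s0.
  move: (`|pole_integral df x eps|) (`|I (fun y => (chi y - 1) * G df y)|) => p b1.
  move: (`|I (fun y => f y * G dchi y)|) (`|I F|) (`|I (fun y => k y * chi y * (f y - f x))|) => b2 b4 b3.
  move: (I (fun y => norm3 (df y))) (I (fun y => `|f y|)) (I (fun y => rdist eps x y ^+ 4)) (fine S) (M * eps ^+ 2) => i1 i2 i4 s m.
  move=> B1 B2 B3 B4 i10 i20 i40 p0 m0 s0.
  have KM : 0 <= K * Mc by rewrite mulr_ge0.
  clear -B1 B2 B3 B4 i10 i20 i40 p0 m0 s0 KM K0 L0 oOmega bOmega charts surf mO iO IE.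
  have Z : 0 <= m * i4 by rewrite mulr_ge0.
  apply: (@le_trans _ _ (p + K * i1 + K * Mc * i2 + L * s + 3 * (m * i4))); first by lra.
  set T := 1 + K + K * Mc + L + 3; move: (m * i4) Z => w Z.
  have t1 : p <= T * p by rewrite ler_peMl// /T; lra.
  have t2 : K * i1 <= T * i1 by rewrite ler_wpM2r// /T; lra.
  have t3 : K * Mc * i2 <= T * i2 by rewrite ler_wpM2r// /T; lra.
  have t4 : L * s <= T * s by rewrite ler_wpM2r// /T; lra.
  have t5 : 3 * w <= T * w by rewrite ler_wpM2r// /T; lra.
  by rewrite !mulrDr; lra.
have c0' : (0 <= (c0^-1)%:E :> \bar R)%E by rewrite lee_fin invr_ge0 ltW.
have := lee_wpmul2l c0' fin; rewrite muleA -!EFinM mulrA mulVf ?gt_eqF// mul1r.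
by rewrite [c0^-1 * _]mulrC.
Qed.

End local_estimate.

(** * Uniform integral bounds for powers of the kernel *)

Section kernels.
Context {R : realType}.
Local Notation M1 := (measurableTypeR R).
Variables (Omega : set (E3 R)) (sigma : {measure set (mE3 R) -> \bar R}).
Hypotheses (oOmega : open Omega) (bOmega : bounded_set Omega).
Hypothesis charts : forall x0, bdry Omega x0 -> exists r e1 e2 e3 psi,
  graph_chart Omega x0 r e1 e2 e3 psi.
Hypothesis surf : surface_measure Omega sigma.
Implicit Types (f : E3 R -> R) (df : E3 R -> E3 R) (x y : E3 R) (M eps : R).

Lemma point_bound_ge0 f df x M eps : 0 <= M -> 0 < eps ->
  (0 <= point_bound Omega sigma f df x M eps)%E.
Proof.
move=> M0 eps0.
have i0 d (T : measurableType d) (mu : {measure set T -> \bar R}) D (g : T -> R) :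
    (forall t : T, 0 <= g t) -> (0 <= \int[mu]_(t in D) (g t)%:E)%E.
  by move=> g0; apply: integral_ge0 => t _; rewrite lee_fin.
rewrite /point_bound; apply: adde_ge0; [apply: adde_ge0; [apply: adde_ge0; [apply: adde_ge0|]|]|].
- by rewrite lee_fin.
- by apply: i0 => y; exact: norm3_ge0.
- exact: i0.
- by apply: i0 => y; rewrite mulr_ge0// ltW// rdist_gt0.
- apply: mule_ge0; first by rewrite lee_fin mulr_ge0// sqr_ge0.
  by apply: i0 => y; rewrite exprn_ge0// ltW// rdist_gt0.
Qed.

(** Compactness of the boundary; the largest admissible [eps] of a union is the smaller of the
    two. *)
Lemma point_bound_global : exists C e0 : R, [/\ 0 <= C, 0 < e0 &
  forall f df x M eps, C1grad f df -> bdry Omega x -> 0 <= M -> 0 < eps <= e0 ->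
    (forall y, Omega y -> `|f y - f x| <= M * norm3 (y - x)) ->
    (`|f x|%:E <= C%:E * point_bound Omega sigma f df x M eps)%E].
Proof.
pose G := [set U : set (E3 R) | exists C e0 : R, [/\ 0 <= C, 0 < e0 &
  forall f df x M eps, C1grad f df -> bdry Omega x -> U x -> 0 <= M -> 0 < eps <= e0 ->
    (forall y, Omega y -> `|f y - f x| <= M * norm3 (y - x)) ->
    (`|f x|%:E <= C%:E * point_bound Omega sigma f df x M eps)%E]].
have [||x0 bx0|U bU [C [e0 [C0 e00 H]]]] := @compact_union_cover _ (bdry Omega) G (compact_bdry bOmega).
- by exists 0, 1; split.
- move=> U V [C1 [e1 [C10 e10 H1]]] [C2 [e2 [C20 e20 H2]]].
  exists (C1 + C2), (Num.min e1 e2); split; [exact: addr_ge0|by rewrite lt_min e10|].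
  move=> f df x M eps Cf bx [Ux|Vx] M0 /andP[eps0]; rewrite le_min => /andP[epse1 epse2] lip.
  + apply: (le_trans (H1 f df x M eps Cf bx Ux M0 _ lip)); first by rewrite eps0.
    by apply: lee_wpmul2r; [exact: point_bound_ge0|rewrite lee_fin lerDl].
  + apply: (le_trans (H2 f df x M eps Cf bx Vx M0 _ lip)); first by rewrite eps0.
    by apply: lee_wpmul2r; [exact: point_bound_ge0|rewrite lee_fin lerDr].
- have [U oU H] := point_bound_local oOmega bOmega charts surf bx0.
  by exists U.
exists C, e0; split => // f df x M eps Cf bx; exact: (H f df x M eps Cf bx (bU x bx)).
Qed.

Lemma domain_density : exists2 c : R, 0 < c & forall x (d : R), Omega x -> 0 < d <= c ->
  ((c * d ^+ 3)%:E <= leb3 (ball3 x d `&` Omega : set (mE3 R)))%E.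
Proof.
pose G := [set U : set (E3 R) | exists2 c : R, 0 < c & forall x (d : R), Omega x -> U x ->
  0 < d <= c -> ((c * d ^+ 3)%:E <= leb3 (ball3 x d `&` Omega : set (mE3 R)))%E].
have near_patch x0 e1 e2 e3 psi b rho tau : patch Omega x0 e1 e2 e3 psi b rho tau ->
    tau <= 3 / 2 * rho -> exists2 U : set (E3 R), open U /\ U x0 & G U.
  move=> pat taurho; have [c [c0 near_d]] := patch_density oOmega pat taurho.
  have [U oU HU] := near_open near_d; exists U => //; exists c => // x d Ox Ux.
  exact: (HU x Ux (subset_closure Ox)).
have [||x0 cx0|U cU [c c0 H]] := @compact_union_cover _ (closure Omega) G
  (bounded_closure_compact bOmega).
- by exists 1.
- move=> U V [c1 c10 H1] [c2 c20 H2]; exists (Num.min c1 c2); first by rewrite lt_min c10.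
  move=> x d Ox UVx /andP[d0]; rewrite le_min => /andP[d1 d2].
  have d3 : 0 <= d ^+ 3 by rewrite exprn_ge0// ltW.
  case: UVx => [Ux|Vx].
    apply: le_trans (H1 x d Ox Ux _); last by rewrite d0.
    by rewrite lee_fin ler_wpM2r// ge_min lexx.
  apply: le_trans (H2 x d Ox Vx _); last by rewrite d0.
  by rewrite lee_fin ler_wpM2r// ge_min lexx orbT.
- have [Ox|nOx] := pselect (Omega x0).
    have [c [b [rho pat]]] := interior_patch oOmega Ox.
    exact: near_patch pat (lexx _).
  have bx : bdry Omega x0 by apply/bdryE.
  have [r [e1 [e2 [e3 [psi ch]]]]] := charts bx.
  have [rho [pat _]] := bdry_patch oOmega ch bx.
  have [rho0 _ _ _ _] := pat.
  by apply: (near_patch _ _ _ _ _ _ _ _ pat); lra.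
by exists c => // x d Ox; apply: H => //; apply: cU; exact: subset_closure.
Qed.

(** By [(|v| + eps)^2 <= 2 v^2 + 2 eps^2] any coordinate [v] of [y - x] bounds the kernel; a power
    of the kernel is thus dominated by a product of one-dimensional kernels. *)
Lemma rdist_coord (v eps : R) x y : 0 < eps -> `|v| <= norm3 (y - x) ->
  rdist eps x y <= 2 * (`|v| + eps)^-1.
Proof.
move=> eps0 vy; have ve : 0 < `|v| + eps by rewrite ltr_wpDl.
rewrite -[2]invrK -invfM /rdist lef_pV2 ?posrE ?mulr_gt0 ?invr_gt0//; last first.
  by rewrite sqrtr_gt0 ltr_wpDl ?dot3_ge0// exprn_gt0.
have h0 : 0 <= 2^-1 * (`|v| + eps) by rewrite mulr_ge0// ltW.
rewrite -[leLHS]ger0_norm// -sqrtr_sqr ler_sqrt; last by rewrite addr_ge0 ?dot3_ge0 ?sqr_ge0.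
rewrite -norm3_sqr; have := normr_ge0 v; have n0 := norm3_ge0 (y - x).
move: vy eps0 n0; move: (norm3 (y - x)) (`|v|) => n w wn e0 n0 w0.
have h1 : (w + eps) ^+ 2 <= 2 * w ^+ 2 + 2 * eps ^+ 2 by exact: sqrD_le2.
have h2 : w ^+ 2 <= n ^+ 2 by rewrite lerXn2r.
have h3 : 0 <= eps ^+ 2 by exact: sqr_ge0.
have h4 : 0 <= w ^+ 2 by exact: sqr_ge0.
rewrite exprMn exprVn; have -> : (2 ^+ 2)^-1 = 4^-1 :> R by congr (_^-1); ring.
lra.
Qed.

Lemma rdist_powR_coord (v p eps : R) x y : 0 < eps -> 0 <= p -> `|v| <= norm3 (y - x) ->
  rdist eps x y `^ p <= 2 `^ p * (`|v| + eps) `^ (- p).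
Proof.
move=> eps0 p0 vy; have ve : 0 < `|v| + eps by rewrite ltr_wpDl.
have -> : (`|v| + eps) `^ (- p) = ((`|v| + eps)^-1) `^ p.
  by rewrite -(powR_inv1 (ltW ve)) -powRrM mulN1r.
rewrite -powRM ?invr_ge0 ?(ltW ve)//; apply: ge0_ler_powR => //.
- by rewrite nnegrE ltW// rdist_gt0.
- by rewrite nnegrE mulr_ge0// invr_ge0 ltW.
- exact: rdist_coord.
Qed.

Lemma integral_prod2 (G1 G2 : M1 -> \bar R) :
  measurable_fun setT G1 -> measurable_fun setT G2 ->
  (forall t, (0 <= G1 t)%E) -> (forall t, (0 <= G2 t)%E) ->
  (\int[leb2]_y (G1 y.1 * G2 y.2) = \int[leb1]_t G1 t * \int[leb1]_t G2 t)%E.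
Proof.
move=> m1 m2 p1 p2.
have mF : measurable_fun [set: M1 * M1] (fun p : M1 * M1 => G1 p.1 * G2 p.2)%E.
  apply: emeasurable_funM; first exact: (measurableT_comp m1 measurable_fst).
  exact: (measurableT_comp m2 measurable_snd).
have F0 (p : M1 * M1) : (0 <= G1 p.1 * G2 p.2)%E by exact: mule_ge0.
apply: (etrans (@fubini_tonelli1 _ _ _ _ R (@lebesgue_measure R) (@lebesgue_measure R) _ mF F0)).
rewrite /fubini_F /=.
under eq_integral do rewrite ge0_integralTZl//.
by rewrite ge0_integralTZr//; exact: integral_ge0.
Qed.

Lemma integral_prod3 (G1 G2 G3 : M1 -> \bar R) :
  measurable_fun setT G1 -> measurable_fun setT G2 -> measurable_fun setT G3 ->
  (forall t, (0 <= G1 t)%E) -> (forall t, (0 <= G2 t)%E) -> (forall t, (0 <= G3 t)%E) ->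
  (\int[leb3]_y (G1 y.1.1 * G2 y.1.2 * G3 y.2) =
   \int[leb1]_t G1 t * \int[leb1]_t G2 t * \int[leb1]_t G3 t)%E.
Proof.
move=> m1 m2 m3 p1 p2 p3.
have m12 : measurable_fun [set: M1 * M1] (fun p : M1 * M1 => G1 p.1 * G2 p.2)%E.
  apply: emeasurable_funM; first exact: (measurableT_comp m1 measurable_fst).
  exact: (measurableT_comp m2 measurable_snd).
have mF : measurable_fun [set: mE3 R] (fun p : mE3 R => G1 p.1.1 * G2 p.1.2 * G3 p.2)%E.
  apply: emeasurable_funM; first exact: (measurableT_comp m12 measurable_fst).
  exact: (measurableT_comp m3 measurable_snd).
have p12 (p : M1 * M1) : (0 <= G1 p.1 * G2 p.2)%E by exact: mule_ge0.
have F0 (y : mE3 R) : (0 <= G1 y.1.1 * G2 y.1.2 * G3 y.2)%E by apply: mule_ge0; [exact: p12|].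
apply: (etrans (leb3_tonelli mF F0)) => /=.
under eq_integral do rewrite ge0_integralTZl//.
rewrite ge0_integralTZr//; last exact: integral_ge0.
by rewrite integral_prod2.
Qed.

(** One factor of that product: the kernel in a single coordinate with pole [a], cut to the window
    of radius [B] around [b]. *)
Let G (q b B eps a : R) : M1 -> \bar R :=
  (fun t => (2 `^ q * (`|t - a| + eps) `^ (- q))%:E) \_ `[b - B, b + B].

Let mG q b B eps a : measurable_fun setT (G q b B eps a).
Proof.
apply/(measurable_restrictT _ (measurable_itv _)); apply: measurable_funTS.
apply/measurable_EFinP; apply: measurable_funM => //.
apply: (measurableT_comp (measurable_powR _)); apply: measurable_funD => //.
by apply: measurableT_comp => //; exact: measurable_funB.
Qed.

Let G0 q b B eps a t : (0 <= G q b B eps a t)%E.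
Proof. by apply: erestrict_ge0 => s _; rewrite lee_fin mulr_ge0// powR_ge0. Qed.

Let Gb q B : 0 < q < 1 -> 0 < B -> exists2 K : R, 0 <= K & forall b a eps, 0 < eps <= 1 ->
  (\int[leb1]_t G q b B eps a t <= K%:E)%E.
Proof.
move=> q01 B0; have [K K0 HK] := power_kernel_bound q01 B0.
exists (2 `^ q * K); first by rewrite mulr_ge0// powR_ge0.
move=> b a eps e01; rewrite -integral_mkcond.
under eq_integral do rewrite EFinM.
rewrite ge0_integralZl//.
- by rewrite EFinM; apply: lee_wpmul2l; [rewrite lee_fin powR_ge0|exact: HK].
- apply: measurable_funTS; apply/measurable_EFinP.
  apply: (measurableT_comp (measurable_powR _)); apply: measurable_funD => //.
  by apply: measurableT_comp => //; exact: measurable_funB.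
- by move=> t _; rewrite lee_fin powR_ge0.
Qed.

Lemma measurable_rdist_powR eps x (p : R) : 0 < eps ->
  measurable_fun [set: mE3 R] (fun y : mE3 R => (rdist eps x y `^ p)%:E).
Proof.
move=> eps0; apply/measurable_EFinP; apply: (measurableT_comp (measurable_powR _)).
by apply: continuous3_measurable; exact: rdist_continuous.
Qed.

(** Each of the three coordinates receives the exponent 11/12, which is below 1, so the
    one-dimensional bound applies three times. *)
Lemma domain_kernel_bound : exists2 K : R, 0 <= K & forall x eps, 0 < eps <= 1 ->
  (\int[leb3]_(y in Omega) (rdist eps x y `^ (11 / 4))%:E <= K%:E)%E.
Proof.
have [B B0 HB] := bounded_norm3 bOmega.
have q01 : 0 < (11 / 12 : R) < 1 by rewrite divr_gt0//= ltr_pdivrMr// mul1r ltr_nat.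
have [K K0 HK] := Gb q01 B0; exists (K * K * K); first by rewrite !mulr_ge0.
move=> x eps e01; have /andP[eps0 _] := e01.
pose g a := G (11 / 12) 0 B eps a.
apply: (@le_trans _ _ (\int[leb3]_y (g x.1.1 y.1.1 * g x.1.2 y.1.2 * g x.2 y.2))%E); last first.
  rewrite integral_prod3; try exact: mG; try by move=> t; exact: G0.
  rewrite !EFinM; apply: lee_pmul; [| |apply: lee_pmul|]; try exact: HK;
    by rewrite ?mule_ge0// integral_ge0// => t _; exact: G0.
rewrite integral_mkcond; apply: ge0_le_integral => //.
- by move=> y _; apply: erestrict_ge0 => z _; rewrite lee_fin powR_ge0.
- apply/(measurable_restrictT _ (open3_measurable oOmega)); apply: measurable_funTS.
  exact: measurable_rdist_powR.
- apply: emeasurable_funM; last exact: (measurableT_comp (mG _ _ _ _ _) measurable_snd).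
  apply: emeasurable_funM.
    exact: (measurableT_comp (mG _ _ _ _ _) (@measurable_mE311 R)).
  exact: (measurableT_comp (mG _ _ _ _ _) (@measurable_mE312 R)).
move=> y _; rewrite patchE; case: ifPn => [yO|_]; last first.
  by rewrite !mule_ge0//; exact: G0.
rewrite inE in yO; have yB := HB y yO.
have iB (t : R) : `|t| <= norm3 y -> t \in `[0 - B, 0 + B]%classic.
  move=> ty; rewrite inE/= in_itv/= sub0r add0r -ler_norml; exact: le_trans ty yB.
rewrite /g /G !patchE !iB ?coord11_le_norm3 ?coord12_le_norm3 ?coord2_le_norm3//.
rewrite -!EFinM lee_fin.
have r0 := rdist_gt0 x eps0 y.
have -> : 11 / 4 = 11 / 12 + 11 / 12 + 11 / 12 :> R by lra.
rewrite !powRD; try by rewrite gt_eqF// implybT.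
have q0 : (0 : R) <= 11 / 12 by lra.
have h1 := rdist_powR_coord eps0 q0 (coord11_le_norm3 (y - x)).
have h2 := rdist_powR_coord eps0 q0 (coord12_le_norm3 (y - x)).
have h3 := rdist_powR_coord eps0 q0 (coord2_le_norm3 (y - x)).
by apply: ler_pM; rewrite ?mulr_ge0 ?powR_ge0//; apply: ler_pM; rewrite ?powR_ge0.
Qed.

(** In a chart the two tangential coordinates receive 5/8 each. The pole ranges over the whole
    space, hence the parametrised form of [bdry_integral_bound]. *)
Lemma bdry_kernel_bound : exists2 K : R, 0 <= K & forall x eps, 0 < eps <= 1 ->
  (\int[sigma]_(y in bdry Omega) (rdist eps x y `^ (5 / 4))%:E <= K%:E)%E.
Proof.
have [||||K K0 HK] := @bdry_integral_bound R Omega sigma oOmega bOmega charts surf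
  (E3 R * R)%type (fun i => 0 < i.2 <= 1)
  (fun i y => (rdist i.2 i.1 y `^ (5 / 4))%:E) (fun=> 1%E).
- by move=> i /andP[e0 _]; exact: measurable_rdist_powR.
- by move=> i x; rewrite lee_fin powR_ge0.
- by move=> i; rewrite lee_fin.
- move=> e1 e2 e3 psi b rho rho0 onb C _.
  have q01 : 0 < (5 / 8 : R) < 1 by rewrite divr_gt0//= ltr_pdivrMr// mul1r ltr_nat.
  have rho2 : 0 < rho / 2 by rewrite divr_gt0.
  have [K K0 HK] := Gb q01 rho2; exists (K * K); first by rewrite mulr_ge0.
  move=> [x eps] /= e01; have /andP[eps0 _] := e01; rewrite mule1.
  pose g c a := G (5 / 8) c (rho / 2) eps a.
  apply: (@le_trans _ _ (\int[leb2]_y (g b.1 (dot3 x e1) y.1 * g b.2 (dot3 x e2) y.2))%E); last first.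
    rewrite integral_prod2; try exact: mG; try by move=> t; exact: G0.
    by rewrite EFinM; apply: lee_pmul; try exact: HK; rewrite integral_ge0// => t _; exact: G0.
  have mP : measurable_fun setT (fun y : M1 * M1 => graph_coord e1 e2 e3 psi (y, 0) : mE3 R).
    apply: (measurableT_comp (measurable_graph_coord e1 e2 e3 (continuous2_measurable (C11_continuous C)))).
    by apply/measurable_fun_pairP; split; [exact: measurable_id|exact: measurable_cst].
  rewrite integral_mkcond; apply: ge0_le_integral => //.
  - by move=> y _; apply: erestrict_ge0 => z _; rewrite lee_fin powR_ge0.
  - apply/(measurable_restrictT _ (cc_rect_measurable _ _)); apply: measurable_funTS.
    exact: (measurableT_comp (measurable_rdist_powR x (5 / 4) eps0) mP).
  - apply: emeasurable_funM; first exact: (measurableT_comp (mG _ _ _ _ _) measurable_fst).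
    exact: (measurableT_comp (mG _ _ _ _ _) measurable_snd).
  move=> y _; rewrite patchE; case: ifPn => [yO|_]; last by rewrite mule_ge0//; exact: G0.
  rewrite inE in yO; have /cc_rectE[y1 y2] := yO.
  have iB (t c : R) : `|t - c| <= rho / 2 -> t \in `[c - rho / 2, c + rho / 2]%classic.
    by rewrite ler_norml => /andP[? ?]; rewrite inE/= in_itv/=; apply/andP; split; lra.
  rewrite /g /G !patchE !iB// -!EFinM lee_fin.
  set Y := graph_coord e1 e2 e3 psi (y, 0).
  have r0 := rdist_gt0 x eps0 Y.
  have -> : 5 / 4 = 5 / 8 + 5 / 8 :> R by lra.
  rewrite powRD; last by rewrite gt_eqF// implybT.
  have q0 : (0 : R) <= 5 / 8 by lra.
  have [[n1 n2 _] _] := onb.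
  have nrm (e : E3 R) : dot3 e e = 1 -> `|dot3 (Y - x) e| <= norm3 (Y - x).
    move=> ee; have e1' : norm3 e = 1 by rewrite /norm3 ee sqrtr1.
    by have := dot3_CS (Y - x) e; rewrite e1' mulr1.
  have d1 : dot3 (Y - x) e1 = y.1 - dot3 x e1.
    by rewrite dot3Bl; congr (_ - _); exact: (congr1 (fun z : E3 R => z.1.1) (frameK onb (y, psi y + 0))).
  have d2 : dot3 (Y - x) e2 = y.2 - dot3 x e2.
    by rewrite dot3Bl; congr (_ - _); exact: (congr1 (fun z : E3 R => z.1.2) (frameK onb (y, psi y + 0))).
  have h1 := rdist_powR_coord eps0 q0 (nrm e1 n1).
  have h2 := rdist_powR_coord eps0 q0 (nrm e2 n2).
  by rewrite d1 in h1; rewrite d2 in h2; apply: ler_pM; rewrite ?powR_ge0.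
by exists K => // x eps e01; have := HK (x, eps) e01; rewrite mule1.
Qed.

End kernels.

(** * The kernel along the curve *)

Section curve_kernel.
Context {R : realType}.
Local Notation M1 := (measurableTypeR R).
Implicit Types (x y v : E3 R) (s t eps : R).

Lemma is_derive_dot3 (g : R -> E3 R) (dg : E3 R) s v : is_derive s (1 : R) g dg ->
  is_derive s (1 : R) (fun t => dot3 (g t) v) (dot3 dg v).
Proof.
move=> [dgs dgE]; apply: cvg_is_derive.
have h : (fun h : R => h^-1 *: (g (h + s) - g s)) @ 0^' --> dg.
  rewrite -dgE /derive.
  rewrite (_ : (fun h : R => _) = (fun h : R => h^-1 *: ((g \o shift s) (h *: (1 : R)) - g s))).
    exact: dgs.
  by apply/funext => h; rewrite /= scaleRE mulr1.
have cd : continuous (fun z : E3 R => dot3 z v).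
  by apply: continuous_fun_dot3 => z; [exact: cvg_id|exact: cvg_cst].
have k := continuous_cvg _ (cd dg) h; have {}k := k _.
rewrite (_ : (fun h0 : R => h0^-1 *: (_ - _)) =
    (fun z => dot3 z v) \o (fun h0 : R => h0^-1 *: (g (h0 + s) - g s))); first exact: k.
by apply/funext => h0; rewrite /= dot3Zl dot3Bl.
Qed.

Variables (gamma dgamma : R -> E3 R) (c : R).
Hypothesis C1g : C1_on01 gamma dgamma.
Hypothesis c0 : 0 < c.
Hypothesis dgc : forall s, 0 <= s <= 1 -> c <= norm3 (dgamma s).

Lemma curve_MVT v s t : 0 <= s -> s < t -> t <= 1 -> exists2 u, s < u < t &
  dot3 (gamma t - gamma s) v = dot3 (dgamma u) v * (t - s).
Proof.
move=> s0 st t1; have [cg cdg dg] := C1g.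
have [|||u] := @MVT R (fun t => dot3 (gamma t) v) (fun t => dot3 (dgamma t) v) s t.
- exact: st.
- move=> u; rewrite in_itv/= => /andP[su ut]; apply: is_derive_dot3; apply: dg.
  by rewrite (le_lt_trans s0 su) (lt_le_trans ut t1).
- have sub : `[s, t]%classic `<=` `[0, 1]%classic.
    by move=> u /=; rewrite !in_itv/= => /andP[h1 h2]; rewrite (le_trans s0)// (le_trans h2).
  have cst' := continuous_subspaceW sub cg.
  move=> u; apply: (@continuous_comp _ _ _ (gamma : subspace _ -> E3 R) (fun z : E3 R => dot3 z v)).
    exact: cst'.
  by apply: continuous_fun_dot3 => z; [exact: cvg_id|exact: cvg_cst].
by rewrite in_itv/= => sut E; exists u => //; rewrite dot3Bl.
Qed.

(** The increment is projected on [v = dgamma s0]: by continuity the scalar product of the velocity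
    with [v] exceeds half of [norm3 v ^+ 2] near [s0], and the mean value theorem applies to this
    scalar function. Only a local statement is possible, since the curve may cross itself. *)
Lemma curve_local_bilipschitz s0 : 0 <= s0 <= 1 -> exists2 d : R, 0 < d & forall s t,
  0 <= s <= 1 -> 0 <= t <= 1 -> `|s - s0| <= d -> `|t - s0| <= d ->
  c / 2 * `|t - s| <= norm3 (gamma t - gamma s).
Proof.
move=> s01; have [cg cdg dg] := C1g; set v := dgamma s0.
have vc := dgc s01; rewrite -/v in vc.
have v0 : 0 < norm3 v by exact: lt_le_trans vc.
have cdv : {within `[0, 1], continuous (fun t => dot3 (dgamma t) v)}.
  move=> u; apply: (@continuous_comp _ _ _ (dgamma : subspace _ -> E3 R) (fun z : E3 R => dot3 z v)).
    exact: cdg.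
  by apply: continuous_fun_dot3 => z; [exact: cvg_id|exact: cvg_cst].
have s0i : `[0, 1]%classic s0 by rewrite /= in_itv.
have half : norm3 v ^+ 2 / 2 < dot3 v v.
  by rewrite -norm3_sqr ltr_pdivrMr// ltr_pMr ?ltr1n// exprn_gt0.
have [d d0 Hd] : exists2 d : R, 0 < d & forall t, 0 <= t <= 1 -> `|t - s0| < d ->
    norm3 v ^+ 2 / 2 < dot3 (dgamma t) v.
  move: (cdv s0); rewrite /continuous_at /= => cs.
  have nb : nbhs (s0 : subspace `[0, 1]%classic) [set t | norm3 v ^+ 2 / 2 < dot3 (dgamma t) v].
    by have /cvgr_gt := cs; apply.
  have {nb} : nbhs_subspace (s0 : subspace `[0, 1]%classic) [set t | norm3 v ^+ 2 / 2 < dot3 (dgamma t) v] := nb.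
  rewrite -(nbhs_subspace_in s0i) => nb.
  have /nbhs_ballP[d /= d0 Hd] := nb.
  exists d => // t t01 ts; apply: Hd; last by rewrite /= in_itv.
  by rewrite /ball/= distrC.
exists (d / 2); first by rewrite divr_gt0.
have key s t : 0 <= s -> s <= t -> t <= 1 -> `|s - s0| <= d / 2 -> `|t - s0| <= d / 2 ->
    c / 2 * (t - s) <= norm3 (gamma t - gamma s).
  move=> s_0; rewrite le_eqVlt => /predU1P[<-|st] t1 sd td.
    by rewrite subrr mulr0 norm3_ge0.
  have [u /andP[su ut] E] := curve_MVT v s_0 st t1.
  have u01 : 0 <= u <= 1 by apply/andP; split; lra.
  have ud : `|u - s0| < d.
    move: sd td; rewrite !ler_norml ltr_norml => /andP[? ?] /andP[? ?].
    by apply/andP; split; lra.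
  have h1 := Hd u u01 ud.
  have h2 := le_trans (ler_norm _) (dot3_CS (gamma t - gamma s) v).
  rewrite -(ler_pM2r v0); apply: le_trans h2; rewrite E.
  rewrite mulrAC ler_pM2r ?subr_gt0//; apply: ltW; apply: le_lt_trans h1.
  by have h3 := ler_wpM2r (ltW v0) vc; rewrite expr2; clear -h3 C1g c0 dgc; lra.
move=> s t /andP[s_0 s1] /andP[t_0 t1] sd td; have [st|/ltW ts] := leP s t.
  by rewrite ger0_norm ?subr_ge0//; exact: key.
by rewrite distrC ger0_norm ?subr_ge0// norm3B; exact: key.
Qed.

(** On a short arc the distance from [y] to [gamma s] dominates the parameter distance to the
    nearest point of the arc, which gives a one-dimensional kernel of exponent 3/4; compactness of
    [[0, 1]] joins the arcs. *)
Lemma curve_kernel_bound : exists2 K : R, 0 <= K & forall y eps, 0 < eps <= 1 ->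
  (\int[leb1]_(s in `[0%R, 1%R]) (rdist eps (gamma s) y `^ (3 / 4))%:E <= K%:E)%E.
Proof.
have [cg cdg _] := C1g.
have mk y eps (D : set M1) : measurable D -> 0 < eps -> D `<=` `[0, 1]%classic ->
    measurable_fun D (fun s => (rdist eps (gamma s) y `^ (3 / 4))%:E).
  move=> mD eps0 D01; apply/measurable_EFinP.
  apply: (measurableT_comp (measurable_powR _)).
  apply: (measurable_funS (measurable_itv _) D01).
  apply: subspace_continuous_measurable_fun; first exact: measurable_itv.
  move=> s; apply: (@continuous_comp _ _ _ (gamma : subspace _ -> E3 R) (fun z => rdist eps z y)).
    exact: cg.
  rewrite (_ : (fun z => _) = rdist eps y); first exact: rdist_continuous.
  by apply/funext => z; rewrite /rdist -!norm3_sqr norm3B.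
pose G := [set U : set M1 | measurable U /\ exists2 K : R, 0 <= K & forall y eps, 0 < eps <= 1 ->
  (\int[leb1]_(s in `[0%R, 1%R] `&` U) (rdist eps (gamma s) y `^ (3 / 4))%:E <= K%:E)%E].
have [||s0 s01|U U01 [mU [K K0 HK]]] := @compact_union_cover (M1 : topologicalType) `[0, 1]%classic G
  (@segment_compact _ _ _).
- by split => //; exists 0 => // y eps _; rewrite setI0 integral_set0.
- move=> U V [mU [K1 K10 H1]] [mV [K2 K20 H2]]; split; first exact: measurableU.
  exists (K1 + K2); first exact: addr_ge0.
  move=> y eps e01; have /andP[eps0 _] := e01.
  have mUi : measurable (`[0%R, 1%R] `&` U : set M1) by exact: measurableI.
  have mVi : measurable (`[0%R, 1%R] `&` V : set M1) by exact: measurableI.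
  rewrite setIUr EFinD; apply: le_trans (leeD (H1 y eps e01) (H2 y eps e01)).
  set k := (X in integral _ _ X).
  have k0 s : (0 <= k s)%E by rewrite /k lee_fin powR_ge0.
  rewrite [leLHS](_ : _ = \int[leb1]_(s in (`[0%R, 1%R] `&` U) `|` (`[0%R, 1%R] `&` V)) (k \_ `[0%R, 1%R]) s)%E; last first.
    apply: eq_integral => s; rewrite inE patchE => -[[h _]|[h _]]; by rewrite mem_set.
  apply: le_trans (ge0_integral_setU_le leb1 mUi mVi _ _) _.
  + by apply/(measurable_restrictT _ (measurable_itv _)); exact: mk.
  + by move=> s; exact: erestrict_ge0.
  + apply: leeD; rewrite le_eqVlt; apply/orP; left; apply/eqP; apply: eq_integral => s;
      by rewrite inE patchE => -[h _]; rewrite mem_set.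
- rewrite /= in_itv/= in s01.
  have [d d0 Hd] := curve_local_bilipschitz s01.
  exists (ball s0 d : set R); first by split; [exact: ball_open|exact: ballxx].
  have mB : measurable (ball s0 d : set M1).
    by rewrite ball_itv; exact: measurable_itv.
  split => //.
  have q01 : 0 < (3 / 4 : R) < 1 by rewrite divr_gt0//= ltr_pdivrMr// mul1r ltr_nat.
  have [K K0 HK] := power_kernel_bound q01 d0.
  pose a := Num.max 0 (s0 - d); pose b := Num.min 1 (s0 + d).
  have ab : a <= b.
    move/andP: s01 => [? ?]; rewrite /a /b ge_max !le_min.
    by apply/andP; split; apply/andP; split; lra.
  have abE s : s \in `[a, b] -> 0 <= s <= 1 /\ `|s - s0| <= d.
    rewrite in_itv/= /a /b ge_max le_min => /andP[/andP[? ?] /andP[? ?]]; split.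
      by apply/andP.
    by rewrite ler_norml; apply/andP; split; lra.
  (* The [c / 2] of the local bound is halved because [norm3 (gamma s - gamma t)] is at most twice
     [norm3 (gamma s - y)] for the nearest parameter [t]; the minimum with 1 lets [m] multiply [eps]
     as well. *)
  pose m := Num.min (c / 4) 1.
  have m0 : 0 < m by rewrite lt_min divr_gt0//=.
  exists (2 `^ (3 / 4) * (m^-1 `^ (3 / 4)) * K).
    by rewrite !mulr_ge0 ?powR_ge0.
  move=> y eps e01; have /andP[eps0 eps1] := e01.
  have csub : {within `[a, b], continuous (fun s => norm3 (gamma s - y))}.
    have sub : `[a, b]%classic `<=` `[0, 1]%classic.
      by move=> s /= /abE[/andP[h1 h2] _]; rewrite in_itv/= h1 h2.
    have cst' := continuous_subspaceW sub cg.
    move=> s; apply: (@continuous_comp _ _ _ (gamma : subspace _ -> E3 R) (fun z : E3 R => norm3 (z - y))).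
      exact: cst'.
    move=> z; apply: (@continuous_comp _ _ _ (fun z : E3 R => z - y) (@norm3 R)).
      by apply: cvgB; [exact: cvg_id|exact: cvg_cst].
    exact: continuous_norm3.
  (* A parameter of the arc nearest to [y], playing the part of the pole on the line. *)
  have [t tab tmin] := EVT_min ab csub.
  have [t01 td] := abE t tab.
  have low s : `[0%R, 1%R]%classic s -> ball s0 d s -> m * (`|s - t| + eps) <= norm3 (gamma s - y) + eps.
    rewrite /= in_itv/= => s01'; rewrite /ball/= distrC => sd.
    have sab : s \in `[a, b].
      move: sd s01'; rewrite ltr_norml => /andP[H H0] /andP[? ?].
      rewrite in_itv/= /a /b ge_max le_min; apply/andP; split; apply/andP; split=> //.
        by rewrite lerBlDr -lerBlDl; clear -H C1g c0 dgc; lra.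
      by clear -H0 C1g c0 dgc; lra.
    have h1 := tmin s sab.
    have h2 := Hd t s t01 s01' td (ltW sd).
    have h3 := norm3_triangleB (gamma s) y (gamma t).
    have h4 := norm3B y (gamma t).
    have m1 : m <= c / 4 by rewrite /m ge_min lexx.
    have m2 : m <= 1 by rewrite /m ge_min lexx orbT.
    rewrite mulrDr; apply: lerD; last by rewrite ler_piMl// ltW.
    have h5 : m * `|s - t| <= c / 4 * `|s - t| by rewrite ler_wpM2r.
    apply: (le_trans h5); rewrite h4 in h3; clear -h1 h2 h3 C1g c0 dgc; lra.
  have st0 s : 0 < `|s - t| + eps by rewrite ltr_wpDl.
  apply: (@le_trans _ _ (\int[leb1]_(s in `[(s0 - d)%R, (s0 + d)%R])
     ((2 `^ (3 / 4) * m^-1 `^ (3 / 4))%:E * ((`|s - t| + eps) `^ (- (3 / 4)))%:E))%E); last first.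
    rewrite ge0_integralZl//.
    - by rewrite [leRHS]EFinM; apply: lee_wpmul2l; [rewrite lee_fin mulr_ge0// powR_ge0|exact: HK].
    - apply/measurable_EFinP; apply: measurable_funTS.
      apply: (measurableT_comp (measurable_powR _)); apply: measurable_funD => //.
      by apply: measurableT_comp => //; exact: measurable_funB.
    - by move=> s _; rewrite lee_fin powR_ge0.
    - by rewrite lee_fin mulr_ge0// powR_ge0.
  rewrite integral_mkcond [leRHS]integral_mkcond; apply: ge0_le_integral => //.
  - by move=> s _; apply: erestrict_ge0 => z _; rewrite lee_fin powR_ge0.
  - have mI : measurable (`[0%R, 1%R] `&` ball s0 d : set M1) by exact: measurableI.
    by apply/(measurable_restrictT _ mI); apply: mk => // s [].
  - apply/(measurable_restrictT _ (measurable_itv _)); apply: measurable_funTS.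
    apply: measurable_funeM; apply/measurable_EFinP.
    apply: (measurableT_comp (measurable_powR _)); apply: measurable_funD => //.
    by apply: measurableT_comp => //; exact: measurable_funB.
  move=> s _; rewrite !patchE; case: ifPn => [|_]; last first.
    by case: ifP => // _; rewrite mule_ge0 // lee_fin ?mulr_ge0 ?powR_ge0.
  rewrite inE => -[s01' sd]; rewrite mem_set; last first.
    by move: sd; rewrite /= in_itv/= /ball/= ltr_norml => /andP[? ?]; apply/andP; split; lra.
  rewrite -EFinM lee_fin.
  have q0 : 0 <= 3 / 4 :> R by rewrite divr_ge0.
  have h := low s s01' sd.
  have n0 := norm3_ge0 (gamma s - y).
  have r1 : rdist eps (gamma s) y <= 2 * (m^-1 * (`|s - t| + eps)^-1).
    have := @rdist_coord R (norm3 (gamma s - y)) eps (gamma s) y eps0.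
    rewrite (ger0_norm n0) norm3B => /(_ (lexx _)) /le_trans; apply.
    rewrite ler_pM2l// -invfM lef_pV2 ?posrE ?mulr_gt0//; first by rewrite norm3B.
    by rewrite ltr_wpDl// norm3_ge0.
  have -> : (`|s - t| + eps) `^ (- (3 / 4)) = ((`|s - t| + eps)^-1) `^ (3 / 4).
    by rewrite -(powR_inv1 (ltW (st0 s))) -powRrM mulN1r.
  have iv0 : 0 <= (`|s - t| + eps)^-1 by rewrite invr_ge0 ltW.
  have im0 : 0 <= m^-1 by rewrite invr_ge0 ltW.
  rewrite -mulrA -powRM// -powRM ?mulr_ge0//; apply: ge0_ler_powR => //.
  - by rewrite nnegrE ltW// rdist_gt0.
  - by rewrite nnegrE !mulr_ge0.
exists K => // y eps e01; rewrite -(setIidl U01); exact: HK.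
Qed.

End curve_kernel.

(** * Schur's test and the fractional Hardy inequality *)

(** The integral of a nonnegative function is a supremum over the simple functions below it, and
    every simple function below [f] is below [h]. *)
Lemma ge0_le_integral_nomeas d (T : measurableType d) (R : realType)
    (mu : {measure set T -> \bar R}) (D : set T) (f h : T -> \bar R) :
  (forall x, D x -> (0 <= f x)%E) -> (forall x, D x -> (f x <= h x)%E) ->
  (\int[mu]_(x in D) f x <= \int[mu]_(x in D) h x)%E.
Proof.
move=> f0 fh; rewrite !ge0_integralE//; last by move=> x Dx; exact: le_trans (f0 x Dx) (fh x Dx).
apply: le_ereal_sup => _ [k /= kf <-]; exists k => // x; apply: le_trans (kf x) _.
by rewrite !patchE; case: ifPn => //; rewrite inE; exact: fh.
Qed.

Lemma weighted_sum_le {R : realType} (c a b k q : R) (S X : \bar R) :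
  0 <= c -> 0 <= a -> 0 <= b -> 0 <= k -> 0 <= q -> (0 <= S)%E -> (0 <= X)%E ->
  c * a <= k -> c * b <= k * q ->
  (c%:E * (a%:E * S + b%:E * X) <= k%:E * (S + X * q%:E))%E.
Proof.
move=> c0 a0 b0 k0 q0 S0 X0 h1 h2.
have aS : (0 <= a%:E * S)%E by rewrite mule_ge0.
have bX : (0 <= b%:E * X)%E by rewrite mule_ge0.
have qX : (0 <= X * q%:E)%E by rewrite mule_ge0.
rewrite (ge0_muleDr _ aS bX) (ge0_muleDr _ S0 qX) !muleA -!EFinM.
apply: leeD; first by apply: lee_wpmul2r => //; rewrite lee_fin.
by rewrite [leRHS]muleAC -EFinM; apply: lee_wpmul2r => //; rewrite lee_fin.
Qed.

Lemma weighted_sum_le_bound {R : realType} (k N : R) (S X W : \bar R) :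
  0 <= k -> 0 <= N -> (0 <= S)%E -> (0 <= X)%E -> (W <= N%:E)%E ->
  (k%:E * (S + X * W) <= (k * (N + 1))%:E * (X + S))%E.
Proof.
move=> k0 N0 S0 X0 WN.
have N1 : (0 <= N%:E)%E by rewrite lee_fin.
have e1 : (0 <= 1%:E :> \bar R)%E by rewrite lee_fin.
rewrite EFinM -muleA; apply: lee_wpmul2l; first by rewrite lee_fin.
rewrite EFinD (ge0_muleDl _ N1 e1) mul1e addeC; apply: leeD; last by rewrite leeDr.
rewrite muleC; apply: (le_trans (lee_wpmul2r X0 WN)).
by apply: lee_wpmul2l => //; rewrite leeDl.
Qed.

(** Log-convexity of moments in arithmetic form; [a], [w], [b], [c] are the integrals along the
    curve of the kernel to the powers 3/4, 5/4, 7/4 and 11/4. *)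
Lemma fourth_power_interpolation (R : realType) (a w b c K : R) :
  0 <= a -> 0 <= w -> 0 <= b -> 0 <= c ->
  w ^+ 2 <= a * b -> b ^+ 2 <= a * c -> a <= K -> w ^+ 4 <= K ^+ 3 * c.
Proof.
move=> a0 w0 b0 c0 h1 h2 aK.
have h4 : w ^+ 4 <= (a * b) ^+ 2.
  by rewrite -[4%N]/(2 * 2)%N exprM lerXn2r// nnegrE ?sqr_ge0 ?mulr_ge0.
apply: (le_trans h4); rewrite exprMn.
apply: (@le_trans _ _ (a ^+ 2 * (a * c))); first by rewrite ler_wpM2l ?sqr_ge0.
rewrite mulrA -exprSr ler_wpM2r// lerXn2r// nnegrE//.
exact: le_trans aK.
Qed.

Section kernel_operators.
Context {R : realType}.
Local Notation M1 := (measurableTypeR R).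
Variable g : M1 -> mE3 R.
Hypothesis mg : measurable_fun setT g.
Implicit Types (p q eps : R).
Let J : set M1 := `[0, 1]%classic.
Let mJ : measurable J := measurable_itv _.

Lemma measurable_rdist2 d (T : measurableType d) (u v : T -> mE3 R) eps p : 0 < eps ->
  measurable_fun setT u -> measurable_fun setT v ->
  measurable_fun setT (fun t => rdist eps (u t) (v t) `^ p : M1).
Proof.
move=> eps0 mu mv; apply: (measurableT_comp (measurable_powR _)).
rewrite (_ : (fun t => _) = (rdist eps 0 : mE3 R -> M1) \o (fun t => (v t : E3 R) - u t)).
  apply: measurableT_comp; last exact: measurable_mE3B.
  by apply: continuous3_measurable; exact: rdist_continuous.
by apply/funext => t; rewrite /rdist /= subr0.
Qed.

Let curve_weight p eps (y : mE3 R) : \bar R :=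
  (\int[leb1]_(s in J) (rdist eps (g s) y `^ p)%:E)%E.

Section one_measure.
Local Open Scope ereal_scope.
Variables (m : {sigma_finite_measure set (mE3 R) -> \bar R}) (D : set (mE3 R)).
Hypothesis mD : measurable D.

Lemma tonelli_swap (F : mE3 R -> M1 -> \bar R) :
  measurable_fun setT (fun w => F w.1 w.2) -> (forall y s, 0 <= F y s) ->
  \int[m]_(y in D) \int[leb1]_(s in J) F y s = \int[leb1]_(s in J) \int[m]_(y in D) F y s.
Proof.
move=> mF F0.
have mDJ : measurable (D `*` J) by exact: measurableX.
pose H := (fun w => F w.1 w.2) \_ (D `*` J).
have mH : measurable_fun setT H.
  by apply/(measurable_restrictT _ mDJ); exact: measurable_funTS.
have H0 w : 0 <= H w by apply: erestrict_ge0.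
have := @fubini_tonelli _ _ _ _ R m (@lebesgue_measure R) H mH H0.
move=> E; rewrite [LHS]integral_mkcond [RHS]integral_mkcond.
apply: (etrans _ (etrans E _)).
  apply: eq_integral => y _; rewrite patchE; case: ifPn => yD; last first.
    apply/esym/integral0_eq => s _; rewrite /H patchE memNset// => -[/= yD' _].
    by move: yD; rewrite notin_setE.
  rewrite integral_mkcond; apply: eq_integral => s _; rewrite /H !patchE /=.
  congr (if _ then _ else _); apply/idP/idP; rewrite !inE; last by case.
  by rewrite inE in yD.
apply: eq_integral => s _; rewrite patchE; case: ifPn => sJ; last first.
  apply/integral0_eq => y _; rewrite /H patchE memNset// => -[_ /= sJ'].
  by move: sJ; rewrite notin_setE.
rewrite [RHS]integral_mkcond; apply: eq_integral => y _; rewrite /H !patchE /=.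
congr (if _ then _ else _); apply/idP/idP; rewrite !inE; first by case.
by rewrite inE in sJ.
Qed.

(** Schur's test: the kernel power is split into the halves [p / 2] and [q / 2], Cauchy-Schwarz in
    [y] isolates the factor bounded by [A], and Tonelli moves the integral over [s] onto the
    remaining power. The weight is kept in the conclusion because it is unbounded in the case that
    Hardy's inequality treats. *)
Lemma kernel_sqr_integral (e : mE3 R -> R) p q eps (A : R) : (0 < eps)%R ->
  measurable_fun setT e -> (forall y, 0 <= e y)%R ->
  (forall s, J s -> \int[m]_(y in D) (rdist eps (g s) y `^ q)%:E <= A%:E) ->
  \int[leb1]_(s in J) (\int[m]_(y in D) (e y * rdist eps (g s) y `^ ((p + q) / 2))%:E) ^+ 2 <=
  A%:E * \int[m]_(y in D) ((e y ^+ 2)%:E * curve_weight p eps y).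
Proof.
move=> eps0 me e0 HA.
have A0 : (0 <= A)%R.
  rewrite -lee_fin; apply: le_trans (HA 0%R _); last by rewrite /J /= in_itv/= lexx ler01.
  by apply: integral_ge0 => y _; rewrite lee_fin powR_ge0.
have mgy : measurable_fun setT (fun w : mE3 R * M1 => g w.2) by exact: measurableT_comp.
pose F (y : mE3 R) (s : M1) := (e y ^+ 2 * rdist eps (g s) y `^ p)%:E.
have mF : measurable_fun setT (fun w => F w.1 w.2).
  apply/measurable_EFinP; apply: measurable_funM.
    by apply: measurable_funX; exact: (measurableT_comp me measurable_fst).
  by apply: measurable_rdist2 => //; do ?[exact: measurable_fst|exact: measurableT_comp].
have F0 y s : 0 <= F y s by rewrite lee_fin mulr_ge0 ?sqr_ge0 ?powR_ge0.
have mrs s p' : measurable_fun setT (fun y : mE3 R => (rdist eps (g s) y `^ p')%R : M1).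
  by apply: measurable_rdist2.
have mIF : measurable_fun J (fun s => \int[m]_(y in D) F y s).
  apply: measurable_funTS.
  rewrite (_ : (fun s => _) = fun s => \int[m]_y ((fun w => F w.1 w.2) \_ (D `*` setT)) (y, s)); last first.
    apply/funext => s; rewrite integral_mkcond; apply: eq_integral => y _; rewrite !patchE.
    by congr (if _ then _ else _); apply/idP/idP; rewrite !inE; [split|case].
  have mDT : measurable (D `*` setT : set (mE3 R * M1)) by exact: measurableX.
  apply: (@measurable_fun_fubini_tonelli_G _ _ _ _ R m).
    by apply/(measurable_restrictT _ mDT); exact: measurable_funTS.
  by move=> w; apply: erestrict_ge0 => z _; exact: F0.
have CS s : J s -> (\int[m]_(y in D) (e y * rdist eps (g s) y `^ ((p + q) / 2))%:E) ^+ 2 <=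
    A%:E * \int[m]_(y in D) F y s.
  move=> Js; pose a y := (e y * rdist eps (g s) y `^ (p / 2))%R.
  pose b y := (rdist eps (g s) y `^ (q / 2))%R.
  have r0 y : (0 < rdist eps (g s) y)%R by exact: rdist_gt0.
  have -> : \int[m]_(y in D) (e y * rdist eps (g s) y `^ ((p + q) / 2))%:E =
      \int[m]_(y in D) (a y * b y)%:E.
    apply: eq_integral => y _; rewrite /a /b mulrDl powRD ?mulrA//.
    by rewrite (gt_eqF (r0 y)) implybT.
  have ma : measurable_fun D (a : mE3 R -> M1).
    by apply: measurable_funTS; apply: measurable_funM; [exact: me|exact: mrs].
  have mb : measurable_fun D (b : mE3 R -> M1) by apply: measurable_funTS; exact: mrs.
  have a0 y : D y -> (0 <= a y)%R by move=> _; rewrite mulr_ge0 ?powR_ge0.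
  have b0 y : D y -> (0 <= b y)%R by move=> _; rewrite powR_ge0.
  have sq y p' : (rdist eps (g s) y `^ (p' / 2) ^+ 2 = rdist eps (g s) y `^ p')%R.
    by rewrite -powR_mulrn ?powR_ge0// -powRrM divfK.
  apply: (le_trans (@cauchy_schwarz _ _ R m D a b mD ma mb a0 b0)).
  rewrite muleC; apply: lee_pmul; try by apply: integral_ge0 => y _; rewrite lee_fin sqr_ge0.
    by under eq_integral do rewrite sq; exact: HA.
  by rewrite le_eqVlt; apply/orP; left; apply/eqP; apply: eq_integral => y _; rewrite /a exprMn sq.
apply: (@le_trans _ _ (\int[leb1]_(s in J) (A%:E * \int[m]_(y in D) F y s))).
  apply: ge0_le_integral_nomeas => [s Js|s Js]; last exact: CS.
  by apply: mule_ge0; apply: integral_ge0 => y _; rewrite lee_fin mulr_ge0 ?powR_ge0.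
rewrite ge0_integralZl//; last by move=> s _; apply: integral_ge0.
rewrite -(tonelli_swap mF F0); apply: lee_wpmul2l; first by rewrite lee_fin.
rewrite le_eqVlt; apply/orP; left; apply/eqP; apply: eq_integral => y _.
rewrite /F /curve_weight; under eq_integral do rewrite EFinM.
rewrite ge0_integralZl//.
- apply: measurable_funTS; apply/measurable_EFinP.
  by apply: measurable_rdist2 => //; do ?[exact: measurable_cst].
- by move=> s _; rewrite lee_fin powR_ge0.
- by rewrite lee_fin sqr_ge0.
Qed.

End one_measure.

Section hardy.
Variables (Omega : set (E3 R)) (K2 K3 cd : R).
Hypotheses (oOmega : open Omega) (bOmega : bounded_set Omega).
Hypotheses (K20 : 0 <= K2) (K30 : 0 <= K3) (cd0 : 0 < cd).
Hypothesis HK2 : forall x eps, 0 < eps <= 1 ->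
  (\int[leb3]_(y in Omega) (rdist eps x y `^ (11 / 4))%:E <= K2%:E)%E.
Hypothesis HK3 : forall y eps, 0 < eps <= 1 ->
  (\int[leb1]_(s in J) (rdist eps (g s) y `^ (3 / 4))%:E <= K3%:E)%E.
Hypothesis dens : forall x (d : R), Omega x -> 0 < d <= cd ->
  ((cd * d ^+ 3)%:E <= leb3 (ball3 x d `&` Omega : set (mE3 R)))%E.
Let mO : measurable (Omega : set (mE3 R)) := open3_measurable oOmega.

Let mr y eps p : 0 < eps -> measurable_fun setT (fun s => rdist eps (g s) y `^ p : M1).
Proof. by move=> eps0; apply: measurable_rdist2 => //; exact: measurable_cst. Qed.

Let CS1 y eps p q : 0 < eps ->
  ((curve_weight ((p + q) / 2) eps y) ^+ 2 <= curve_weight p eps y * curve_weight q eps y)%E.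
Proof.
move=> eps0; rewrite /curve_weight.
have r0 s : 0 < rdist eps (g s) y by exact: rdist_gt0.
under [X in (X ^+ 2)%E]eq_integral => s _.
  rewrite mulrDl powRD; last by rewrite (gt_eqF (r0 s)) implybT.
  over.
have m' p' : measurable_fun J (fun s => rdist eps (g s) y `^ p' : M1).
  by apply: measurable_funTS; exact: mr.
apply: (le_trans (@cauchy_schwarz _ M1 R leb1 J (fun s => rdist eps (g s) y `^ (p / 2))
  (fun s => rdist eps (g s) y `^ (q / 2)) mJ (m' _) (m' _) _ _)).
- by move=> s _; rewrite powR_ge0.
- by move=> s _; rewrite powR_ge0.
have sq s p' : rdist eps (g s) y `^ (p' / 2) ^+ 2 = rdist eps (g s) y `^ p'.
  by rewrite -powR_mulrn ?powR_ge0// -powRrM divfK.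
rewrite le_eqVlt; apply/orP; left; apply/eqP.
by congr (_ * _)%E; apply: eq_integral => s _; rewrite sq.
Qed.

Let cw_ge0 p eps y : (0 <= curve_weight p eps y)%E.
Proof. by apply: integral_ge0 => s _; rewrite lee_fin powR_ge0. Qed.

Let cw_fin p eps y : 0 < eps -> 0 <= p -> curve_weight p eps y \is a fin_num.
Proof.
move=> eps0 p0; rewrite ge0_fin_numE//.
apply: (@le_lt_trans _ _ (\int[leb1]_(s in J) cst (eps^-1 `^ p)%:E s)%E).
  apply: ge0_le_integral_nomeas => s _; first by rewrite lee_fin powR_ge0.
  rewrite lee_fin; apply: ge0_ler_powR => //; rewrite ?nnegrE ?invr_ge0 ?(ltW eps0)//.
  exact: rdist_le.
by rewrite integral_cst// leb1_cc// -EFinM ltry.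
Qed.

(** Two Cauchy-Schwarz steps, with 5/4 the mean of 3/4 and 7/4, and 7/4 the mean of 3/4 and 11/4.
    The fourth power is the one that a ball of radius [1 / W] will call for. *)
Let cw4 y eps : 0 < eps <= 1 ->
  ((fine (curve_weight (5 / 4) eps y) ^+ 4)%:E <= (K3 ^+ 3)%:E * curve_weight (11 / 4) eps y)%E.
Proof.
move=> e01; have /andP[eps0 _] := e01.
have h1 := @CS1 y eps (3 / 4) (7 / 4) eps0; have h2 := @CS1 y eps (3 / 4) (11 / 4) eps0.
have h3 := HK3 y e01.
rewrite (_ : (3 / 4 + 7 / 4) / 2 = 5 / 4) in h1; last by field.
rewrite (_ : (3 / 4 + 11 / 4) / 2 = 7 / 4) in h2; last by field.
move: h1 h2 h3; rewrite -/(curve_weight (3 / 4) eps y).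
have F (p : R) : 0 <= p -> curve_weight p eps y = (fine (curve_weight p eps y))%:E.
  by move=> p0; rewrite fineK// cw_fin.
have f0 p : 0 <= fine (curve_weight p eps y) by rewrite fine_ge0.
have [q1 q2 q3 q4] : [/\ (0 : R) <= 3 / 4, (0 : R) <= 5 / 4, (0 : R) <= 7 / 4 & (0 : R) <= 11 / 4].
  by split; rewrite divr_ge0.
rewrite (F _ q1) (F _ q2) (F _ q3) (F _ q4) -!EFin_expe -!EFinM !lee_fin /=.
exact: (fourth_power_interpolation (f0 _) (f0 _) (f0 _) (f0 _)).
Qed.

(** The weight of exponent 5/4 is unbounded near the curve but lies in L^4 of the domain, uniformly
    in [eps]: Tonelli reduces it to the kernel of exponent 11/4. *)
Let cw4_integral eps : 0 < eps <= 1 ->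
  (\int[leb3]_(y in Omega) (fine (curve_weight (5 / 4) eps y) ^+ 4)%:E <= (K3 ^+ 3 * K2)%:E)%E.
Proof.
move=> e01; have /andP[eps0 _] := e01.
have K33 : (0 <= (K3 ^+ 3)%:E)%E by rewrite lee_fin exprn_ge0.
have mF : measurable_fun setT (fun w : mE3 R * M1 => (rdist eps (g w.2) w.1 `^ (11 / 4))%:E).
  by apply/measurable_EFinP; apply: measurable_rdist2 => //; do ?[exact: measurable_fst|exact: measurableT_comp].
apply: (@le_trans _ _ (\int[leb3]_(y in Omega) ((K3 ^+ 3)%:E * curve_weight (11 / 4) eps y))%E).
  apply: ge0_le_integral_nomeas => y _; last exact: cw4.
  by rewrite lee_fin exprn_ge0// fine_ge0.
rewrite ge0_integralZl//; last first.
  apply: measurable_funTS; rewrite /curve_weight.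
  rewrite (_ : (fun y => _) = fun y => (\int[leb1]_s ((fun w : mE3 R * M1 => (rdist eps (g w.2) w.1 `^ (11 / 4))%:E) \_ (setT `*` J)) (y, s))%E); last first.
    apply/funext => y; rewrite integral_mkcond; apply: eq_integral => s _; rewrite !patchE.
    by congr (if _ then _ else _); apply/idP/idP; rewrite !inE; [split|case].
  have mTJ : measurable (setT `*` J : set (mE3 R * M1)) by exact: measurableX.
  apply: (@measurable_fun_fubini_tonelli_F _ _ _ _ R (@lebesgue_measure R)).
    by apply/(measurable_restrictT _ mTJ); exact: measurable_funTS.
  by move=> w; apply: erestrict_ge0 => z _; rewrite lee_fin powR_ge0.
rewrite [in leRHS]EFinM; apply: lee_wpmul2l => //; rewrite /curve_weight.
apply: le_trans (_ : \int[leb1]_(s in J) cst K2%:E s <= _)%E; last first.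
  by rewrite integral_cst// leb1_cc// subr0 mule1.
apply: le_trans (_ : \int[leb1]_(s in J) \int[sleb3]_(y in Omega) (rdist eps (g s) y `^ (11 / 4))%:E <= _)%E; last first.
  apply: ge0_le_integral_nomeas => s _; last exact: HK2.
  by apply: integral_ge0 => y _; rewrite lee_fin powR_ge0.
rewrite le_eqVlt; apply/orP; left; apply/eqP.
apply: (@tonelli_swap sleb3 Omega mO (fun y s => (rdist eps (g s) y `^ (11 / 4))%:E)) => //.
by move=> y s; rewrite lee_fin powR_ge0.
Qed.

(** The integrand of [slobodeckij] for dimension 3, order 1/2 and power 2. The exponent is left
    unevaluated so that both are convertible; its value is 4. *)
Definition gagliardo (E : mE3 R -> mE3 R) (y z : E3 R) : R :=
  norm3 ((E y : E3 R) - E z) `^ 2 / norm3 (y - z) `^ (3 + 2^-1 * 2).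

(* Averaging over a ball of radius [1 / W(y)] turns the weight [W] into the
   Gagliardo seminorm of order 1/2. *)
Lemma hardy : exists2 C : R, 0 <= C & forall (E : mE3 R -> mE3 R) eps, 0 < eps <= 1 ->
  measurable_fun setT E ->
  (\int[leb3]_(y in Omega) ((norm3 (E y) ^+ 2)%:E * curve_weight (5 / 4) eps y) <=
   C%:E * (\int[leb3]_(y in Omega) (norm3 (E y) ^+ 2)%:E +
     \int[leb3]_(y in Omega) \int[leb3]_(z in Omega) (gagliardo E y z)%:E))%E.
Proof.
have volfin : (leb3 (Omega : set (mE3 R)) < +oo)%E by exact: leb3_bounded_lty.
pose vol := fine (leb3 (Omega : set (mE3 R))).
have volE : leb3 (Omega : set (mE3 R)) = vol%:E by rewrite fineK// ge0_fin_numE.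
have vol0 : 0 <= vol by rewrite fine_ge0.
pose k := 2 / cd; have k0 : 0 <= k by rewrite divr_ge0// ltW.
pose N := K3 ^+ 3 * K2 + cd ^- 4 * vol.
have cd4 : 0 <= cd ^- 4 by rewrite invr_ge0 exprn_ge0// ltW.
have N0 : 0 <= N by rewrite addr_ge0// mulr_ge0// exprn_ge0.
exists (k * (N + 1)); first by rewrite mulr_ge0// addr_ge0.
move=> E eps e01 mE; have /andP[eps0 _] := e01.
set X := (\int[leb3]_(y in Omega) (norm3 (E y) ^+ 2)%:E)%E.
pose S y := (\int[leb3]_(z in Omega) (gagliardo E y z)%:E)%E.
have gag0 y z : 0 <= gagliardo E y z by rewrite divr_ge0// powR_ge0.
have S0 y : (0 <= S y)%E by apply: integral_ge0 => z _; rewrite lee_fin.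
have X0 : (0 <= X)%E by apply: integral_ge0 => z _; rewrite lee_fin sqr_ge0.
have mX : measurable_fun setT (fun z : mE3 R => (norm3 (E z) ^+ 2)%:E).
  by apply/measurable_EFinP; apply: measurable_funX; exact: measurable_fun_norm3.
have mgag : measurable_fun setT (fun w : mE3 R * mE3 R => (gagliardo E w.1 w.2)%:E).
  apply/measurable_EFinP; apply: measurable_funM.
    apply: (measurableT_comp (measurable_powR _)); apply: measurable_fun_norm3.
    by apply: measurable_mE3B; apply: measurableT_comp.
  rewrite (_ : (fun w => _) = fun w : mE3 R * mE3 R => norm3 ((w.1 : E3 R) - w.2) `^ (- (3 + 2^-1 * 2))); last first.
    by apply/funext => w; rewrite powRN.
  apply: (measurableT_comp (measurable_powR _)); apply: measurable_fun_norm3.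
  exact: measurable_mE3B.
have mS : measurable_fun setT (S : mE3 R -> \bar R).
  rewrite (_ : S = fun y => (\int[sleb3]_z ((fun w : mE3 R * mE3 R => (gagliardo E w.1 w.2)%:E) \_ (setT `*` Omega)) (y, z))%E); last first.
    apply/funext => y; rewrite /S integral_mkcond; apply: eq_integral => z _; rewrite !patchE.
    by congr (if _ then _ else _); apply/idP/idP; rewrite !inE; [split|case].
  have mTO : measurable (setT `*` Omega : set (mE3 R * mE3 R)) by exact: measurableX.
  apply: (@measurable_fun_fubini_tonelli_F _ _ _ _ R sleb3).
    by apply/(measurable_restrictT _ mTO); exact: measurable_funTS.
  by move=> w; apply: erestrict_ge0 => z _; rewrite lee_fin.
pose w y := fine (curve_weight (5 / 4) eps y).
have w0 y : 0 <= w y by rewrite fine_ge0.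
have q0 : (0 : R) <= 5 / 4 by rewrite divr_ge0.
have key y : Omega y -> ((norm3 (E y) ^+ 2)%:E * curve_weight (5 / 4) eps y <=
    k%:E * (S y + X * (w y ^+ 4 + cd ^- 4)%:E))%E.
  move=> Oy; have -> : curve_weight (5 / 4) eps y = (w y)%:E by rewrite fineK// cw_fin.
  have [wy0|wy0] := eqVneq (w y) 0.
    by rewrite wy0 mule0 mule_ge0 ?lee_fin// adde_ge0// mule_ge0// lee_fin addr_ge0 ?exprn_ge0.
  have wy : 0 < w y by rewrite lt_neqAle eq_sym wy0 w0.
  (* The radius [1 / W(y)], truncated so that the density of the domain applies to the ball. *)
  pose rho := Num.min cd (w y)^-1.
  have rho0 : 0 < rho by rewrite lt_min cd0 invr_gt0.
  have rcd : rho <= cd by rewrite ge_min lexx.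
  have rw : rho * w y <= 1 by rewrite -ler_pdivlMr// mul1r ge_min lexx orbT.
  have rho3 : 0 < rho ^+ 3 by exact: exprn_gt0.
  (* If [rho] is [1 / w y] the left side is [w y ^+ 4]; if [rho] is [cd], then [w y < 1 / cd] and
     the left side is at most [cd ^- 4]. *)
  have wr : w y / rho ^+ 3 <= w y ^+ 4 + cd ^- 4.
    have [c1|c1] := leP (w y)^-1 cd.
      have -> : rho = (w y)^-1 by rewrite /rho min_r.
      by rewrite exprVn invrK -exprS lerDl.
    have -> : rho = cd by rewrite /rho min_l// ltW.
    apply: (@le_trans _ _ (cd ^- 4)); last by rewrite lerDr exprn_ge0.
    rewrite ler_pdivrMr ?exprn_gt0// [cd ^+ 4]exprSr invfM -mulrA [_^-1 * cd ^+ 3]mulrC mulrA mulVf ?mul1r ?expf_neq0 ?gt_eqF//.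
    by rewrite -[leLHS]invrK lef_pV2 ?posrE ?invr_gt0// ltW.
  pose B : set (mE3 R) := ball3 y rho `&` Omega.
  have mB : measurable B by apply: measurableI => //; apply: open3_measurable; exact: open_ball3.
  have BO : B `<=` Omega by move=> z [].
  have d1 := dens Oy (introT andP (conj rho0 rcd)).
  have e20 : (0 <= (norm3 (E y) ^+ 2)%:E)%E by rewrite lee_fin sqr_ge0.
  have r4 : 0 <= 2 * rho ^+ 4 by rewrite mulr_ge0// exprn_ge0// ltW.
  (* [E y] is compared with [E z] for [z] in the ball, where [|y - z| <= rho] and the denominator of
     the Gagliardo integrand is at most [rho ^+ 4]. Multiplication by [w y / (cd * rho ^+ 3)] then
     turns [rho ^+ 4] into [rho * w y <= 1]. *)
  have h1 : ((norm3 (E y) ^+ 2)%:E * (cd * rho ^+ 3)%:E <= (2 * rho ^+ 4)%:E * S y + 2%:E * X)%E.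
    apply: (le_trans (lee_wpmul2l e20 d1)).
    rewrite -/B -integral_cst//.
    apply: (@le_trans _ _ (\int[leb3]_(z in B) ((2 * rho ^+ 4)%:E * (gagliardo E y z)%:E + 2%:E * (norm3 (E z) ^+ 2)%:E))%E).
      apply: ge0_le_integral_nomeas => z Bz //; rewrite -!EFinM -EFinD lee_fin.
      have n1 := norm3_triangle ((E y : E3 R) - E z) (E z); rewrite subrK in n1.
      have n2 := sqrD_le2 (norm3 ((E y : E3 R) - E z)) (norm3 (E z)).
      apply: (@le_trans _ _ ((norm3 ((E y : E3 R) - E z) + norm3 (E z)) ^+ 2)).
        by rewrite lerXn2r// nnegrE ?addr_ge0 ?norm3_ge0.
      apply: (le_trans n2); rewrite lerD2r -mulrA ler_wpM2l//.
      rewrite /gagliardo -[(2 : R)]/(2%:R) powR_mulrn ?norm3_ge0//.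
      have -> : (3 + 2^-1 * 2%:R : R) = 4%:R by field.
      rewrite powR_mulrn ?norm3_ge0//.
      have [yz|yz] := eqVneq (norm3 (y - z)) 0.
        have -> : z = y by apply/eqP; rewrite eq_sym -subr_eq0; apply/eqP; exact: norm3_eq0.
        by rewrite subrr norm30 expr0n/= mul0r mulr0.
      have yzp : 0 < norm3 (y - z) by rewrite lt_neqAle eq_sym yz norm3_ge0.
      rewrite mulrA ler_pdivlMr ?exprn_gt0// mulrC ler_wpM2r ?sqr_ge0//.
      by rewrite lerXn2r ?nnegrE ?norm3_ge0 ?(ltW rho0)// norm3B; case: Bz => /ltW.
    have mgy : measurable_fun setT (fun z : mE3 R => (gagliardo E y z)%:E).
      apply: (measurableT_comp mgag (_ : measurable_fun setT (fun z : mE3 R => (y : mE3 R, z)))).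
      by apply/measurable_fun_pairP; split; [exact: measurable_cst|exact: measurable_id].
    rewrite ge0_integralD//; last 4 first.
    - by move=> z _; rewrite mule_ge0 ?lee_fin.
    - by apply: measurable_funTS; exact: measurable_funeM.
    - by move=> z _; rewrite mule_ge0 ?lee_fin ?sqr_ge0.
    - by apply: measurable_funTS; exact: measurable_funeM.
    rewrite ge0_integralZl//; last 2 first.
    - exact: measurable_funTS.
    - by move=> z _; rewrite lee_fin.
    rewrite ge0_integralZl//; last 2 first.
    - exact: measurable_funTS.
    - by move=> z _; rewrite lee_fin sqr_ge0.
    apply: leeD; apply: lee_wpmul2l; rewrite ?lee_fin//; apply: ge0_subset_integral => //.
    - exact: measurable_funTS.
    - by move=> z _; rewrite lee_fin.
    - exact: measurable_funTS.
    - by move=> z _; rewrite lee_fin sqr_ge0.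
  have c1 : 0 <= w y / (cd * rho ^+ 3) by rewrite divr_ge0// mulr_ge0// ltW.
  have c1' : (0 <= (w y / (cd * rho ^+ 3))%:E)%E by rewrite lee_fin.
  have := lee_wpmul2l c1' h1.
  rewrite muleCA -EFinM divfK ?mulf_neq0 ?gt_eqF// => /le_trans; apply.
  apply: (weighted_sum_le c1 r4 (ler0n _ 2) k0 _ (S0 y) X0).
  - by rewrite addr_ge0// exprn_ge0.
  - rewrite /k (_ : w y / _ * _ = 2 / cd * (rho * w y)); last by field; rewrite !gt_eqF.
    by rewrite ler_piMr.
  - rewrite /k (_ : w y / _ * _ = 2 / cd * (w y / rho ^+ 3)); last by field; rewrite !gt_eqF.
    by rewrite ler_wpM2l.
have mw4 : measurable_fun setT (fun y : mE3 R => (w y ^+ 4 + cd ^- 4)%:E).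
  apply/measurable_EFinP; apply: measurable_funD => //; apply: measurable_funX.
  apply: measurableT_comp => //; rewrite /curve_weight.
  rewrite (_ : (fun y => _) = fun y => (\int[leb1]_s ((fun w : mE3 R * M1 => (rdist eps (g w.2) w.1 `^ (5 / 4))%:E) \_ (setT `*` J)) (y, s))%E); last first.
    apply/funext => y; rewrite integral_mkcond; apply: eq_integral => s _; rewrite !patchE.
    by congr (if _ then _ else _); apply/idP/idP; rewrite !inE; [split|case].
  have mTJ : measurable (setT `*` J : set (mE3 R * M1)) by exact: measurableX.
  apply: (@measurable_fun_fubini_tonelli_F _ _ _ _ R (@lebesgue_measure R)).
    apply/(measurable_restrictT _ mTJ); apply: measurable_funTS; apply/measurable_EFinP.
    by apply: measurable_rdist2 => //; do ?[exact: measurable_fst|exact: measurableT_comp].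
  by move=> z; apply: erestrict_ge0 => z' _; rewrite lee_fin powR_ge0.
(* The term free of the seminorm is the constant [X] times this weight, so integrability of its
   fourth power suffices. *)
have N4 : (\int[leb3]_(y in Omega) (w y ^+ 4 + cd ^- 4)%:E <= N%:E)%E.
  under eq_integral do rewrite EFinD.
  have a1 (y : mE3 R) : Omega y -> (0 <= (w y ^+ 4)%:E)%E by move=> _; rewrite lee_fin exprn_ge0.
  have a2 : measurable_fun (Omega : set (mE3 R)) (fun y : mE3 R => (w y ^+ 4)%:E).
    apply: measurable_funTS; apply/measurable_EFinP.
    have /measurable_EFinP h := mw4.
    have := measurable_funB h (@measurable_cst _ _ _ _ setT (cd ^- 4 : M1)).
    by apply: eq_measurable_fun => y _; rewrite /= addrK.
  have a3 (y : mE3 R) : Omega y -> (0 <= (cd ^- 4)%:E :> \bar R)%E by move=> _; rewrite lee_fin.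
  rewrite (ge0_integralD _ mO a1 a2 a3 (@measurable_cst _ _ _ _ _ _)).
  rewrite integral_cst// volE -EFinM /N EFinD; apply: leeD => //.
  exact: cw4_integral.
apply: (@le_trans _ _ (\int[leb3]_(y in Omega) (k%:E * (S y + X * (w y ^+ 4 + cd ^- 4)%:E)))%E).
  apply: ge0_le_integral_nomeas => y Oy; last exact: key.
  by rewrite mule_ge0 ?lee_fin ?sqr_ge0.
have p0 y : (0 <= (w y ^+ 4 + cd ^- 4)%:E)%E by rewrite lee_fin addr_ge0// exprn_ge0.
have mXw : measurable_fun setT (fun y : mE3 R => X * (w y ^+ 4 + cd ^- 4)%:E)%E by exact: measurable_funeM.
rewrite ge0_integralZl//; last 2 first.
- by apply: measurable_funTS; exact: emeasurable_funD.
- by move=> y _; rewrite adde_ge0// mule_ge0.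
rewrite ge0_integralD//; last 3 first.
- exact: measurable_funTS.
- by move=> y _; rewrite mule_ge0.
- exact: measurable_funTS.
rewrite ge0_integralZl//; last exact: measurable_funTS.
by apply: weighted_sum_le_bound => //; apply: integral_ge0.
Qed.

End hardy.
End kernel_operators.

Section square_integrability.
Context d (T : measurableType d) (R : realType).
Variable mu : {measure set T -> \bar R}.

Lemma sqr_integrable D (F : T -> R) : measurable D -> (mu D < +oo)%E -> measurable_fun D F ->
  (\int[mu]_(x in D) (F x ^+ 2)%:E < +oo)%E -> mu.-integrable D (EFin \o F).
Proof.
move=> mD fD mF sF.
have i2 : mu.-integrable D (fun x => (F x ^+ 2 + 1)%:E).
  under eq_fun do rewrite EFinD.
  apply: integrableD => //; last first.
    by apply/integrableP; split; [exact: measurable_cst|rewrite integral_cst//= normr1 mul1e].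
  apply/integrableP; split; first by apply/measurable_EFinP; exact: measurable_funX.
  by under eq_integral => x _ do rewrite gee0_abs ?lee_fin ?sqr_ge0//.
apply: le_integrable i2 => //; first exact/measurable_EFinP.
move=> x _; rewrite /= lee_fin [leRHS]ger0_norm ?addr_ge0 ?sqr_ge0//.
rewrite -[F x ^+ 2]real_normK ?num_real//.
by have := sqr_ge0 (`|F x| - 1); have := normr_ge0 (F x); nra.
Qed.

Lemma mul_bounded_integrable D (F B : T -> R) (M : R) : measurable D -> measurable_fun D B ->
  (forall x, D x -> `|B x| <= M) -> mu.-integrable D (EFin \o F) ->
  mu.-integrable D (fun x => (F x * B x)%:E).
Proof.
move=> mD mB HB iF.
have iM : mu.-integrable D (fun x => M%:E * (EFin \o F) x)%E by exact: integrableZl.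
apply: le_integrable iM => //.
  by apply/measurable_EFinP; apply: measurable_funM => //; apply/measurable_EFinP; case/integrableP: iF.
move=> x Dx; by rewrite /= lee_fin !normrM mulrC ler_wpM2r// (le_trans (HB _ Dx))// ler_norm.
Qed.

Lemma sum6_sqr_le (R' : realDomainType) (a b c e f g : R') :
  (a + b + c + e + f + g) ^+ 2 <=
  6%:R * (a ^+ 2 + b ^+ 2 + c ^+ 2 + e ^+ 2 + f ^+ 2 + g ^+ 2).
Proof.
have h (x y : R') : 0 <= (x - y) ^+ 2 by exact: sqr_ge0.
have := h a b; have := h a c; have := h a e; have := h a f; have := h a g.
have := h b c; have := h b e; have := h b f; have := h b g; have := h c e.
have := h c f; have := h c g; have := h e f; have := h e g; have := h f g.
by lra.
Qed.

Lemma norm_Rintegral_le D (F : T -> R) : measurable D -> mu.-integrable D (EFin \o F) ->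
  (`|\int[mu]_(x in D) F x|%:E <= \int[mu]_(x in D) `|F x|%:E)%E.
Proof.
move=> mD iF; have iN : mu.-integrable D (fun x => `|F x|%:E).
  by have := integrable_abse iF; apply: eq_integrable => // x _ /=.
rewrite (le_trans (_ : _ <= (\int[mu]_(x in D) `|F x|)%:E)%E) ?lee_fin ?le_normr_Rintegral//.
by rewrite /Rintegral fineK//; exact: integrable_fin_num.
Qed.

Lemma sqr_integral_le D (F : T -> R) (A : R) : measurable D -> mu D = A%:E -> measurable_fun D F ->
  (forall x, D x -> 0 <= F x) ->
  ((\int[mu]_(x in D) (F x)%:E) ^+ 2 <= A%:E * \int[mu]_(x in D) (F x ^+ 2)%:E)%E.
Proof.
move=> mD DA mF F0.
have := @cauchy_schwarz _ _ _ mu D (fun=> 1) F mD (measurable_cst _) mF (fun _ _ => ler01) F0.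
under eq_integral do rewrite mul1r.
by under [in leRHS]eq_integral do rewrite expr1n; rewrite integral_cst// mul1e DA.
Qed.

End square_integrability.

(** * Smooth bumps and mollified Dirac masses *)

Section bumps.
Context {R : realType}.
Local Notation M1 := (measurableTypeR R).
Implicit Types (f F : R -> R) (q : {poly R}).

(** The classical flat function with a polynomial factor in [1 / x]; the factor makes the family
    stable under differentiation. *)
Definition flat q (x : R) : R := if 0 < x then q.[x^-1] * expR (- x^-1) else 0.

Lemma horner_growth q : exists2 C : R, 0 <= C & exists m, forall t, 0 <= t -> `|q.[t]| <= C * (1 + t) ^+ m.
Proof.
elim/poly_ind: q => [|q c [C C0 [m Hq]]].
  by exists 0 => //; exists 0%N => t _; rewrite horner0 normr0 mul0r.
exists (C + `|c|); first by rewrite addr_ge0.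
exists m.+1 => t t0; rewrite hornerMXaddC; apply: (le_trans (ler_normD _ _)).
have t1 : 1 <= 1 + t by rewrite lerDl.
rewrite mulrDl; apply: lerD; last by rewrite ler_peMr// exprn_ege1.
rewrite normrM (ger0_norm t0) exprSr mulrA; apply: ler_pM => //; first exact: Hq.
by rewrite lerDr.
Qed.

(** Exponential decay beats the polynomial. Two powers of [x] suffice to differentiate at 0 by the
    quadratic criterion, so two are added to the growth exponent [m] of [q]. *)
Lemma flat_quadratic q : exists2 K : R, 0 <= K & forall x, `|flat q x| <= K * (Num.max 0 x) ^+ 2.
Proof.
have [C C0 [m Hq]] := horner_growth q.
exists (C * ((m.+2)`!%:R * expR 1)); first by rewrite mulr_ge0// mulr_ge0// expR_ge0.
move=> x; rewrite /flat; case: ifPn => [x0|x0]; last first.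
  by rewrite normr0 mulr_ge0 ?sqr_ge0// mulr_ge0// mulr_ge0// expR_ge0.
have -> : Num.max 0 x = x by rewrite max_r// ltW.
have y0 : 0 <= x^-1 by rewrite invr_ge0 ltW.
set t := x^-1 in y0 *.
have t1 : 0 <= 1 + t by rewrite addr_ge0.
have h1 : (1 + t) ^+ m.+2 <= (m.+2)`!%:R * expR 1 * expR t.
  rewrite -mulrA -expRD.
  have := @expR_ge1Dxn R (1 + t) m.+1 t1.
  have f0 : (0 : R) < (m.+2)`!%:R by rewrite ltr0n fact_gt0.
  move=> h; rewrite mulrC -ler_pdivrMr//; apply: le_trans h; by rewrite lerDr.
have tx : t * x = 1 by rewrite mulVf// gt_eqF.
have h2 : 1 <= (1 + t) * x by rewrite mulrDl tx mul1r lerDr ltW.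
rewrite normrM (ger0_norm (expR_ge0 _)) expRN.
rewrite ler_pdivrMr ?expR_gt0//; apply: (le_trans (Hq _ y0)).
rewrite -!mulrA ler_wpM2l// mulrA mulrC -mulrA [X in _ <= X](_ : _ = x ^+ 2 * ((m.+2)`!%:R * expR 1 * expR t)); last by ring.
apply: (@le_trans _ _ (x ^+ 2 * (1 + t) ^+ m.+2)); last by rewrite ler_wpM2l ?sqr_ge0.
rewrite (_ : x ^+ 2 * _ = (1 + t) ^+ m * ((1 + t) * x) ^+ 2); last by rewrite !exprS; ring.
by rewrite ler_peMr ?exprn_ge0// exprn_ege1.
Qed.

Lemma is_derive_flat q (x : R) : is_derive x (1 : R) (flat q) (flat ('X^2 * (q - q^`())) x).
Proof.
have [x0|x0] := ltP 0 x; last first.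
  have [K K0 HK] := flat_quadratic q.
  have z p : flat p x = 0 by rewrite /flat ltNge x0.
  rewrite z; apply: (@quadratic_is_derive _ _ _ _ K) => h.
  rewrite z mul0r !subr0; apply: (le_trans (HK _)); rewrite ler_wpM2l//.
  have [hx|hx] := leP 0 (h + x).
    by rewrite lerXn2r ?nnegrE// ?(le_trans hx)// ?gerDl.
  by rewrite expr0n sqr_ge0.
have xn : x != 0 by rewrite gt_eqF.
have dV : is_derive x (1 : R) (fun t => t^-1) (- x ^- 2).
  have := @is_deriveV R id x 1 1 xn (is_derive_id _ _); by rewrite /GRing.scale/= mulr1.
have dN : is_derive x (1 : R) (fun t => - t^-1) (x ^- 2).
  by have := is_deriveN dV; rewrite opprK.
have d1 := @is_derive1_comp R (horner q) (fun t => t^-1) x _ _ (is_derive_poly q x^-1) dV.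
have d2 := @is_derive1_comp R expR (fun t => - t^-1) x _ _ (is_derive_expR _) dN.
have := is_deriveM d1 d2; rewrite /GRing.scale/=.
set D := (X in is_derive _ _ _ X) => dM.
have -> : flat ('X^2 * (q - q^`())) x = D.
  rewrite /flat x0 hornerM hornerXn hornerD hornerN /D -exprVn; ring.
apply: near_eq_is_derive dM; near=> t.
have t0 : 0 < t by near: t; exact: (lt_nbhsr x0).
by rewrite /flat t0.
Unshelve. all: end_near. Qed.

(** A class stable under differentiation, whose members are therefore smooth. Primitives are
    included for the twice integrated bump. *)
Inductive bump_expr : (R -> R) -> Prop :=
| bump_flat q : bump_expr (flat q)
| bump_cst c : bump_expr (fun=> c)
| bump_add f F : bump_expr f -> bump_expr F -> bump_expr (fun x => f x + F x)
| bump_mul f F : bump_expr f -> bump_expr F -> bump_expr (fun x => f x * F x)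
| bump_affine f a b : bump_expr f -> bump_expr (fun x => f (a * x + b))
| bump_primitive f F : bump_expr f -> (forall x : R, is_derive x (1 : R) F (f x)) -> bump_expr F.

Lemma is_derive_comp_affine f df (a b x : R) : is_derive (a * x + b) (1 : R) f df ->
  is_derive x (1 : R) (fun t => f (a * t + b)) (df * a).
Proof.
move=> h; apply: (@is_derive1_comp R f (fun t => a * t + b)) => //.
have := is_deriveD (@is_deriveZ R R R id a x 1 1 (is_derive_id _ _)) (is_derive_cst b x 1).
by rewrite /GRing.scale/= mulr1 addr0.
Qed.

Lemma bump_derive f : bump_expr f ->
  exists2 df, bump_expr df & forall x : R, is_derive x (1 : R) f (df x).
Proof.
elim=> {f} [q|c|f F bf [df bdf Hf] bF [dF bdF HF]|f F bf [df bdf Hf] bF [dF bdF HF]|f a b bf [df bdf Hf]|f F bf _ HF].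
- by exists (flat ('X^2 * (q - q^`()))); [exact: bump_flat|exact: is_derive_flat].
- by exists (fun=> 0); [exact: bump_cst|move=> x; exact: is_derive_cst].
- by exists (fun x => df x + dF x); [exact: bump_add|move=> x; exact: is_deriveD].
- exists (fun x => f x * dF x + F x * df x); first by apply: bump_add; exact: bump_mul.
  by move=> x; exact: is_deriveM.
- exists (fun x => df (a * x + b) * a); last by move=> x; exact: is_derive_comp_affine.
  by apply: bump_mul (bump_cst a); exact: bump_affine.
- by exists f.
Qed.

Lemma is_derive_scale f df (x v : R) : is_derive x (1 : R) f df -> is_derive x v f (v * df).
Proof.
move=> [d e]; have df1 : differentiable f x by apply/derivable1_diffP.
split; first exact: diff_derivable.
rewrite deriveE// -[v in LHS]mulr1 -[v * 1]/(v *: (1 : R)) linearZ/= -deriveE//.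
by rewrite e.
Qed.

Lemma bump_smooth f : bump_expr f -> smooth f.
Proof.
move=> bf l /=.
have : bump_expr (foldr (fun v h => 'D_v h) f l).
  elim: l => //= v l /bump_derive [df bdf H].
  rewrite (_ : 'D_v _ = fun x => v * df x); first exact: bump_mul (bump_cst v) bdf.
  by apply/funext => x; have [_ ->] := is_derive_scale v (H x).
move=> /bump_derive [df _ H]; split; first exact: is_derive_continuous H.
by move=> v x; have [] := is_derive_scale v (H x).
Qed.

Lemma exists_primitive f : continuous f -> (forall x, x <= 0 -> f x = 0) ->
  exists2 F, (forall x : R, is_derive x (1 : R) F (f x)) & forall x, x <= 0 -> F x = 0.
Proof.
move=> cf f0.
(* Since [f] vanishes on the negative half-line any negative base point gives the same function;
   below it the integral is over an empty set and [F] is 0 as well. *)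
pose F x := \int[@lebesgue_measure R]_(t in `[-1, x]) f t.
have F0 x : x <= 0 -> F x = 0.
  move=> x0; rewrite /F (@eq_Rintegral _ _ _ _ _ (fun=> 0)) ?Rintegral_cst ?mul0r//.
  by move=> t; rewrite inE/= in_itv/= => /andP[_ tx]; rewrite f0// (le_trans tx).
exists F => // x; have [x1|x1] := ltP (- 1) x; last first.
  have x0 : x < 0 by apply: le_lt_trans x1 _; rewrite oppr_lt0.
  rewrite f0 ?ltW//; apply: (near_eq_is_derive _ (is_derive_cst 0 x 1)).
  near=> t; rewrite F0//; apply: ltW; near: t; exact: (lt_nbhsl x0).
have xu : x < x + 1 by rewrite ltrDl.
have [|d e] := @continuous_FTC1_closed R f (-1) x (x + 1) xu _ x1 (cf x).
  exact: continuous_integrable_segment.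
by split; [exact: d|rewrite -derive1E; exact: e].
Unshelve. all: end_near. Qed.

End bumps.

Section unit_bump.
Context {R : realType}.

Lemma bump_continuous (f : R -> R) : bump_expr f -> continuous f.
Proof. by move=> bf; have [df _ H] := bump_derive bf; exact: is_derive_continuous H. Qed.

(** A bump [rho] of mass 1 on [[0, 1]] with its first and second primitives [P] and [Q]: smooth
    versions of the Dirac mass, the Heaviside function and the positive part. To the right of the
    support [Q] is affine with offset [m], the mean of [rho]. *)
Record unit_bump (rho drho P Q : R -> R) (m : R) : Prop := UnitBump {
  bumpQ : bump_expr Q;
  derQ : forall x : R, is_derive x (1 : R) Q (P x);
  derP : forall x : R, is_derive x (1 : R) P (rho x);
  derrho : forall x : R, is_derive x (1 : R) rho (drho x);
  bumprho : bump_expr rho;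
  bumpdrho : bump_expr drho;
  rho_ge0 : forall x, 0 <= rho x;
  bump_left : forall x, x <= 0 -> [/\ rho x = 0, P x = 0 & Q x = 0];
  bump_right : forall x, 1 <= x -> [/\ rho x = 0, P x = 1 & Q x = x - m];
  P01 : forall x, 0 <= P x <= 1 }.

Lemma unit_bump_exists : exists rho drho P Q m, unit_bump rho drho P Q m.
Proof.
pose f1 : R -> R := flat 1; pose r0 x := f1 x * f1 (-1 * x + 1).
have br0 : bump_expr r0 by apply: bump_mul; [exact: bump_flat|apply: bump_affine; exact: bump_flat].
have f1_ge0 x : 0 <= f1 x by rewrite /f1 /flat; case: ifP => // _; rewrite hornerC mul1r expR_ge0.
have f1_gt0 x : 0 < x -> 0 < f1 x by move=> x0; rewrite /f1 /flat x0 hornerC mul1r expR_gt0.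
have f1_0 x : x <= 0 -> f1 x = 0 by move=> x0; rewrite /f1 /flat ltNge x0.
have r0_ge0 x : 0 <= r0 x by rewrite mulr_ge0.
have r00 x : x <= 0 -> r0 x = 0 by move=> x0; rewrite /r0 f1_0// mul0r.
have r01 x : 1 <= x -> r0 x = 0 by move=> x1; rewrite /r0 [X in _ * X]f1_0 ?mulr0//; lra.
have [dr0 bdr0 Dr0] := bump_derive br0.
have [P0 DP0 P00] := exists_primitive (bump_continuous br0) r00.
have P0_mono x t : x <= t -> P0 x <= P0 t.
  move=> xt; have [c _ e] := MVT_between x t DP0.
  by rewrite -subr_ge0 e mulr_ge0// subr_ge0.
(* The mean value point between 1/2 and 3/4 lies in [[1/4, 3/4]], where the unnormalised bump is
   positive. *)
have P01_gt0 : 0 < P0 1.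
  have [c cb e] := MVT_between 2^-1 (3 / 4) DP0.
  have h : P0 2^-1 < P0 (3 / 4).
    rewrite -subr_gt0 e mulr_gt0//; last by lra.
    have {cb} : `|c - 2^-1| <= 4^-1 by apply: (le_trans cb); rewrite ger0_norm; lra.
    by rewrite ler_norml => /andP[? ?]; rewrite mulr_gt0// f1_gt0//; lra.
  have h0 : 0 <= P0 2^-1 by rewrite -(P00 0)//; apply: P0_mono; rewrite invr_ge0.
  by apply: (le_lt_trans h0); apply: (lt_le_trans h); apply: P0_mono; lra.
have P0_1 x : 1 <= x -> P0 x = P0 1.
  move=> x1; have [c cb e] := MVT_between x 1 DP0.
  have c1 : 1 <= c.
    move: cb; rewrite (ler0_norm (_ : 1 - x <= 0)) ?subr_le0// ler_norml => /andP[? ?]; lra.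
  by apply/esym/eqP; rewrite -subr_eq0 e r01// mul0r.
pose k := (P0 1)^-1.
have k0 : 0 < k by rewrite invr_gt0.
pose rho x := k * r0 x; pose P x := k * P0 x.
have Dk (f df : R -> R) (x : R) : is_derive x (1 : R) f (df x) -> is_derive x (1 : R) (fun t => k * f t) (k * df x).
  by move=> d; exact: is_deriveZ.
have bP : bump_expr P by apply: bump_mul (bump_cst k) _; exact: bump_primitive br0 DP0.
have P_0 x : x <= 0 -> P x = 0 by move=> x0; rewrite /P P00// mulr0.
have P_1 x : 1 <= x -> P x = 1 by move=> x1; rewrite /P P0_1// mulVf// gt_eqF.
have P_01 x : 0 <= P x <= 1.
  have Pm u t : u <= t -> P u <= P t by move=> ut; rewrite /P ler_wpM2l ?P0_mono// ltW.
  have [x0|x0] := leP x 0; first by rewrite P_0// lexx ler01.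
  have [x1|x1] := leP 1 x; first by rewrite P_1// lexx ler01.
  by rewrite -{1}(P_0 0)// -(P_1 1)// !Pm// ltW.
have [Q DQ Q0] := exists_primitive (bump_continuous bP) P_0.
exists rho, (fun x => k * dr0 x), P, Q, (1 - Q 1); split => //.
- exact: bump_primitive bP DQ.
- by move=> x; exact: Dk.
- by move=> x; exact: Dk.
- exact: bump_mul (bump_cst k) br0.
- exact: bump_mul (bump_cst k) bdr0.
- by move=> x; rewrite mulr_ge0// ltW.
- by move=> x x0; rewrite /rho r00// mulr0 P_0// Q0.
- move=> x x1; rewrite /rho r01// mulr0 P_1//; split => //.
  have D1 (t : R) : is_derive t (1 : R) (fun u => Q u - u) (P t - 1) by exact: is_deriveB.
  have [c cb e] := MVT_between x 1 D1.
  have c1 : 1 <= c.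
    move: cb; rewrite (ler0_norm (_ : 1 - x <= 0)) ?subr_le0// ler_norml => /andP[? ?]; lra.
  by move: e; rewrite P_1// subrr mul0r => e; lra.
Qed.

End unit_bump.

Section mollification.
Context {R : realType}.
Local Notation M1 := (measurableTypeR R).
Local Notation L1 := (@leb1 R).
Variables (rho drho P Q : R -> R) (m : R).
Hypothesis ub : unit_bump rho drho P Q m.
Variables (a b : R).
Hypothesis ab : a < b.
Local Notation I := (`]a, b[%classic : set M1).

(** A Dirac mass at [s] mollified to the right, on [[s, s + h]]. The argument is written as an
    affine function so as to stay in [bump_expr]. *)
Definition kernel (s h z : R) : R := h^-1 * rho (h^-1 * z + - (s / h)).

Lemma affineE (s h z : R) : h != 0 -> h^-1 * z + - (s / h) = (z - s) / h.
Proof. by move=> h0; rewrite mulrBl mulrC. Qed.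

Lemma kernel_continuous s h : continuous (kernel s h).
Proof.
apply: bump_continuous; apply: bump_mul (bump_cst h^-1) _.
by apply: bump_affine; exact: (bumprho ub).
Qed.

Lemma integrable_itvoo (f : R -> R) : continuous f -> L1.-integrable I (EFin \o f).
Proof.
move=> cf; apply: (@integrableS _ _ _ L1 `[a, b]%classic) => //; last exact: continuous_integrable_segment.
exact: subset_itv_oo_cc.
Qed.

Lemma itvoo_lty : (L1 I < +oo)%E.
Proof. by rewrite leb1_oo ?ltW// ltry. Qed.

Lemma bounded_itvoo (f : R -> R) : continuous f -> exists2 M, 0 <= M & forall x, I x -> `|f x| <= M.
Proof.
move=> cf; have cg : {within `[a, b], continuous (fun x => `|f x|)}.
  by apply: continuous_subspaceT => x; apply: continuous_comp; [exact: cf|exact: norm_continuous].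
have [c _ Hc] := EVT_max (ltW ab) cg.
by exists `|f c| => // x Ix; apply: Hc; exact: (subset_itv_oo_cc Ix).
Qed.

Lemma kernel_integral s h : 0 < h -> a <= s -> s + h <= b -> \int[L1]_(z in I) kernel s h z = 1.
Proof.
move=> h0 as_ shb; have hn : h != 0 by rewrite gt_eqF.
have D (t : R) : is_derive t (1 : R) (fun z => P (h^-1 * z + - (s / h))) (kernel s h t).
  by rewrite /kernel [h^-1 * rho _]mulrC; apply: is_derive_comp_affine; exact: (derP ub).
have := FTC_segment D (@kernel_continuous s h) (ltW ab).
have [_ -> _] : [/\ rho (h^-1 * b + - (s / h)) = 0, P (h^-1 * b + - (s / h)) = 1 & Q (h^-1 * b + - (s / h)) = h^-1 * b + - (s / h) - m].
  by apply: (bump_right ub); rewrite affineE// ler_pdivlMr// mul1r; lra.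
have [_ -> _] : [/\ rho (h^-1 * a + - (s / h)) = 0, P (h^-1 * a + - (s / h)) = 0 & Q (h^-1 * a + - (s / h)) = 0].
  by apply: (bump_left ub); rewrite affineE// ler_pdivrMr// mul0r; lra.
rewrite subr0 => E1; rewrite -[RHS]/(fine 1%:E) -E1 /Rintegral; congr fine; apply/esym/integral_itv_bndoo.
by apply/measurable_EFinP; apply: continuous_measurable1 => //; exact: kernel_continuous.
Qed.

Lemma kernel_ge0 s h z : 0 < h -> 0 <= kernel s h z.
Proof. by move=> h0; rewrite mulr_ge0 ?invr_ge0 ?(ltW h0)// (rho_ge0 ub). Qed.

Lemma kernel_supp s h z : 0 < h -> kernel s h z != 0 -> s <= z <= s + h.
Proof.
move=> h0; have hn : h != 0 by rewrite gt_eqF.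
apply: contra_neqT; rewrite negb_and -!ltNge => zs; rewrite /kernel.
have [zs'|zs'] := ltP z s.
  have hz : h^-1 * z + - (s / h) <= 0 by rewrite affineE// ler_pdivrMr// mul0r; lra.
  by have [-> _ _] := bump_left ub hz; rewrite mulr0.
have {zs} zs : s + h < z by move: zs; rewrite ltNge zs'.
have hz : 1 <= h^-1 * z + - (s / h) by rewrite affineE// ler_pdivlMr// mul1r; lra.
by have [-> _ _] := bump_right ub hz; rewrite mulr0.
Qed.

Lemma mollified_value (w : R -> R) (s h s0 e : R) : 0 < h -> a <= s -> s + h <= b ->
  L1.-integrable I (EFin \o w) ->
  (forall z, I z -> s <= z <= s + h -> `|w z - w s0| <= e) ->
  `|\int[L1]_(z in I) (w z * kernel s h z) - w s0| <= e.
Proof.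
move=> h0 as_ shb iw we; have mI : measurable I by exact: measurable_itv.
have ik := integrable_itvoo (@kernel_continuous s h).
have [M _ HM] := bounded_itvoo (@kernel_continuous s h).
have mk : measurable_fun I (kernel s h : M1 -> M1) by apply: continuous_measurable1 => //; exact: kernel_continuous.
have iwk := mul_bounded_integrable mI mk HM iw.
have ick : L1.-integrable I (EFin \o (fun z => w s0 * kernel s h z)).
  by have := integrableZl mI (w s0) ik; apply: eq_integrable.
have -> : w s0 = \int[L1]_(z in I) (w s0 * kernel s h z) by rewrite RintegralZl// kernel_integral// mulr1.
rewrite -RintegralB//.
apply: (le_trans (le_normr_Rintegral mI (integrableB mI iwk ick))).
have iek : L1.-integrable I (EFin \o (fun z => e * kernel s h z)).
  by have := integrableZl mI e ik; apply: eq_integrable.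
have -> : e = \int[L1]_(z in I) (e * kernel s h z) by rewrite RintegralZl// kernel_integral// mulr1.
apply: le_Rintegral => //.
  by have := integrable_abse (integrableB mI iwk ick); apply: eq_integrable.
move=> z Iz; rewrite -mulrBl normrM (ger0_norm (kernel_ge0 _ _ h0)).
have [->|kn] := eqVneq (kernel s h z) 0; first by rewrite !mulr0.
by rewrite ler_wpM2r ?kernel_ge0// we//; exact: kernel_supp kn.
Qed.

End mollification.

(** * Schur's test on the boundary and in the domain *)

Section trace_estimate.
Context {R : realType}.
Local Notation M1 := (measurableTypeR R).
Variables (Omega : set (E3 R)) (sigma : {measure set (mE3 R) -> \bar R}).
Hypotheses (oOmega : open Omega) (cOmega : connected Omega).
Hypotheses (bOmega : bounded_set Omega) (nOmega : Omega !=set0).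
Hypothesis charts : forall x0, bdry Omega x0 -> exists r e1 e2 e3 psi,
  graph_chart Omega x0 r e1 e2 e3 psi.
Hypothesis surf : surface_measure Omega sigma.
Let mO : measurable (Omega : set (mE3 R)) := open3_measurable oOmega.
Let mB : measurable (bdry Omega : set (mE3 R)) := @measurable_bdry R Omega.

(** The trace inequality applied to the constant 1. *)
Lemma bdry_measure_lty : (sigma (bdry Omega) < +oo)%E.
Proof.
have [C C0 H] := bdry_trace oOmega bOmega charts surf.
have := H _ _ (C1grad_cst 1); rewrite /energy.
have -> : (\int[leb3]_(x in Omega) (norm3 (cst (0 : E3 R) x) ^+ 2)%:E = 0)%E.
  by under eq_integral do rewrite /= norm30 expr0n; rewrite integral0.
under eq_integral do rewrite /= expr1n; under [in leRHS]eq_integral do rewrite /= expr1n.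
rewrite !integral_cst// !mul1e adde0 => /le_lt_trans; apply.
by rewrite lte_mul_pinfty ?lee_fin//; exact: leb3_bounded_lty.
Qed.

(** The restriction of [sigma] to the boundary is finite, hence sigma-finite, which allows Tonelli's
    theorem in Schur's test. *)
Definition bdry_measure : {sigma_finite_measure set (mE3 R) -> \bar R} :=
  mfrestr mB bdry_measure_lty.

Lemma bdry_measureE (F : mE3 R -> \bar R) :
  (\int[bdry_measure]_(x in bdry Omega) F x = \int[sigma]_(x in bdry Omega) F x)%E.
Proof.
apply: eq_measure_integral => A mA AB.
by rewrite /bdry_measure/= /mfrestr /mrestr setIidl.
Qed.

Lemma domain_volume : exists2 A : R, 0 <= A & leb3 Omega = A%:E.
Proof.
exists (fine (leb3 Omega)); first exact: fine_ge0.
by rewrite fineK// ge0_fin_numE//; exact: leb3_bounded_lty.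
Qed.

Lemma continuous_integrable_domain (p : E3 R -> R) : continuous p ->
  (leb3 : {measure set (mE3 R) -> \bar R}).-integrable Omega (EFin \o p).
Proof. by move=> cp; exact: bounded_integrable3. Qed.

Lemma bounded_bdry : bounded_set (bdry Omega).
Proof. exact: compact_bounded (compact_bdry bOmega). Qed.

Variables (gamma : R -> E3 R) (g : M1 -> mE3 R).
Hypothesis mg : measurable_fun setT g.
Hypothesis gE : forall s, 0 <= s <= 1 -> g s = gamma s.
Hypothesis gB : forall s, 0 <= s <= 1 -> bdry Omega (gamma s).
Variable K3 : R.
Hypothesis K30 : 0 <= K3.
Hypothesis HK3 : forall (y : E3 R) (eps : R), 0 < eps <= 1 ->
  (\int[leb1]_(s in `[0%R, 1%R]) (rdist eps (g s) y `^ (3 / 4))%:E <= K3%:E)%E.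
Let J : set M1 := `[0, 1]%classic.

Lemma measurable_kernel_integral (mu : {sigma_finite_measure set (mE3 R) -> \bar R})
    (D : set (mE3 R)) (e : mE3 R -> R) (p eps : R) :
  measurable D -> 0 < eps -> measurable_fun setT e -> (forall y, 0 <= e y) ->
  measurable_fun setT (fun s : M1 => \int[mu]_(y in D) (e y * rdist eps (g s) y `^ p)%:E)%E.
Proof.
move=> mD eps0 me e0.
rewrite (_ : (fun s => _) = fun s => (\int[mu]_y ((fun w : M1 * mE3 R =>
    (e w.2 * rdist eps (g w.1) w.2 `^ p)%:E) \_ (setT `*` D)) (s, y))%E); last first.
  apply/funext => s; rewrite integral_mkcond; apply: eq_integral => y _; rewrite !patchE.
  by congr (if _ then _ else _); apply/idP/idP; rewrite !inE; [split|case].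
have mTD : measurable (setT `*` D : set (M1 * mE3 R)) by exact: measurableX.
apply: (@measurable_fun_fubini_tonelli_F _ _ _ _ R mu).
  apply/(measurable_restrictT _ mTD); apply: measurable_funTS; apply/measurable_EFinP.
  apply: measurable_funM; first exact: measurableT_comp.
  by apply: measurable_rdist2 => //; exact: measurableT_comp.
by move=> w; apply: erestrict_ge0 => z _; rewrite lee_fin mulr_ge0// powR_ge0.
Qed.

Let bsq (e : mE3 R -> R) := (\int[sigma]_(y in bdry Omega) (e y ^+ 2)%:E)%E.

Lemma bdry_kernel_sqr : exists2 C : R, 0 <= C & forall (e : mE3 R -> R) eps, 0 < eps <= 1 ->
  measurable_fun setT e -> (forall y, 0 <= e y) ->
  (\int[leb1]_(s in J) (\int[sigma]_(y in bdry Omega) (e y * rdist eps (g s) y)%:E) ^+ 2 <=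
   C%:E * bsq e)%E.
Proof.
have [K K0 HK] := bdry_kernel_bound oOmega bOmega charts surf.
exists (K * K3); first exact: mulr_ge0.
move=> e eps e01 me e0; have /andP[eps0 _] := e01.
have HK' s : J s -> (\int[bdry_measure]_(y in bdry Omega) (rdist eps (g s) y `^ (5 / 4))%:E <= K%:E)%E.
  by move=> _; rewrite bdry_measureE; exact: HK.
have := @kernel_sqr_integral R g mg bdry_measure (bdry Omega) mB e (3 / 4) (5 / 4) eps K eps0 me e0 HK'.
rewrite (_ : (3 / 4 + 5 / 4) / 2 = 1); last by field.
rewrite bdry_measureE => h.
apply: (@le_trans _ _ (\int[leb1]_(s in J) (\int[bdry_measure]_(y in bdry Omega)
    (e y * rdist eps (g s) y `^ 1)%:E) ^+ 2)%E).
  apply: ge0_le_integral_nomeas => s _; first by rewrite sqre_ge0.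
  rewrite bdry_measureE le_eqVlt; apply/orP; left; apply/eqP; congr (_ ^+ 2)%E.
  by apply: eq_integral => y _; rewrite powRr1// ltW// rdist_gt0.
apply: (le_trans h); rewrite EFinM -muleA; apply: lee_wpmul2l; first by rewrite lee_fin.
rewrite /bsq -ge0_integralZl//; last 2 first.
- by apply: measurable_funTS; apply/measurable_EFinP; exact: measurable_funX.
- by move=> y _; rewrite lee_fin sqr_ge0.
apply: ge0_le_integral_nomeas => y _.
  by rewrite mule_ge0 ?lee_fin ?sqr_ge0// integral_ge0// => s _; rewrite lee_fin powR_ge0.
by rewrite muleC; apply: lee_wpmul2r; [rewrite lee_fin sqr_ge0|exact: HK3].
Qed.

Let dsq (e : mE3 R -> R) := (\int[leb3]_(y in Omega) (e y ^+ 2)%:E)%E.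
Let gag (E : mE3 R -> mE3 R) :=
  (\int[leb3]_(y in Omega) \int[leb3]_(z in Omega) (gagliardo E y z)%:E)%E.

Lemma domain_kernel_sqr : exists2 C : R, 0 <= C & forall (E : mE3 R -> mE3 R) eps, 0 < eps <= 1 ->
  measurable_fun setT E ->
  (\int[leb1]_(s in J) (\int[leb3]_(y in Omega) (norm3 (E y) * rdist eps (g s) y ^+ 2)%:E) ^+ 2 <=
   C%:E * (dsq (fun y => norm3 (E y)) + gag E))%E.
Proof.
have [K K0 HK] := domain_kernel_bound oOmega bOmega.
have [cd cd0 dens] := domain_density oOmega bOmega charts.
have [C C0 HC] := hardy mg oOmega bOmega K0 K30 cd0 HK HK3 dens.
exists (K * C); first exact: mulr_ge0.
move=> E eps e01 mE; have /andP[eps0 _] := e01.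
have mN : measurable_fun setT (fun y : mE3 R => norm3 (E y) : M1) by exact: measurable_fun_norm3.
have := @kernel_sqr_integral R g mg sleb3 Omega mO _ (5 / 4) (11 / 4) eps K eps0 mN
  (fun y => norm3_ge0 _) (fun s _ => HK (g s) _ e01).
rewrite (_ : (5 / 4 + 11 / 4) / 2 = 2%:R); last by field.
move=> h; apply: (@le_trans _ _ (\int[leb1]_(s in J) (\int[sleb3]_(y in Omega)
    (norm3 (E y) * rdist eps (g s) y `^ 2%:R)%:E) ^+ 2)%E).
  apply: ge0_le_integral_nomeas => s _; first by rewrite sqre_ge0.
  rewrite le_eqVlt; apply/orP; left; apply/eqP; congr (_ ^+ 2)%E.
  by apply: eq_integral => y _; rewrite powR_mulrn// ltW// rdist_gt0.
apply: (le_trans h); rewrite EFinM -muleA; apply: lee_wpmul2l; first by rewrite lee_fin.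
exact: HC.
Qed.

End trace_estimate.

Lemma inLp2_sqr d (T : measurableType d) (R : realType) (mu : {measure set T -> \bar R})
    (D : set T) (f : T -> R) : measurable D -> inLp mu 2 D f ->
  (\int[mu]_(x in D) (f x ^+ 2)%:E < +oo)%E.
Proof.
move=> mD [_ fN]; rewrite -L2norm_sqr// -[L2norm mu D f]fineK; last first.
  by rewrite ge0_fin_numE// Lnorm_ge0.
by rewrite -EFin_expe ltry.
Qed.

(** * Functions of H^2 on an interval are Lipschitz *)

Section h2_lipschitz.
Context {R : realType}.
Local Notation M1 := (measurableTypeR R).
Local Notation L1 := (@leb1 R).
Variables (a b : R).
Hypothesis ab : a < b.
Local Notation I := (`]a, b[%classic : set M1).
Let mI : measurable I := measurable_itv _.

Lemma bump_test_function (f : R -> R) (al be : R) : bump_expr f -> a < al -> be < b ->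
  (forall z, f z != 0 -> al <= z <= be) -> test_function `]a, b[%classic f.
Proof.
move=> bf a1 b1 supp.
have cl : closure [set x | f x != 0] `<=` `[al, be]%classic.
  have cI : `[al, be]%classic = closure `[al, be]%classic.
    by apply/closure_id; exact: compact_closed (segment_compact (a := al) (b := be)).
  by rewrite cI; apply: closure_subset => z /= fz; rewrite in_itv/=; exact: supp.
split; first exact: bump_smooth.
  apply: subclosed_compact cl; [exact: closed_closure|exact: segment_compact].
by move=> z /cl/=; rewrite !in_itv/= => /andP[? ?]; apply/andP; split; lra.
Qed.

Variables (rho drho P Q : R -> R) (m : R).
Hypothesis ub : unit_bump rho drho P Q m.
(** [c] and [l] place a fixed bump on the middle third of the interval; [dk] is the derivative of
    that bump. *)
Let c := (2 * a + b) / 3.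
Let l := (b - a) / 3.
Let dk z := l^-1 * (drho (l^-1 * z + - (c / l)) * l^-1).

(** The difference of two mollified values of [w] is the integral of [w] against the second
    derivative of a test function, up to a correction; two weak integrations by parts move both
    derivatives onto [w]. The bound is linear in [t - s] and independent of [h]. *)
Lemma weak_second_difference (Dw : nat -> R -> R) (M0 s t h : R) : inHk `]a, b[%classic 2 Dw ->
  (forall z, I z -> `|dk z| <= M0) -> 0 < h -> a < s -> a < t -> s + h < b -> t + h < b ->
  `|\int[L1]_(z in I) (Dw 0%N z * kernel rho s h z) - \int[L1]_(z in I) (Dw 0%N z * kernel rho t h z)| <=
  `|t - s| * (M0 * \int[L1]_(z in I) `|Dw 0%N z| + 2 * \int[L1]_(z in I) `|Dw 2%N z|).
Proof.
move=> [Lw Ww] HM h0 as_ at_ sb tb.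
have l0 : 0 < l by rewrite /l divr_gt0// subr_gt0.
have [hn ln] : h != 0 /\ l != 0 by rewrite !gt_eqF.
have cl : c + l < b by rewrite /c /l; lra.
have ac : a < c by rewrite /c; lra.
have fD := itvoo_lty ab.
have iDw n : (n <= 2)%N -> L1.-integrable I (EFin \o Dw n).
  by move=> n2; have [mD _] := Lw n n2; apply: sqr_integrable => //; exact: inLp2_sqr (Lw n n2).
pose U (p h' z : R) := h'^-1 * z + - (p / h').
(* Beyond both supports the twice integrated masses at [s] and [t] differ by the constant [t - s].
   Subtracting that multiple of a smoothed step makes [psi] compactly supported; its second
   derivative then contains the extra term with [dk]. *)
pose psi z := (h * Q (U s h z) + (- h) * Q (U t h z)) + (- (t - s)) * P (U c l z).
pose dpsi z := (P (U s h z) + (- 1) * P (U t h z)) + (- (t - s)) * kernel rho c l z.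
pose ddpsi z := (kernel rho s h z + (- 1) * kernel rho t h z) + (- (t - s)) * dk z.
have bA (f : R -> R) p h' : bump_expr f -> bump_expr (fun z => f (U p h' z)) by move=> bf; exact: bump_affine.
have bZ (f : R -> R) k : bump_expr f -> bump_expr (fun z => k * f z) by move=> bf; exact: bump_mul (bump_cst k) bf.
have bP : bump_expr P by exact: bump_primitive (bumprho ub) (derP ub).
have bQ := bumpQ ub.
have bk p h' : bump_expr (kernel rho p h') by apply: (bZ (fun z => rho (U p h' z))); apply: bA; exact: bumprho ub.
have bpsi : bump_expr psi by apply: bump_add; [apply: bump_add|]; apply: bZ; exact: bA.
have bdpsi : bump_expr dpsi by apply: bump_add; [apply: bump_add; [exact: bA|apply: bZ; exact: bA]|exact: bZ].
have bdk : bump_expr dk by apply: bZ; apply: bump_mul (bump_cst _); apply: bA; exact: bumpdrho ub.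
have Dk (f df : R -> R) k (x : R) : is_derive x (1 : R) f (df x) -> is_derive x (1 : R) (fun t => k * f t) (k * df x).
  by move=> d; exact: is_deriveZ.
have dP p h' (x : R) : is_derive x (1 : R) (fun z => P (U p h' z)) (kernel rho p h' x).
  by rewrite /kernel [h'^-1 * rho _]mulrC; apply: is_derive_comp_affine; exact: (derP ub).
have dQ p k (x : R) : is_derive x (1 : R) (fun z => k * Q (U p h z)) (k / h * P (U p h x)).
  rewrite -mulrA [h^-1 * _]mulrC.
  by apply: (Dk (fun z => Q (U p h z)) (fun x => P (U p h x) * h^-1)); apply: is_derive_comp_affine; exact: (derQ ub).
have d1 (x : R) : is_derive x (1 : R) psi (dpsi x).
  have -> : dpsi x = (h / h * P (U s h x) + - h / h * P (U t h x)) + (- (t - s)) * kernel rho c l x.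
    by rewrite mulNr divff// mul1r.
  exact: (is_deriveD (is_deriveD (dQ s h x) (dQ t (- h) x)) (Dk _ _ _ x (dP c l x))).
have drk (x : R) : is_derive x (1 : R) (kernel rho c l) (dk x).
  by apply: (Dk (fun z => rho (U c l z)) (fun z => drho (U c l z) * l^-1)); apply: is_derive_comp_affine; exact: (derrho ub).
have d2 (x : R) : is_derive x (1 : R) dpsi (ddpsi x).
  exact: (is_deriveD (is_deriveD (dP s h x) (Dk _ _ (- 1) x (dP t h x))) (Dk _ _ _ x (drk x))).
have lft p h' z : 0 < h' -> z <= p -> [/\ rho (U p h' z) = 0, P (U p h' z) = 0 & Q (U p h' z) = 0].
  by move=> h'0 zp; apply: (bump_left ub); rewrite /U affineE ?gt_eqF// ler_pdivrMr// mul0r subr_le0.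
have rgt p h' z : 0 < h' -> p + h' <= z -> [/\ rho (U p h' z) = 0, P (U p h' z) = 1 & Q (U p h' z) = U p h' z - m].
  by move=> h'0 zp; apply: (bump_right ub); rewrite /U affineE ?gt_eqF// ler_pdivlMr// mul1r; lra.
pose al := Num.min s (Num.min t c); pose be := Num.max (s + h) (Num.max (t + h) (c + l)).
have aal : a < al by rewrite !lt_min as_ at_ ac.
have bbe : be < b by rewrite !gt_max sb tb cl.
have out z : (z <= al) || (be <= z) -> psi z = 0 /\ dpsi z = 0.
  rewrite /psi /dpsi /kernel -/(U c l z) => /orP[|].
    rewrite !le_min => /and3P[z1 z2 z3].
    have [_ -> ->] := lft _ _ _ h0 z1; have [_ -> ->] := lft _ _ _ h0 z2.
    have [-> -> _] := lft _ _ _ l0 z3; rewrite !mulr0 !addr0.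
    by split.
  rewrite !ge_max => /and3P[z1 z2 z3].
  have [_ -> ->] := rgt _ _ _ h0 z1; have [_ -> ->] := rgt _ _ _ h0 z2.
  have [-> -> _] := rgt _ _ _ l0 z3; rewrite /U; split; last by ring.
  by field.
have tf (f : R -> R) : bump_expr f -> (forall z, (z <= al) || (be <= z) -> f z = 0) -> test_function `]a, b[%classic f.
  move=> bf f0; apply: (bump_test_function bf aal bbe) => z.
  by apply: contra_neqT; rewrite negb_and -!ltNge => zz; apply: f0; case/orP: zz => /ltW ->; rewrite ?orbT.
have w1 := Ww 0%N isT dpsi (tf _ bdpsi (fun z hz => (out z hz).2)).
have w2 := Ww 1%N isT psi (tf _ bpsi (fun z hz => (out z hz).1)).
have e1 (x : R) : 'D_1 dpsi x = ddpsi x by have [_ ->] := d2 x.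
have e2 (x : R) : 'D_1 psi x = dpsi x by have [_ ->] := d1 x.
have W : \int[L1]_(z in I) (Dw 0%N z * ddpsi z) = \int[L1]_(z in I) (Dw 2%N z * psi z).
  move: w1 w2; under eq_Rintegral do rewrite e1; under [in X in _ -> X -> _]eq_Rintegral do rewrite e2.
  by move=> -> ->; rewrite opprK.
have ik n (f : R -> R) : (n <= 2)%N -> bump_expr f -> L1.-integrable I (EFin \o (fun z => Dw n z * f z)).
  move=> n2 bf; have cf := bump_continuous bf; have [M _ HM'] := bounded_itvoo ab cf.
  apply: mul_bounded_integrable mI _ HM' (iDw _ n2); exact: continuous_measurable1.
have i1 := ik 0%N _ isT (bk s h); have i2 := ik 0%N _ isT (bk t h); have i3 := ik 0%N _ isT bdk.
pose X := \int[L1]_(z in I) (Dw 0%N z * dk z).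
have i4 : L1.-integrable I (EFin \o (fun z => (t - s) * (Dw 0%N z * dk z))).
  by have := integrableZl mI (t - s) i3; apply: eq_integrable.
have i12 : L1.-integrable I (EFin \o (fun z => Dw 0%N z * kernel rho s h z - Dw 0%N z * kernel rho t h z)).
  by have := integrableB mI i1 i2; apply: eq_integrable.
have E : \int[L1]_(z in I) (Dw 0%N z * ddpsi z) =
    \int[L1]_(z in I) (Dw 0%N z * kernel rho s h z) - \int[L1]_(z in I) (Dw 0%N z * kernel rho t h z) - (t - s) * X.
  rewrite /X -RintegralZl// -RintegralB// -RintegralB//.
  by apply: eq_Rintegral => z _; rewrite /ddpsi; ring.
have -> : \int[L1]_(z in I) (Dw 0%N z * kernel rho s h z) - \int[L1]_(z in I) (Dw 0%N z * kernel rho t h z) =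
    (t - s) * X + \int[L1]_(z in I) (Dw 2%N z * psi z) by rewrite -W E; ring.
have bnd n (f : R -> R) K : (n <= 2)%N -> bump_expr f -> (forall z, I z -> `|f z| <= K) ->
    `|\int[L1]_(z in I) (Dw n z * f z)| <= K * \int[L1]_(z in I) `|Dw n z|.
  move=> n2 bf HK; have inf := ik n _ n2 bf.
  apply: (le_trans (le_normr_Rintegral mI inf)).
  have iN : L1.-integrable I (EFin \o (fun z => `|Dw n z|)).
    by have := integrable_abse (iDw _ n2); apply: eq_integrable.
  rewrite -RintegralZl//; apply: le_Rintegral => //.
  - by have := integrable_abse inf; apply: eq_integrable.
  - by have := integrableZl mI K iN; apply: eq_integrable.
  - by move=> z Iz; rewrite normrM mulrC ler_wpM2r// HK.
apply: (le_trans (ler_normD _ _)); rewrite mulrDr; apply: lerD.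
  by rewrite normrM ler_wpM2l//; exact: bnd.
rewrite mulrA; apply: bnd => // z _.
(* [Q] has slope between 0 and 1, so the scaled difference in [psi] is at most [|t - s|]; the
   smoothed step adds as much again, which gives the factor 2. *)
have QL x y : `|Q x - Q y| <= `|x - y|.
  have [e _ ->] := MVT_between y x (derQ ub); have /andP[p0 p1] := P01 ub e.
  by rewrite normrM ger0_norm// ler_piMl.
have q1 : `|h * Q (U s h z) + (- h) * Q (U t h z)| <= `|t - s|.
  rewrite mulNr -mulrBr normrM gtr0_norm//; apply: (le_trans (ler_wpM2l (ltW h0) (QL _ _))).
  rewrite -{1}(gtr0_norm h0) -normrM (_ : h * _ = t - s)//; by rewrite /U; field.
have q2 : `|(- (t - s)) * P (U c l z)| <= `|t - s|.
  by have /andP[p0 p1] := P01 ub (U c l z); rewrite normrM normrN (ger0_norm p0) ler_piMr.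
by apply: (le_trans (ler_normD _ _)); rewrite mulr_natr mulr2n; exact: lerD.
Qed.

End h2_lipschitz.

Lemma within_continuous_ball {R : realType} (w : R -> R) (a b s0 e : R) :
  {within `[a, b], continuous w} -> a <= s0 <= b -> 0 < e ->
  exists2 d : R, 0 < d & forall z, a <= z <= b -> `|z - s0| < d -> `|w z - w s0| <= e.
Proof.
move=> cw s01 e0; have s0i : `[a, b]%classic s0 by rewrite /= in_itv.
move: (cw s0); rewrite /continuous_at /= => cs.
have nb : nbhs (s0 : subspace `[a, b]%classic) [set t | `|w s0 - w t| < e].
  by have /cvgrPdist_lt := cs; apply.
have {nb} : nbhs_subspace (s0 : subspace `[a, b]%classic) [set t | `|w s0 - w t| < e] := nb.
rewrite -(nbhs_subspace_in s0i) => /nbhs_ballP[d /= d0 Hd].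
exists d => // z zab zs; rewrite distrC ltW//; apply: Hd; last by rewrite /= in_itv.
by rewrite /ball/= distrC.
Qed.

Lemma sqrte_le {R : realType} (X : \bar R) (d : R) : (0 <= X)%E ->
  (X `^ 2^-1 <= d%:E)%E -> 0 <= d /\ (X <= (d ^+ 2)%:E)%E.
Proof.
have q0 : 2^-1 != 0 :> R by rewrite invr_neq0.
case: X => [r| |] // r0; last by rewrite /poweR (negbTE q0).
rewrite poweR_EFin lee_fin powR12_sqrt// => h.
have d0 : 0 <= d by apply: le_trans h; exact: sqrtr_ge0.
by split => //; rewrite lee_fin -[r]sqr_sqrtr// lerXn2r// nnegrE// sqrtr_ge0.
Qed.

Lemma clamp_exists {R : realType} (a b h x : R) : 0 < h -> h <= (b - a) / 3 -> a <= x <= b ->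
  exists t, [/\ a + h <= t, t <= b - 2 * h, t - x <= 2 * h & x - t <= 2 * h].
Proof.
move=> h0 hab /andP[ax xb]; have [c1|c1] := leP x (a + h); first by exists (a + h); split; lra.
by have [c2|c2] := leP (b - 2 * h) x; [exists (b - 2 * h)|exists x]; split; lra.
Qed.

Section h2_lipschitz_bound.
Context {R : realType}.
Local Notation M1 := (measurableTypeR R).
Local Notation L1 := (@leb1 R).
Variables (a b : R).
Hypothesis ab : a < b.
Local Notation I := (`]a, b[%classic : set M1).
Let mI : measurable I := measurable_itv _.

(** The second difference bound as [h] tends to 0: mollified values approach point values by
    continuity on the closed interval. Points near the ends are first moved inside by at most
    [2 * h], to leave room for the support of the mollifier. *)
Lemma h2_lipschitz_L1 : exists2 M : R, 0 <= M & forall Dw : nat -> R -> R,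
  inHk `]a, b[%classic 2 Dw -> {within `[a, b], continuous (Dw 0%N)} ->
  forall s t, a <= s <= b -> a <= t <= b -> `|Dw 0%N t - Dw 0%N s| <=
    `|t - s| * (M * \int[L1]_(z in I) `|Dw 0%N z| + 2 * \int[L1]_(z in I) `|Dw 2%N z|).
Proof.
have [rho [drho [P [Q [m ub]]]]] := @unit_bump_exists R.
set l := (b - a) / 3; set c := (2 * a + b) / 3.
have cdk : continuous (fun z => l^-1 * (drho (l^-1 * z + - (c / l)) * l^-1)).
  apply: bump_continuous; apply: bump_mul (bump_cst _) _; apply: bump_mul (bump_cst _).
  by apply: bump_affine; exact: bumpdrho ub.
have [M M0 HM] := bounded_itvoo ab cdk.
exists M => // Dw hD cw s0 t0 s01 t01.
set K := M * _ + 2 * _; have K0 : 0 <= K by rewrite addr_ge0// mulr_ge0// Rintegral_ge0.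
apply/ler_addgt0Pr => e e0.
have e4 : 0 < e / 4 by rewrite divr_gt0.
have [d1 d10 H1] := within_continuous_ball cw s01 e4.
have [d2 d20 H2] := within_continuous_ball cw t01 e4.
(* A quarter of [d1] and [d2] since the shift and the support together move a point by at most
   [3 * h]; the last bound makes [4 * h * K], the cost of shifting both points, at most [e / 2]. *)
pose h := Num.min (Num.min (d1 / 4) (d2 / 4)) (Num.min ((b - a) / 3) (e / (8 * (K + 1)))).
have K1 : 0 < 8 * (K + 1) by rewrite mulr_gt0// ltr_wpDl.
have h0 : 0 < h by rewrite !lt_min !divr_gt0// subr_gt0.
have [hd1 hd2 hab heK] : [/\ h <= d1 / 4, h <= d2 / 4, h <= (b - a) / 3 & h <= e / (8 * (K + 1))].
  by split; rewrite /h !ge_min lexx ?orbT.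
have hK : 4 * h * K <= e / 2.
  have : h * (8 * (K + 1)) <= e by rewrite -ler_pdivlMr.
  by have := h0; clear -K0; nra.
have [s [s1 s2 s3 s4]] := clamp_exists h0 hab s01.
have [t [t1 t2 t3 t4]] := clamp_exists h0 hab t01.
have iw : L1.-integrable I (EFin \o Dw 0%N).
  have [Lw _] := hD; have [mD _] := Lw 0%N isT.
  by apply: sqr_integrable => //; [exact: itvoo_lty|exact: (inLp2_sqr mI (Lw 0%N isT))].
have [as_ at_ sb tb] : [/\ a <= s, a <= t, s + h <= b & t + h <= b] by split; clear -s1 s2 t1 t2 h0; lra.
have A1 := mollified_value ub ab h0 as_ sb iw (s0 := s0) (e := e / 4).
have A2 := mollified_value ub ab h0 at_ tb iw (s0 := t0) (e := e / 4).
have {}A1 : `|\int[L1]_(z in I) (Dw 0%N z * kernel rho s h z) - Dw 0%N s0| <= e / 4.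
  apply: A1 => z; rewrite /= in_itv/= => /andP[az zb] /andP[sz zs]; apply: H1.
    by rewrite !ltW.
  by rewrite ltr_norml; apply/andP; split; clear -d10 hd1 s3 s4 sz zs h0; lra.
have {}A2 : `|\int[L1]_(z in I) (Dw 0%N z * kernel rho t h z) - Dw 0%N t0| <= e / 4.
  apply: A2 => z; rewrite /= in_itv/= => /andP[az zb] /andP[sz zs]; apply: H2.
    by rewrite !ltW.
  by rewrite ltr_norml; apply/andP; split; clear -d20 hd2 t3 t4 sz zs h0; lra.
have [as' at' sb' tb'] : [/\ a < s, a < t, s + h < b & t + h < b] by split; clear -s1 s2 t1 t2 h0; lra.
have := weak_second_difference ab ub hD HM h0 as' at' sb' tb'; rewrite -/K.
set As := \int[L1]_(z in I) (_ * kernel rho s h z) in A1 *.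
set At := \int[L1]_(z in I) (_ * kernel rho t h z) in A2 * => D.
have ts : `|t - s| <= `|t0 - s0| + 4 * h.
  have h1 := ler_norm (t0 - s0); have h2 := ler_norm (s0 - t0); rewrite distrC in h2.
  by rewrite ler_norml; apply/andP; split; clear -h1 h2 s3 s4 t3 t4; lra.
have D' : `|As - At| <= `|t0 - s0| * K + e / 2.
  apply: (le_trans D); apply: (le_trans (ler_wpM2r K0 ts)); rewrite mulrDl lerD2l//.
have -> : Dw 0%N t0 - Dw 0%N s0 = (As - Dw 0%N s0) - (At - Dw 0%N t0) - (As - At) by ring.
apply: (le_trans (ler_normB _ _)); have := ler_normB (As - Dw 0%N s0) (At - Dw 0%N t0).
by clear -A1 A2 D'; lra.
Qed.

(** On a bounded interval the L^1 norm is at most the square root of the length times the L^2 norm,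
    and each L^2 norm is below the H^2 norm. *)
Lemma h2_lipschitz : exists2 C : R, 0 <= C & forall Dw : nat -> R -> R,
  inHk `]a, b[%classic 2 Dw -> {within `[a, b], continuous (Dw 0%N)} ->
  forall s t, a <= s <= b -> a <= t <= b -> (`|Dw 0%N t - Dw 0%N s|%:E <=
    (`|t - s| * C)%:E * Hknorm `]a, b[%classic 2 Dw)%E.
Proof.
have [M M0 HM] := h2_lipschitz_L1.
pose A := Num.sqrt (b - a); have A0 : 0 <= A by exact: sqrtr_ge0.
exists ((M + 2) * A); first by rewrite mulr_ge0// addr_ge0.
move=> Dw hD cw s t s01 t01; have [Lw _] := hD.
have nf n : (n <= 2)%N -> L2norm leb1 I (Dw n) = (fine (L2norm leb1 I (Dw n)))%:E.
  by move=> n2; rewrite fineK// ge0_fin_numE ?Lnorm_ge0//; have [] := Lw n n2.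
pose N n := fine (L2norm leb1 I (Dw n)).
have N0 n : 0 <= N n by rewrite fine_ge0// Lnorm_ge0.
pose S := N 0%N ^+ 2 + N 1%N ^+ 2 + N 2%N ^+ 2.
have S0 : 0 <= S by rewrite !addr_ge0// sqr_ge0.
have HE : Hknorm `]a, b[%classic 2 Dw = (Num.sqrt S)%:E.
  have HS : (\sum_(n < 3) L2norm leb1 I (Dw n) ^+ 2 = S%:E)%E.
    rewrite (eq_bigr (fun n : 'I_3 => (N n ^+ 2)%:E)).
      by rewrite sumEFin; congr EFin; rewrite !big_ord_recr big_ord0 /= add0r.
    move=> n _; have n2 : (n <= 2)%N by rewrite -ltnS; exact: ltn_ord.
    by rewrite (nf _ n2) -EFin_expe.
  by rewrite /Hknorm HS poweR_EFin powR12_sqrt.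
have L1L2 n : (n <= 2)%N -> \int[L1]_(z in I) `|Dw n z| <= A * N n.
  move=> n2; have [mD _] := Lw n n2.
  have mN : measurable_fun I (fun z => `|Dw n z| : M1) by exact: measurableT_comp.
  have := @sqr_integral_le _ _ _ L1 I (fun z => `|Dw n z|) (b - a) mI (leb1_oo (ltW ab)) mN (fun z _ => normr_ge0 _).
  under [in leRHS]eq_integral do rewrite real_normK ?num_real//.
  rewrite -L2norm_sqr// nf// -EFin_expe -EFinM => h.
  have i0 : (0 <= \int[L1]_(z in I) `|Dw n z|%:E)%E by apply: integral_ge0.
  rewrite /Rintegral; move: h i0; case: (integral _ _ _) => [r| |]//.
  rewrite -EFin_expe !lee_fin /= => h r0; rewrite -(ler_sqr r0) ?mulr_ge0//.
    by rewrite exprMn sqr_sqrtr// subr_ge0 ltW.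
  by rewrite nnegrE mulr_ge0.
rewrite HE -EFinM lee_fin; apply: (le_trans (HM _ hD cw _ _ s01 t01)).
rewrite -mulrA; apply: ler_wpM2l => //.
have NS n : (n <= 2)%N -> N n <= Num.sqrt S.
  move=> n2; rewrite -[N n]ger0_norm// -sqrtr_sqr ler_sqrt// /S.
  by have := sqr_ge0 (N 0%N); have := sqr_ge0 (N 1%N); have := sqr_ge0 (N 2%N);
    case: n n2 => [|[|[|]]]// _; clear; lra.
have h n : (n <= 2)%N -> \int[L1]_(z in I) `|Dw n z| <= A * Num.sqrt S.
  by move=> n2; apply: (le_trans (L1L2 n n2)); rewrite ler_wpM2l// NS.
have h1 := ler_wpM2l M0 (h 0%N isT); have h2 := h 2%N isT.
have -> : (M + 2) * A * Num.sqrt S = M * (A * Num.sqrt S) + 2 * (A * Num.sqrt S) by ring.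
by move: h1 h2; lra.
Qed.

End h2_lipschitz_bound.

(** Young's inequality with weight [k], for a quantity known through its square. *)
Lemma am_gm_abs {R : realType} (x u v k : R) : 0 <= u -> 0 <= v -> 0 < k ->
  x ^+ 2 <= u * v -> `|x| <= k * u + v / (4 * k).
Proof.
move=> u0 v0 k0 h.
have k4 : 0 < 4 * k by rewrite mulr_gt0.
have r0 : 0 <= k * u + v / (4 * k).
  by apply: addr_ge0; [rewrite mulr_ge0// ltW|rewrite divr_ge0// ltW].
rewrite -(ler_sqr (normr_ge0 _)) ?nnegrE// real_normK ?num_real//; apply: (le_trans h).
have -> : u * v = (k * u + v / (4 * k)) ^+ 2 - (k * u - v / (4 * k)) ^+ 2.
  by field; rewrite gt_eqF.
by rewrite gerBl sqr_ge0.
Qed.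

Lemma sum6_sqr_lee {R : realType} (x C : R) (t1 t2 t3 t4 t5 t6 : \bar R) : 0 <= C ->
  [/\ t1 \is a fin_num, t2 \is a fin_num & t3 \is a fin_num] ->
  [/\ t4 \is a fin_num, t5 \is a fin_num & t6 \is a fin_num] ->
  (`|x|%:E <= C%:E * (t1 + t2 + t3 + t4 + t5 + t6))%E ->
  ((x ^+ 2)%:E <= (6 * C ^+ 2)%:E * (t1 ^+ 2 + t2 ^+ 2 + t3 ^+ 2 + t4 ^+ 2 + t5 ^+ 2 + t6 ^+ 2))%E.
Proof.
move=> C0 [] /fineK <- /fineK <- /fineK <- [] /fineK <- /fineK <- /fineK <-.
rewrite -!EFin_expe -!EFinD -!EFinM !lee_fin => h.
rewrite -[x ^+ 2]real_normK ?num_real//.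
have h2 := le_trans (normr_ge0 x) h.
apply: (le_trans (_ : _ <= (C * (fine t1 + fine t2 + fine t3 + fine t4 + fine t5 + fine t6)) ^+ 2)).
  by rewrite lerXn2r.
rewrite exprMn [6 * C ^+ 2]mulrC -[leRHS]mulrA ler_wpM2l ?sqr_ge0//.
exact: sum6_sqr_le.
Qed.

Section square_products.
Context d (T : measurableType d) (R : realType).
Variables (mu : {measure set T -> \bar R}) (D : set T).
Hypothesis mD : measurable D.

Lemma sqr_mul_integrable (F G K : T -> R) :
  measurable_fun D F -> measurable_fun D G -> measurable_fun D K ->
  (forall x, D x -> `|K x| <= `|F x| * `|G x|) ->
  (\int[mu]_(x in D) (F x ^+ 2)%:E < +oo)%E -> (\int[mu]_(x in D) (G x ^+ 2)%:E < +oo)%E ->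
  mu.-integrable D (EFin \o K) /\ (\int[mu]_(x in D) K x) ^+ 2 <=
    fine (\int[mu]_(x in D) (F x ^+ 2)%:E)%E * fine (\int[mu]_(x in D) (G x ^+ 2)%:E)%E.
Proof.
move=> mF mG mK KFG fF fG.
have mFa : measurable_fun D (fun x => `|F x|) by exact: measurableT_comp.
have mGa : measurable_fun D (fun x => `|G x|) by exact: measurableT_comp.
have := @cauchy_schwarz _ _ _ mu D _ _ mD mFa mGa (fun x _ => normr_ge0 _) (fun x _ => normr_ge0 _).
under [X in (_ <= X * _)%E]eq_integral do rewrite real_normK ?num_real//.
under [X in (_ <= _ * X)%E]eq_integral do rewrite real_normK ?num_real//.
have F0 : (0 <= \int[mu]_(x in D) (F x ^+ 2)%:E)%E by apply: integral_ge0 => x _; rewrite lee_fin sqr_ge0.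
have G0 : (0 <= \int[mu]_(x in D) (G x ^+ 2)%:E)%E by apply: integral_ge0 => x _; rewrite lee_fin sqr_ge0.
have FG0 : (0 <= \int[mu]_(x in D) (`|F x| * `|G x|)%:E)%E by apply: integral_ge0 => x _; rewrite lee_fin mulr_ge0.
rewrite -{1}[X in (_ <= X * _)%E]fineK ?ge0_fin_numE// -{1}[X in (_ <= _ * X)%E]fineK ?ge0_fin_numE//.
rewrite -EFinM => cs.
have ffin : (\int[mu]_(x in D) (`|F x| * `|G x|)%:E)%E \is a fin_num.
  by move: cs FG0; case: (integral _ _ _) => [r| |]//; rewrite expe2 mulyy leye_eq.
have iFG : mu.-integrable D (fun x => (`|F x| * `|G x|)%:E).
  apply/integrableP; split; first by apply/measurable_EFinP; exact: measurable_funM.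
  under eq_integral => x _ do rewrite gee0_abs ?lee_fin ?mulr_ge0//.
  by rewrite -ge0_fin_numE.
have iK : mu.-integrable D (EFin \o K).
  apply: le_integrable iFG => //; first exact/measurable_EFinP.
  by move=> x Dx; rewrite /= lee_fin [leRHS]ger0_norm ?mulr_ge0//; exact: KFG.
split => //.
have h1 := norm_Rintegral_le mD iK.
have h2 : (\int[mu]_(x in D) `|K x|%:E <= \int[mu]_(x in D) (`|F x| * `|G x|)%:E)%E.
  by apply: ge0_le_integral_nomeas => x Dx; rewrite lee_fin//; exact: KFG.
have := le_trans h1 h2; rewrite -(fineK ffin) lee_fin => h3.
move: cs; rewrite -(fineK ffin) -EFin_expe lee_fin; apply: le_trans.
by rewrite -[leLHS]real_normK ?num_real// lerXn2r// nnegrE fine_ge0.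
Qed.

End square_products.

(** * Weak formulation for a smooth approximation *)

Section smooth_trace.
Context {R : realType}.
Local Notation M1 := (measurableTypeR R).

Lemma continuous_measurable_mE3 (g : E3 R -> E3 R) : continuous g -> measurable_fun setT (g : mE3 R -> mE3 R).
Proof.
move=> cg; apply: measurable_mE3; apply: continuous3_measurable => x.
- by apply: (@continuous_comp _ _ _ g (fun z : E3 R => z.1.1)); [exact: cg|exact: continuous_E3_11].
- by apply: (@continuous_comp _ _ _ g (fun z : E3 R => z.1.2)); [exact: cg|exact: continuous_E3_12].
- by apply: (@continuous_comp _ _ _ g (fun z : E3 R => z.2)); [exact: cg|exact: continuous_E3_2].
Qed.

Lemma smooth_cst3 (k : R) : smooth (cst k : E3 R -> R).
Proof.
move=> l /=; have [k' ->] : exists k' : R, foldr (fun v h => 'D_v h) (cst k : E3 R -> R) l = cst k'.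
  elim: l => [|v l [k' IH]]/=; first by exists k.
  by exists 0; rewrite IH; apply/funext => x; rewrite derive_cst.
by split => [|v x]; [exact: cst_continuous|exact: derivable_cst].
Qed.

Lemma lipschitz_on_bounded (S : set (E3 R)) (f : E3 R -> R) (df : E3 R -> E3 R) : bounded_set S -> C1grad f df ->
  exists2 M : R, 0 <= M & forall y z, S y -> S z -> `|f y - f z| <= M * norm3 (y - z).
Proof.
move=> /bounded_norm3 [B B0 HB] C1f; have [cf cdf Df] := C1f.
(* [S] need not be convex, so the gradient is bounded on a cube that contains the segments between
   its points: they stay within [3 * B] of the origin. *)
pose a0 : E3 R := (- (3 * B), - (3 * B), - (3 * B)).
have cnd : continuous (fun x => norm3 (df x)).
  by move=> x; apply: continuous_comp; [exact: cdf|exact: continuous_norm3].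
have [M M0 HM] := continuous_bounded_on (@cube_bounded R a0 (6 * B)) cnd.
exists M => // y z Sy Sz.
have D t : is_derive t (1 : R) (f \o (fun t => z + t *: (y - z))) (dot3 (df (z + t *: (y - z))) (y - z)).
  by apply: Df; exact: is_derive_line.
have [c c1 e] := MVT_between 0 1 D.
move: e; rewrite /= scale1r scale0r addr0 subr0 mulr1 [z + (y - z)]addrC subrK => ->.
rewrite !subr0 normr1 in c1.
have cn : norm3 (z + c *: (y - z)) <= 3 * B.
  have h1 := norm3_triangle z (c *: (y - z)); rewrite norm3Z in h1.
  have h2 := norm3_triangle y (- z); rewrite norm3N in h2.
  have h3 := HB _ Sy; have h4 := HB _ Sz.
  have h5 : `|c| * norm3 (y - z) <= norm3 (y - z) by rewrite ler_piMl// norm3_ge0.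
  by clear -h1 h2 h3 h4 h5; lra.
apply: (le_trans (dot3_CS _ _)); rewrite ler_wpM2r ?norm3_ge0//.
apply: (le_trans (ler_norm _)); apply: HM.
move: (z + c *: (y - z)) cn => p cn; apply/cubeE; rewrite /a0/=.
have q1 := le_trans (coord11_le_norm3 p) cn; have q2 := le_trans (coord12_le_norm3 p) cn.
have q3 := le_trans (coord2_le_norm3 p) cn.
move: q1 q2 q3; rewrite !ler_norml => /andP[? ?] /andP[? ?] /andP[? ?].
by split; apply/andP; split; lra.
Qed.

Variables (Omega : set (E3 R)) (sigma : {measure set (mE3 R) -> \bar R}).
Hypotheses (oOmega : open Omega) (cOmega : connected Omega).
Hypotheses (bOmega : bounded_set Omega) (nOmega : Omega !=set0).
Hypothesis charts : forall x0, bdry Omega x0 -> exists r e1 e2 e3 psi,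
  graph_chart Omega x0 r e1 e2 e3 psi.
Hypothesis surf : surface_measure Omega sigma.
Let mO : measurable (Omega : set (mE3 R)) := open3_measurable oOmega.
Let mB : measurable (bdry Omega : set (mE3 R)) := @measurable_bdry R Omega.
Let fO : (leb3 (Omega : set (mE3 R)) < +oo)%E := leb3_bounded_lty mO bOmega.
Let fB : (sigma (bdry Omega) < +oo)%E := bdry_measure_lty oOmega bOmega charts surf.

Section one_function.
Variables (E : mE3 R -> mE3 R) (h : mE3 R -> R) (f : E3 R -> R).
Hypotheses (mE : measurable_fun setT E) (mh : measurable_fun setT (h : mE3 R -> M1)).
Hypothesis sf : smooth f.
Hypothesis fE : (\int[leb3]_(y in Omega) (norm3 (E y) ^+ 2)%:E < +oo)%E.
Hypothesis fh : (\int[sigma]_(y in bdry Omega) (h y ^+ 2)%:E < +oo)%E.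
Hypothesis weak : forall phi : E3 R -> R, smooth phi ->
  \int[leb3]_(y in Omega) dot3 (grad3 f y - E y) (grad3 phi y) =
  \int[sigma]_(y in bdry Omega) (h y * phi y).

Let C1f := smooth_C1grad sf.
Let mN : measurable_fun setT (fun y : mE3 R => norm3 (E y) : M1) := measurable_fun_norm3 mE.
(** [E] is the gradient of [f] minus that of the solution with Neumann data [h]; [weak] is the weak
    formulation for the latter. Integrability of both parts has to be checked before the integral is
    split. *)
Lemma gradient_split (phi : E3 R -> R) : smooth phi ->
  [/\ leb3.-integrable Omega (EFin \o (fun y : mE3 R => dot3 (E y) (grad3 phi y))),
      sigma.-integrable (bdry Omega) (EFin \o (fun y => h y * phi y)) &
      \int[leb3]_(y in Omega) dot3 (grad3 f y) (grad3 phi y) =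
      \int[sigma]_(y in bdry Omega) (h y * phi y) + \int[leb3]_(y in Omega) dot3 (E y) (grad3 phi y)].
Proof.
move=> sp; have [cp cdp _] := smooth_C1grad sp; have [cf cdf _] := C1f.
have cnd : continuous (fun x => norm3 (grad3 phi x)).
  by move=> x; apply: continuous_comp; [exact: cdp|exact: continuous_norm3].
have [M M0 HM] := continuous_bounded_on bOmega cnd.
have [Mp _ HMp] := continuous_bounded_on (bounded_bdry bOmega) cp.
have iN := sqr_integrable mO fO (measurable_funTS mN) fE.
have i1 : leb3.-integrable Omega (EFin \o (fun y : mE3 R => dot3 (E y) (grad3 phi y))).
  have mnd : measurable_fun (Omega : set (mE3 R)) (fun y => norm3 (grad3 phi y) : M1).
    by apply: measurable_funTS; apply: measurable_fun_norm3; exact: continuous_measurable_mE3.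
  have := mul_bounded_integrable mO mnd HM iN.
  apply: le_integrable => //.
    by apply/measurable_EFinP; apply: measurable_funTS; apply: measurable_fun_dot3 => //; exact: continuous_measurable_mE3.
  by move=> y _; rewrite /= lee_fin [leRHS]ger0_norm ?mulr_ge0 ?norm3_ge0//; exact: dot3_CS.
have i2 : sigma.-integrable (bdry Omega) (EFin \o (fun y => h y * phi y)).
  apply: (mul_bounded_integrable mB _ HMp); first by apply: measurable_funTS; exact: continuous3_measurable.
  by apply: sqr_integrable => //; exact: measurable_funTS.
split => //; rewrite -weak// -RintegralD//.
  by apply: eq_Rintegral => y _; rewrite dot3Bl subrK.
have i3 : leb3.-integrable Omega (EFin \o (fun y : mE3 R => dot3 (grad3 f y) (grad3 phi y))).
  by apply: bounded_integrable3 => //; exact: continuous_fun_dot3.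
by have := integrableB mO i3 i1; apply: eq_integrable => // y _; rewrite /= dot3Bl.
Qed.

(** The kernel itself is taken as test function; its gradient has norm at most [r ^+ 2]. *)
Lemma pole_integral_le x eps : 0 < eps ->
  (`|pole_integral Omega (grad3 f) x eps|%:E <=
   \int[sigma]_(y in bdry Omega) (`|h y| * rdist eps x y)%:E +
   \int[leb3]_(y in Omega) (norm3 (E y) * rdist eps x y ^+ 2)%:E)%E.
Proof.
move=> eps0; have sr := smooth_rdist x eps0; have [i1 i2 e] := gradient_split sr.
have g3 y : grad3 (rdist eps x) y = - (rdist eps x y ^+ 3) *: (y - x).
  by rewrite (C1grad_grad3 (C1grad_rdist x eps0)).
have -> : pole_integral Omega (grad3 f) x eps = \int[leb3]_(y in Omega) dot3 (grad3 f y) (grad3 (rdist eps x) y).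
  by apply: eq_Rintegral => y _; rewrite g3 dot3Zr [dot3 (grad3 f y) _]dot3C.
rewrite e; apply: (@le_trans _ _ (`|\int[sigma]_(y in bdry Omega) (h y * rdist eps x y)|%:E +
  `|\int[leb3]_(y in Omega) dot3 (E y) (grad3 (rdist eps x) y)|%:E)%E).
  by rewrite -EFinD lee_fin ler_normD.
apply: leeD.
  apply: (le_trans (norm_Rintegral_le mB i2)); apply: ge0_le_integral_nomeas => y _; rewrite lee_fin//.
  by rewrite normrM (gtr0_norm (rdist_gt0 _ eps0 _)).
apply: (le_trans (norm_Rintegral_le mO i1)); apply: ge0_le_integral_nomeas => y _; rewrite lee_fin//.
apply: (le_trans (dot3_CS _ _)); rewrite ler_wpM2l ?norm3_ge0// g3 norm3Z normrN.
have r0 := rdist_gt0 x eps0 y.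
rewrite gtr0_norm ?exprn_gt0// exprSr -mulrA ler_piMr ?sqr_ge0//.
exact: rdist_norm_le1.
Qed.

End one_function.
End smooth_trace.

Section trace_bound.
Context {R : realType}.
Local Notation M1 := (measurableTypeR R).
Variables (Omega : set (E3 R)) (sigma : {measure set (mE3 R) -> \bar R}).
Hypotheses (oOmega : open Omega) (cOmega : connected Omega).
Hypotheses (bOmega : bounded_set Omega) (nOmega : Omega !=set0).
Hypothesis charts : forall x0, bdry Omega x0 -> exists r e1 e2 e3 psi,
  graph_chart Omega x0 r e1 e2 e3 psi.
Hypothesis surf : surface_measure Omega sigma.
Let mO : measurable (Omega : set (mE3 R)) := open3_measurable oOmega.
Let mB : measurable (bdry Omega : set (mE3 R)) := @measurable_bdry R Omega.
Let fO : (leb3 (Omega : set (mE3 R)) < +oo)%E := leb3_bounded_lty mO bOmega.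
Let fB : (sigma (bdry Omega) < +oo)%E := bdry_measure_lty oOmega bOmega charts surf.

Section one_function.
Variables (E : mE3 R -> mE3 R) (h : mE3 R -> R) (f : E3 R -> R).
Hypotheses (mE : measurable_fun setT E) (mh : measurable_fun setT (h : mE3 R -> M1)).
Hypothesis sf : smooth f.
Hypothesis fE : (\int[leb3]_(y in Omega) (norm3 (E y) ^+ 2)%:E < +oo)%E.
Hypothesis fh : (\int[sigma]_(y in bdry Omega) (h y ^+ 2)%:E < +oo)%E.
Hypothesis weak : forall phi : E3 R -> R, smooth phi ->
  \int[leb3]_(y in Omega) dot3 (grad3 f y - E y) (grad3 phi y) =
  \int[sigma]_(y in bdry Omega) (h y * phi y).

Lemma C1grad_shift (c : R) : C1grad (fun y => f y - c) (grad3 f).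
Proof.
have := C1gradB (smooth_C1grad sf) (C1grad_cst c); congr C1grad.
by apply/funext => y; rewrite subr0.
Qed.

(** The test function [f - c] turns the weak formulation into an identity for the energy [en];
    Young's inequality absorbs half of [en], the boundary values of [f - c] being bounded through
    the constant [k] of the trace and Poincare inequality. *)
Lemma energy_le (c k eta en bc : R) : 0 <= k -> 0 <= en -> 0 <= bc ->
  energy Omega (grad3 f) = en%:E ->
  (\int[sigma]_(y in bdry Omega) ((f y - c) ^+ 2)%:E)%E = bc%:E ->
  bc <= k * (en + eta) -> 0 <= eta ->
  en <= 2 * (k + 1) * fine (\int[sigma]_(y in bdry Omega) (h y ^+ 2)%:E)%E +
    2 * fine (\int[leb3]_(y in Omega) (norm3 (E y) ^+ 2)%:E)%E + eta.
Proof.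
move=> k0 en0 bc0 enE bcE bck eta0.
have [cf cdf _] := smooth_C1grad sf.
have sp : smooth (fun y => f y - c) := smoothB sf (smooth_cst3 c).
have gp : grad3 (fun y => f y - c) = grad3 f by rewrite (C1grad_grad3 (C1grad_shift c)).
have [i1 i2 e] := gradient_split oOmega bOmega charts surf mE mh sf fE fh weak sp.
rewrite gp in e.
have cp : continuous (fun y : E3 R => f y - c) by have [] := C1grad_shift c.
set n2 := fine (\int[sigma]_(y in bdry Omega) (h y ^+ 2)%:E)%E.
set x := fine (\int[leb3]_(y in Omega) (norm3 (E y) ^+ 2)%:E)%E.
have n20 : 0 <= n2 by apply: fine_ge0; apply: integral_ge0 => y _; rewrite lee_fin sqr_ge0.
have x0 : 0 <= x by apply: fine_ge0; apply: integral_ge0 => y _; rewrite lee_fin sqr_ge0.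
have eE : \int[leb3]_(y in Omega) dot3 (grad3 f y) (grad3 f y) = en.
  rewrite -[RHS]/(fine en%:E) -enE /energy /Rintegral; congr fine.
  by apply: eq_integral => y _; rewrite norm3_sqr.
have mcont (p : E3 R -> R) : continuous p -> measurable_fun (bdry Omega : set (mE3 R)) (p : mE3 R -> M1).
  by move=> cp'; apply: measurable_funTS; exact: continuous3_measurable.
have fbc : (\int[sigma]_(y in bdry Omega) ((f y - c) ^+ 2)%:E < +oo)%E by rewrite bcE ltry.
have fen : (\int[leb3]_(y in Omega) (norm3 (grad3 f y) ^+ 2)%:E < +oo)%E.
  by move: enE; rewrite /energy => ->; rewrite ltry.
have mhB : measurable_fun (bdry Omega : set (mE3 R)) (h : mE3 R -> M1) by exact: measurable_funTS.
have [||_ I1] := sqr_mul_integrable mB mhB (mcont _ cp) (K := fun y => h y * (f y - c)) _ _ fh fbc.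
- by apply: measurable_funM => //; exact: mcont.
- by move=> y _; rewrite normrM.
have mdf : measurable_fun setT (grad3 f : mE3 R -> mE3 R) by exact: continuous_measurable_mE3.
have mNE : measurable_fun (Omega : set (mE3 R)) (fun y => norm3 (E y) : M1).
  by apply: measurable_funTS; exact: measurable_fun_norm3.
have mNf : measurable_fun (Omega : set (mE3 R)) (fun y => norm3 (grad3 f y) : M1).
  by apply: measurable_funTS; exact: measurable_fun_norm3.
have [||_ I2] := sqr_mul_integrable mO mNE mNf (K := fun y => dot3 (E y) (grad3 f y)) _ _ fE fen.
- by apply: measurable_funTS; exact: measurable_fun_dot3.
- by move=> y _; rewrite !(ger0_norm (norm3_ge0 _)); exact: dot3_CS.
rewrite bcE -/n2 in I1; rewrite -/(energy Omega (grad3 f)) enE -/x in I2.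
have k1 : 0 < k + 1 by rewrite ltr_wpDl.
(* The weight [k + 1] in the first application makes the boundary term at most [(en + eta) / 4]; the
   second yields [en / 4]. *)
have a1 := am_gm_abs n20 bc0 k1 I1; have a2 := am_gm_abs x0 en0 ltr01 I2.
rewrite mulr1 mul1r in a2.
have b1 : bc / (4 * (k + 1)) <= (en + eta) / 4.
  rewrite ler_pdivrMr ?mulr_gt0// (_ : (en + eta) / 4 * _ = k * (en + eta) + (en + eta)); last by field.
  by apply: (le_trans bck); rewrite lerDl addr_ge0.
have := le_trans (ler_norm _) a1; have := le_trans (ler_norm _) a2.
move: e; rewrite eE; set J1 := \int[sigma]_(_ in _) _; set J2 := \int[leb3]_(_ in _) _.
move: b1 eta0; have -> : 2 * (k + 1) * n2 = 2 * ((k + 1) * n2) by ring.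
by move: ((k + 1) * n2) (bc / _) => p1 p2; lra.
Qed.

End one_function.

Variables (gamma : R -> E3 R) (g : M1 -> mE3 R).
Hypothesis mg : measurable_fun setT g.
Hypothesis gE : forall s, 0 <= s <= 1 -> g s = gamma s.
Hypothesis gB : forall s, 0 <= s <= 1 -> bdry Omega (gamma s).
Variable K3 : R.
Hypothesis K30 : 0 <= K3.
Hypothesis HK3 : forall (y : E3 R) (eps : R), 0 < eps <= 1 ->
  (\int[leb1]_(s in `[0%R, 1%R]) (rdist eps (g s) y `^ (3 / 4))%:E <= K3%:E)%E.
Let J : set M1 := `[0, 1]%classic.
Let mJ : measurable J := measurable_itv _.

(** Since [eps * r <= 1], the integrand [eps^2 r^4] is at most [eps^(3/4) r^(11/4)], whose integral
    tends to 0 uniformly in the pole. *)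
Lemma remainder_small (M q : R) : 0 <= M -> 0 < q -> forall e0, 0 < e0 -> exists eps : R,
  [/\ 0 < eps <= e0, eps <= 1 & forall x, ((M * eps ^+ 2)%:E * \int[leb3]_(y in Omega) (rdist eps x y ^+ 4)%:E <= q%:E)%E].
Proof.
move=> M0 q0 e0 e00; have [K K0 HK] := domain_kernel_bound oOmega bOmega.
have MK : 0 < M * K + 1 by rewrite ltr_wpDl// mulr_ge0.
have t0 : 0 < q / (M * K + 1) by rewrite divr_gt0.
(* The exponent inverts the power 3/4 of [eps]; the added 1 avoids a division by 0. *)
pose t := (q / (M * K + 1)) `^ (4 / 3); have tp : 0 < t by exact: powR_gt0.
pose eps := Num.min (Num.min e0 1) t; exists eps.
have eps0 : 0 < eps by rewrite !lt_min e00 ltr01 tp.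
have [h1 h2 h3] : [/\ eps <= e0, eps <= 1 & eps <= t] by rewrite /eps !ge_min !lexx !orbT.
split; rewrite ?eps0// => x; have r0 y := rdist_gt0 x eps0 y.
have p34 : (0 : R) <= 3 / 4 by rewrite divr_ge0.
have p54 : (0 : R) <= 5 / 4 by rewrite divr_ge0.
have e34 : eps `^ (3 / 4) <= q / (M * K + 1).
  apply: (le_trans (ge0_ler_powR p34 _ _ h3)); rewrite ?nnegrE ?(ltW eps0) ?(ltW tp)//.
  rewrite /t -powRrM (_ : 4 / 3 * (3 / 4) = 1); last by field.
  by rewrite powRr1// ltW.
have pw y : eps ^+ 2 * rdist eps x y ^+ 4 <= eps `^ (3 / 4) * rdist eps x y `^ (11 / 4).
  have re : rdist eps x y <= eps^-1 by exact: rdist_le.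
  have E1 : eps ^+ 2 = eps `^ (3 / 4) * eps `^ (5 / 4).
    rewrite -powRD; last by rewrite (gt_eqF eps0) implybT.
    by rewrite (_ : 3 / 4 + 5 / 4 = 2%:R) ?powR_mulrn ?(ltW eps0)//; field.
  have E2 : rdist eps x y ^+ 4 = rdist eps x y `^ (11 / 4) * rdist eps x y `^ (5 / 4).
    rewrite -powRD; last by rewrite (gt_eqF (r0 y)) implybT.
    by rewrite (_ : 11 / 4 + 5 / 4 = 4%:R) ?powR_mulrn ?(ltW (r0 y))//; field.
  rewrite E1 E2 (_ : _ * _ * _ = eps `^ (3 / 4) * rdist eps x y `^ (11 / 4) * (eps `^ (5 / 4) * rdist eps x y `^ (5 / 4))); last by ring.
  rewrite ler_piMr ?mulr_ge0 ?powR_ge0// -powRM ?(ltW eps0) ?(ltW (r0 y))//.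
  have er : 0 <= eps * rdist eps x y by rewrite mulr_ge0// ltW.
  apply: (@le_trans _ _ (1 `^ (5 / 4))); last by rewrite powR1.
  apply: ge0_ler_powR => //; first by rewrite nnegrE.
  by apply: (le_trans (ler_wpM2l (ltW eps0) re)); rewrite divff// gt_eqF.
rewrite EFinM -muleA.
apply: (@le_trans _ _ (M%:E * ((eps `^ (3 / 4))%:E * K%:E))%E).
  apply: lee_wpmul2l; first by rewrite lee_fin.
  apply: le_trans (lee_wpmul2l _ (HK x eps _)); last 2 first.
  - by rewrite lee_fin powR_ge0.
  - by rewrite eps0.
  rewrite -ge0_integralZl//; last 3 first.
  - apply: measurable_funTS; apply/measurable_EFinP; apply: measurable_funX.
    by apply: continuous3_measurable; exact: rdist_continuous.
  - by move=> y _; rewrite lee_fin exprn_ge0// ltW.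
  - by rewrite lee_fin sqr_ge0.
  rewrite -ge0_integralZl//; last 3 first.
  - by apply: measurable_funTS; exact: measurable_rdist_powR.
  - by move=> y _; rewrite lee_fin powR_ge0.
  - by rewrite lee_fin powR_ge0.
  apply: ge0_le_integral_nomeas => y _; rewrite -EFinM lee_fin//.
  by rewrite mulr_ge0 ?sqr_ge0// exprn_ge0// ltW.
rewrite -!EFinM lee_fin mulrCA; apply: (le_trans (ler_wpM2r _ e34)); first by rewrite mulr_ge0.
by rewrite mulrAC ler_pdivrMr// ler_wpM2l ?(ltW q0)// lerDl.
Qed.

End trace_bound.

(** * Trace estimate for a smooth approximation *)

Section smooth_trace_bound.
Context {R : realType}.
Local Notation M1 := (measurableTypeR R).
Variables (Omega : set (E3 R)) (sigma : {measure set (mE3 R) -> \bar R}).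
Hypotheses (oOmega : open Omega) (cOmega : connected Omega).
Hypotheses (bOmega : bounded_set Omega) (nOmega : Omega !=set0).
Hypothesis charts : forall x0, bdry Omega x0 -> exists r e1 e2 e3 psi,
  graph_chart Omega x0 r e1 e2 e3 psi.
Hypothesis surf : surface_measure Omega sigma.
Let mO : measurable (Omega : set (mE3 R)) := open3_measurable oOmega.
Let mB : measurable (bdry Omega : set (mE3 R)) := @measurable_bdry R Omega.
Let fO : (leb3 (Omega : set (mE3 R)) < +oo)%E := leb3_bounded_lty mO bOmega.
Let fB : (sigma (bdry Omega) < +oo)%E := bdry_measure_lty oOmega bOmega charts surf.

Variables (gamma : R -> E3 R) (g : M1 -> mE3 R).
Hypothesis mg : measurable_fun setT g.
Hypothesis gE : forall s, 0 <= s <= 1 -> g s = gamma s.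
Hypothesis gB : forall s, 0 <= s <= 1 -> bdry Omega (gamma s).
Variable K3 : R.
Hypothesis K30 : 0 <= K3.
Hypothesis HK3 : forall (y : E3 R) (eps : R), 0 < eps <= 1 ->
  (\int[leb1]_(s in `[0%R, 1%R]) (rdist eps (g s) y `^ (3 / 4))%:E <= K3%:E)%E.
Let J : set M1 := `[0, 1]%classic.
Let mJ : measurable J := measurable_itv _.

Lemma measurable_bdry_kernel (e : mE3 R -> R) (eps : R) : 0 < eps -> measurable_fun setT (e : mE3 R -> M1) ->
  (forall y, 0 <= e y) ->
  measurable_fun setT (fun s : M1 => \int[sigma]_(y in bdry Omega) (e y * rdist eps (g s) y)%:E)%E.
Proof.
move=> eps0 me e0.
have := measurable_kernel_integral mg (bdry_measure oOmega bOmega charts surf) 1 mB eps0 me e0.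
apply: eq_measurable_fun => s _; rewrite bdry_measureE; apply: eq_integral => y _.
by rewrite powRr1// ltW// rdist_gt0.
Qed.

Lemma measurable_domain_kernel (e : mE3 R -> R) (eps : R) : 0 < eps -> measurable_fun setT (e : mE3 R -> M1) ->
  (forall y, 0 <= e y) ->
  measurable_fun setT (fun s : M1 => \int[leb3]_(y in Omega) (e y * rdist eps (g s) y ^+ 2)%:E)%E.
Proof.
move=> eps0 me e0.
have := measurable_kernel_integral mg sleb3 2%:R mO eps0 me e0.
apply: eq_measurable_fun => s _; apply: eq_integral => y _.
by rewrite powR_mulrn// ltW// rdist_gt0.
Qed.

Lemma kernel_integral_fin (mu : {measure set (mE3 R) -> \bar R}) (D : set (mE3 R)) (e k : mE3 R -> R) (M : R) :
  measurable D -> (mu D < +oo)%E -> measurable_fun setT (e : mE3 R -> M1) -> measurable_fun setT (k : mE3 R -> M1) ->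
  (\int[mu]_(y in D) (e y ^+ 2)%:E < +oo)%E -> (forall y, D y -> `|k y| <= M) ->
  (\int[mu]_(y in D) (e y * k y)%:E)%E \is a fin_num.
Proof.
move=> mD fD me mk fe kM; apply: integrable_fin_num => //.
apply: (mul_bounded_integrable mD (measurable_funTS mk) kM).
by apply: sqr_integrable => //; exact: measurable_funTS.
Qed.

(** The pointwise bound for [f - c] at [gamma s] has six terms, which are squared and integrated
    over [s]. Those with [h] and with [f - c] on the boundary fall under Schur's test, the one with
    [E] under Hardy's inequality; the two integrals over the domain do not depend on [s], and the
    remainder is made small by [eps]. No norm of [f] is left, as its energy is bounded by [h], [E]
    and [eta]. *)
Lemma smooth_trace_bound : exists2 C : R, 0 <= C &
  forall (E : mE3 R -> mE3 R) (h : mE3 R -> R) (f : E3 R -> R) (eta n2 x sg : R),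
  measurable_fun setT E -> measurable_fun setT (h : mE3 R -> M1) -> smooth f ->
  (\int[sigma]_(y in bdry Omega) (h y ^+ 2)%:E)%E = n2%:E ->
  (\int[leb3]_(y in Omega) (norm3 (E y) ^+ 2)%:E)%E = x%:E ->
  (\int[leb3]_(y in Omega) \int[leb3]_(z in Omega) (gagliardo E y z)%:E)%E = sg%:E ->
  (forall phi : E3 R -> R, smooth phi ->
    \int[leb3]_(y in Omega) dot3 (grad3 f y - E y) (grad3 phi y) =
    \int[sigma]_(y in bdry Omega) (h y * phi y)) ->
  0 < eta ->
  exists c : R, ((\int[leb1]_(s in J) ((f (gamma s) - c) ^+ 2)%:E <= (C * (n2 + x + sg + eta))%:E)%E) /\
    (\int[leb3]_(y in Omega) ((f y - c) ^+ 2)%:E <= (C * (n2 + x + sg + eta))%:E)%E.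
Proof.
have [Cp Cp0 HP] := poincare_trace oOmega cOmega bOmega nOmega charts surf.
have [C0 [e0 [C00 e00 HC0]]] := point_bound_global oOmega bOmega charts surf.
have [Kb Kb0 HKb] := bdry_kernel_sqr oOmega bOmega charts surf mg K30 HK3.
have [Kd Kd0 HKd] := domain_kernel_sqr oOmega bOmega charts mg K30 HK3.
have [A A0 AE] := domain_volume oOmega bOmega.
(* With [T] the sum of [n2], [x], [sg] and [eta], the energy of [f] will be at most [a1 * T], and
   the squared norms of [f - c] on the domain and on the boundary at most [a2 * T]. *)
pose a1 := 2 * (Cp + 1) + 2; pose a2 := Cp * (a1 + 1).
have a10 : 0 <= a1 by rewrite addr_ge0// mulr_ge0// addr_ge0.
have a20 : 0 <= a2 by rewrite mulr_ge0// addr_ge0.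
pose B := Kb + Kd + Kb * a2 + (A * a1 + A * a2 + 1).
have B0 : 0 <= B by rewrite !addr_ge0// mulr_ge0.
have C60 : 0 <= 6 * C0 ^+ 2 by rewrite mulr_ge0// sqr_ge0.
exists (6 * C0 ^+ 2 * B + a2); first by rewrite addr_ge0// mulr_ge0.
move=> E h f eta n2 x sg mE mh sf hE EE GE weak eta0.
have fE : (\int[leb3]_(y in Omega) (norm3 (E y) ^+ 2)%:E < +oo)%E by rewrite EE ltry.
have fh : (\int[sigma]_(y in bdry Omega) (h y ^+ 2)%:E < +oo)%E by rewrite hE ltry.
have n20 : 0 <= n2 by rewrite -lee_fin -hE; apply: integral_ge0 => y _; rewrite lee_fin sqr_ge0.
have x0 : 0 <= x by rewrite -lee_fin -EE; apply: integral_ge0 => y _; rewrite lee_fin sqr_ge0.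
have sg0 : 0 <= sg.
  rewrite -lee_fin -GE; apply: integral_ge0 => y _; apply: integral_ge0 => z _.
  by rewrite lee_fin divr_ge0// powR_ge0.
set T := n2 + x + sg + eta; have T0 : 0 <= T by rewrite !addr_ge0// ltW.
have [cf cdf _] := smooth_C1grad sf.
have cN : continuous (fun y => norm3 (grad3 f y)).
  by move=> y; apply: continuous_comp; [exact: cdf|exact: continuous_norm3].
have [c Hc] := HP f (grad3 f) eta (smooth_C1grad sf) eta0; exists c.
have c1 := C1grad_shift sf c; have [cp _ _] := c1.
have enE : energy Omega (grad3 f) = (fine (energy Omega (grad3 f)))%:E.
  have cN2 : continuous (fun y => norm3 (grad3 f y) ^+ 2).
    rewrite (_ : (fun y => _) = fun y => dot3 (grad3 f y) (grad3 f y)); first exact: continuous_fun_dot3.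
    by apply/funext => y; rewrite norm3_sqr.
  by rewrite fineK//; apply: bounded_integral_fin_num => // y; exact: sqr_ge0.
set en := fine (energy Omega (grad3 f)) in enE.
have en0 : 0 <= en by apply: fine_ge0; exact: energy_ge0.
rewrite enE -EFinD -EFinM in Hc.
have P0 : (0 <= \int[leb3]_(y in Omega) ((f y - c) ^+ 2)%:E)%E by apply: integral_ge0 => y _; rewrite lee_fin sqr_ge0.
have B0' : (0 <= \int[sigma]_(y in bdry Omega) ((f y - c) ^+ 2)%:E)%E by apply: integral_ge0 => y _; rewrite lee_fin sqr_ge0.
have PE : (\int[leb3]_(y in Omega) ((f y - c) ^+ 2)%:E)%E = (fine (\int[leb3]_(y in Omega) ((f y - c) ^+ 2)%:E)%E)%:E.
  by rewrite fineK// ge0_fin_numE// (le_lt_trans _ (ltry (Cp * (en + eta))))//; apply: le_trans Hc; rewrite leeDl.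
have BE : (\int[sigma]_(y in bdry Omega) ((f y - c) ^+ 2)%:E)%E = (fine (\int[sigma]_(y in bdry Omega) ((f y - c) ^+ 2)%:E)%E)%:E.
  by rewrite fineK// ge0_fin_numE// (le_lt_trans _ (ltry (Cp * (en + eta))))//; apply: le_trans Hc; rewrite leeDr.
set pc := fine (\int[leb3]_(y in Omega) ((f y - c) ^+ 2)%:E)%E in PE.
set bc := fine (\int[sigma]_(y in bdry Omega) ((f y - c) ^+ 2)%:E)%E in BE.
have pc0 : 0 <= pc by exact: fine_ge0.
have bc0 : 0 <= bc by exact: fine_ge0.
rewrite PE BE -EFinD lee_fin in Hc.
have pcb : pc <= Cp * (en + eta) by apply: le_trans Hc; rewrite lerDl.
have bcb : bc <= Cp * (en + eta) by apply: le_trans Hc; rewrite lerDr.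
have enT : en <= a1 * T.
  have := energy_le oOmega bOmega charts surf mE mh sf fE fh weak Cp0 en0 bc0 enE BE bcb (ltW eta0).
  rewrite hE EE /= => /le_trans; apply.
  have h1 : 0 <= Cp * x by rewrite mulr_ge0.
  have h2 : 0 <= Cp * sg by rewrite mulr_ge0.
  have h3 : 0 <= Cp * eta by rewrite mulr_ge0// ltW.
  have -> : a1 * T = (2 * (Cp + 1) * n2 + 2 * x + eta) + (2 * n2 + 2 * x + 4 * sg + 3 * eta + 2 * (Cp * x) + 2 * (Cp * sg) + 2 * (Cp * eta)).
    by rewrite /a1 /T; ring.
  by rewrite lerDl !addr_ge0// ?mulr_ge0// ltW.
have etaT : eta <= T by rewrite /T lerDr !addr_ge0.
have CpT : Cp * (en + eta) <= a2 * T.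
  by rewrite /a2 -mulrA ler_wpM2l// mulrDl mul1r lerD.
have pcT := le_trans pcb CpT; have bcT := le_trans bcb CpT.
split; last first.
  rewrite PE lee_fin; apply: (le_trans pcT); rewrite mulrDl lerDr.
  by rewrite mulr_ge0// mulr_ge0.
have bcl : bounded_set (closure Omega) := compact_bounded (bounded_closure_compact bOmega).
have [M M0 HM] := lipschitz_on_bounded bcl (smooth_C1grad sf).
have q0 : 0 < Num.sqrt eta by rewrite sqrtr_gt0.
(* [eps] depends on [f] through its Lipschitz constant [M], which is harmless because all kernel
   bounds are uniform in [eps]. The square of the remainder is at most [eta]. *)
have [eps [epse eps1 Heps]] := remainder_small oOmega bOmega M0 q0 e00.
have /andP[eps0 epse0] := epse.
have e01 : 0 < eps <= 1 by rewrite eps0.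
pose S1 s := (\int[sigma]_(y in bdry Omega) (`|h y| * rdist eps (g s) y)%:E)%E.
pose S2 s := (\int[leb3]_(y in Omega) (norm3 (E y) * rdist eps (g s) y ^+ 2)%:E)%E.
pose S5 s := (\int[sigma]_(y in bdry Omega) (`|f y - c| * rdist eps (g s) y)%:E)%E.
pose k := A * en + A * pc + eta.
have k0 : 0 <= k by rewrite !addr_ge0 ?mulr_ge0// ltW.
have mha : measurable_fun setT (fun y => `|h y| : M1) by exact: measurableT_comp.
have mNE : measurable_fun setT (fun y => norm3 (E y) : M1) by exact: measurable_fun_norm3.
have mfa : measurable_fun setT (fun y : mE3 R => `|f y - c| : M1).
  by apply: measurableT_comp => //; exact: continuous3_measurable.
have mr s : measurable_fun setT (rdist eps (g s) : mE3 R -> M1).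
  by apply: continuous3_measurable; exact: rdist_continuous.
have ra s y : `|rdist eps (g s) y| <= eps^-1 by rewrite gtr0_norm ?rdist_gt0//; exact: rdist_le.
have sqa (u : mE3 R -> R) (mu : {measure set (mE3 R) -> \bar R}) (D : set (mE3 R)) :
    (\int[mu]_(y in D) (`|u y| ^+ 2)%:E = \int[mu]_(y in D) (u y ^+ 2)%:E)%E.
  by apply: eq_integral => y _; rewrite real_normK ?num_real.
have pw s : J s -> (((f (gamma s) - c) ^+ 2)%:E <= (6 * C0 ^+ 2)%:E * (S1 s ^+ 2 + S2 s ^+ 2 + S5 s ^+ 2 + k%:E))%E.
  move=> Js; have s01 : 0 <= s <= 1 by move: Js; rewrite /J /= in_itv.
  have gsE := gE s01; have bs := gB s01.
  pose t3 := (\int[leb3]_(y in Omega) (norm3 (grad3 f y))%:E)%E.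
  pose t4 := (\int[leb3]_(y in Omega) `|f y - c|%:E)%E.
  pose t6 := ((M * eps ^+ 2)%:E * \int[leb3]_(y in Omega) (rdist eps (gamma s) y ^+ 4)%:E)%E.
  have f1 : S1 s \is a fin_num by apply: (kernel_integral_fin (M := eps^-1)) => //; rewrite sqa.
  have f5 : S5 s \is a fin_num by apply: (kernel_integral_fin (M := eps^-1)) => //; rewrite sqa BE ltry.
  have f2 : S2 s \is a fin_num.
    have mr2 : measurable_fun setT (fun y : mE3 R => rdist eps (g s) y ^+ 2 : M1).
      by apply: measurable_funX; exact: mr.
    have ra2 y : Omega y -> `|rdist eps (g s) y ^+ 2| <= eps^-1 ^+ 2.
      by move=> _; rewrite normrX lerXn2r ?nnegrE ?invr_ge0 ?(ltW eps0).
    exact: (kernel_integral_fin mO fO mNE mr2 fE ra2).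
  have f3 : t3 \is a fin_num by apply: bounded_integral_fin_num => // y; exact: norm3_ge0.
  have f4 : t4 \is a fin_num.
    apply: bounded_integral_fin_num => // y.
    by apply: (@continuous_comp _ _ _ (fun y => f y - c) (fun z : R => `|z|)); [exact: cp|exact: norm_continuous].
  have t60 : (0 <= t6)%E.
    rewrite mule_ge0//; first by rewrite lee_fin mulr_ge0// sqr_ge0.
    by apply: integral_ge0 => y _; rewrite lee_fin exprn_ge0// ltW// rdist_gt0.
  have t6q : (t6 <= (Num.sqrt eta)%:E)%E by exact: Heps.
  have f6 : t6 \is a fin_num by rewrite ge0_fin_numE// (le_lt_trans t6q)// ltry.
  have lip y : Omega y -> `|(f y - c) - (f (gamma s) - c)| <= M * norm3 (y - gamma s).
    move=> Oy; rewrite (_ : _ - c - _ = f y - f (gamma s)); last by ring.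
    by apply: HM; [exact: subset_closure|case: bs].
  have pb := HC0 (fun y => f y - c) (grad3 f) (gamma s) M eps c1 bs M0 epse lip.
  have pb' : (`|f (gamma s) - c|%:E <= C0%:E * (S1 s + S2 s + t3 + t4 + S5 s + t6))%E.
    apply: (le_trans pb); apply: lee_wpmul2l; first by rewrite lee_fin.
    rewrite /point_bound -/t3 -/t4 -/t6 /S5 gsE; do 4! (apply: leeD; last exact: lexx).
    rewrite /S1 /S2 gsE.
    exact: (pole_integral_le oOmega bOmega charts surf mE mh sf fE fh weak _ eps0).
  apply: (le_trans (sum6_sqr_lee C00 (And3 f1 f2 f3) (And3 f4 f5 f6) pb')).
  apply: lee_wpmul2l; first by rewrite lee_fin.
  have b3 : (t3 ^+ 2 <= (A * en)%:E)%E.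
    have mN : measurable_fun (Omega : set (mE3 R)) (fun y => norm3 (grad3 f y) : M1).
      by apply: measurable_funTS; exact: continuous3_measurable.
    by have := sqr_integral_le mO AE mN (fun y _ => norm3_ge0 _); rewrite -/(energy Omega (grad3 f)) enE -EFinM.
  have b4 : (t4 ^+ 2 <= (A * pc)%:E)%E.
    by have := sqr_integral_le mO AE (measurable_funTS mfa) (fun y _ => normr_ge0 _); rewrite sqa PE -EFinM.
  have b6 : (t6 ^+ 2 <= eta%:E)%E.
    rewrite -(fineK f6) -EFin_expe lee_fin -[leRHS]sqr_sqrtr ?(ltW eta0)//.
    by rewrite lerXn2r ?nnegrE ?fine_ge0 ?sqrtr_ge0// -lee_fin fineK.
  move: b3 b4 b6; rewrite /k -(fineK f1) -(fineK f2) -(fineK f3) -(fineK f4) -(fineK f5) -(fineK f6).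
  rewrite -!EFin_expe -!EFinD !lee_fin.
  move=> h3 h4 h6; have := lerD (lerD h3 h4) h6.
  move: (fine _ ^+ 2) (fine _ ^+ 2) (fine _ ^+ 2) (fine _ ^+ 2) (fine _ ^+ 2) (fine _ ^+ 2) => u1 u2 u3 u4 u5 u6 u7.
  have -> : u3 + u2 + u6 + u5 + u1 + u4 = (u3 + u2 + u1) + (u6 + u5 + u4) by ring.
  by rewrite lerD2l.
apply: (@le_trans _ _ (\int[leb1]_(s in J) ((6 * C0 ^+ 2)%:E * (S1 s ^+ 2 + S2 s ^+ 2 + S5 s ^+ 2 + k%:E)))%E).
  by apply: ge0_le_integral_nomeas => s Js; [rewrite lee_fin sqr_ge0|exact: pw].
have mS1 : measurable_fun J (fun s => S1 s ^+ 2)%E.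
  by apply: measurable_funTS; apply: emeasurable_funM; apply: measurable_bdry_kernel.
have mS5 : measurable_fun J (fun s => S5 s ^+ 2)%E.
  by apply: measurable_funTS; apply: emeasurable_funM; apply: measurable_bdry_kernel.
have mS2 : measurable_fun J (fun s => S2 s ^+ 2)%E.
  by apply: measurable_funTS; apply: emeasurable_funM; apply: measurable_domain_kernel => // y; exact: norm3_ge0.
have mk : measurable_fun J (fun s : M1 => k%:E) by exact: measurable_cst.
have p1 s : J s -> (0 <= S1 s ^+ 2)%E by rewrite sqre_ge0.
have p2 s : J s -> (0 <= S2 s ^+ 2)%E by rewrite sqre_ge0.
have p5 s : J s -> (0 <= S5 s ^+ 2)%E by rewrite sqre_ge0.
have pk s : J s -> (0 <= k%:E)%E by rewrite lee_fin.
have m12 := emeasurable_funD mS1 mS2; have m125 := emeasurable_funD m12 mS5.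
have p12 s : J s -> (0 <= S1 s ^+ 2 + S2 s ^+ 2)%E by move=> Js; rewrite adde_ge0// ?p1// p2.
have p125 s : J s -> (0 <= S1 s ^+ 2 + S2 s ^+ 2 + S5 s ^+ 2)%E by move=> Js; rewrite adde_ge0// ?p12// p5.
have m4 := emeasurable_funD m125 mk.
have p4 s : J s -> (0 <= S1 s ^+ 2 + S2 s ^+ 2 + S5 s ^+ 2 + k%:E)%E by move=> Js; rewrite adde_ge0// ?p125// pk.
have C6e : (0 <= (6 * C0 ^+ 2)%:E)%E by rewrite lee_fin.
rewrite (ge0_integralZl _ mJ m4 p4 C6e) (ge0_integralD _ mJ p125 m125 pk mk).
rewrite (ge0_integralD _ mJ p12 m12 p5 mS5) (ge0_integralD _ mJ p1 mS1 p2 mS2).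
have -> : (\int[leb1]_(s in J) k%:E = k%:E)%E by rewrite integral_cst// leb1_cc// subr0 mule1.
have i1 : (\int[leb1]_(s in J) S1 s ^+ 2 <= (Kb * n2)%:E)%E.
  by have := HKb (fun y => `|h y|) eps e01 mha (fun y => normr_ge0 _); rewrite sqa hE -EFinM.
have i5 : (\int[leb1]_(s in J) S5 s ^+ 2 <= (Kb * bc)%:E)%E.
  by have := HKb (fun y => `|f y - c|) eps e01 mfa (fun y => normr_ge0 _); rewrite sqa BE -EFinM.
have i2 : (\int[leb1]_(s in J) S2 s ^+ 2 <= (Kd * (x + sg))%:E)%E.
  by have := HKd E eps e01 mE; rewrite EE GE -EFinD -EFinM.
apply: (@le_trans _ _ ((6 * C0 ^+ 2)%:E * ((Kb * n2)%:E + (Kd * (x + sg))%:E + (Kb * bc)%:E + k%:E))%E).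
  by apply: lee_wpmul2l => //; apply: leeD => //; apply: leeD => //; exact: leeD.
rewrite -!EFinD -EFinM lee_fin; apply: (@le_trans _ _ (6 * C0 ^+ 2 * B * T)); last first.
  by rewrite [leRHS]mulrDl lerDl mulr_ge0.
rewrite -mulrA ler_wpM2l// /B mulrDl [(Kb + Kd + _) * T]mulrDl [(Kb + Kd) * T]mulrDl.
apply: lerD; [apply: lerD; [apply: lerD|]|].
- by rewrite ler_wpM2l// /T -!addrA lerDl !addr_ge0// ltW.
- rewrite ler_wpM2l// /T (_ : n2 + x + sg + eta = (x + sg) + (n2 + eta)); last by ring.
  by rewrite lerDl addr_ge0// ltW.
- by rewrite -mulrA ler_wpM2l.
- have h1 := ler_wpM2l A0 enT; have h2 := ler_wpM2l A0 pcT.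
  rewrite [leRHS](_ : _ = A * (a1 * T) + A * (a2 * T) + T); last by ring.
  exact: lerD (lerD h1 h2) etaT.
Qed.

End smooth_trace_bound.

Lemma integral_le_2D d (T : measurableType d) (R : realType) (mu : {measure set T -> \bar R})
    (D : set T) (f a b : T -> \bar R) : measurable D -> measurable_fun D a -> measurable_fun D b ->
  (forall x, D x -> 0 <= f x)%E -> (forall x, D x -> 0 <= a x)%E -> (forall x, D x -> 0 <= b x)%E ->
  (forall x, D x -> f x <= 2%:E * a x + 2%:E * b x)%E ->
  (\int[mu]_(x in D) f x <= 2%:E * \int[mu]_(x in D) a x + 2%:E * \int[mu]_(x in D) b x)%E.
Proof.
move=> mD ma mb f0 a0 b0 fab.
have e2 : (0 <= 2%:E :> \bar R)%E by rewrite lee_fin.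
have ma2 : measurable_fun D (fun x => 2%:E * a x)%E by exact: measurable_funeM.
have mb2 : measurable_fun D (fun x => 2%:E * b x)%E by exact: measurable_funeM.
have a20 x : D x -> (0 <= 2%:E * a x)%E by move=> Dx; rewrite mule_ge0// a0.
have b20 x : D x -> (0 <= 2%:E * b x)%E by move=> Dx; rewrite mule_ge0// b0.
apply: (le_trans (ge0_le_integral_nomeas mu f0 fab)).
by rewrite (ge0_integralD _ mD a20 ma2 b20 mb2) (ge0_integralZl _ mD ma a0 e2) (ge0_integralZl _ mD mb b0 e2).
Qed.

(** * Errors of approximation, and extension of the curve *)

Lemma ereal_cvg0_lt {R : realType} (X : nat -> \bar R) (e : R) : X @ \oo --> 0%E -> 0 < e ->
  \forall n \near \oo, (X n < e%:E)%E.
Proof.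
move=> X0 e0; have nb : nbhs (0%E : \bar R) [set x : \bar R | (x < e%:E)%E].
  change (nbhs (0 : R) (fun r : R => (r%:E < e%:E)%E)).
  by near=> r; rewrite lte_fin; near: r; exact: lt_nbhsl.
exact: X0 nb.
Unshelve. all: end_near. Qed.

Section gagliardo_triangle.
Context {R : realType}.
Local Notation M1 := (measurableTypeR R).
Variable Omega : set (E3 R).
Hypothesis oOmega : open Omega.
Let mO : measurable (Omega : set (mE3 R)) := open3_measurable oOmega.

Lemma measurable_gagliardo (E : mE3 R -> mE3 R) : measurable_fun setT E ->
  measurable_fun setT (fun w : mE3 R * mE3 R => (gagliardo E w.1 w.2)%:E).
Proof.
move=> mE; apply/measurable_EFinP; apply: measurable_funM.
  apply: (measurableT_comp (measurable_powR _)); apply: measurable_fun_norm3.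
  by apply: measurable_mE3B; apply: measurableT_comp.
rewrite (_ : (fun w => _) = fun w : mE3 R * mE3 R => norm3 ((w.1 : E3 R) - w.2) `^ (- (3 + 2^-1 * 2))); last first.
  by apply/funext => w; rewrite powRN.
apply: (measurableT_comp (measurable_powR _)); apply: measurable_fun_norm3.
exact: measurable_mE3B.
Qed.

Lemma gagliardo_ge0 (E : mE3 R -> mE3 R) y z : 0 <= gagliardo E y z.
Proof. by rewrite divr_ge0// powR_ge0. Qed.

Lemma measurable_gagliardo_integral (E : mE3 R -> mE3 R) : measurable_fun setT E ->
  measurable_fun setT (fun y : mE3 R => \int[leb3]_(z in Omega) (gagliardo E y z)%:E)%E.
Proof.
move=> mE; rewrite (_ : (fun y => _) = fun y => (\int[sleb3]_z ((fun w : mE3 R * mE3 R =>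
    (gagliardo E w.1 w.2)%:E) \_ (setT `*` Omega)) (y, z))%E); last first.
  apply/funext => y; rewrite integral_mkcond; apply: eq_integral => z _; rewrite !patchE.
  by congr (if _ then _ else _); apply/idP/idP; rewrite !inE; [split|case].
have mTO : measurable (setT `*` Omega : set (mE3 R * mE3 R)) by exact: measurableX.
apply: (@measurable_fun_fubini_tonelli_F _ _ _ _ R sleb3).
  by apply/(measurable_restrictT _ mTO); apply: measurable_funTS; exact: measurable_gagliardo.
by move=> w; apply: erestrict_ge0 => z _; rewrite lee_fin gagliardo_ge0.
Qed.

Lemma sqr_norm3B_le (p q : E3 R) : norm3 (p - q) ^+ 2 <= 2 * norm3 p ^+ 2 + 2 * norm3 q ^+ 2.
Proof.
apply: le_trans (sqrD_le2 (norm3 p) (norm3 q)).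
rewrite lerXn2r ?nnegrE ?addr_ge0 ?norm3_ge0//.
by have := norm3_triangle p (- q); rewrite norm3N.
Qed.

Lemma gagliardo_integral_le (F G : mE3 R -> mE3 R) : measurable_fun setT F -> measurable_fun setT G ->
  (\int[leb3]_(y in Omega) \int[leb3]_(z in Omega) (gagliardo (fun x => (F x : E3 R) - G x) y z)%:E <=
   2%:E * \int[leb3]_(y in Omega) \int[leb3]_(z in Omega) (gagliardo F y z)%:E +
   2%:E * \int[leb3]_(y in Omega) \int[leb3]_(z in Omega) (gagliardo G y z)%:E)%E.
Proof.
move=> mF mG.
have i0 (K : mE3 R -> mE3 R) y : (0 <= \int[leb3]_(z in Omega) (gagliardo K y z)%:E)%E.
  by apply: integral_ge0 => z _; rewrite lee_fin gagliardo_ge0.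
apply: integral_le_2D => //.
- by apply: measurable_funTS; exact: measurable_gagliardo_integral.
- by apply: measurable_funTS; exact: measurable_gagliardo_integral.
move=> y _.
have ms (K : mE3 R -> mE3 R) : measurable_fun setT K ->
    measurable_fun (Omega : set (mE3 R)) (fun z => (gagliardo K y z)%:E).
  move=> mK; apply: measurable_funTS; apply: (measurableT_comp (measurable_gagliardo mK)
    (_ : measurable_fun setT (fun z : mE3 R => (y : mE3 R, z)))).
  by apply/measurable_fun_pairP; split; [exact: measurable_cst|exact: measurable_id].
apply: integral_le_2D => //; [exact: ms|exact: ms|..].
- by move=> z _; rewrite lee_fin gagliardo_ge0.
- by move=> z _; rewrite lee_fin gagliardo_ge0.
- by move=> z _; rewrite lee_fin gagliardo_ge0.
move=> z _; rewrite -!EFinM -EFinD lee_fin /gagliardo !mulrA -mulrDl.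
apply: ler_wpM2r; first by rewrite invr_ge0 powR_ge0.
rewrite -[(2 : R)]/(2%:R) !powR_mulrn ?norm3_ge0//.
rewrite (_ : (F y : E3 R) - G y - ((F z : E3 R) - G z) = ((F y : E3 R) - F z) - ((G y : E3 R) - G z)).
  exact: sqr_norm3B_le.
by rewrite !opprB addrACA [RHS]addrACA; congr (_ + _); exact: addrC.
Qed.

End gagliardo_triangle.

Section curve_extension.
Context {R : realType}.
Local Notation M1 := (measurableTypeR R).
Variables (gamma dgamma : R -> E3 R).
Hypothesis C1g : C1_on01 gamma dgamma.

(** [gamma] is continuous on [[0, 1]] only; the extension by 0 is measurable on the whole line, as
    the product measurability arguments require. *)
Definition curve_ext (s : M1) : mE3 R := if 0 <= s <= 1 then gamma s else (0 : E3 R).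

Lemma curve_extE (s : R) : 0 <= s <= 1 -> curve_ext s = gamma s.
Proof. by rewrite /curve_ext => ->. Qed.

Lemma measurable_within_coord (f : E3 R -> R) (c : R -> E3 R) : continuous f ->
  {within `[0, 1], continuous c} -> measurable_fun (`[0, 1]%classic : set M1) (f \o c : M1 -> M1).
Proof.
move=> cf cc; apply: subspace_continuous_measurable_fun => // s.
by apply: (@continuous_comp _ _ _ (c : subspace _ -> E3 R) f); [exact: cc|exact: cf].
Qed.

Lemma measurable_curve_ext : measurable_fun setT curve_ext.
Proof.
have [cg _ _] := C1g; have mJ : measurable (`[0, 1]%classic : set M1) by exact: measurable_itv.
have key (f : E3 R -> R) : continuous f -> f 0 = 0 -> measurable_fun setT (fun s => f (curve_ext s) : M1).
  move=> cf f0; have /(measurable_restrictT _ mJ) := measurable_within_coord cf cg.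
  apply: eq_measurable_fun => s _; rewrite patchE /curve_ext; case: ifPn => sJ.
    by have -> : 0 <= s <= 1 by move/set_mem: sJ; rewrite /= in_itv.
  case: ifPn => [s01|_]; last by rewrite f0.
  by move/negP: sJ; case; apply/mem_set; rewrite /= in_itv.
apply: measurable_mE3.
- by apply: (key (fun z => z.1.1)) => //; exact: continuous_E3_11.
- by apply: (key (fun z => z.1.2)) => //; exact: continuous_E3_12.
- by apply: (key (fun z => z.2)) => //; exact: continuous_E3_2.
Qed.

End curve_extension.

(** * The operator estimate *)

Section operator_part.
Context {R : realType}.
Local Notation M1 := (measurableTypeR R).
Variables (gamma dgamma : R -> E3 R) (cg : R) (u : E3 R -> R) (dg : R -> R) (a b : R).
Hypothesis C1g : C1_on01 gamma dgamma.
Hypothesis cg0 : 0 < cg.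
Hypothesis dgc : forall s : R, 0 <= s <= 1 -> cg <= norm3 (dgamma s).
Hypothesis C1u : C1_on01 (u \o gamma) dg.
Hypothesis dg0 : forall s : R, 0 <= s <= 1 -> dg s != 0.
Hypothesis hI : (u \o gamma) @` `[0, 1] = `[a, b]%classic.
Let J : set M1 := `[0, 1]%classic.
Let mJ : measurable J := measurable_itv _.

Lemma range_bounds s : 0 <= s <= 1 -> a <= u (gamma s) <= b.
Proof.
move=> s01; have : ((u \o gamma) @` `[0, 1]) (u (gamma s)) by exists s => //=; rewrite in_itv.
by rewrite hI /= in_itv.
Qed.

(** Otherwise [u] would be constant along the curve, and its derivative at the parameter 1/2 would
    vanish. *)
Lemma range_nondegenerate : a < b.
Proof.
rewrite ltNge; apply/negP => ba.
have cst_u s : 0 <= s <= 1 -> u (gamma s) = a by move=> /range_bounds /andP[? ?]; apply/eqP; rewrite eq_le; apply/andP; split; lra.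
have h2 : 0 < (2^-1 : R) < 1 by apply/andP; split; lra.
have [_ _ /(_ _ h2) [_ e]] := C1u.
have h2' : 0 <= (2^-1 : R) <= 1 by case/andP: h2 => /ltW -> /ltW ->.
have := dg0 h2'; rewrite -e.
suff -> : 'D_1 (u \o gamma) (2^-1) = 'D_1 (cst a : R -> R) (2^-1) by rewrite derive_cst eqxx.
apply: near_eq_derive; case/andP: h2 => h0 h1; near=> t.
rewrite /= cst_u//; apply/andP; split; apply: ltW; near: t; [exact: lt_nbhsr|exact: lt_nbhsl].
Unshelve. all: end_near. Qed.

(** Both arguments of [w] lie in [[a, b]], where the Lipschitz bound of H^2 functions applies
    pointwise in [s]; integration leaves the L^2 distance of the arguments. That [delta] is
    nonnegative follows from the noise bound and is returned for later use. *)
Lemma operator_perturbation : exists2 C : R, 0 <= C & forall (delta : R) (gd : E3 R -> R),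
  measurable_fun (`[0, 1] : set M1) (gd \o gamma) ->
  (L2norm_curve gamma dgamma (fun x => (u x - gd x)%R) <= delta%:E)%E ->
  (forall s : R, 0 <= s <= 1 -> a <= gd (gamma s) <= b) ->
  0 <= delta /\ forall (w : R -> R) (Dw : nat -> R -> R), Dw 0%N = w ->
    inHk `]a, b[ 2 Dw -> {within `[a, b], continuous w} ->
    (L2norm leb1 `[0%R, 1%R] (fun s => (opT u gamma w s - opT gd gamma w s)%R)
       <= (C * delta)%:E * Hknorm `]a, b[ 2 Dw)%E.
Proof.
have ab := range_nondegenerate; have [C C0 HC] := h2_lipschitz ab.
(* The noise is measured in arc length and the result in the parameter; the speed is at least [cg],
   which costs [1 / cg] in the squared norm. *)
pose q := (Num.sqrt cg)^-1; have q0 : 0 <= q by rewrite invr_ge0 sqrtr_ge0.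
exists (C * q); first exact: mulr_ge0.
move=> delta gd mgd hd rgd; pose F s := u (gamma s) - gd (gamma s).
have I0 : (0 <= \int[leb1]_(s in J) (F s ^+ 2 * norm3 (dgamma s))%:E)%E.
  by apply: integral_ge0 => s _; rewrite lee_fin mulr_ge0 ?sqr_ge0 ?norm3_ge0.
have [d0 hI2] := sqrte_le I0 hd; split => // w Dw Dw0 hD cw.
have [cu _ _] := C1u; have [_ cdg _] := C1g.
have mu : measurable_fun J (u \o gamma : M1 -> M1) by exact: subspace_continuous_measurable_fun.
have mF : measurable_fun J (F : M1 -> M1) by exact: measurable_funB.
have F2 : (\int[leb1]_(s in J) (F s ^+ 2)%:E <= (q ^+ 2 * delta ^+ 2)%:E)%E.
  have q2 : q ^+ 2 = cg^-1 by rewrite /q exprVn sqr_sqrtr// ltW.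
  apply: (@le_trans _ _ (\int[leb1]_(s in J) ((q ^+ 2)%:E * (F s ^+ 2 * norm3 (dgamma s))%:E))%E).
    apply: ge0_le_integral_nomeas => s Js; first by rewrite lee_fin sqr_ge0.
    have s01 : 0 <= s <= 1 by move: Js; rewrite /J /= in_itv.
    rewrite -EFinM lee_fin mulrCA ler_peMr ?sqr_ge0// q2 mulrC ler_pdivlMr// mul1r.
    exact: dgc.
  rewrite ge0_integralZl//; last 3 first.
  - apply/measurable_EFinP; apply: measurable_funM; first exact: measurable_funX.
    exact: (measurable_within_coord (@continuous_norm3 R) cdg).
  - by move=> s _; rewrite lee_fin mulr_ge0 ?sqr_ge0 ?norm3_ge0.
  - by rewrite lee_fin sqr_ge0.
  by rewrite EFinM; apply: lee_wpmul2l hI2; rewrite lee_fin sqr_ge0.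
have [Lw _] := hD.
have Hfin : Hknorm `]a, b[%classic 2 Dw \is a fin_num.
  rewrite /Hknorm ge0_fin_numE ?poweR_ge0//; apply: poweR_lty.
  apply: lte_sum_pinfty => n _; have n2 : (n <= 2)%N by rewrite -ltnS; exact: ltn_ord.
  have [_ N] := Lw n n2.
  rewrite -[L2norm _ _ _]fineK; last by rewrite ge0_fin_numE// Lnorm_ge0.
  by rewrite -EFin_expe ltry.
set H := fine (Hknorm `]a, b[%classic 2 Dw).
have HE : Hknorm `]a, b[%classic 2 Dw = H%:E by rewrite fineK.
have H0 : 0 <= H by rewrite fine_ge0// poweR_ge0.
rewrite HE -EFinM L2norm_le//; last by rewrite !mulr_ge0.
apply: (@le_trans _ _ (\int[leb1]_(s in J) (((C * H) ^+ 2)%:E * (F s ^+ 2)%:E))%E).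
  apply: ge0_le_integral_nomeas => s Js; first by rewrite lee_fin sqr_ge0.
  have s01 : 0 <= s <= 1 by move: Js; rewrite /J /= in_itv.
  have cw' : {within `[a, b], continuous (Dw 0%N)} by rewrite Dw0.
  have := HC Dw hD cw' _ _ (rgd _ s01) (range_bounds s01).
  rewrite HE -EFinM lee_fin Dw0 -/(F s) => h.
  rewrite -EFinM lee_fin -exprMn -[leLHS]real_normK ?num_real// -[leRHS]real_normK ?num_real//.
  rewrite lerXn2r ?nnegrE// normrM (ger0_norm (mulr_ge0 C0 H0)); apply: (le_trans h).
  by rewrite [leLHS](_ : _ = C * H * `|F s|)//; ring.
rewrite ge0_integralZl//; last 3 first.
- by apply/measurable_EFinP; exact: measurable_funX.
- by move=> s _; rewrite lee_fin sqr_ge0.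
- by rewrite lee_fin sqr_ge0.
apply: (le_trans (lee_wpmul2l _ F2)); first by rewrite lee_fin sqr_ge0.
by rewrite -EFinM lee_fin -!exprMn le_eqVlt; apply/orP; left; apply/eqP; congr (_ ^+ 2); ring.
Qed.

End operator_part.

(** * The data estimate *)

Section trace_part.
Context {R : realType}.
Local Notation M1 := (measurableTypeR R).
Variables (Omega : set (E3 R)) (sigma : {measure set (mE3 R) -> \bar R}).
Hypothesis dom : bounded_C11_domain Omega.
Hypothesis surf : surface_measure Omega sigma.
Let nOmega : Omega !=set0. Proof. by case: dom. Qed.
Let oOmega : open Omega. Proof. by case: dom. Qed.
Let cOmega : connected Omega. Proof. by case: dom. Qed.
Let bOmega : bounded_set Omega. Proof. by case: dom. Qed.
Let charts : forall x0, bdry Omega x0 -> exists r e1 e2 e3 psi, graph_chart Omega x0 r e1 e2 e3 psi.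
Proof. by case: dom. Qed.
Let mO : measurable (Omega : set (mE3 R)) := open3_measurable oOmega.
Let mB : measurable (bdry Omega : set (mE3 R)) := @measurable_bdry R Omega.
Let fO : (leb3 (Omega : set (mE3 R)) < +oo)%E := leb3_bounded_lty mO bOmega.
Let fB : (sigma (bdry Omega) < +oo)%E := bdry_measure_lty oOmega bOmega charts surf.
Let J : set M1 := `[0, 1]%classic.
Let mJ : measurable J := measurable_itv _.

Lemma domain_volume_gt0 : exists2 A : R, 0 < A & leb3 Omega = A%:E.
Proof.
have [A A0 AE] := domain_volume oOmega bOmega; exists A => //.
have [c c0 Hc] := domain_density oOmega bOmega charts; have [x0 Ox0] := nOmega.
have := Hc x0 c Ox0; rewrite c0 lexx => /(_ isT) h.
have mb : measurable (ball3 x0 c : set (mE3 R)) by apply: open3_measurable; exact: open_ball3.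
have h2 : (leb3 (ball3 x0 c `&` Omega : set (mE3 R)) <= leb3 (Omega : set (mE3 R)))%E.
  exact: measureIr.
have := le_trans h h2; rewrite AE lee_fin; apply: lt_le_trans.
by rewrite mulr_gt0// exprn_gt0.
Qed.

(** On a set of finite measure, by [t <= 1 + t^p]. *)
Lemma inLp_integrable (p : R) (j : E3 R -> R) : 1 <= p -> inLp sigma p (bdry Omega) j ->
  sigma.-integrable (bdry Omega) (EFin \o j).
Proof.
move=> p1 [mj Nj]; have p0 : p != 0 by rewrite gt_eqF// (lt_le_trans ltr01).
have := poweR_lty p Nj; rewrite poweR_Lnorm//.
rewrite [X in (X < _)%E](_ : _ = (\int[sigma]_(x in bdry Omega) (`|j x| `^ p)%:E)%E); last first.
  rewrite [RHS]integral_mkcond; apply: eq_integral => x _; rewrite /= !patchE.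
  by case: ifPn => // _; rewrite normr0 powR0.
move=> fin.
have ip : sigma.-integrable (bdry Omega) (fun x => (1 + `|j x| `^ p)%:E).
  under eq_fun do rewrite EFinD.
  apply: integrableD => //.
    by apply/integrableP; split; [exact: measurable_cst|rewrite integral_cst//= normr1 mul1e].
  apply/integrableP; split.
    apply/measurable_EFinP; apply: (measurableT_comp (measurable_powR _)).
    exact: measurableT_comp.
  by under eq_integral => x _ do rewrite gee0_abs ?lee_fin ?powR_ge0//.
apply: le_integrable ip => //; first exact/measurable_EFinP.
move=> x _; rewrite /= lee_fin [leRHS]ger0_norm ?addr_ge0 ?powR_ge0//.
have [j1|j1] := leP `|j x| 1; first by rewrite (le_trans j1)// lerDl powR_ge0.
apply: (@le_trans _ _ (`|j x| `^ p)); last by rewrite lerDr.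
by rewrite -{1}[`|j x|]powRr1// ler_powR// ltW.
Qed.

Lemma Rintegral_sqr_le d (T : measurableType d) (mu : {measure set T -> \bar R}) (D : set T)
    (F : T -> R) (A B : R) : measurable D -> mu D = A%:E -> 0 <= A -> mu.-integrable D (EFin \o F) ->
  (\int[mu]_(x in D) (F x ^+ 2)%:E <= B%:E)%E -> (\int[mu]_(x in D) F x) ^+ 2 <= A * B.
Proof.
move=> mD DA A0 iF FB; have mF : measurable_fun D F by apply/measurable_EFinP; case/integrableP: iF.
have mN : measurable_fun D (fun x => `|F x|) by exact: measurableT_comp.
have := sqr_integral_le mD DA mN (fun x _ => normr_ge0 _).
under [X in (_ <= _ * X)%E]eq_integral do rewrite real_normK ?num_real//.
have h1 := norm_Rintegral_le mD iF.
have A0e : (0 <= A%:E)%E by rewrite lee_fin.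
have iN : mu.-integrable D (fun x => `|F x|%:E).
  by have := integrable_abse iF; apply: eq_integrable => // x _ /=.
move=> /le_trans/(_ (lee_wpmul2l A0e FB)); rewrite -EFinM.
move: h1; rewrite -(fineK (integrable_fin_num mD iN)) -EFin_expe !lee_fin => h1; apply: le_trans.
by rewrite -[leLHS]real_normK ?num_real// lerXn2r// nnegrE (le_trans _ h1).
Qed.

Lemma sqr_split (p q : R) : (p - q) ^+ 2 <= 2 * p ^+ 2 + 2 * q ^+ 2.
Proof. by have := sqrD_le2 p (- q); rewrite sqrrN. Qed.

Lemma H32norm_parts (V : E3 R -> R) (DV : E3 R -> E3 R) (e : R) :
  (H32norm Omega V DV < e%:E)%E ->
  [/\ (\int[leb3]_(x in Omega) (V x ^+ 2)%:E <= (e ^+ 2)%:E)%E,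
      (\int[leb3]_(x in Omega) (norm3 (DV x) ^+ 2)%:E <= (e ^+ 2)%:E)%E &
      (\int[leb3]_(y in Omega) \int[leb3]_(z in Omega) (gagliardo DV y z)%:E <= (e ^+ 2)%:E)%E].
Proof.
move/ltW; rewrite /H32norm !L2norm_sqr//.
set I1 := (\int[leb3]_(x in Omega) (V x ^+ 2)%:E)%E.
set I2 := (\int[leb3]_(x in Omega) ((norm3 \o DV) x ^+ 2)%:E)%E.
have I10 : (0 <= I1)%E by apply: integral_ge0 => x _; rewrite lee_fin sqr_ge0.
have I20 : (0 <= I2)%E by apply: integral_ge0 => x _; rewrite lee_fin sqr_ge0.
rewrite -[slobodeckij _ _ _ _ _ _]/(\int[leb3]_(y in Omega) \int[leb3]_(z in Omega) (gagliardo DV y z)%:E)%E.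
set I3 := (\int[leb3]_(y in Omega) _)%E.
have I30 : (0 <= I3)%E by apply: integral_ge0 => y _; apply: integral_ge0 => z _; rewrite lee_fin gagliardo_ge0.
have I12 : (0 <= I1 + I2)%E by rewrite adde_ge0.
have I123 : (0 <= I1 + I2 + I3)%E by rewrite adde_ge0.
move=> /(sqrte_le I123) [_ h]; split.
- by apply: le_trans h; apply: (@le_trans _ _ (I1 + I2)%E); rewrite leeDl.
- by apply: le_trans h; apply: (@le_trans _ _ (I1 + I2)%E); rewrite ?leeDr ?leeDl.
- by apply: le_trans h; rewrite leeDr.
Qed.

Lemma gradient_pairing_integrable (V : E3 R -> R) (DV : E3 R -> E3 R) (phi : E3 R -> R) :
  inH1 Omega V DV -> smooth phi ->
  leb3.-integrable Omega (EFin \o (fun y : mE3 R => dot3 (DV y) (grad3 phi y))).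
Proof.
move=> [_ mDV LDV _] sp; have [_ cdp _] := smooth_C1grad sp.
have mD0 : measurable_fun setT ((DV : mE3 R -> mE3 R) \_ Omega) by apply/(measurable_restrictT _ mO).
have mdp : measurable_fun setT (grad3 phi : mE3 R -> mE3 R) by exact: continuous_measurable_mE3.
have cN : continuous (fun y => norm3 (grad3 phi y) ^+ 2).
  rewrite (_ : (fun y => _) = fun y => dot3 (grad3 phi y) (grad3 phi y)); first exact: continuous_fun_dot3.
  by apply/funext => y; rewrite norm3_sqr.
have fG : (\int[leb3]_(y in Omega) (norm3 (grad3 phi y) ^+ 2)%:E < +oo)%E.
  by rewrite -ge0_fin_numE ?integral_ge0// => [|y _]; rewrite ?lee_fin ?sqr_ge0//; apply: bounded_integral_fin_num => // y; exact: sqr_ge0.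
have [mNV _] := LDV.
have mNp : measurable_fun (Omega : set (mE3 R)) (fun y => norm3 (grad3 phi y) : M1).
  by apply: measurable_funTS; exact: measurable_fun_norm3.
have mK : measurable_fun (Omega : set (mE3 R)) (fun y => dot3 (DV y) (grad3 phi y) : M1).
  have : measurable_fun (Omega : set (mE3 R)) (fun y => dot3 (((DV : mE3 R -> mE3 R) \_ Omega) y) (grad3 phi y) : M1).
    by apply: measurable_funTS; exact: measurable_fun_dot3.
  by apply: eq_measurable_fun => y yO; rewrite patchE yO.
have bnd x : Omega x -> `|dot3 (DV x) (grad3 phi x)| <= `|(norm3 \o DV) x| * `|norm3 (grad3 phi x)|.
  by move=> _; rewrite /= !(ger0_norm (norm3_ge0 _)); exact: dot3_CS.
by have [] := sqr_mul_integrable mO mNV mNp mK bnd (inLp2_sqr mO LDV) fG.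
Qed.

Variables (gamma dgamma : R -> E3 R) (cg p : R) (j : E3 R -> R).
Hypothesis crv : C1_curve_in (bdry Omega) gamma dgamma.
Hypothesis cg0 : 0 < cg.
Hypothesis dgc : forall s : R, 0 <= s <= 1 -> cg <= norm3 (dgamma s).
Hypothesis p1 : 1 <= p.
Hypothesis jLp : inLp sigma p (bdry Omega) j.
Variables (v : E3 R -> R) (Dv : E3 R -> E3 R) (y : R -> R).
Hypothesis hv : zero_average_solution Omega sigma j v Dv.
Hypothesis hy : curve_trace Omega gamma v Dv y.

Section one_perturbation.
Variables (jd vd : E3 R -> R) (Dvd : E3 R -> E3 R) (yd : R -> R) (n2 : R).
Hypothesis mjd : measurable_fun (bdry Omega : set (mE3 R)) jd.
Hypothesis hvd : zero_average_solution Omega sigma jd vd Dvd.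
Let h : mE3 R -> R := (fun x : mE3 R => j x - jd x) \_ (bdry Omega : set (mE3 R)).
Hypothesis hn2 : (\int[sigma]_(x in bdry Omega) ((j x - jd x) ^+ 2)%:E = n2%:E)%E.

Lemma measurable_data_difference : measurable_fun setT (h : mE3 R -> M1).
Proof. by apply/(measurable_restrictT _ mB); apply: measurable_funB => //; case: jLp. Qed.

Lemma data_difference_sqr : (\int[sigma]_(x in bdry Omega) (h x ^+ 2)%:E = n2%:E)%E.
Proof. by rewrite -hn2; apply: eq_integral => x xB; rewrite /h patchE xB. Qed.

(** The difference of the two weak formulations; the work lies in justifying the linearity of the
    integrals. *)
Lemma difference_weak (phi : E3 R -> R) : smooth phi ->
  \int[leb3]_(x in Omega) dot3 (Dv x - Dvd x) (grad3 phi x) = \int[sigma]_(x in bdry Omega) (h x * phi x).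
Proof.
move=> sp; have [cp _ _] := smooth_C1grad sp.
have [[H1v Wv] _] := hv; have [[H1d Wd] _] := hvd.
have [M _ HM] := continuous_bounded_on (bounded_bdry bOmega) cp.
have mp : measurable_fun (bdry Omega : set (mE3 R)) (phi : mE3 R -> M1) by apply: measurable_funTS; exact: continuous3_measurable.
have ij := mul_bounded_integrable mB mp HM (inLp_integrable p1 jLp).
have ih : sigma.-integrable (bdry Omega) (EFin \o (fun x => h x * phi x)).
  apply: (mul_bounded_integrable mB mp HM); apply: sqr_integrable => //.
    by apply: measurable_funTS; exact: measurable_data_difference.
  by rewrite data_difference_sqr ltry.
have Wv' := Wv phi sp; have Wd' := Wd phi sp.
under [in LHS]eq_Rintegral => x _ do rewrite dot3Bl.
rewrite (RintegralB mO (gradient_pairing_integrable H1v sp) (gradient_pairing_integrable H1d sp)).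
rewrite (_ : \int[leb3]_(x in Omega) dot3 (Dv x) (grad3 phi x) = \int[sigma]_(x in bdry Omega) (j x * phi x)); last first.
  by rewrite -Wv'; apply: eq_Rintegral => x _; rewrite mul1r.
(* [jd] is only known to be measurable; written as [j - h], it inherits integrability from [j] and
   from the square-integrable [h]. *)
rewrite (_ : \int[leb3]_(x in Omega) dot3 (Dvd x) (grad3 phi x) = \int[sigma]_(x in bdry Omega) (j x * phi x - h x * phi x)); last first.
  rewrite (_ : \int[sigma]_(x in bdry Omega) (j x * phi x - h x * phi x) = \int[sigma]_(x in bdry Omega) (jd x * phi x)).
    by rewrite -Wd'; apply: eq_Rintegral => x _; rewrite mul1r.
  by apply: eq_Rintegral => x xB; rewrite /h patchE xB; ring.
by rewrite RintegralB// opprB addrC subrK.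
Qed.

End one_perturbation.
Lemma vector_swap (a b c d : E3 R) : a - b - ((d - b) - (c - a)) = c - d.
Proof. by apply: E3_eq => /=; ring. Qed.

(** The smooth functions of the two traces, at an index where all four errors are below [e], are
    subtracted to give an [f] close to [v - vd]. The smooth estimate then bounds [y - yd] by
    [C1 * delta ^+ 2 + C2 * e ^+ 2] in squared norm, and [e] is arbitrary. *)
Lemma trace_perturbation : exists2 C : R, 0 <= C & forall (delta : R) (jd vd : E3 R -> R)
    (Dvd : E3 R -> E3 R) (yd : R -> R),
  measurable_fun (bdry Omega : set (mE3 R)) jd ->
  (L2norm sigma (bdry Omega) (fun x => (j x - jd x)%R) <= delta%:E)%E ->
  zero_average_solution Omega sigma jd vd Dvd ->
  curve_trace Omega gamma vd Dvd yd ->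
  (L2norm leb1 `[0%R, 1%R] (fun s => (y s - yd s)%R) <= (C * delta)%:E)%E.
Proof.
have [C1g gB] := crv; have [cgam _ _] := C1g.
have [K3 K30 HK3] := curve_kernel_bound C1g cg0 dgc.
have mg := measurable_curve_ext C1g; have gE := @curve_extE R gamma.
have HK3' (z : E3 R) (eps : R) : 0 < eps <= 1 ->
    (\int[leb1]_(s in `[0%R, 1%R]) (rdist eps (curve_ext gamma s) z `^ (3 / 4))%:E <= K3%:E)%E.
  move=> e01; apply: le_trans (HK3 z eps e01); rewrite le_eqVlt; apply/orP; left; apply/eqP.
  by apply: eq_integral => s; rewrite inE /= in_itv/= => s01; rewrite gE.
have [C C0 HC] := smooth_trace_bound oOmega cOmega bOmega nOmega charts surf mg gE gB K30 HK3'.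
have [A A0 AE] := domain_volume_gt0; have A0' := ltW A0.
(* The coefficients of [delta ^+ 2] and [e ^+ 2] in the final sum
   [8 e^2 + 4 C T + 4 (8 e^2 + 2 C T) / A], where [T = delta^2 + 9 e^2] and [A] is the volume of the
   domain. *)
pose C1 := 4 * C + 8 * C / A; pose C2 := 8 + 36 * C + (72 * C + 32) / A.
have C10 : 0 <= C1 by rewrite addr_ge0// ?divr_ge0// mulr_ge0.
have C20 : 0 <= C2.
  by apply: addr_ge0; [apply: addr_ge0 => //; rewrite mulr_ge0|rewrite divr_ge0// addr_ge0// mulr_ge0].
exists (Num.sqrt C1); first exact: sqrtr_ge0.
move=> delta jd vd Dvd yd mjd hd hvd hyd.
have d0 : 0 <= delta by rewrite -lee_fin (le_trans _ hd)// Lnorm_ge0.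
have N := hd; rewrite L2norm_le// in N.
have N0 : (0 <= \int[sigma]_(x in bdry Omega) ((j x - jd x) ^+ 2)%:E)%E by apply: integral_ge0 => x _; rewrite lee_fin sqr_ge0.
have [n2 hn2] : exists n2 : R, (\int[sigma]_(x in bdry Omega) ((j x - jd x) ^+ 2)%:E = n2%:E)%E.
  by move: N N0; case: (integral _ _ _) => [r| |]// _ _; exists r.
have n2d : n2 <= delta ^+ 2 by rewrite -lee_fin -hn2.
rewrite L2norm_le//; last by rewrite mulr_ge0// sqrtr_ge0.
rewrite exprMn sqr_sqrtr//; apply/lee_addgt0Pr => t t0.
have C21 : 0 < C2 + 1 by rewrite ltr_wpDl.
(* Chosen so that [C2 * e ^+ 2 <= t], the prescribed excess. *)
pose e := Num.sqrt (t / (C2 + 1)); have e0 : 0 < e by rewrite sqrtr_gt0 divr_gt0.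
have e2 : e ^+ 2 = t / (C2 + 1) by rewrite sqr_sqrtr// divr_ge0// ltW.
have Ce : C2 * e ^+ 2 <= t.
  by rewrite e2 mulrA ler_pdivrMr// mulrC ler_wpM2l ?(ltW t0)// lerDl.
have [my [phi [sphi H1 H2]]] := hy; have [myd [phid [sphid H1d H2d]]] := hyd.
have [n [b1 b2 b3 b4]] : exists n, [/\
    (H32norm Omega (fun x => v x - phi n x)%R (fun x => Dv x - grad3 (phi n) x)%R < e%:E)%E,
    (H32norm Omega (fun x => vd x - phid n x)%R (fun x => Dvd x - grad3 (phid n) x)%R < e%:E)%E,
    (L2norm leb1 J (fun s => phi n (gamma s) - y s)%R < e%:E)%E &
    (L2norm leb1 J (fun s => phid n (gamma s) - yd s)%R < e%:E)%E].
  have [M _ HM] := filterI (filterI (ereal_cvg0_lt H1 e0) (ereal_cvg0_lt H1d e0))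
    (filterI (ereal_cvg0_lt H2 e0) (ereal_cvg0_lt H2d e0)).
  by exists M; have [[k1 k2] [k3 k4]] := HM M (leqnn M); exact (And4 k1 k2 k3 k4).
have [v1 v2 v3] := H32norm_parts b1; have [w1 w2 w3] := H32norm_parts b2.
have z3 := ltW b3; have z4 := ltW b4; rewrite L2norm_le ?(ltW e0)// in z3; rewrite L2norm_le ?(ltW e0)// in z4.
pose f x := phi n x - phid n x; have sf : smooth f := smoothB (sphi n) (sphid n).
have [cf _ _] := smooth_C1grad sf.
have gf : grad3 f = fun x => grad3 (phi n) x - grad3 (phid n) x.
  by rewrite (C1grad_grad3 (C1gradB (smooth_C1grad (sphi n)) (smooth_C1grad (sphid n)))).
have [[H1v _] mean_v] := hv; have [[H1vd _] mean_vd] := hvd.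
have [Lv mDv _ _] := H1v; have [Lvd mDvd _ _] := H1vd.
(* The weak gradients are measurable on [Omega] only, hence cut off to 0 outside; on [Omega] nothing
   changes. *)
pose F1 : mE3 R -> mE3 R := fun x => (((Dv : mE3 R -> mE3 R) \_ Omega) x : E3 R) - grad3 (phi n) x.
pose F2 : mE3 R -> mE3 R := fun x => (((Dvd : mE3 R -> mE3 R) \_ Omega) x : E3 R) - grad3 (phid n) x.
have mF (D : E3 R -> E3 R) (q : E3 R -> R) : measurable_fun (Omega : set (mE3 R)) (D : mE3 R -> mE3 R) -> smooth q ->
    measurable_fun setT (fun x : mE3 R => (((D : mE3 R -> mE3 R) \_ Omega) x : E3 R) - grad3 q x : mE3 R).
  move=> mD sq; have [_ cdq _] := smooth_C1grad sq.
  by apply: measurable_mE3B; [apply/(measurable_restrictT _ mO)|exact: continuous_measurable_mE3].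
have mF1 : measurable_fun setT F1 := mF Dv (phi n) mDv (sphi n).
have mF2 : measurable_fun setT F2 := mF Dvd (phid n) mDvd (sphid n).
have F1E x : x \in (Omega : set (mE3 R)) -> F1 x = Dv x - grad3 (phi n) x by move=> xO; rewrite /F1 patchE xO.
have F2E x : x \in (Omega : set (mE3 R)) -> F2 x = Dvd x - grad3 (phid n) x by move=> xO; rewrite /F2 patchE xO.
(* On [Omega] this is the gradient of [f] minus [Dv - Dvd]; the order of subtraction is that of
   [weak]. *)
pose E : mE3 R -> mE3 R := fun x => (F2 x : E3 R) - F1 x.
have mE : measurable_fun setT E by exact: measurable_mE3B.
have v2' : (\int[leb3]_(x in Omega) (norm3 (F1 x) ^+ 2)%:E <= (e ^+ 2)%:E)%E.
  by apply: le_trans v2; rewrite le_eqVlt; apply/orP; left; apply/eqP; apply: eq_integral => x xO; rewrite F1E.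
have w2' : (\int[leb3]_(x in Omega) (norm3 (F2 x) ^+ 2)%:E <= (e ^+ 2)%:E)%E.
  by apply: le_trans w2; rewrite le_eqVlt; apply/orP; left; apply/eqP; apply: eq_integral => x xO; rewrite F2E.
have v3' : (\int[leb3]_(a in Omega) \int[leb3]_(b in Omega) (gagliardo F1 a b)%:E <= (e ^+ 2)%:E)%E.
  apply: le_trans v3; rewrite le_eqVlt; apply/orP; left; apply/eqP; apply: eq_integral => a aO.
  by apply: eq_integral => b bO; rewrite /gagliardo !F1E.
have w3' : (\int[leb3]_(a in Omega) \int[leb3]_(b in Omega) (gagliardo F2 a b)%:E <= (e ^+ 2)%:E)%E.
  apply: le_trans w3; rewrite le_eqVlt; apply/orP; left; apply/eqP; apply: eq_integral => a aO.
  by apply: eq_integral => b bO; rewrite /gagliardo !F2E.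
have two (X Y Z : \bar R) : (X <= 2%:E * Y + 2%:E * Z)%E -> (Y <= (e ^+ 2)%:E)%E -> (Z <= (e ^+ 2)%:E)%E ->
    (X <= (4 * e ^+ 2)%:E)%E.
  move=> h hY hZ; apply: (le_trans h).
  have -> : (4 * e ^+ 2)%:E = (2%:E * (e ^+ 2)%:E + 2%:E * (e ^+ 2)%:E)%E by rewrite -!EFinM -EFinD; congr EFin; ring.
  by apply: leeD; apply: lee_wpmul2l => //; rewrite lee_fin.
have fin_of (X : \bar R) (b : R) : (0 <= X)%E -> (X <= b%:E)%E -> exists r : R, X = r%:E /\ r <= b.
  by case: X => [r| |]// _; rewrite lee_fin => h; exists r.
have [x [xE xb]] : exists r : R, (\int[leb3]_(a in Omega) (norm3 (E a) ^+ 2)%:E)%E = r%:E /\ r <= 4 * e ^+ 2.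
  apply: fin_of; first by apply: integral_ge0 => a _; rewrite lee_fin sqr_ge0.
  apply: two w2' v2'; apply: integral_le_2D => //.
  - by apply: measurable_funTS; apply/measurable_EFinP; apply: measurable_funX; exact: measurable_fun_norm3.
  - by apply: measurable_funTS; apply/measurable_EFinP; apply: measurable_funX; exact: measurable_fun_norm3.
  - by move=> a _; rewrite lee_fin sqr_ge0.
  - by move=> a _; rewrite lee_fin sqr_ge0.
  - by move=> a _; rewrite lee_fin sqr_ge0.
  - by move=> a _; rewrite -!EFinM -EFinD lee_fin; exact: sqr_norm3B_le.
have [sg [sgE sgb]] : exists r : R, (\int[leb3]_(a in Omega) \int[leb3]_(b in Omega) (gagliardo E a b)%:E)%E = r%:E /\ r <= 4 * e ^+ 2.
  apply: fin_of; first by apply: integral_ge0 => a _; apply: integral_ge0 => b _; rewrite lee_fin gagliardo_ge0.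
  by apply: two w3' v3'; exact: gagliardo_integral_le.
have weak (q : E3 R -> R) : smooth q -> \int[leb3]_(a in Omega) dot3 (grad3 f a - E a) (grad3 q a) =
    \int[sigma]_(a in bdry Omega) (((fun b : mE3 R => j b - jd b) \_ (bdry Omega : set (mE3 R))) a * q a).
  move=> sq; rewrite -(difference_weak mjd hvd hn2 sq); apply: eq_Rintegral => a aO.
  by rewrite gf /E F1E// F2E// vector_swap.
have e20 : 0 < e ^+ 2 by rewrite exprn_gt0.
have [c [I1 I2]] := HC E _ f (e ^+ 2) n2 x sg mE (measurable_data_difference mjd) sf
  (data_difference_sqr hn2) xE sgE weak e20.
pose T := delta ^+ 2 + 9 * e ^+ 2.
have TT : C * (n2 + x + sg + e ^+ 2) <= C * T.
  rewrite ler_wpM2l// /T (_ : delta ^+ 2 + 9 * e ^+ 2 = delta ^+ 2 + 4 * e ^+ 2 + 4 * e ^+ 2 + e ^+ 2); last by ring.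
  by rewrite lerD2r; apply: lerD => //; exact: lerD.
have {}I1 : (\int[leb1]_(s in J) ((f (gamma s) - c) ^+ 2)%:E <= (C * T)%:E)%E by apply: (le_trans I1); rewrite lee_fin.
have {}I2 : (\int[leb3]_(a in Omega) ((f a - c) ^+ 2)%:E <= (C * T)%:E)%E by apply: (le_trans I2); rewrite lee_fin.
have iv : leb3.-integrable Omega (EFin \o v) by apply: sqr_integrable => //; [case: Lv|exact: inLp2_sqr].
have ivd : leb3.-integrable Omega (EFin \o vd) by apply: sqr_integrable => //; [case: Lvd|exact: inLp2_sqr].
have iF : leb3.-integrable Omega (EFin \o f) by exact: continuous_integrable_domain.
have iV : leb3.-integrable Omega (EFin \o (fun a => v a - vd a)) by have := integrableB mO iv ivd; apply: eq_integrable.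
have ifV : leb3.-integrable Omega (EFin \o (fun a => f a - (v a - vd a))) by have := integrableB mO iF iV; apply: eq_integrable.
have icst : leb3.-integrable Omega (EFin \o (fun=> c)).
  by apply: continuous_integrable_domain => // a; exact: cst_continuous.
have ifc : leb3.-integrable Omega (EFin \o (fun a => f a - c)) by have := integrableB mO iF icst; apply: eq_integrable.
have mphi (q : E3 R -> R) : smooth q -> measurable_fun (Omega : set (mE3 R)) (q : mE3 R -> M1).
  by move=> /smooth_C1grad [cq _ _]; apply: measurable_funTS; exact: continuous3_measurable.
have IV : (\int[leb3]_(a in Omega) ((f a - (v a - vd a)) ^+ 2)%:E <= (4 * e ^+ 2)%:E)%E.
  apply: two w1 v1; apply: integral_le_2D => //.
  - by apply/measurable_EFinP; apply: measurable_funX; apply: measurable_funB; [case: Lvd|exact: mphi].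
  - by apply/measurable_EFinP; apply: measurable_funX; apply: measurable_funB; [case: Lv|exact: mphi].
  - by move=> a _; rewrite lee_fin sqr_ge0.
  - by move=> a _; rewrite lee_fin sqr_ge0.
  - by move=> a _; rewrite lee_fin sqr_ge0.
  - move=> a _; rewrite -!EFinM -EFinD lee_fin /f.
    rewrite (_ : _ - _ - _ = (vd a - phid n a) - (v a - phi n a)); last by ring.
    exact: sqr_split.
(* The zero averages of [v] and [vd] enter here: they show that the constant [c] left by Poincare's
   inequality is itself small. *)
have cA : c * A = \int[leb3]_(a in Omega) (f a - (v a - vd a)) - \int[leb3]_(a in Omega) (f a - c).
  have q1 := RintegralB mO iF iV; have q2 := RintegralB mO iv ivd; have q3 := RintegralB mO iF icst.
  have q4 : \int[leb3]_(_ in Omega) c = c * A by rewrite Rintegral_cst// AE.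
  by rewrite q1 q2 q3 q4 mean_v mean_vd; ring.
have c2 : c ^+ 2 <= (8 * e ^+ 2 + 2 * (C * T)) / A.
  have h1 := Rintegral_sqr_le mO AE A0' ifV IV; have h2 := Rintegral_sqr_le mO AE A0' ifc I2.
  have := sqr_split (\int[leb3]_(a in Omega) (f a - (v a - vd a))) (\int[leb3]_(a in Omega) (f a - c)).
  rewrite -cA ler_pdivlMr// => h3; rewrite -(ler_pM2r A0).
  have -> : c ^+ 2 * A * A = (c * A) ^+ 2 by ring.
  have two0 : (0 : R) <= 2 by [].
  apply: (le_trans h3); have := lerD (ler_wpM2l two0 h1) (ler_wpM2l two0 h2).
  by move=> /le_trans; apply; rewrite le_eqVlt; apply/orP; left; apply/eqP; ring.
have mfg : measurable_fun J (fun s => f (gamma s) : M1) by exact: (measurable_within_coord cf cgam).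
have mphig (q : E3 R -> R) : smooth q -> measurable_fun J (fun s => q (gamma s) : M1).
  by move=> /smooth_C1grad [cq _ _]; exact: (measurable_within_coord cq cgam).
have Z1 : (\int[leb1]_(s in J) ((y s - yd s - f (gamma s)) ^+ 2)%:E <= (4 * e ^+ 2)%:E)%E.
  apply: two z4 z3; apply: integral_le_2D => //.
  - by apply/measurable_EFinP; apply: measurable_funX; apply: measurable_funB => //; exact: mphig.
  - by apply/measurable_EFinP; apply: measurable_funX; apply: measurable_funB => //; exact: mphig.
  - by move=> s _; rewrite lee_fin sqr_ge0.
  - by move=> s _; rewrite lee_fin sqr_ge0.
  - by move=> s _; rewrite lee_fin sqr_ge0.
  - move=> s _; rewrite -!EFinM -EFinD lee_fin /f.
    rewrite (_ : _ - _ - _ = (phid n (gamma s) - yd s) - (phi n (gamma s) - y s)); last by ring.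
    exact: sqr_split.
(* The unit length of the parameter interval makes the constant [c] contribute [c ^+ 2]. *)
have Z2 : (\int[leb1]_(s in J) (f (gamma s) ^+ 2)%:E <= (2 * (C * T) + 2 * c ^+ 2)%:E)%E.
  apply: (@le_trans _ _ (2%:E * \int[leb1]_(s in J) ((f (gamma s) - c) ^+ 2)%:E + 2%:E * \int[leb1]_(s in J) (c ^+ 2)%:E)%E).
    apply: integral_le_2D => //.
    - by apply/measurable_EFinP; apply: measurable_funX; apply: measurable_funB.
    - by move=> s _; rewrite lee_fin sqr_ge0.
    - by move=> s _; rewrite lee_fin sqr_ge0.
    - by move=> s _; rewrite lee_fin sqr_ge0.
    - by move=> s _; rewrite -!EFinM -EFinD lee_fin; have := sqrD_le2 (f (gamma s) - c) c; rewrite subrK.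
  rewrite (_ : (2 * (C * T) + 2 * c ^+ 2)%:E = (2%:E * (C * T)%:E + 2%:E * (c ^+ 2)%:E)%E); last first.
    by rewrite -[RHS]/((_ * _)%:E + (_ * _)%:E)%E EFinD.
  rewrite integral_cst// leb1_cc// subr0 mule1; apply: leeD => //.
  by apply: lee_wpmul2l => //; rewrite lee_fin.
apply: (@le_trans _ _ (2%:E * \int[leb1]_(s in J) ((y s - yd s - f (gamma s)) ^+ 2)%:E + 2%:E * \int[leb1]_(s in J) (f (gamma s) ^+ 2)%:E)%E).
  apply: integral_le_2D => //.
  - by apply/measurable_EFinP; apply: measurable_funX; do 2! (apply: measurable_funB => //).
  - by apply/measurable_EFinP; exact: measurable_funX.
  - by move=> s _; rewrite lee_fin sqr_ge0.
  - by move=> s _; rewrite lee_fin sqr_ge0.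
  - by move=> s _; rewrite lee_fin sqr_ge0.
  - by move=> s _; rewrite -!EFinM -EFinD lee_fin; have := sqrD_le2 (y s - yd s - f (gamma s)) (f (gamma s)); rewrite subrK.
have e22 : (0 <= 2%:E :> \bar R)%E by rewrite lee_fin.
apply: (le_trans (leeD (lee_wpmul2l e22 Z1) (lee_wpmul2l e22 Z2))).
rewrite -!EFinM -!EFinD lee_fin.
have -> : 2 * (4 * e ^+ 2) + 2 * (2 * (C * T) + 2 * c ^+ 2) = 8 * e ^+ 2 + 4 * (C * T) + 4 * c ^+ 2 by ring.
have four0 : (0 : R) <= 4 by [].
apply: (le_trans (lerD (lexx _) (ler_wpM2l four0 c2))).
apply: le_trans (lerD (lexx (C1 * delta ^+ 2)) Ce).
rewrite le_eqVlt; apply/orP; left; apply/eqP; rewrite /C1 /C2 /T; field.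
by rewrite gt_eqF.
Qed.

End trace_part.

(** * Assembly of the two estimates *)

Theorem theorem3 (R : realType)
  (Omega : set (E3 R)) (sigma : {measure set (mE3 R) -> \bar R})
  (p : R) (j : E3 R -> R)
  (a : R -> R) (c_a : R)
  (gamma dgamma : R -> E3 R) (c_gamma : R)
  (u : E3 R -> R) (Du : E3 R -> E3 R)
  (dg : R -> R) (c_g : R) (g_min g_max : R)
  (v : E3 R -> R) (Dv : E3 R -> E3 R) (y : R -> R)
  (A1 : bounded_C11_domain Omega)
  (hsigma : surface_measure Omega sigma)
  (hp : 3 < p)
  (A2 : inWsp_bdry Omega sigma (1 - p^-1) p j)
  (A2_mean : \int[sigma]_(x in bdry Omega) j x = 0)
  (A3 : inH1loc a)
  (hc_a : 0 < c_a)
  (A3_bounds : forall t : R, c_a <= a t <= c_a^-1)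
  (A4 : C1_curve_in (bdry Omega) gamma dgamma)
  (hc_gamma : 0 < c_gamma)
  (A4_bounds : forall s : R, 0 <= s <= 1 ->
     c_gamma <= norm3 (dgamma s) <= c_gamma^-1)
  (hu : neumann_solution Omega sigma (a \o u) j u Du)
  (hu_cont : {within closure Omega, continuous u})
  (hdg : C1_on01 (u \o gamma) dg)
  (hc_g : 0 < c_g)
  (A5 : forall s : R, 0 <= s <= 1 ->
     c_g <= `|dg s| / norm3 (dgamma s) <= c_g^-1)
  (hI : (u \o gamma) @` `[0, 1] = `[g_min, g_max]%classic)
  (hv : zero_average_solution Omega sigma j v Dv)
  (hy : curve_trace Omega gamma v Dv y) :
  exists C : R,
    forall (delta : R) (j_delta g_delta : E3 R -> R)
      (v_delta : E3 R -> R) (Dv_delta : E3 R -> E3 R) (y_delta : R -> R),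
    measurable_fun (bdry Omega : set (mE3 R)) j_delta ->
    (L2norm sigma (bdry Omega) (fun x => (j x - j_delta x)%R) <= delta%:E)%E ->
    measurable_fun (`[0, 1] : set (measurableTypeR R)) (g_delta \o gamma) ->
    (L2norm_curve gamma dgamma (fun x => (u x - g_delta x)%R) <= delta%:E)%E ->
    (forall s : R, 0 <= s <= 1 -> g_min <= g_delta (gamma s) <= g_max) ->
    zero_average_solution Omega sigma j_delta v_delta Dv_delta ->
    curve_trace Omega gamma v_delta Dv_delta y_delta ->
    (forall (w : R -> R) (Dw : nat -> R -> R),
       Dw 0%N = w ->
       inHk `]g_min, g_max[ 2 Dw ->
       {within `[g_min, g_max], continuous w} ->
       (L2norm leb1 `[0%R, 1%R] 
          (fun s => (opT u gamma w s - opT g_delta gamma w s)%R)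
          <= (C * delta)%:E * Hknorm `]g_min, g_max[ 2 Dw)%E) /\
    (L2norm leb1 `[0%R, 1%R] (fun s => (y s - y_delta s)%R)
       <= (C * delta)%:E)%E.
Proof.
have [C1g _] := A4.
have dgc s : 0 <= s <= 1 -> c_gamma <= norm3 (dgamma s) by move=> /A4_bounds/andP[].
have dg0 s : 0 <= s <= 1 -> dg s != 0.
  move=> /A5 /andP[h _]; apply/eqP => e; move: h.
  by rewrite e normr0 mul0r leNgt hc_g.
have [C1 C10 H1] := operator_perturbation C1g hc_gamma dgc hdg dg0 hI.
have p1 : 1 <= p by apply: ltW; apply: le_lt_trans hp; rewrite ler1n.
have [jLp _] := A2.
have [C2 C20 H2] := trace_perturbation A1 hsigma A4 hc_gamma dgc p1 jLp hv hy.
(* One constant must serve both estimates; enlarging each of them to the sum uses [0 <= delta]. *)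
exists (C1 + C2) => delta jd gd vd Dvd yd mjd hjd mgd hgd rgd hvd hyd.
have [d0 H] := H1 delta gd mgd hgd rgd; split.
  move=> w Dw e hD cw; apply: (le_trans (H w Dw e hD cw)); apply: lee_wpmul2r; first exact: poweR_ge0.
  by rewrite lee_fin ler_wpM2r// lerDl.
apply: (le_trans (H2 delta jd vd Dvd yd mjd hjd hvd hyd)).
by rewrite lee_fin ler_wpM2r// lerDr.
Qed.
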